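(* Let $m$ be a fully supported Radon measure on $\mathbb{R}$, let $(\mathcal{E},\mathcal{F})$ be a regular and strongly local Dirichlet form on $L^2(\mathbb{R},m)$ with effective intervals $\{(I_n,\mathtt{s}_n):n\ge1\}$ and scale measure $\lambda_{\mathtt{s}}$, and let $\mathfrak{f}:\mathbb{R}\to\mathbb{R}$ be strictly increasing and continuous with $\mathfrak{f}(0)=0$. Let $\mathscr{C}_{\mathfrak{f}}=\{\varphi\circ\mathfrak{f}:\varphi\in C_c^\infty(\mathfrak{f}(\mathbb{R}))\}$ and assume that $\mathscr{C}_{\mathfrak{f}}\subset\mathcal{F}$, equivalently that $\lambda^{\mathrm e}_{\mathfrak{f}}\ll\lambda_{\mathtt{s}}$ and $d\lambda^{\mathrm e}_{\mathfrak{f}}/d\lambda_{\mathtt{s}}\in L^2_{\mathrm{loc}}(\mathbb{R},\lambda_{\mathtt{s}})$. Let $(\mathfrak{E},\mathfrak{F})$ be the D-subspace of $(\mathcal{E},\mathcal{F})$ generated by $\mathscr{C}_{\mathfrak{f}}$, i.e. $\mathfrak{F}$ is the $\mathcal{E}_1$-closure of $\mathscr{C}_{\mathfrak{f}}$ and $\mathfrak{E}=\mathcal{E}|_{\mathfrak{F}\times\mathfrak{F}}$. Let $(\bar{\mathfrak{E}},\bar{\mathfrak{F}})$ be the Dirichlet form on $L^2(\mathbb{R},m)$ represented by the effective intervals $\{(\bar{\mathtt{I}}_k,\bar{\mathfrak{s}}_k):k\ge1\}$ obtained by the $\mathfrak{f}$-interval-merge of $\{I_n:n\ge1\}$ under the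 measure $\bar\lambda$, the absolutely continuous part of $\lambda_{\mathtt{s}}$ with respect to $\lambda_{\mathfrak{f}}^{\mathrm e}$. Then $(\mathfrak{E},\mathfrak{F})=(\bar{\mathfrak{E}},\bar{\mathfrak{F}})$.
   Context: $\langle a,b\rangle$ denotes an interval with endpoints $-\infty\le a<b\le\infty$, where each endpoint may or may not belong to it; intervals in $\mathbb{R}$ do not contain $\pm\infty$. For $J=\langle a,b\rangle$ fix the point $e\in J$: $e=(a+b)/2$ if both endpoints are finite, $e=a+1$ if only $a$ is finite, $e=b-1$ if only $b$ is finite, $e=0$ if $J=\mathbb{R}$ (write $e_n$ for the point of $I_n$). Let $\mathbf{S}(J)$ be the set of strictly increasing continuous functions $\mathtt{s}:J\to\mathbb{R}$ with $\mathtt{s}(e)=0$ (scale functions); put $\mathtt{s}(a)=\lim_{x\downarrow a}\mathtt{s}(x)$, $\mathtt{s}(b)=\lim_{x\uparrow b}\mathtt{s}(x)$, and let $d\mathtt{s}$ be the induced measure on $J$. Let $\mathbf{S}_\infty(J)$ be the set of $\mathtt{s}\in\mathbf{S}(J)$ adapted to $J$: $a\in J$ iff $a+\mathtt{s}(a)>-\infty$ (both finite), and $b\in J$ iff $b+\mathtt{s}(b)<\infty$. For a function $u$ on $J$, $u\ll\mathtt{s}$ means $u=g\circ\mathtt{s}$ with $g$ (locally) absolutely continuous, and $\frac{du}{d\mathtt{s}}:=g'\circ\mathtt{s}$. For $\mathtt{s}\in\mathbf{S}_\infty(J)$ define $\mathcal{F}^{(\mathtt{s})}$ as the set of $u\in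 L^2(J,m|_J)$ with $u\ll\mathtt{s}$, $\frac{du}{d\mathtt{s}}\in L^2(J,d\mathtt{s})$, with $u(a)=0$ whenever ($a=-\infty$, $\mathtt{s}(-\infty)>-\infty$, $m((-\infty,0])<\infty$) and $u(b)=0$ whenever ($b=\infty$, $\mathtt{s}(\infty)<\infty$, $m([0,\infty))<\infty$), and $\mathcal{E}^{(\mathtt{s})}(u,v)=\frac12\int_J\frac{du}{d\mathtt{s}}\frac{dv}{d\mathtt{s}}\,d\mathtt{s}$. A class of effective intervals is an at most countable family $\{(I_n,\mathtt{s}_n):n\ge1\}$ of mutually disjoint intervals $I_n\subset\mathbb{R}$ with $\mathtt{s}_n\in\mathbf{S}_\infty(I_n)$. It represents the regular strongly local Dirichlet form on $L^2(\mathbb{R},m)$ given by $\mathcal{F}=\{u\in L^2(\mathbb{R},m): u|_{I_n}\in\mathcal{F}^{(\mathtt{s}_n)}\ \forall n,\ \sum_n\mathcal{E}^{(\mathtt{s}_n)}(u|_{I_n},u|_{I_n})<\infty\}$, $\mathcal{E}(u,v)=\sum_n\mathcal{E}^{(\mathtt{s}_n)}(u|_{I_n},v|_{I_n})$. It is a known theorem (Li–Ying) that every regular strongly local Dirichlet form on $L^2(\mathbb{R},m)$ is represented this way by a class of effective intervals, unique up to order; these are called its effective intervals. The scale measure is $\lambda_{\mathtt{s}}=\sum_n d\mathtt{s}_n$ (each $d\mathtt{s}_n$ extended by zero outside $I_n$). D-subspace: $(\mathcal{E}^1,\mathcal{F}^1)$ is a D-subspace of $(\mathcal{E}^2,\mathcal{F}^2)$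 (regular Dirichlet forms on the same $L^2$ space) if $\mathcal{F}^1\subset\mathcal{F}^2$ and $\mathcal{E}^2=\mathcal{E}^1$ on $\mathcal{F}^1\times\mathcal{F}^1$. $\mathcal{E}_1(u,v)=\mathcal{E}(u,v)+\int uv\,dm$. For $\mathfrak{f}$ as in the claim, $\lambda_{\mathfrak{f}}$ is its induced Radon measure on $\mathbb{R}$, $\lambda^{\mathrm e}_{\mathfrak{f}}=\lambda_{\mathfrak{f}}|_{\bigcup_nI_n}$ and $\lambda^{\mathrm t}_{\mathfrak{f}}=\lambda_{\mathfrak{f}}|_{(\bigcup_nI_n)^c}$. Lebesgue decomposition: $\lambda_{\mathtt{s}}=\bar\lambda+\kappa$ with $\bar\lambda=g\cdot\lambda^{\mathrm e}_{\mathfrak{f}}\ll\lambda^{\mathrm e}_{\mathfrak{f}}$ and $\kappa$ singular with respect to $\lambda^{\mathrm e}_{\mathfrak{f}}$. $I_i$ and $I_j$ are $\mathfrak{f}$-scale-connected with respect to $\bar\lambda$ if $\lambda^{\mathrm t}_{\mathfrak{f}}([e_i,e_j])=0$ and $\bar\lambda([e_i,e_j])<\infty$, where $[e_i,e_j]$ is the closed interval with endpoints $e_i,e_j$ in either order. This is an equivalence relation on $\{I_n\}$; let $\{\bar{\mathfrak{I}}_k:k\ge1\}$ be its classes. The $\mathfrak{f}$-interval-merge replaces each class $\bar{\mathfrak{I}}_k$ by the pair $(\bar{\mathtt{I}}_k,\bar{\mathfrak{s}}_k)$ defined as follows: with $\mathfrak{a}_k=\inf\bigcup_{J\in\bar{\mathfrak{I}}_k}J$,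 $\mathfrak{b}_k=\sup\bigcup_{J\in\bar{\mathfrak{I}}_k}J$, $\bar{\mathfrak{s}}_k$ is the scale function on $(\mathfrak{a}_k,\mathfrak{b}_k)$ with $d\bar{\mathfrak{s}}_k=\bar\lambda|_{(\mathfrak{a}_k,\mathfrak{b}_k)}$ vanishing at the fixed point of $(\mathfrak{a}_k,\mathfrak{b}_k)$, and $\bar{\mathtt{I}}_k=\langle\mathfrak{a}_k,\mathfrak{b}_k\rangle$ where $\mathfrak{a}_k\in\bar{\mathtt{I}}_k$ iff $\mathfrak{a}_k+\bar{\mathfrak{s}}_k(\mathfrak{a}_k)>-\infty$ and $\mathfrak{b}_k\in\bar{\mathtt{I}}_k$ iff $\mathfrak{b}_k+\bar{\mathfrak{s}}_k(\mathfrak{b}_k)<\infty$. The family $\{(\bar{\mathtt{I}}_k,\bar{\mathfrak{s}}_k)\}$ is a class of effective intervals with scale measure $\bar\lambda$. *)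

(* Defs.v *)
From HB Require Import structures.
From mathcomp Require Import all_boot all_order all_algebra.
From mathcomp Require Import all_classical all_reals all_analysis.
From mathcomp Require Import measurable_realfun.
Import Order.TTheory GRing.Theory Num.Theory.
Import numFieldNormedType.Exports.

Set Implicit Arguments.
Unset Strict Implicit.
Unset Printing Implicit Defensive.

Local Open Scope classical_set_scope.
Local Open Scope ring_scope.

(** Conventions. Functions on an interval [J] are total functions [R -> R] whose
    values outside [J] are never used. Subspaces of L^2(R, m) are represented by
    sets of functions [R -> R] that are stable under m-a.e. equality. *)

Section intervals.
Context {R : realType}.
Implicit Types (J : set R) (s u : R -> R) (a b : \bar R).

Definition lower J : \bar R := ereal_inf (EFin @` J).
Definition upper J : \bar R := ereal_sup (EFin @` J).

(* The strict inequality excludes the empty set and singletons. *)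
Definition nondegenerate_interval J := is_interval J /\ (lower J < upper J)%E.

Definition fixed_point a b : R :=
  match a, b with
  | a%:E, b%:E => (a + b) / 2
  | a%:E, _ => a + 1
  | _, b%:E => b - 1
  | _, _ => 0
  end.

Definition itv_point J : R := fixed_point (lower J) (upper J).

(* The filter "x decreases to a", for a finite or a = -oo. *)
Definition down_to a : set_system R :=
  if a is r%:E then r^'+ else ninfty_nbhs R.

Definition up_to b : set_system R :=
  if b is r%:E then r^'- else pinfty_nbhs R.

(* The boundary values s(a) and s(b). *)
Definition lower_value a s : \bar R := lim ((s x)%:E @[x --> down_to a]).
Definition upper_value b s : \bar R := lim ((s x)%:E @[x --> up_to b]).

Definition scale_function J s :=
  [/\ {in J &, {homo s : x y / x < y}}, {within J, continuous s}
    & s (itv_point J) = 0].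

(* Here lower J < +oo and s(lower J) < +oo, and dually at the upper endpoint, so
   that no sum of opposite infinities occurs. *)
Definition adapted J s :=
  ((EFin @` J) (lower J) <-> (-oo < lower J + lower_value (lower J) s)%E) /\
  ((EFin @` J) (upper J) <-> (upper J + upper_value (upper J) s < +oo)%E).

End intervals.

Section scale_measures.
Context {R : realType}.
Implicit Types (J : set R) (s : R -> R).

Definition is_scale_measure J s
    (mu : {measure set (measurableTypeR R) -> \bar R}) :=
  mu (~` J) = 0%E /\
  (forall x y, J x -> J y -> x <= y -> mu `[x, y]%classic = (s y - s x)%:E).

(* The measure ds, extended by zero outside J; [lebesgue_stieltjes_measure] does
   not apply, since s may be unbounded at an endpoint not in J. The properties in
   [is_scale_measure] determine the measure when s is a scale function on J. *)
Definition scale_measure J s : {measure set (measurableTypeR R) -> \bar R} :=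
  if pselect (exists mu, is_scale_measure J s mu) is left h
  then projT1 (cid h) else mzero.

Lemma scale_measureP J s :
  nondegenerate_interval J -> scale_function J s ->
  is_scale_measure J s (scale_measure J s).
Proof.
move=> [iJ _] [sJ cs _]; rewrite /scale_measure; case: pselect => [h|[]].
  exact: (projT2 (cid h)).
have inc x y : J x -> J y -> (s x < s y) = (x < y).
  move=> Jx Jy; apply/idP/idP => [|xy]; last by apply: sJ; rewrite ?inE.
  case: (ltgtP x y) => // [yx|->]; last by rewrite ltxx.
  by rewrite ltNge ltW// sJ// inE.
have ince x y : J x -> J y -> (s x <= s y) = (x <= y).
  by move=> Jx Jy; rewrite !leNgt inc.
pose D : set (measurableTypeR R) := s @` J.
have iD : is_interval D.
  by apply/connected_intervalP/connected_continuous_connected => //; apply/connected_intervalP.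
have mD : measurable D by exact: is_interval_measurable.
have /choice[h hP] t : exists x, D t -> J x /\ s x = t.
  have [[x Jx <-]|nD] := pselect (D t); first by exists x.
  by exists 0 => /nD.
have mh : measurable_fun (D : set (measurableTypeR R))
    (h : measurableTypeR R -> measurableTypeR R).
  apply: (measurability _ (RGenOInfty.measurableE R)) => //= _ [_ [c ->] <-].
  apply: is_interval_measurable => x y /= [Dx]; rewrite in_itv/= andbT.
  move=> cx [Dy]; rewrite in_itv/= andbT => cy z /andP[xz zy].
  have Dz : D z by apply: (iD x y) => //; rewrite xz.
  split => //; rewrite /= in_itv/= andbT (lt_le_trans cx)//.
  have [Jx sx] := hP _ Dx; have [Jz sz] := hP _ Dz.
  by rewrite -ince// sx sz.
pose g : measurableTypeR R -> measurableTypeR R := (h : measurableTypeR R -> measurableTypeR R) \_ D.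
have mg : measurable_fun setT g.
  by exact: (proj1 (measurable_restrictT
    (h : measurableTypeR R -> measurableTypeR R) mD) mh).
have gE t : D t -> g t = h t by move=> Dt; rewrite /g patchE mem_set.
pose leb : {measure set (measurableTypeR R) -> \bar R} := lebesgue_measure.
pose nu : {measure set (measurableTypeR R) -> \bar R} := mrestr leb mD.
exists (measure_function_pushforward__canonical__measure_function_Measure nu mg).
split.
  rewrite /= /pushforward /= /nu /= /mrestr.
  rewrite (_ : _ `&` _ = set0) ?measure0//; apply/seteqP; split=> // t [+ Dt] /=.
  by change (~ J (g t) -> False); rewrite gE//; have [? _] := hP _ Dt.
move=> x y Jx Jy xy; rewrite /= /pushforward /= /mrestr.
rewrite (_ : _ `&` _ = `[s x, s y]%classic); last first.
  apply/seteqP; split => [t [+ Dt]|t st].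
    change (`[x, y]%classic (g t) -> `[s x, s y]%classic t).
    rewrite gE//; have [Jt <-] := hP _ Dt.
    by move=> /=; rewrite !in_itv/= !ince//; have [_ ->] := hP _ Dt.
  have Dt : D t.
    by apply: (iD (s x) (s y)); [exists x|exists y|exact: st].
  split => //; change (`[x, y]%classic (g t)); rewrite gE//; move: st.
  have [Jt et] := hP _ Dt.
  by move=> /=; rewrite -{1}et !in_itv/= !ince.
rewrite /leb lebesgue_measure_itv/= lte_fin inc//.
by move: xy; rewrite le_eqVlt => /orP[/eqP ->|->//]; rewrite ltxx subrr.
Qed.

End scale_measures.

Section scale_derivatives.
Context {R : realType}.
Implicit Types (J : set R) (s u g : R -> R).

Definition abs_continuous (c d : R) g :=
  forall eps, 0 < eps -> exists2 delta, 0 < delta &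
    forall (n : nat) (x y : 'I_n -> R),
      (forall i, c <= x i <= y i /\ y i <= d) ->
      trivIset setT (fun i => `]x i, y i[%classic) ->
      \sum_(i < n) (y i - x i) < delta ->
      \sum_(i < n) `|g (y i) - g (x i)| < eps.

Definition loc_abs_continuous (A : set R) g :=
  forall c d, c <= d -> `[c, d]%classic `<=` A -> abs_continuous c d g.

Definition is_scale_factor J s u g :=
  loc_abs_continuous (s @` J) g /\ forall x, J x -> u x = g (s x).

Definition scale_abs_continuous J s u := exists g, is_scale_factor J s u g.

(* du/ds = g' o s. Two factors g agree on s(J), hence their derivatives agree on
   the interior of s(J), whose complement in s(J) has at most two points. *)
Definition scale_derive J s u : R -> R :=
  let g : R -> R := xget (cst 0) [set g | is_scale_factor J s u g] in
  fun x => derive1 g (s x).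

End scale_derivatives.

Section forms.
Context {R : realType}.
Variable m : {measure set (measurableTypeR R) -> \bar R}.

Definition radon := forall K : set R, compact K -> (m K < +oo)%E.

Definition fully_supported :=
  forall U : set R, open U -> U !=set0 -> (0 < m U)%E.

Record energy_form := EnergyForm {
  domain : set (R -> R) ;
  energy : (R -> R) -> (R -> R) -> R }.

Implicit Types (A B : energy_form) (u v w : R -> R).

Definition form_eq A B :=
  domain A = domain B /\
  forall u v, domain A u -> domain A v -> energy A u v = energy B u v.

Definition energy1 A u v : R := energy A u v + \int[m]_x (u x * v x).

Record dirichlet_form A : Prop := {
  dirichlet_L2 : forall u, domain A u -> u \in Lfun m 2%:E ;
  dirichlet_ae : forall u v, domain A u -> v \in Lfun m 2%:E ->
    {ae m, forall x, v x = u x} ->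
    domain A v /\ forall w, domain A w -> energy A v w = energy A u w ;
  dirichlet_zero : domain A (cst 0) ;
  dirichlet_linear : forall (c : R) u v, domain A u -> domain A v ->
    domain A (fun x => c * u x + v x) ;
  dirichlet_sym : forall u v, domain A u -> domain A v ->
    energy A u v = energy A v u ;
  dirichlet_bilinear : forall (c : R) u v w,
    domain A u -> domain A v -> domain A w ->
    energy A (fun x => c * u x + v x) w = c * energy A u w + energy A v w ;
  dirichlet_ge0 : forall u, domain A u -> 0 <= energy A u u ;
  dirichlet_dense : forall u, u \in Lfun m 2%:E -> forall eps, 0 < eps ->
    exists2 v, domain A v & \int[m]_x ((u x - v x) ^+ 2) < eps ;
  dirichlet_closed : forall u_ : nat -> R -> R, (forall n, domain A (u_ n)) ->
    (forall eps, 0 < eps -> exists N, forall p q, (N <= p)%N -> (N <= q)%N ->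
      energy1 A (u_ p \- u_ q) (u_ p \- u_ q) < eps) ->
    exists2 u, domain A u &
      energy1 A (u_ n \- u) (u_ n \- u) @[n --> \oo] --> (0 : R) ;
  dirichlet_markov : forall u, domain A u ->
    let v := fun x => Num.min (Num.max (u x) 0) 1 in
    domain A v /\ energy A v v <= energy A u u }.

Definition Cc : set (R -> R) :=
  [set u | continuous u /\ compact (closure [set x | u x != 0])].

Definition regular_form A :=
  (forall u, domain A u -> forall eps, 0 < eps ->
    exists v, [/\ domain A v, Cc v & energy1 A (u \- v) (u \- v) < eps]) /\
  (forall u, Cc u -> forall eps, 0 < eps ->
    exists v, [/\ domain A v, Cc v & forall x, `|u x - v x| < eps]).

(* The support of the measure |u|.m *)
Definition ae_support u : set R :=
  ~` [set x | exists U : set R,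
    [/\ open U, U x & {ae m, forall y, U y -> u y = 0}]].

Definition strongly_local A :=
  forall u v, domain A u -> domain A v ->
    compact (ae_support u) -> compact (ae_support v) ->
    (exists (U : set R) (c : R),
      [/\ open U, ae_support u `<=` U & {ae m, forall y, U y -> v y = c}]) ->
    energy A u v = 0.

Definition generated_form A (S : set (R -> R)) : energy_form :=
  EnergyForm [set u | domain A u /\ forall eps, 0 < eps ->
         exists2 v, S v & energy1 A (u \- v) (u \- v) < eps]
       (energy A).

Section scale_forms.
Variables (J : set R) (s : R -> R).

Definition L2_on (mu : {measure set (measurableTypeR R) -> \bar R})
    (D : set R) : set (R -> R) :=
  [set u | u \_ D \in Lfun mu 2%:E].

Definition scale_domain : set (R -> R) :=
  [set u | [/\ L2_on m J u, scale_abs_continuous J s u,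
    L2_on (scale_measure J s) J (scale_derive J s u),
    (lower J = -oo%E -> (-oo < lower_value (lower J) s)%E ->
      (m `]-oo, 0%R]%classic < +oo)%E -> u x @[x --> -oo] --> (0 : R))
    & (upper J = +oo%E -> (upper_value (upper J) s < +oo)%E ->
      (m `[0%R, +oo[%classic < +oo)%E -> u x @[x --> +oo] --> (0 : R))]].

Definition scale_energy u v : \bar R :=
  (2^-1%:E * \int[scale_measure J s]_(x in J)
    (scale_derive J s u x * scale_derive J s v x)%:E)%E.

End scale_forms.
End forms.

Section effective_intervals.
Context {R : realType}.
Implicit Type m : {measure set (measurableTypeR R) -> \bar R}.

(* A family of intervals with functions, indexed by a set of natural numbers. *)
Record itv_family := ItvFamily {
  indices : set nat ;
  itv : nat -> set R ;
  scale : nat -> R -> R }.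

Implicit Type C : itv_family.

Record effective_intervals C : Prop := {
  eff_trivIset : trivIset (indices C) (itv C) ;
  eff_itv : forall n, indices C n -> nondegenerate_interval (itv C n) ;
  eff_scale : forall n, indices C n -> scale_function (itv C n) (scale C n) ;
  eff_adapted : forall n, indices C n -> adapted (itv C n) (scale C n) }.

Definition covered C : set (measurableTypeR R) :=
  \bigcup_(n in indices C) itv C n.

Lemma measurable_covered C : effective_intervals C -> measurable (covered C).
Proof.
move=> hC; apply: bigcup_measurable => n Cn.
by apply: is_interval_measurable; case: (eff_itv hC Cn).
Qed.

Lemma measurable_uncovered C :
  effective_intervals C -> measurable (~` covered C).
Proof. by move=> hC; apply: measurableC; exact: measurable_covered. Qed.

(* A function satisfying pointwise, on every interval of C, the conditions that
   define the domain of the form represented by C. *)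
Definition eff_function m C : set (R -> R) :=
  [set u | (forall n, indices C n -> scale_domain m (itv C n) (scale C n) u) /\
    (\sum_(0 <= n <oo | n \in indices C)
       scale_energy (itv C n) (scale C n) u u < +oo)%E].

Definition eff_version m C (u : R -> R) : R -> R :=
  xget u [set v | {ae m, forall x, v x = u x} /\ eff_function m C v].

(* When m is fully supported, the version of u is unique on each interval. The
   series defining the energy converges absolutely. *)
Definition represented_form m C : energy_form :=
  EnergyForm [set u | u \in Lfun m 2%:E /\
         exists v, {ae m, forall x, v x = u x} /\ eff_function m C v]
       (fun u v => fine (\sum_(0 <= n <oo | n \in indices C)
         scale_energy (itv C n) (scale C n) (eff_version m C u)
           (eff_version m C v))%E).

Definition total_scale_measure C
    : {measure set (measurableTypeR R) -> \bar R} :=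
  mseries (fun n => if n \in indices C
    then scale_measure (itv C n) (scale C n) else mzero) 0.

End effective_intervals.

Section special_functions.
Context {R : realType}.

Definition smooth (phi : R -> R) :=
  forall (n : nat) (x : R), derivable (derive1n n phi) x 1.

(* phi ranges over functions on R, extended by zero outside of f(R). *)
Definition composed_test_functions (f : R -> R) : set (R -> R) :=
  [set phi \o f | phi in [set phi | [/\ smooth phi,
     compact (closure [set y | phi y != 0])
     & closure [set y | phi y != 0] `<=` range f]]].

End special_functions.

Section merge.
Context {R : realType}.
Implicit Types mu nu nu_a nu_s lam_t lbar :
  {measure set (measurableTypeR R) -> \bar R}.
Implicit Type C : @itv_family R.

Definition mutually_singular mu nu :=
  exists N, [/\ measurable N, mu N = 0%E & nu (~` N) = 0%E].

Definition lebesgue_decomposition nu mu nu_a nu_s :=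
  [/\ forall A, measurable A -> nu A = (nu_a A + nu_s A)%E,
      exists g : measurableTypeR R -> \bar R,
        [/\ measurable_fun setT g, forall x, (0 <= g x)%E
          & forall A, measurable A -> nu_a A = (\int[mu]_(x in A) g x)%E]
    & mutually_singular nu_s mu].

(* Below, lam_t is the restriction of the measure induced by f to the complement
   of the intervals of C, and lbar is the absolutely continuous part of the scale
   measure of C. *)
Definition scale_connected lam_t lbar C (i j : nat) :=
  let ei := itv_point (itv C i) in
  let ej := itv_point (itv C j) in
  let K := `[Num.min ei ej, Num.max ei ej]%classic in
  lam_t K = 0%E /\ (lbar K < +oo)%E.

Definition connected_class lam_t lbar C (n : nat) : set nat :=
  [set j | indices C j /\ scale_connected lam_t lbar C n j].

(* The function vanishing at e with increments given by mu. *)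
Definition distribution_function mu (e : R) : R -> R := fun x =>
  if e <= x then fine (mu `]e, x]%classic) else - fine (mu `]x, e]%classic).

(* Each equivalence class is indexed by its least element. *)
Definition interval_merge lam_t lbar C : itv_family :=
  let J n := \bigcup_(j in connected_class lam_t lbar C n) itv C j in
  let a n := lower (J n) in
  let b n := upper (J n) in
  let s n := distribution_function lbar (fixed_point (a n) (b n)) in
  ItvFamily
    [set n | indices C n /\
      forall j, connected_class lam_t lbar C n j -> (n <= j)%N]
    (fun n => [set x | [\/ (a n < x%:E < b n)%E,
      x%:E = a n /\ (-oo < a n + lower_value (a n) (s n))%E
      | x%:E = b n /\ (b n + upper_value (b n) (s n) < +oo)%E]])
    s.

End merge.

(* Main.v *)
Require Import Defs.
From HB Require Import structures.
From mathcomp Require Import all_boot all_order all_algebra.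
From mathcomp Require Import all_classical all_reals all_analysis.
From mathcomp Require Import measurable_realfun.
From mathcomp Require Import ring lra.
Import Order.TTheory GRing.Theory Num.Theory.
Import numFieldNormedType.Exports.

Set Implicit Arguments.
Unset Strict Implicit.
Unset Printing Implicit Defensive.

Local Open Scope classical_set_scope.
Local Open Scope ring_scope.

(** Both forms are described by densities. A function u belongs to the form represented by a
    family of intervals with scale measure lam exactly when it has a version v whose
    increments on each interval are the integrals of some D in L^2(lam) and which satisfies
    the boundary conditions at infinity, and the energy is half the integral of D^2
    ([represented_domainP], [represented_energyE]). That the derivatives du/ds of the
    definition are such densities is the fundamental theorem of calculus for absolutely
    continuous functions ([abs_continuous_density], [ae_derive1_primitive]), transported by
    the scale ([scale_derive_increments], [increments_scale_abs_continuous]).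

    Let lf be the measure of f, lfe and lft its restrictions to the intervals and to the rest
    of the line, and let N be a set that carries lfe and lbar but not the singular part of
    lam, so that lbar is lam restricted to N, and lbar = g lfe. The density D of a test
    function phi o f vanishes off N and satisfies D g = phi'(f) ([test_density_exists]).

    A limit of test functions belongs to the merged form ([closure_represents]). Its density
    still vanishes off N. Inside a merged interval lft vanishes, so that the increments of the
    test functions are integrals of D for lbar across the gaps between the original intervals
    as well, and this passes to the limit because lbar is finite there. At infinity the
    boundary condition follows from the Hoelder estimate [increments_holder], because test
    functions vanish far away.

    Conversely, a merged function u with density D belongs to the original form with density
    D on N and 0 elsewhere ([merge_represents]). Let r be u minus its projection on the closure
    of the test functions, for the norm E_1. It is again a merged function, and it is orthogonal
    to the test functions. As in the lemma of du Bois-Reymond, testing against functions whose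
    derivatives concentrate near two points shows that its density, extended by zero to the
    gaps, agrees lf-almost everywhere with a function G such that dG = 2 r dm on the whole
    line ([density_equation]). A maximum principle then gives r = 0. Suppose that r > 0 and
    G >= 0 at a point inside a merged interval. To the right of it r stays away from zero, and
    G increases and stays above some c > 0 ([no_positive_right]). Since G is in L^2(lbar) on
    the interval, lbar is finite up to the right endpoint b. If b is finite, G is
    positive also slightly beyond b; hence there is no gap and lbar is finite there, and the
    merged interval would extend beyond b. If b is infinite, lbar and m are finite near
    infinity, and the boundary condition forces r to tend to 0. The case G <= 0 is symmetric,
    and negative values are excluded by changing signs. So r vanishes on the merged intervals;
    then D = 0, hence G = 0, and the equation shows that r vanishes m-almost everywhere
    ([remainder_null]). *)

(** * Integrals and almost everywhere statements *)

Lemma integrable_cst_lty d (T : measurableType d) (R : realType)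
    (mu : {measure set T -> \bar R}) (A : set T) (k : R) :
  measurable A -> (mu A < +oo)%E -> mu.-integrable A (fun=> k%:E).
Proof.
move=> mA fA; apply/integrableP; split; first exact: measurable_cst.
by rewrite integral_cst//= lte_mul_pinfty.
Qed.

Section real_integrable.
Context d (T : measurableType d) (R : realType).
Variables (mu : {measure set T -> \bar R}) (A : set T).
Hypothesis mA : measurable A.
Implicit Types f h : T -> R.

Lemma integrable_realZ (c : R) f : mu.-integrable A (EFin \o f) ->
  mu.-integrable A (EFin \o (fun x => c * f x)).
Proof. by move=> i1; have := integrableZl mA c i1. Qed.

Lemma integrable_realD f h : mu.-integrable A (EFin \o f) ->
  mu.-integrable A (EFin \o h) -> mu.-integrable A (EFin \o (fun x => f x + h x)).
Proof. by move=> i1 i2; have := integrableD mA i1 i2. Qed.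

Lemma integrable_realB f h : mu.-integrable A (EFin \o f) ->
  mu.-integrable A (EFin \o h) -> mu.-integrable A (EFin \o (fun x => f x - h x)).
Proof. by move=> i1 i2; have := integrableB mA i1 i2. Qed.

Lemma RintegralE f : mu.-integrable A (EFin \o f) ->
  (\int[mu]_(x in A) (f x)%:E = (\int[mu]_(x in A) f x)%:E)%E.
Proof. by move=> i1; rewrite fineK//; have := integrable_fin_num mA i1. Qed.

End real_integrable.

Lemma ae_imply d (T : measurableType d) (R : realType)
    (mu : {measure set T -> \bar R}) (P Q : T -> Prop) :
  (forall x, P x -> Q x) -> {ae mu, forall x, P x} -> {ae mu, forall x, Q x}.
Proof. exact: (@filterS _ _ (ae_filter_ringOfSetsType mu)). Qed.

Lemma ae_imply2 d (T : measurableType d) (R : realType)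
    (mu : {measure set T -> \bar R}) (P Q S : T -> Prop) :
  (forall x, P x -> Q x -> S x) ->
  {ae mu, forall x, P x} -> {ae mu, forall x, Q x} -> {ae mu, forall x, S x}.
Proof. exact: (@filterS2 _ _ (ae_filter_ringOfSetsType mu)). Qed.

Lemma ae_eq_integrable d (T : measurableType d) (R : realType)
    (mu : {measure set T -> \bar R}) (A : set T) (f h : T -> \bar R) :
  measurable A -> measurable_fun A h -> ae_eq mu A f h ->
  mu.-integrable A f -> mu.-integrable A h.
Proof.
move=> mA mh fh /integrableP[mf f_lty]; apply/integrableP; split => //.
rewrite -(@ge0_ae_eq_integral _ _ _ mu _ (fun x => `|f x|%E))//.
- exact: measurableT_comp.
- exact: measurableT_comp.
- exact: (ae_eq_abse fh).
Qed.

Section integral_uniqueness.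
Context {R : realType}.
Local Notation M := (measurableTypeR R).
Implicit Types mu nu : {measure set M -> \bar R}.

Lemma measurable_cc (a b : R) : measurable (`[a, b]%classic : set M).
Proof. exact: measurable_itv. Qed.

(** The sets for which the integrals agree form a Dynkin system that contains the
    intervals [x, oo[, which generate the Borel sets. *)
Lemma cc_integral_unique mu1 mu2 (h1 h2 : M -> \bar R) (a b : R) :
  mu1.-integrable `[a, b] h1 -> mu2.-integrable `[a, b] h2 ->
  (forall x, a <= x <= b ->
    (\int[mu1]_(z in `[x, b]) h1 z = \int[mu2]_(z in `[x, b]) h2 z)%E) ->
  forall A : set M, measurable A -> A `<=` `[a, b]%classic ->
    (\int[mu1]_(z in A) h1 z = \int[mu2]_(z in A) h2 z)%E.
Proof.
move=> i1 i2 h A mA Aab.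
pose K : set M := `[a, b]%classic.
have mK : measurable K by exact: measurable_cc.
have mSK (S : set M) : measurable S -> measurable (S `&` K) by move=> ?; exact: measurableI.
have fin mu (k : M -> \bar R) (B : set M) : mu.-integrable K k -> measurable B ->
    B `<=` K -> (\int[mu]_(z in B) k z \is a fin_num)%E.
  by move=> ik mB BK; apply: integrable_fin_num => //; exact: integrableS ik.
suff H : forall S : set M, measurable S ->
    (\int[mu1]_(z in S `&` K) h1 z = \int[mu2]_(z in S `&` K) h2 z)%E.
  by rewrite -(setIidl Aab); exact: H.
have [ba|ab] := ltP b a.
  have K0 : K = set0 by rewrite /K set_itv_ge// bnd_simp -ltNge.
  by move=> S _; rewrite K0 setI0 !integral_set0.
have KE : (\int[mu1]_(z in K) h1 z = \int[mu2]_(z in K) h2 z)%E by apply: h; rewrite lexx.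
move=> S mS.
have := @dynkin_induction _ M (@RGenCInfty.G R)
  [set S : set M | (\int[mu1]_(z in S `&` K) h1 z = \int[mu2]_(z in S `&` K) h2 z)%E].
move/(_ _ _ _ _ _ _ S); apply => //.
- exact: RGenCInfty.measurableE.
- move=> _ _ [x ->] [y ->]; exists (Num.max x y).
  by apply/seteqP; split => t /=; rewrite !in_itv/= !andbT ge_max => /andP.
- by rewrite /= setTI.
- move=> _ [x ->] /=.
  have [xa|ax] := leP x a.
    rewrite (_ : _ `&` _ = K)//; apply/seteqP; split=> [t []//|t Kt]; split => //.
    by move: Kt; rewrite /K/= !in_itv/= => /andP[at_ _]; rewrite andbT (le_trans xa).
  have [xb|bx] := leP x b.
    rewrite (_ : _ `&` _ = `[x, b]%classic); first by apply: h; rewrite xb ltW.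
    apply/seteqP; split=> t /=; rewrite !in_itv/= andbT.
      by move=> [-> /andP[]].
    by move=> /andP[xt tb]; split=> //; rewrite /K/= in_itv/= tb (le_trans (ltW ax)).
  rewrite (_ : _ `&` _ = set0) ?integral_set0//.
  apply/seteqP; split=> // t [] /=; rewrite !in_itv/= andbT => xt /andP[_ tb].
  by have := lt_le_trans bx (le_trans xt tb); rewrite ltxx.
- move=> {mS}S mS /= SE.
  have split_ mu (k : M -> \bar R) : mu.-integrable K k ->
      (\int[mu]_(z in ~` S `&` K) k z = \int[mu]_(z in K) k z - \int[mu]_(z in S `&` K) k z)%E.
    move=> ik.
    have mCS : measurable (~` S) by exact: measurableC.
    rewrite -[in X in (X - _)%E](_ : (~` S `&` K) `|` (S `&` K) = K); last first.
      by rewrite -setIUl setUC setUCr setTI.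
    rewrite integral_setU//=; [|exact: mSK|exact: mSK| |]; last 2 first.
    - rewrite -setIUl setUC setUCr setTI; exact: measurable_int ik.
    - by apply/disj_setPS => t [[nS _] [St _]].
    by rewrite addeK//; apply: (fin _ _ _ ik) => //; exact: mSK.
  by rewrite !split_// SE KE.
- move=> F mF tF FE /=.
  have big mu (k : M -> \bar R) : mu.-integrable K k ->
      (\int[mu]_(z in \bigcup_k F k `&` K) k z = \sum_(i <oo) \int[mu]_(z in F i `&` K) k z)%E.
    move=> ik; rewrite setI_bigcupl integral_bigcup//.
    - exact: trivIset_setIr.
    - by move=> ?; exact: mSK.
    - apply: integrableS ik => //; first by apply: bigcup_measurable => ? _; exact: mSK.
      by move=> t [? _ []].
  by rewrite !big//; apply: eq_eseriesr => i _; exact: FE.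
- have E : @measurable _ M = <<s @RGenCInfty.G R >> := @RGenCInfty.measurableE R.
  by rewrite -E.
Qed.

Lemma cc_ae_eq mu (h1 h2 : M -> \bar R) (a b : R) :
  mu.-integrable `[a, b] h1 -> mu.-integrable `[a, b] h2 ->
  (forall x, a <= x <= b ->
    (\int[mu]_(z in `[x, b]) h1 z = \int[mu]_(z in `[x, b]) h2 z)%E) ->
  ae_eq mu `[a, b]%classic h1 h2.
Proof.
move=> i1 i2 h; apply: integral_ae_eq => //; first exact: measurable_int i2.
by move=> E ? ?; exact: cc_integral_unique i1 i2 h _ _ _.
Qed.

Lemma cc_measure_unique mu1 mu2 (a b : R) :
  (mu1 `[a, b]%classic < +oo)%E ->
  (forall x, a <= x <= b -> mu1 `[x, b]%classic = mu2 `[x, b]%classic) ->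
  forall A : set M, measurable A -> A `<=` `[a, b]%classic -> mu1 A = mu2 A.
Proof.
move=> f1 h A mA Aab.
have [ba|ab] := ltP b a.
  have K0 : `[a, b]%classic = set0 :> set R by rewrite set_itv_ge// bnd_simp -ltNge.
  by move: Aab; rewrite K0 subset0 => ->; rewrite !measure0.
have f2 : (mu2 `[a, b]%classic < +oo)%E by rewrite -h ?lexx ?ab.
have E mu (B : set M) : measurable B -> (\int[mu]_(z in B) 1%:E = mu B)%E.
  by move=> mB; rewrite integral_cst// mul1e.
rewrite -!E//; apply: (cc_integral_unique (a := a) (b := b)) => //.
- exact: integrable_cst_lty.
- exact: integrable_cst_lty.
by move=> x xab; rewrite !E//; [exact: h|exact: measurable_cc..].
Qed.

End integral_uniqueness.


(** * Densities and square-integrable functions *)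

Section density.
Local Open Scope ereal_scope.
Context d (T : measurableType d) (R : realType).
Variables (nu mu : {measure set T -> \bar R}) (g : T -> \bar R).
Hypotheses (mg : measurable_fun setT g) (g0 : forall x, 0 <= g x).
Hypothesis nuE : forall A, measurable A -> nu A = \int[mu]_(x in A) g x.

Import HBNNSimple.

Lemma ge0_integral_density f E : (forall x, 0 <= f x) ->
    measurable E -> measurable_fun E f ->
  \int[nu]_(x in E) f x = \int[mu]_(x in E) (f x * g x).
Proof.
move=> f0 mE mf; apply/esym.
pose h := nnsfun_approx mE mf.
have nd_h x a b : (a <= b)%N -> (h a x <= h b x)%R by move=> ab; exact/lefP/nd_nnsfun_approx.
have hf x : E x -> (EFin \o h n) x @[n --> \oo] --> f x by move=> Ex; exact: cvg_nnsfun_approx.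
have -> : \int[nu]_(x in E) f x =
    lim (\int[nu]_(x in E) (EFin \o h n) x @[n --> \oo]).
  have fE x : E x -> f x = lim ((EFin \o h n) x @[n --> \oo]).
    by move=> Ex; apply/esym/cvg_lim => //; exact: hf.
  under eq_integral => x /[!inE] /fE -> //.
  apply: monotone_convergence => //.
  - move=> n; apply/measurable_EFinP.
    by apply: (measurable_funS measurableT) => //; exact/measurable_funP.
  - by move=> n x Ex //=; rewrite lee_fin.
  - by move=> x Ex a b ab; rewrite lee_fin; exact: nd_h.
have -> : \int[mu]_(x in E) (f \* g) x =
    lim (\int[mu]_(x in E) ((EFin \o h n) \* g) x @[n --> \oo]).
  have fg x : E x -> f x * g x = lim (((EFin \o h n) \* g) x @[n --> \oo]).
    move=> Ex; apply/esym/cvg_lim => //.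
    have [gx0|gx0] := eqVneq (g x) 0.
      rewrite gx0 mule0 (_ : (fun n => _) = cst 0); first exact: cvg_cst.
      by apply/funext => n /=; rewrite mule0.
    have [fx0|fx0] := eqVneq (f x) 0.
      rewrite fx0 mul0e (_ : (fun n => _) = cst 0); first exact: cvg_cst.
      apply/funext => n /=; rewrite (_ : h n x = 0%R) ?mul0e//.
      apply/eqP; rewrite eq_le fun_ge0 andbT -lee_fin -[leRHS]fx0.
      have -> : f x = lim ((EFin \o h n) x @[n --> \oo]) by apply/esym/cvg_lim => //; exact: hf.
      apply: lime_ge; first by apply/cvg_ex; exists (f x); exact: hf.
      by near=> k; rewrite lee_fin; apply: nd_h; near: k; exact: nbhs_infty_ge.
    apply: cvgeM; [|exact: hf|exact: cvg_cst].
    by apply: neq0_mule_def; rewrite mule_neq0.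
  under eq_integral => x /[!inE] /fg -> //.
  apply: monotone_convergence => [//| | |].
  - move=> n; apply/emeasurable_funM; apply/measurable_funTS => //.
    exact/measurable_EFinP.
  - by move=> n x Ex /=; rewrite mule_ge0 ?lee_fin.
  - by move=> x Ex a b ab/=; rewrite lee_wpmul2r ?lee_fin//; exact: nd_h.
suff suf n : \int[mu]_(x in E) ((EFin \o h n) x * g x) =
    \int[nu]_(x in E) (EFin \o h n) x.
  by under eq_fun do rewrite suf.
transitivity (\int[nu]_(x in E)
   (\sum_(y \in range (h n)) (y * \1_(h n @^-1` [set y]) x)%:E)); last first.
  by apply: eq_integral => t tE; rewrite /= fimfunE -fsumEFin.
have indich m r : measurable_fun E (fun x => (r * \1_(h m @^-1` [set r]) x)%:E).
  by apply: (measurable_comp measurableT) => //; exact: measurable_funM.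
rewrite ge0_integral_fsum//; last by move=> m y Ey; exact: nnfun_muleindic_ge0.
transitivity (\int[mu]_(x in E) (\sum_(y \in range (h n))
    (y * \1_(h n @^-1` [set y]) x)%:E * g x)).
  under [RHS]eq_integral => x xE.
    rewrite -ge0_mule_fsuml => [|y]; last exact: nnfun_muleindic_ge0.
    rewrite fsumEFin // -(fimfunE _ x); over.
  by [].
rewrite ge0_integral_fsum//; last 2 first.
  - move=> y; apply: emeasurable_funM => //; exact: measurable_funTS.
  - by move=> m y Ey; rewrite mule_ge0// nnfun_muleindic_ge0.
apply: eq_fsbigr => r rhn.
under [RHS]eq_integral do rewrite EFinM.
rewrite integralZl_indic_nnsfun => //.
under eq_integral do rewrite EFinM -muleA.
rewrite ge0_integralZl//.
- under eq_integral do rewrite muleC.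
  rewrite (eq_integral (g \_ (h n @^-1` [set r]))); last first.
    by move=> x xE; rewrite epatch_indic.
  by rewrite -integral_mkcondr -nuE// integral_indic// setIC.
- apply: emeasurable_funM; first exact/measurable_EFinP.
  exact/measurable_funTS.
- by move=> t Et; rewrite mule_ge0 ?lee_fin.
- by move: rhn; rewrite inE => -[t _ <-]; rewrite lee_fin.
Unshelve. all: by end_near. Qed.

End density.

Section square_integrable.
Local Open Scope ereal_scope.
Context d (T : measurableType d) (R : realType).
Variable mu : {measure set T -> \bar R}.
Implicit Types (f h : T -> R) (A : set T).

Lemma Lfun2P f : f \in Lfun mu 2%:E <->
  measurable_fun setT f /\ \int[mu]_x (f x ^+ 2)%:E < +oo.
Proof.
split=> [f2|[mf f2]].
  split; first by move: f2; rewrite inE => /andP[]; rewrite inE.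
  have /integrableP[_] := Lfun2_integrable_sqr f2.
  by under eq_integral => x _ do rewrite /= ger0_norm ?sqr_ge0//.
rewrite inE; apply/andP; split; rewrite inE//= /finite_norm unlock.
rewrite poweR_lty//; under eq_integral => x _ do rewrite /= powR_mulrn// -normrX ger0_norm ?sqr_ge0//.
by [].
Qed.

Lemma Lfun2_measurable f : f \in Lfun mu 2%:E -> measurable_fun setT f.
Proof. by case/Lfun2P. Qed.

Lemma Lfun2M f h : f \in Lfun mu 2%:E -> h \in Lfun mu 2%:E ->
  mu.-integrable setT (fun x => (f x * h x)%:E).
Proof. by move=> f2 h2; apply/Lfun1_integrable; exact: Lfun2_mul_Lfun1. Qed.

Lemma Lfun2_linear (c : R) f h : f \in Lfun mu 2%:E -> h \in Lfun mu 2%:E ->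
  (fun x => c * f x + h x)%R \in Lfun mu 2%:E.
Proof.
move=> f2 h2; have [mf _] := (Lfun2P f).1 f2; have [mh _] := (Lfun2P h).1 h2.
apply/Lfun2P; split; first by apply: measurable_funD => //; exact: measurable_funM.
have i1 := Lfun2M f2 f2; have i2 := Lfun2M f2 h2; have i3 := Lfun2M h2 h2.
have : mu.-integrable setT (fun x => (c ^+ 2)%:E * (f x * f x)%:E +
    ((2 * c)%:E * (f x * h x)%:E + (h x * h x)%:E)).
  by apply: integrableD => //; [|apply: integrableD => //]; exact: integrableZl.
move=> /integrableP[_]; apply: le_lt_trans.
apply: ge0_le_integral => //.
- by move=> x _; rewrite lee_fin sqr_ge0.
- by apply/measurable_EFinP/measurable_funX; apply: measurable_funD => //; exact: measurable_funM.
- apply: measurableT_comp => //; apply: emeasurable_funD; [|apply: emeasurable_funD];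
    do 1? apply: emeasurable_funM => //; apply/measurable_EFinP; exact: measurable_funM.
- move=> x _; rewrite -!EFinM -!EFinD lee_fin; apply: le_trans (ler_norm _).
  by rewrite le_eqVlt; apply/predU1P; left; ring.
Qed.

Lemma Lfun2_restrict f A : measurable A -> f \in Lfun mu 2%:E ->
  f \_ A \in Lfun mu 2%:E.
Proof.
move=> mA /Lfun2P[mf f2]; apply/Lfun2P; split.
  by apply/(measurable_restrictT _ mA); exact: measurable_funTS.
apply: le_lt_trans f2; apply: ge0_le_integral => //.
- by move=> x _; rewrite lee_fin sqr_ge0.
- apply/measurable_EFinP/measurable_funX.
  by apply/(measurable_restrictT _ mA); exact: measurable_funTS.
- by apply/measurable_EFinP/measurable_funX.
- by move=> x _; rewrite lee_fin patchE; case: ifP => // _; rewrite expr0n sqr_ge0.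
Qed.

Lemma Lfun2_integrable f A : measurable A -> mu A < +oo -> f \in Lfun mu 2%:E ->
  mu.-integrable A (EFin \o f).
Proof.
move=> mA fA f2; have [mf _] := (Lfun2P f).1 f2.
have i1 : mu.-integrable A (fun x => (f x * f x)%:E + 1).
  apply: integrableD => //; first by apply: integrableS (Lfun2M f2 f2).
  exact: integrable_cst_lty.
apply: le_integrable i1 => //; first by apply/measurable_EFinP; exact: measurable_funTS.
move=> x _; rewrite -EFinD !abse_EFin lee_fin; apply: le_trans (ler_norm _).
rewrite -[(f x * f x)%R]ger0_norm -?expr2 ?sqr_ge0// normrX.
by have := sqr_ge0 (`|f x| - 1)%R; nra.
Qed.

(** Cauchy-Schwarz against the indicator of A. *)
Lemma Rintegral_sqr_le f A : measurable A -> mu A < +oo -> f \in Lfun mu 2%:E ->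
  ((\int[mu]_(x in A) f x) ^+ 2 <=
    fine (mu A) * \int[mu]_(x in A) (f x ^+ 2))%R.
Proof.
move=> mA fA f2.
have i1 : mu.-integrable A (EFin \o f) by exact: Lfun2_integrable.
have i2 : mu.-integrable A (fun x => (f x ^+ 2)%:E).
  by apply: integrableS (Lfun2_integrable_sqr f2).
have ic (c : R) : mu.-integrable A (EFin \o cst c).
  exact: integrable_cst_lty.
have H (c : R) : (0 <= \int[mu]_(x in A) (f x ^+ 2) - 2 * c * \int[mu]_(x in A) f x
    + c ^+ 2 * fine (mu A))%R.
  have -> : (\int[mu]_(x in A) (f x ^+ 2) - 2 * c * \int[mu]_(x in A) f x
    + c ^+ 2 * fine (mu A) = \int[mu]_(x in A) ((f x - c) ^+ 2))%R.
    have i3 := integrable_realZ mA (2 * c) i1.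
    have i4 := integrable_realB mA i2 i3.
    have i5 := ic (c ^+ 2)%R.
    rewrite -RintegralZl// -Rintegral_cst// -RintegralB// -RintegralD//.
    by apply: eq_Rintegral => x _ /=; ring.
  by apply: Rintegral_ge0 => x _; exact: sqr_ge0.
have [m0|m0] := eqVneq (fine (mu A)) 0%R.
  rewrite m0 mul0r; have := H ((\int[mu]_(x in A) (f x ^+ 2) + 1) / (2 * \int[mu]_(x in A) f x))%R.
  rewrite m0 mulr0 addr0; have [->|I0] := eqVneq (\int[mu]_(x in A) f x)%R 0%R.
    by rewrite expr0n.
  set I := (\int[mu]_(x in A) f x)%R in I0 *; set J := (\int[mu]_(x in A) _)%R.
  rewrite (_ : (J - _ = -1)%R); last by field.
  by rewrite ler0N1.
have mp : (0 < fine (mu A))%R by rewrite lt0r m0 fine_ge0.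
have := H (\int[mu]_(x in A) f x / fine (mu A))%R.
set I := (\int[mu]_(x in A) f x)%R; set J := (\int[mu]_(x in A) _)%R.
rewrite (_ : _ + _ = J - I ^+ 2 / fine (mu A))%R; last by field.
by rewrite subr_ge0 ler_pdivrMr// mulrC.
Qed.

End square_integrable.


(** * Variation of absolutely continuous functions *)

Section nonoverlapping.
Context {R : realType}.
Implicit Types (l : seq (R * R)) (p q : R * R) (g : R -> R).

Definition nonoverlap p q := (p.2 <= q.1) || (q.2 <= p.1).
Definition proper_pair p := p.1 <= p.2.
Definition pair_within (c d : R) p := (c <= p.1) && (p.2 <= d).
Definition pair_length p : R := p.2 - p.1.

Definition family l := all proper_pair l && pairwise nonoverlap l.

Lemma nonoverlapC p q : nonoverlap p q = nonoverlap q p.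
Proof. by rewrite /nonoverlap orbC. Qed.

(** Absolute continuity restated for lists of pairs, which are easier to refine, split and
    concatenate than families indexed by ordinals. *)
Lemma abs_continuous_family (c d : R) g : abs_continuous c d g ->
  forall eps, 0 < eps -> exists2 delta, 0 < delta &
    forall l, family l -> all (pair_within c d) l ->
      \sum_(p <- l) pair_length p < delta ->
      \sum_(p <- l) `|g p.2 - g p.1| < eps.
Proof.
move=> acg e /acg[delta d0 H]; exists delta => // l /andP[pl nl] wl ld.
pose p0 : R * R := (0, 0).
rewrite (big_nth p0) big_mkord.
apply: (H (size l) (fun i => (nth p0 l i).1) (fun i => (nth p0 l i).2)).
- move=> i; have il : nth p0 l i \in l by apply: mem_nth.
  have /andP[w1 w2] := allP wl _ il.
  by split=> //; rewrite w1; exact: (allP pl _ il).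
- have disj (i j : 'I_(size l)) : (i < j)%N ->
      `](nth p0 l i).1, (nth p0 l i).2[%classic `&` `](nth p0 l j).1, (nth p0 l j).2[%classic = set0.
    move=> ij; have := (pairwiseP p0 nl) i j.
    rewrite !inE !ltn_ord => /(_ isT isT ij) /orP no.
    apply/seteqP; split=> // t []; rewrite /= !in_itv/= => /andP[t1 t2] /andP[t3 t4].
    case: no => h.
      by have := lt_trans (lt_le_trans t2 h) t3; rewrite ltxx.
    by have := lt_trans (lt_le_trans t4 h) t1; rewrite ltxx.
  apply/trivIsetP => i j _ _ ij.
  have : (i != j :> nat) by [].
  rewrite neq_ltn => /orP[|] h; first exact: disj.
  by rewrite setIC; exact: disj.
- by move: ld; rewrite (big_nth p0) big_mkord.
Qed.

(** The successive pairs of a subdivision, so that a variation is a sum over a family. *)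
Fixpoint steps (x : R) (s : seq R) : seq (R * R) :=
  if s is y :: s' then (x, y) :: steps y s' else [::].

Lemma steps_length x s : \sum_(p <- steps x s) pair_length p = last x s - x.
Proof.
elim: s x => [|y s IH] x /=; first by rewrite big_nil subrr.
by rewrite big_cons IH /pair_length/=; ring.
Qed.

Lemma path_le_last (x : R) s : path <%R x s -> x <= last x s.
Proof.
elim: s x => [//|y s IH] x /= /andP[xy /IH]; exact/le_trans/ltW.
Qed.

Lemma steps_within x s : path <%R x s ->
  all (fun p => (x <= p.1) && (p.1 <= p.2) && (p.2 <= last x s)) (steps x s).
Proof.
elim: s x => [//|y s IH] x /= /andP[xy ys].
rewrite lexx (ltW xy)/=; apply/andP; split.
  exact: path_le_last.
apply: sub_all (IH _ ys) => p /andP[/andP[yp ->] ->].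
by rewrite (le_trans (ltW xy) yp).
Qed.

Lemma steps_family x s : path <%R x s -> family (steps x s).
Proof.
elim: s x => [//|y s IH] x /= /andP[xy ys].
have /andP[p1 p2] := IH _ ys.
rewrite /family /= p1 p2 /proper_pair/= (ltW xy)/= andbT.
by apply: sub_all (steps_within ys) => p /andP[/andP[yp _] _]; rewrite /nonoverlap/= yp.
Qed.

Lemma variation_steps a b g s :
  variation a b g s = \sum_(p <- steps a s) `|g p.2 - g p.1|.
Proof.
rewrite /variation; elim: s a => [|y s IH] a /=; first by rewrite !big_nil.
by rewrite big_nat_recl//= big_cons /= -IH.
Qed.

End nonoverlapping.

Section absolutely_continuous_variation.
Context {R : realType}.
Implicit Types (l : seq (R * R)) (p q : R * R).
Variables (c d : R) (g : R -> R) (eps delta : R).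
Hypothesis small : forall l, family l -> all (pair_within c d) l ->
  \sum_(p <- l) pair_length p < delta -> \sum_(p <- l) `|g p.2 - g p.1| < eps.

(** The intervals of the family are replaced one after the other by subdivisions of
    themselves; this keeps the total length, and the supremum over the subdivisions of one
    interval is its total variation. *)
Let small_mixed l l' : family (l ++ l') -> all (pair_within c d) (l ++ l') ->
  \sum_(p <- l ++ l') pair_length p < delta ->
  (\sum_(p <- l) total_variation p.1 p.2 g +
   (\sum_(p <- l') `|g p.2 - g p.1|)%:E <= eps%:E)%E.
Proof.
elim: l l' => [|[x y] l IH] l' fl wl sl.
  by rewrite big_nil add0e lee_fin ltW// small.
have xy : x <= y by case/andP: fl => /andP[].
rewrite big_cons /=.
set rest := (_%:E)%E; set S := (\sum_(_ <- _) _)%E.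
have S0 : (0 <= S)%E.
  rewrite /S big_seq; apply: sume_ge0 => p pl; apply: total_variation_ge0.
  have /andP[/allP/(_ p)] := fl; rewrite inE mem_cat pl orbT => /(_ isT) //.
have key s : itv_partition x y s -> ((variation x y g s)%:E + S + rest <= eps%:E)%E.
  move=> [pxs /eqP lxs].
  have sw := steps_within pxs; have sf := steps_family pxs.
  rewrite (_ : (_ + S + rest)%E =
      (S + (\sum_(p <- steps x s ++ l') `|g p.2 - g p.1|)%:E)%E); last first.
    by rewrite big_cat/= EFinD -(variation_steps x y) addeCA addeA.
  apply: IH.
  - case/andP: fl => /=; rewrite /family !all_cat !pairwise_cat allrel_catr.
    move=> /and3P[_ -> ->] /and4P[/andP[nxl nxl'] -> -> ->].
    case/andP: sf => -> ->; rewrite /= !andbT.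
    apply/andP; split.
      rewrite allrelC; apply/allrelP => p q ps ql.
      have := allP nxl _ ql; have /andP[/andP[h1 _]] := allP sw _ ps.
      rewrite lxs nonoverlapC /nonoverlap/= => h2 /orP[h|h]; apply/orP;
        first [by left; lra|by right; lra].
    apply/allrelP => p q ps ql.
    have := allP nxl' _ ql; have /andP[/andP[h1 _]] := allP sw _ ps.
    rewrite lxs /nonoverlap/= => h2 /orP[h|h]; apply/orP;
      first [by left; lra|by right; lra].
  - move: wl; rewrite /= !all_cat => /andP[/andP[cx yd] /andP[-> ->]]; rewrite /= andbT.
    apply: sub_all sw => p /andP[/andP[xp _]]; rewrite lxs => py.
    by rewrite /pair_within (le_trans cx xp) (le_trans py yd).
  - move: sl; rewrite /= big_cons !big_cat/= steps_length lxs.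
    by rewrite addrCA.
have Sf : (S \is a fin_num).
  have [s ps] : exists s, itv_partition x y s.
    move: xy; rewrite le_eqVlt => /predU1P[->|xy]; first by exists [::]; rewrite /itv_partition/= eqxx.
    by exists [:: y]; rewrite /itv_partition/= xy eqxx.
  have := key _ ps; rewrite addeAC -EFinD => h.
  by rewrite ge0_fin_numE// ltey; apply/eqP => Sy; move: h; rewrite Sy.
rewrite -[S]fineK// -addeA -EFinD.
rewrite -leeBrDr//; apply: ub_ereal_sup => _ [_ [s ps <-] <-].
by have := key s ps; rewrite -[S]fineK// -addeA -EFinD leeBrDr.
Qed.

Lemma small_variation l : family l -> all (pair_within c d) l ->
  \sum_(p <- l) pair_length p < delta ->
  (\sum_(p <- l) total_variation p.1 p.2 g <= eps%:E)%E.
Proof.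
by move=> fl wl sl; have := @small_mixed l [::]; rewrite cats0 big_nil adde0; exact.
Qed.

Lemma short_variation x y : c <= x -> x <= y -> y <= d -> y - x < delta ->
  (total_variation x y g <= eps%:E)%E.
Proof.
move=> cx xy yd yx; have := @small_variation [:: (x, y)].
rewrite !big_seq1; apply => //=.
  by rewrite /family/= /proper_pair/= xy.
by rewrite /pair_within/= cx yd.
Qed.

(** The interval is covered by finitely many pieces shorter than delta. *)
Lemma finite_variation : 0 < delta -> c <= d -> total_variation c d g \is a fin_num.
Proof.
move=> d0 cd.
suff H (n : nat) x : c <= x -> x <= d -> x - c <= n%:R * (delta / 2) ->
    total_variation c x g \is a fin_num.
  apply: (H (Num.bound ((d - c) / (delta / 2)))) => //.
  rewrite -ler_pdivrMr ?divr_gt0//; apply/ltW/archi_boundP.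
  by rewrite divr_ge0 ?subr_ge0// ltW// divr_gt0.
elim: n x => [|n IH] x cx xd; rewrite ?mul0r => xn.
  have -> : x = c by apply/eqP; rewrite eq_le cx andbT -subr_le0.
  by rewrite total_variationxx.
have d20 : 0 < delta / 2 by rewrite divr_gt0.
have [xs|xs] := leP (x - delta / 2) c.
  rewrite ge0_fin_numE ?total_variation_ge0//; apply: le_lt_trans (short_variation _ _ _ _) _ => //.
    by lra.
  by rewrite ltry.
rewrite (@total_variationD _ _ _ (x - delta / 2)) ?(ltW xs)//; last by lra.
rewrite fin_numD IH ?(ltW xs)//=; [|lra|move: xn; rewrite -natr1 mulrDl mul1r; lra].
rewrite ge0_fin_numE ?total_variation_ge0//; last by lra.
apply: le_lt_trans (short_variation _ _ _ _) (ltry _) => //; lra.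
Qed.

End absolutely_continuous_variation.


(** * Absolutely continuous functions are integrals *)

Lemma nat_itvP {R : realType} (x : R) : exists n : nat, - n%:R < x < n%:R.
Proof.
exists (Num.bound `|x|); rewrite -ltr_norml.
by apply: le_lt_trans (archi_boundP _) => //; rewrite ler_norml.
Qed.

Section stieltjes.
Context {R : realType}.
Local Notation M := (measurableTypeR R).

Lemma stieltjes_oc (F : cumulative R R) (a b : R) : a <= b ->
  lebesgue_stieltjes_measure F (`]a, b]%classic : set M) = (F b - F a)%:E.
Proof.
move=> ab; rewrite /lebesgue_stieltjes_measure/= /measure_extension/=.
rewrite measurable_mu_extE//; last exact: is_ocitv.
exact: wlength_itv_bnd.
Qed.

(** The half-open intervals ]a - d, a] have measure F a - F (a - d), which tends to 0. *)
Lemma stieltjes_set1 (F : cumulative R R) (a : R) : {for a, continuous F} ->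
  lebesgue_stieltjes_measure F ([set a] : set M) = 0%E.
Proof.
move=> cF; apply/eqP; rewrite eq_le measure_ge0 andbT.
apply/lee_addgt0Pr => e e0; rewrite add0e.
have [d d0 dF] : exists2 d, 0 < d & F a - F (a - d) < e.
  have /cvgrPdist_lt/(_ _ e0) := cF => /nbhs_ballP[d /= d0 H].
  exists (d / 2); first by rewrite divr_gt0.
  apply: le_lt_trans (ler_norm _) _; apply: H.
  rewrite /ball/= opprB addrC subrK ger0_norm ?divr_ge0 ?ltW//.
  by rewrite ltr_pdivrMr// ltr_pMr// ltr1n.
apply: (@le_trans _ _ (lebesgue_stieltjes_measure F (`]a - d, a]%classic : set M))).
  apply: le_measure; rewrite ?inE; [exact: measurable_set1|exact: measurable_itv|].
  by move=> _ ->; rewrite /= in_itv/= lexx andbT ltrBlDr ltrDl.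
by rewrite stieltjes_oc ?lee_fin ?(ltW dF)// lerBlDr lerDl ltW.
Qed.

Lemma stieltjes_cc (F : cumulative R R) (a b : R) : continuous F -> a <= b ->
  lebesgue_stieltjes_measure F (`[a, b]%classic : set M) = (F b - F a)%:E.
Proof.
move=> cF ab; rewrite -(@setU1itv _ _ _ _ false) ?bnd_simp// setUC measureU0//.
- exact: stieltjes_oc.
- by apply: stieltjes_set1; exact: cF.
Qed.

End stieltjes.

Section monotone_density.
Context {R : realType}.
Local Notation M := (measurableTypeR R).
Variables (F : R -> R) (lo hi : R).
Hypothesis ndF : {homo F : x y / x <= y}.
Hypothesis bndF : forall x, lo <= F x <= hi.
Hypothesis small : forall eps : R, 0 < eps -> exists2 delta : R, 0 < delta &
  forall l, family l -> \sum_(p <- l) pair_length p < delta ->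
    \sum_(p <- l) (F p.2 - F p.1) <= eps.

Let cF : continuous F.
Proof.
move=> x; apply/cvgrPdist_le => e e0.
have [d d0 H] := small e0.
have H1 (u v : R) : u <= v -> v - u < d -> F v - F u <= e.
  by move=> uv vu; have := H [:: (u, v)]; rewrite !big_seq1; apply => //; rewrite /family/= /proper_pair/= uv.
near=> y; have yx : `|x - y| < d by near: y; exact: cvgr_dist_lt.
have [xy|xy] := leP x y.
  rewrite distrC ger0_norm ?subr_ge0 ?ndF//; apply: H1 => //.
  by move: yx; rewrite distrC ger0_norm// subr_ge0.
have {}xy := ltW xy.
rewrite ger0_norm ?subr_ge0 ?ndF//; apply: H1 => //.
by move: yx; rewrite ger0_norm// subr_ge0.
Unshelve. all: by end_near. Qed.

Let FC : cumulative R R :=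
  HB.pack F (isCumulative.Build R _ R F ndF (right_continuousW cF)).

Let lam : {measure set M -> \bar R} := lebesgue_stieltjes_measure FC.

Let lam_cc x y : x <= y -> lam `[x, y]%classic = (F y - F x)%:E.
Proof. by move=> xy; apply: (@stieltjes_cc _ FC). Qed.

Let lam_lty : (lam setT < +oo)%E.
Proof.
have -> : [set: M] = \bigcup_n (`]- n%:R, n%:R]%classic : set M).
  apply/esym; rewrite -subTset => /= x _ /=.
  have [n /andP[h1 h2]] := nat_itvP x.
  by exists n => //=; rewrite in_itv/= h1 ltW.
have ndI : nondecreasing_seq (fun n => `]- n%:R, n%:R]%classic : set M).
  move=> m n mn; apply/subsetPset => x /=; rewrite !in_itv/= => /andP[h1 h2].
  have : m%:R <= n%:R :> R by rewrite ler_nat.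
  by move=> h3; apply/andP; split; lra.
have H := @nondecreasing_cvg_mu _ M R lam (fun n => `]- n%:R, n%:R]%classic).
have /(cvg_lim _) <- // := H (fun=> measurable_itv _) (bigcup_measurable (fun _ _ => measurable_itv _)) ndI.
apply: (@le_lt_trans _ _ (hi - lo)%:E); last by rewrite ltry.
apply: lime_le.
  apply: ereal_nondecreasing_is_cvgn => m n mn /=; apply: le_measure; rewrite ?inE; [exact: measurable_itv..|].
  exact/subsetPset/ndI.
apply: nearW => n; rewrite /= stieltjes_oc ?lee_fin//; last first.
  by apply: (@le_trans _ _ 0); rewrite ?oppr_le0 ler0n.
have /andP[_ h1] := bndF n%:R; have /andP[h2 _] := bndF (- n%:R); move=> /=; lra.
Qed.

Let hull (I : set R) : R * R := (inf I, sup I).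

Let hullP (I : set R) (n : R) : open I -> is_interval I -> I !=set0 ->
  I `<=` `]-n, n[%classic -> I = `]inf I, sup I[%classic /\ inf I < sup I.
Proof.
move=> oI iI [x Ix] In.
have lI : has_lbound I by exists (- n) => y /In/=; rewrite in_itv/= => /andP[/ltW].
have uI : has_ubound I by exists n => y /In/=; rewrite in_itv/= => /andP[_ /ltW].
have E : I = `]inf I, sup I[%classic.
  have := interval_bounded_interior iI lI uI.
  rewrite (interior_id _).1// => {1}->.
split=> //; move: Ix; rewrite {1}E /= in_itv/= => /andP[h1 h2]; exact: lt_trans h1 h2.
Qed.

(** A Lebesgue null set lies in an open set of small Lebesgue measure, whose connected
    components are disjoint intervals of small total length; absolute continuity bounds the
    sum of the increments of F over finitely many of them. *)
Let lam_dominated : lam `<< (lebesgue_measure : set M -> \bar R).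
Proof.
apply/null_content_dominatesP => A mA A0.
pose B n : set M := A `&` `]- n%:R, n%:R[%classic.
have mB n : measurable (B n) by apply: measurableI => //; exact: measurable_itv.
suff B0 n : lam (B n) = 0%E.
  have AE : A = \bigcup_n B n.
    apply/seteqP; split=> [x Ax|x [n _ []//]].
    have [n nx] := nat_itvP x.
    by exists n => //; split => //=; rewrite in_itv.
  apply: measure_negligible => //; rewrite AE; apply: negligible_bigcup => k.
  by apply/negligibleP; [exact: mB|exact: B0].
have leb0 : lebesgue_measure (B n) = 0%E.
  apply/eqP; rewrite eq_le measure_ge0 andbT -A0.
  by apply: le_measure; rewrite ?inE//; exact: subIsetl.
apply/eqP; rewrite eq_le measure_ge0 andbT.
apply/lee_addgt0Pr => e e0; rewrite add0e.
have [d d0 H] := small e0.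
have [U [oU BU Ud]] : exists U : set R, [/\ open U, B n `<=` U & (lebesgue_measure (U `\` B n) < d%:E)%E].
  have leb_lty : (lebesgue_measure (B n) < +oo)%E by rewrite leb0.
  exact: (lebesgue_regularity_outer (mB n) leb_lty d0).
pose W : set R := U `&` `]- n%:R, n%:R[%classic.
have oW : open W by apply: openI => //; exact: interval_open.
have mW : measurable (W : set M) by exact: open_measurable.
have Wd : (lebesgue_measure (W : set M) < d%:E)%E.
  apply: le_lt_trans Ud.
  have mU : measurable (U : set M) by exact: open_measurable.
  have mUB : measurable (U `\` B n : set M) by exact: measurableD.
  rewrite -[leRHS]adde0 -leb0 -measureU//; last by apply/seteqP; split=> // t [[_ +]].
  apply: le_measure; rewrite ?inE//; first exact: measurableU.
  by move=> t [Ut _]; have [Bt|nBt] := pselect (B n t); [right|left].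
have BW : B n `<=` W by move=> t Bt; split; [exact: BU|case: Bt].
have [I [oiI tI WE]] : exists I : nat -> set R,
    [/\ forall q, open (I q) /\ is_interval (I q), trivIset setT I & W = \bigcup_q I q].
  exists (open_disjoint_itv oW); split=> [q||].
  - by split; [exact: open_disjoint_itv_open|exact: open_disjoint_itv_is_interval].
  - exact: open_disjoint_itv_trivIset.
  - exact: open_disjoint_itv_bigcup.
have mI k : measurable (I k : set M) by apply: open_measurable; case: (oiI k).
have IW k : I k `<=` `]- n%:R, n%:R[%classic by move=> t It; have : W t by [rewrite WE; exists k]; case.
have hI k : I k !=set0 -> I k = `]inf (I k), sup (I k)[%classic /\ inf (I k) < sup (I k).
  by move=> I0; have [oIk iIk] := oiI k; exact: hullP (IW k).
apply: (@le_trans _ _ (lam W)); first by apply: le_measure; rewrite ?inE.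
rewrite WE measure_semi_bigcup//; last by rewrite -WE.
apply: lime_le; first by apply: is_cvg_nneseries.
apply: nearW => N.
pose r := [seq k <- index_iota 0 N | I k != set0].
pose l := [seq hull (I k) | k <- r].
have fl : family l.
  apply/andP; split.
    apply/allP => _ /mapP[k + ->]; rewrite mem_filter => /andP[/set0P/hI[_ h] _].
    exact: ltW.
  rewrite pairwise_map; have : pairwise (fun i j => i != j) r.
    by rewrite -uniq_pairwise filter_uniq// iota_uniq.
  have : all (fun k => I k != set0) r by exact: filter_all.
  elim: r {l} => [//|k r IH] /= /andP[k0 ar] /andP[kr pr].
  rewrite IH// andbT; apply/allP => j jr.
  have := allP kr _ jr; have /set0P/hI[Ej hj] := allP ar _ jr.
  have /set0P/hI[Ek hk] := k0.
  move=> kj; rewrite /nonoverlap /=; apply/orP; apply: contrapT => /not_orP[/negP]. 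
  rewrite -ltNge => h1 /negP; rewrite -ltNge => h2.
  have kj0 := trivIsetP.1 tI k j Logic.I Logic.I kj.
  have [x [x1 [x2 [x3 x4]]]] : exists x : R, inf (I k) < x /\ x < sup (I k) /\ inf (I j) < x /\ x < sup (I j).
    pose p := Num.max (inf (I k)) (inf (I j)); pose q := Num.min (sup (I k)) (sup (I j)).
    have pq : p < q by rewrite /p /q gt_max !lt_min hk h1 h2 hj.
    have : p < (p + q) / 2 < q by apply/andP; split; lra.
    rewrite /p /q gt_max lt_min => /andP[/andP[? ?] /andP[? ?]].
    by exists ((p + q) / 2).
  suff : (I k `&` I j) x by rewrite kj0.
  by split; [rewrite Ek|rewrite Ej]; rewrite /= in_itv/=; exact/andP.
have sumE (mu : {measure set M -> \bar R}) : (\sum_(0 <= k < N) mu (I k) = \sum_(k <- r) mu (I k))%E.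
  rewrite /r big_filter; apply/esym; rewrite big_mkcond; apply: eq_bigr => k _.
  by case: ifPn => // /negPn/eqP ->; rewrite measure0.
rewrite sumE.
have le_ : (\sum_(k <- r) lam (I k) <= (\sum_(p <- l) (F p.2 - F p.1))%:E)%E.
  rewrite -sumEFin big_map big_seq [in leRHS]big_seq; apply: lee_sum => k.
  rewrite mem_filter => /andP[/set0P/hI[E h] _] /=.
  have : (lam (I k) <= lam `[inf (I k), sup (I k)]%classic)%E.
    apply: le_measure; rewrite ?inE//.
    by rewrite {1}E; exact: subset_itv_oo_cc.
  by rewrite lam_cc; last exact: ltW.
apply: le_trans le_ _; rewrite lee_fin; apply: H => //.
rewrite -lte_fin; apply: le_lt_trans Wd.
rewrite WE measure_semi_bigcup//; last by rewrite -WE.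
have -> : (\sum_(p <- l) pair_length p)%:E = (\sum_(k <- r) lebesgue_measure (I k : set M))%E.
  rewrite -sumEFin big_map big_seq [in RHS]big_seq; apply: eq_bigr => k.
  rewrite mem_filter => /andP[/set0P/hI[E h] _] /=.
  by rewrite [in RHS]E lebesgue_measure_itv/= lte_fin h EFinB.
by rewrite -sumE; apply: nneseries_lim_ge.
Qed.

(** The density is the Radon-Nikodym derivative of the measure with distribution
    function F. *)
Lemma monotone_density : exists D : R -> R,
  [/\ measurable_fun setT (D : M -> R),
      (lebesgue_measure : {measure set M -> \bar R}).-integrable setT (EFin \o D) &
      forall x y, x <= y -> F y - F x = \int[lebesgue_measure]_(z in `[x, y]) D z].
Proof.
pose nu : {finite_measure set M -> \bar R} := mfrestr measurableT lam_lty.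
have nuE (A : set M) : nu A = lam A by rewrite /nu /= /mfrestr /mrestr setIT.
have dnu : nu `<< (lebesgue_measure : set M -> \bar R).
  apply/null_content_dominatesP => A mA A0; rewrite nuE.
  by have /null_content_dominatesP := lam_dominated; exact.
pose rn := Radon_Nikodym_SigmaFinite.f nu lebesgue_measure.
have rn_fin x : rn x \is a fin_num by exact: Radon_Nikodym_SigmaFinite.f_fin_num.
have irn := Radon_Nikodym_SigmaFinite.f_integrable dnu.
have rnE : EFin \o (fine \o rn) = rn by apply/funext => x /=; rewrite fineK.
exists (fine \o rn); split.
- by apply/measurable_EFinP; rewrite rnE; exact: measurable_int irn.
- by rewrite rnE.
- move=> x y xy; rewrite /Rintegral.
  have -> : (\int[lebesgue_measure]_(z in `[x, y]) ((fine \o rn) z)%:E = lam `[x, y]%classic)%E.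
    rewrite -nuE (Radon_Nikodym_SigmaFinite.f_integral dnu); last exact: measurable_itv.
    by apply: eq_integral => z _; rewrite /= fineK.
  by rewrite lam_cc.
Qed.

End monotone_density.


Section abs_continuous_density.
Context {R : realType}.
Local Notation M := (measurableTypeR R).
Local Notation leb := (@lebesgue_measure R).
Variables (c d : R) (g : R -> R).
Hypothesis cd : c <= d.
Hypothesis acg : abs_continuous c d g.

Let clamp (t : R) := Num.max c (Num.min t d).

Let clamp_itv t : c <= clamp t <= d.
Proof. by rewrite /clamp le_max lexx/= ge_max cd ge_min lexx orbT. Qed.

Let le_clamp : {homo clamp : x y / x <= y}.
Proof.
move=> x y xy; rewrite /clamp ge_max !le_max lexx/=; apply/orP; right.
by rewrite le_min !ge_min xy lexx/= orbT.
Qed.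

Let clamp_id t : c <= t <= d -> clamp t = t.
Proof. by move=> /andP[ct td]; rewrite /clamp (min_idPl td) (max_idPr ct). Qed.

Let clamp_contr x y : x <= y -> clamp y - clamp x <= y - x.
Proof.
move=> xy; rewrite /clamp.
case: (leP x d) => xd; case: (leP y d) => yd; rewrite ?(max_idPr cd).
- by case: (leP c x) => ?; case: (leP c y) => ?; lra.
- by case: (leP c x) => ?; lra.
- by lra.
- by lra.
Qed.

Let clamp_family l : family l -> [/\ family [seq (clamp p.1, clamp p.2) | p <- l],
  all (pair_within c d) [seq (clamp p.1, clamp p.2) | p <- l] &
  \sum_(p <- [seq (clamp p.1, clamp p.2) | p <- l]) pair_length p <=
  \sum_(p <- l) pair_length p].
Proof.
move=> /andP[pl nl]; split.
- apply/andP; split.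
    by rewrite all_map; apply: sub_all pl => p /= h; exact: le_clamp.
  rewrite pairwise_map; apply: sub_pairwise nl => p q /orP[h|h];
    apply/orP; [left|right]; exact: le_clamp.
- rewrite all_map; apply/allP => p _ /=; rewrite /pair_within/=.
  by have /andP[-> _] := clamp_itv p.1; have /andP[_ ->] := clamp_itv p.2.
- rewrite big_map big_seq [leRHS]big_seq; apply: ler_sum => p pl'.
  by apply: clamp_contr; exact: (allP pl).
Qed.

Let tv_fin x y : c <= x -> x <= y -> y <= d -> total_variation x y g \is a fin_num.
Proof.
move=> cx xy yd; have [delta d0 H] := abs_continuous_family acg (ltr01 : 0 < 1 :> R).
have := finite_variation H d0 cd.
rewrite (@total_variationD _ c d y)// ?(le_trans cx)//.
by rewrite (@total_variationD _ c y x)// !fin_numD => /andP[/andP[]].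
Qed.

Let V (t : R) : R := fine (total_variation c (clamp t) g).
Let W (t : R) : R := V t - g (clamp t).

Let VE x y : x <= y -> V y - V x = fine (total_variation (clamp x) (clamp y) g).
Proof.
move=> xy; have /andP[cx xd] := clamp_itv x; have /andP[cy yd] := clamp_itv y.
have xy' := le_clamp xy.
rewrite /V (@total_variationD _ _ _ (clamp x))// fineD ?tv_fin//.
by rewrite addrC addKr.
Qed.

Let VleW x y : x <= y -> `|g (clamp y) - g (clamp x)| <= V y - V x.
Proof.
move=> xy; have /andP[cx xd] := clamp_itv x; have /andP[cy yd] := clamp_itv y.
have xy' := le_clamp xy.
by rewrite VE// -lee_fin fineK ?tv_fin//; exact: total_variation_ge.
Qed.

Let ndV : {homo V : x y / x <= y}.
Proof. by move=> x y xy; rewrite -subr_ge0; apply: le_trans (VleW xy). Qed.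

Let ndW : {homo W : x y / x <= y}.
Proof.
move=> x y xy; rewrite -subr_ge0 /W; have := VleW xy.
by rewrite ler_norml => /andP[_]; lra.
Qed.

Let clampK t : clamp (clamp t) = clamp t. Proof. exact: clamp_id. Qed.

Let V_bnd t : V c <= V t <= V d.
Proof.
have VK x : V x = V (clamp x) by rewrite /V clampK.
by rewrite (VK t); have /andP[h1 h2] := clamp_itv t; rewrite !ndV.
Qed.

Let W_bnd t : W c <= W t <= W d.
Proof.
have WK x : W x = W (clamp x) by rewrite /W /V clampK.
by rewrite (WK t); have /andP[h1 h2] := clamp_itv t; rewrite !ndW.
Qed.

Let smallV eps : 0 < eps -> exists2 delta : R, 0 < delta &
  forall l, family l -> \sum_(p <- l) pair_length p < delta ->
    \sum_(p <- l) (V p.2 - V p.1) <= eps.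
Proof.
move=> e0; have [delta d0 H] := abs_continuous_family acg e0; exists delta => // l fl sl.
have [fl' wl' sl'] := clamp_family fl.
have := small_variation H fl' wl' (le_lt_trans sl' sl).
rewrite big_map /= -lee_fin; apply: le_trans.
rewrite -sumEFin big_seq [leRHS]big_seq; apply: lee_sum => p pl.
have pp : p.1 <= p.2 by case/andP: fl => /allP/(_ _ pl).
have /andP[cx xd] := clamp_itv p.1; have /andP[cy yd] := clamp_itv p.2.
by rewrite VE// fineK// tv_fin// le_clamp.
Qed.

Let smallW eps : 0 < eps -> exists2 delta : R, 0 < delta &
  forall l, family l -> \sum_(p <- l) pair_length p < delta ->
    \sum_(p <- l) (W p.2 - W p.1) <= eps.
Proof.
move=> e0; have e20 : 0 < eps / 2 by rewrite divr_gt0.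
have [delta d0 H] := smallV e20; exists delta => // l fl sl.
apply: (@le_trans _ _ (\sum_(p <- l) (V p.2 - V p.1) + \sum_(p <- l) (V p.2 - V p.1))); last first.
  by rewrite [leRHS]splitr; apply: lerD; exact: H.
rewrite -big_split/= big_seq [leRHS]big_seq; apply: ler_sum => p pl.
have pp : p.1 <= p.2 by case/andP: fl => /allP/(_ _ pl).
by have := VleW pp; rewrite /W ler_norml => /andP[+ _]; lra.
Qed.

(** Jordan decomposition: the total variation V and W = V - g are nondecreasing and satisfy
    the smallness condition of [monotone_density]. The argument is clamped to [c, d] in
    order to have functions on the whole line. *)
Lemma abs_continuous_density : exists D : R -> R,
  [/\ measurable_fun setT (D : M -> R), leb.-integrable setT (EFin \o D) &
      forall x y, c <= x -> x <= y -> y <= d ->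
        g y - g x = \int[leb]_(z in `[x, y]) D z].
Proof.
have [D1 [mD1 iD1 E1]] := monotone_density ndV V_bnd smallV.
have [D2 [mD2 iD2 E2]] := monotone_density ndW W_bnd smallW.
exists (fun x => D1 x - D2 x); split.
- exact: measurable_funB.
- exact: integrable_realB.
- move=> x y cx xy yd; rewrite RintegralB.
  + rewrite -E1// -E2// /W !clamp_id ?(le_trans xy)// ?cx ?(le_trans cx)//; ring.
  + exact: measurable_itv.
  + by apply: integrableS iD1 => //; exact: measurable_itv.
  + by apply: integrableS iD2 => //; exact: measurable_itv.
Qed.

End abs_continuous_density.


(** * Derivatives of integrals *)

Section derivative_of_primitive.
Context {R : realType}.
Local Notation leb := (@lebesgue_measure R).

(** Lebesgue differentiation, applied to D cut off outside of [c, d]. *)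
Lemma ae_derive1_primitive (c d : R) (g D : R -> R) :
  leb.-integrable setT (EFin \o D) ->
  (forall x y, c <= x -> x <= y -> y <= d ->
        g y - g x = \int[leb]_(z in `[x, y]) D z) ->
  {ae leb, forall x, c < x < d -> derivable g x 1 /\ derive1 g x = D x}.
Proof.
move=> iD gD.
have [dc|cd] := ltP d c.
  apply: aeW => x /andP[cx xd]; have := lt_trans cx xd.
  by move=> cd; have := lt_trans cd dc; rewrite ltxx.
pose E := D \_ `[c, d].
have iE : leb.-integrable setT (EFin \o E).
  rewrite /E -restrict_EFin; apply/integrable_restrict => //=.
  by rewrite setTI; apply: integrableS iD => //; exact: measurable_itv.
have := @FTC1Ny R E.
have /[swap]/[apply] : forall y : R, leb.-integrable `]-oo, y] (EFin \o E).
  by move=> y; apply: integrableS iE => //; exact: measurable_itv.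
have lE : locally_integrable setT E by apply: open_integrable_locally => //; exact: openT.
move=> /(_ lE) H.
move: H => /= H; apply: (@filterS _ _ (ae_filter_ringOfSetsType leb) _ _ _ H).
move=> {H} x [dF FE] /andP[cx xd].
set F := fun x => _ in dF FE.
have FgE y : c < y < d -> F y = g y - g c.
  move=> /andP[cy yd]; rewrite /F -Rintegral_mkcondr gD ?lexx ?(ltW cy) ?(ltW yd)//.
  congr (Rintegral _ _ _); apply/seteqP; split => t /=; rewrite !in_itv/=.
    by move=> [-> /andP[-> _]].
  by move=> /andP[-> ty]; rewrite ty (le_trans ty (ltW yd)).
clearbody F.
have nearE : \near x, (F + cst (g c)) x = g x.
  have xI : x \in `]c, d[ by rewrite in_itv/= cx.
  have : \near x, (x \in `]c, d[) by exact: near_in_itvoo.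
  by apply: filterS => y; rewrite in_itv/= !fctE => /FgE ->; rewrite subrK.
have dc := @derivable_cst _ _ _ (g c) x (1 : R).
have dFc : derivable (F + cst (g c)) x 1 := derivableD dF dc.
split; first exact: near_eq_derivable dFc.
have -> : D x = E x by rewrite /E patchE mem_set//= in_itv/= !ltW.
rewrite -FE !derive1E -(near_eq_derive _ nearE) (deriveD dF dc).
by rewrite derive_cst addr0.
Qed.

End derivative_of_primitive.

Section measurable_derivative.
Context {R : realType}.
Local Notation M := (measurableTypeR R).
Variables (U : set R) (g : R -> R).
Hypotheses (oU : open U) (cg : forall x, U x -> {for x, continuous g}).

Let q (h t : R) := h^-1 * (g (h + t) - g t).

(** The points where two difference quotients with steps below 1 / (j + 1) differ by more
    than 1 / (k + 1): derivability is a Cauchy condition on open sets. *)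
Let osc (j k : nat) : set R := \bigcup_(h in [set h | h != 0 /\ `|h| < j.+1%:R^-1])
  \bigcup_(h' in [set h | h != 0 /\ `|h| < j.+1%:R^-1])
  [set t | [/\ U t, U (h + t), U (h' + t) & k.+1%:R^-1 < `|q h t - q h' t|]].

Let cq h t : U t -> U (h + t) -> {for t, continuous (q h)}.
Proof.
move=> Ut Uht; apply: cvgM; first exact: cvg_cst.
apply: cvgB; last exact: cg.
apply: (@continuous_comp _ _ _ (fun t => h + t) g t); last exact: cg.
by apply: cvgD; [exact: cvg_cst|exact: cvg_id].
Qed.

Let near_shift h t : U (h + t) -> \forall t' \near t, U (h + t').
Proof.
move=> Uht.
have c : (fun t' => h + t') t' @[t' --> t] --> h + t.
  by apply: cvgD; [exact: cvg_cst|exact: cvg_id].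
by apply: c; apply: open_nbhs_nbhs.
Qed.

Let open_osc j k : open (osc j k).
Proof.
apply: bigcup_open => h [h0 hj]; apply: bigcup_open => h' [h'0 h'j].
rewrite openE => t [Ut Uht Uh't kq]; rewrite /interior.
have c : (fun t' => `|q h t' - q h' t'|) t' @[t' --> t] --> `|q h t - q h' t|.
  by apply: cvg_norm; apply: cvgB; exact: cq.
have n1 : \forall t' \near t, k.+1%:R^-1 < `|q h t' - q h' t'| by exact: cvgr_gt c _ kq.
have n2 : \forall t' \near t, U t' by exact: open_nbhs_nbhs.
have n3 := near_shift Uht; have n4 := near_shift Uh't.
by near=> t'; split; near: t'.
Unshelve. all: by end_near. Qed.

Let E : set R := \bigcap_k \bigcup_j ~` osc j k.

Let mE : measurable (E : set M).
Proof.
apply: bigcapT_measurable => k; apply: bigcup_measurable => j _.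
by apply: measurableC; exact: open_measurable.
Qed.

Let inv_lt (e : R) : 0 < e -> exists j : nat, j.+1%:R^-1 < e.
Proof.
move=> e0; exists (Num.bound e^-1).
rewrite invf_plt ?posrE//.
apply: lt_trans (_ : (Num.bound e^-1)%:R < _); last by rewrite ltr_nat.
by apply: archi_boundP; rewrite invr_ge0 ltW.
Qed.

Let E_cvg t : U t -> E t -> cvg (q ^~ t @ 0^').
Proof.
move=> Ut Et; apply/cauchy_cvgP/cauchy_exP => e e0.
have [k ke] := inv_lt e0.
have [j _ Ej] := Et k Logic.I.
have [r r0 rU] : exists2 r : R, 0 < r & forall h, `|h| < r -> U (h + t).
  have /nbhs_ballP[r /= r0 H] := open_nbhs_nbhs (conj oU Ut).
  by exists r => // h hr; apply: H; rewrite /ball/= opprD addrCA subrr addr0 normrN.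
pose d := Num.min j.+1%:R^-1 r.
have d0 : 0 < d by rewrite lt_min r0 invr_gt0 ltr0n.
exists (q (d / 2) t).
change (\forall h \near (0 : R)^', ball (q (d / 2) t) e (q h t)).
have near1 : \forall h \near (0 : R)^', `|h| < d by exact: dnbhs0_lt.
near=> h.
have hd : `|h| < d by near: h.
have h0 : h != 0 by near: h; exact: nbhs_dnbhs_neq.
apply: le_lt_trans ke; rewrite leNgt; apply/negP => kq; apply: Ej.
move: hd; rewrite lt_min => /andP[hj hr].
have d2 : `|d / 2| < d by rewrite ger0_norm ?divr_ge0 ?ltW// ltr_pdivrMr// ltr_pMr// ltr1n.
move: (d2); rewrite lt_min => /andP[dj dr].
exists (d / 2); first by split => //; rewrite gt_eqF// divr_gt0.
by exists h => //; split => //; exact: rU.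
Unshelve. all: by end_near. Qed.

Let cvg_E t : cvg (q ^~ t @ 0^') -> E t.
Proof.
move=> /cvg_ex[/= l /cvgrPdist_lt ql] k _.
have k0 : 0 < k.+1%:R^-1 / 2 :> R by rewrite divr_gt0// invr_gt0.
have := ql _ k0; rewrite /dnbhs => /nbhs_ballP[r /= r0 H].
have [j jr] := inv_lt r0; exists j => //.
move=> [h [h0 hj] [h' [h'0 h'j]] [_ _ _]]; apply/negP; rewrite -leNgt.
have B (z : R) : `|z| < j.+1%:R^-1 -> ball 0 r z.
  by move=> zj; rewrite /ball/= sub0r normrN (lt_trans zj).
have := H h (B _ hj) h0; have := H h' (B _ h'j) h'0.
rewrite /= => a1 a2.
rewrite (_ : q h t - q h' t = (l - q h' t) - (l - q h t)); last by ring.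
by apply: le_trans (ler_normB _ _) _; rewrite [leRHS]splitr; apply: lerD; exact: ltW.
Qed.

(** On the measurable set E of the points of derivability the derivative is a limit of
    difference quotients; elsewhere the limit that defines it has the default value 0. *)
Lemma measurable_derive1 : measurable_fun (U : set M) (derive1 g : M -> M).
Proof.
have mU : measurable (U : set M) by exact: open_measurable.
have mg : measurable_fun (U : set M) (g : M -> M) by apply: open_continuous_measurable_fun => // x /set_mem/cg.
have mgU : measurable_fun setT (g \_ U : M -> M) by apply/(measurable_restrictT _ mU).
pose s n : R := n.+1%:R^-1.
pose qU n (t : M) : M := (s n)^-1 * ((g \_ U) (s n + t) - (g \_ U) t).
have mqU n : measurable_fun setT (qU n : M -> M).
  apply: measurable_funM; first exact: measurable_cst.
  apply: measurable_funB => //; apply: measurableT_comp => //.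
  exact: measurable_funD.
apply: (@measurable_fun_cvg _ M R U (fun n => (qU n \_ E : M -> R))).
  move=> n; apply: measurable_funTS; apply/(measurable_restrictT _ mE).
  exact: measurable_funS (mqU n).
move=> t Ut.
have s_gt0 n : 0 < s n by rewrite /s invr_gt0 ltr0n.
have [Et|nEt] := pselect (E t); last first.
  rewrite (_ : (fun n => _) = cst 0); last first.
    by apply/funext => n; rewrite patchE memNset.
  rewrite (_ : derive1 g t = 0); first exact: cvg_cst.
  rewrite /derive1 /lim /lim_in getPN// => l gl; apply: nEt; apply: cvg_E.
  by apply/cvg_ex; exists l.
have s0 : s @ \oo --> (0 : R)^'.
  move=> A; rewrite /dnbhs => /nbhs_ballP[r /= r0 H].
  have [N Nr] := inv_lt r0; exists N => // n /= Nn.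
  apply: H; last by rewrite gt_eqF.
  rewrite /ball/= sub0r normrN gtr0_norm//; apply: le_lt_trans Nr.
  by rewrite /s lef_pV2 ?posrE// ler_nat ltnS.
have gt : q ^~ t @ (0 : R)^' --> derive1 g t := E_cvg Ut Et.
have c := cvg_comp _ _ s0 gt.
apply: cvg_trans c; apply: near_eq_cvg.
have s0' : s @ \oo --> (0 : R) by apply: cvg_trans s0 _; exact: nbhs_dnbhs.
have nU : \forall n \near \oo, U (s n + t).
  have c : (fun n => s n + t) @ \oo --> t.
    by rewrite -[X in _ --> X]add0r; apply: cvgD => //; exact: cvg_cst.
  by apply: c; exact: open_nbhs_nbhs.
near=> n.
have Us : U (s n + t) by near: n.
by rewrite /= patchE mem_set// /qU /q !patchE !mem_set.
Unshelve. all: by end_near. Qed.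

End measurable_derivative.

Section square_integrable_primitive.
Context {R : realType}.
Local Notation M := (measurableTypeR R).
Local Notation leb := (@lebesgue_measure R).

(** Cauchy-Schwarz on each interval gives (g y - g x)^2 <= (y - x) K with K the integral of
    D^2 over it. The weighted inequality 2 sqrt(a b) <= t a + b / t makes this summable. *)
Lemma Lfun2_abs_continuous (c d : R) (g D : R -> R) :
  D \in Lfun leb 2%:E ->
  (forall x y, c <= x -> x <= y -> y <= d ->
        g y - g x = \int[leb]_(z in `[x, y]) D z) ->
  abs_continuous c d g.
Proof.
move=> D2 gD e e0.
have iD := Lfun2_integrable_sqr D2.
pose J : R := \int[leb]_z (D z ^+ 2).
have J0 : 0 <= J by apply: Rintegral_ge0 => z _; exact: sqr_ge0.
have J1 : 0 < J + 1 by lra.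
exists (e ^+ 2 / (J + 1)); first by rewrite divr_gt0// exprn_gt0.
move=> n x y xy tI sl.
pose K (i : 'I_n) : R := \int[leb]_(z in `]x i, y i[) (D z ^+ 2).
have sqd i : (g (y i) - g (x i)) ^+ 2 <= (y i - x i) * K i.
  have [/andP[cx xyi] yd] := xy i.
  have E (h : R -> R) : measurable_fun (`]x i, y i[%classic : set M) (h : M -> R) ->
      \int[leb]_(z in `]x i, y i[) h z = \int[leb]_(z in `[x i, y i]) h z.
    move=> /measurable_EFinP mh; congr fine; apply/esym; exact: integral_itv_bndoo.
  have mD : measurable_fun (`]x i, y i[%classic : set M) (D : M -> R).
    exact/measurable_funTS/Lfun2_measurable/D2.
  have mxy : measurable (`[x i, y i]%classic : set M) by exact: measurable_itv.
  have lxy : leb (`[x i, y i]%classic : set M) = (y i - x i)%:E.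
    rewrite lebesgue_measure_itv/= lte_fin; case: ltP => [_|]; first by rewrite EFinB.
    by move=> yx; rewrite (@le_anti _ _ (x i) (y i)) ?xyi// subrr.
  have lty : (leb (`[x i, y i]%classic : set M) < +oo)%E by rewrite lxy ltry.
  have := Rintegral_sqr_le mxy lty D2.
  have <- : fine (leb (`[x i, y i]%classic : set M)) = y i - x i by rewrite lxy.
  by rewrite gD// /K E//; exact: measurable_funX.
have K0 i : 0 <= K i by apply: Rintegral_ge0 => z _; exact: sqr_ge0.
have sumK : \sum_(i < n) K i <= J.
  rewrite -lee_fin -sumEFin.
  under eq_bigr => i _.
    rewrite /K /Rintegral fineK; last first.
      apply: (@integrable_fin_num _ M); first exact: measurable_itv.
      by apply: integrableS iD => //; exact: measurable_itv.
    over.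
  rewrite -(@ge0_integral_bigsetU _ M R leb _ (fun i : 'I_n => `]x i, y i[%classic))//=.
  - rewrite /J -RintegralE//; apply: ge0_subset_integral => //=.
    + by apply: bigsetU_measurable => i _; exact: measurable_itv.
    + by case/integrableP: iD.
    + by move=> z _; rewrite lee_fin sqr_ge0.
  - exact: index_enum_uniq.
  - by move=> i j _ _; exact: tI.
  - by apply: measurable_funTS; case/integrableP: iD.
  - by move=> z _; rewrite lee_fin sqr_ge0.
(* the weight that makes both terms of the sum smaller than e *)
pose t := (J + 1) / e.
have t0 : 0 < t by rewrite divr_gt0.
have bnd i : `|g (y i) - g (x i)| <= (t * (y i - x i) + K i / t) / 2.
  have [/andP[_ xyi] _] := xy i.
  have := sqd i; rewrite -real_normK ?num_real// => h.
  have {}h : `|g (y i) - g (x i)| ^+ 2 <= ((t * (y i - x i) + K i / t) / 2) ^+ 2.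
    apply: le_trans h _.
    have -> : (y i - x i) * K i = (t * (y i - x i)) * (K i / t).
      by field; rewrite gt_eqF.
    by have := sqr_ge0 (t * (y i - x i) - K i / t); nra.
  rewrite -(@ler_pXn2r _ 2)// nnegrE// divr_ge0// addr_ge0//.
    by rewrite mulr_ge0 ?subr_ge0// ltW.
  by rewrite divr_ge0// ltW.
apply: le_lt_trans (ler_sum _ (fun i _ => bnd i)) _.
rewrite -mulr_suml big_split/= -mulr_sumr -mulr_suml.
have h1 : t * (\sum_(i < n) (y i - x i)) < e.
  rewrite -ltr_pdivlMl//; apply: lt_le_trans sl _.
  by rewrite /t invf_div expr2 [leRHS]mulrAC.
have h2 : (\sum_(i < n) K i) / t < e.
  rewrite ltr_pdivrMr//; apply: le_lt_trans sumK _.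
  by rewrite /t mulrCA divff ?gt_eqF// mulr1; lra.
lra.
Qed.

End square_integrable_primitive.


(** * Change of variables by a scale function *)

Lemma integral_image_measure d1 d2 (X : measurableType d1) (Y : measurableType d2)
    (R : realType) (phi : X -> Y) (mu : {measure set X -> \bar R}) (D : set Y)
    (k : Y -> \bar R) :
  measurable_fun setT phi -> measurable D -> measurable_fun D k ->
  (\int[pushforward mu phi]_(y in D) k y = \int[mu]_(x in phi @^-1` D) (k \o phi) x)%E.
Proof.
move=> mphi mD mk; rewrite [in LHS]integralE [in RHS]integralE; congr (_ - _)%E.
  rewrite (ge0_integral_pushforward mphi)//; last exact: measurable_funepos.
  by rewrite -funepos_comp.
rewrite (ge0_integral_pushforward mphi)//; last exact: measurable_funeneg.
by rewrite -funeneg_comp.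
Qed.

Section intervals.
Context {R : realType}.
Local Notation M := (measurableTypeR R).
Implicit Types (J : set R) (x y : R).

Lemma nondecreasing_in_measurable J (k : R -> R) : is_interval J ->
  {in J &, {homo k : x y / x <= y}} -> measurable_fun (J : set M) (k : M -> M).
Proof.
move=> iJ kJ; apply: (measurability _ (RGenCInfty.measurableE R)) => //= _ [_ [r ->] <-].
apply: is_interval_measurable => s t [/= Js + [Jt +]].
rewrite !in_itv/= !andbT => fs ft u /andP[su ut].
have Ju : J u by apply: (iJ s t) => //; rewrite su.
by split => //=; rewrite in_itv/= andbT (le_trans fs)// kJ ?inE.
Qed.

Lemma interval_exhaustion_up J x0 : is_interval J -> J x0 -> exists b : nat -> R,
  [/\ forall n, J (b n) /\ x0 <= b n, nondecreasing_seq b &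
      forall x, J x -> exists n, x <= b n].
Proof.
move=> iJ Jx0.
have [[mx [Jm Jmx]]|nomax] := pselect (exists mx, J mx /\ forall x, J x -> x <= mx).
  exists (fun=> mx); split => // [_|x Jx]; first by split => //; exact: Jmx.
  by exists 0; exact: Jmx.
have above x : J x -> exists2 y, J y & x < y.
  move=> Jx; apply: contrapT => h; apply: nomax; exists x; split => // y Jy.
  by rewrite leNgt; apply/negP => xy; apply: h; exists y.
have [ubJ|nubJ] := pselect (has_ubound J).
  have hs : has_sup J by split=> //; exists x0.
  have lts x : J x -> x < sup J.
    move=> Jx; have [y Jy xy] := above _ Jx; apply: lt_le_trans xy _.
    exact: sup_upper_bound hs _ Jy.
  have inJ x : x0 <= x -> x < sup J -> J x.
    move=> x0x xs; have [y Jy xy] := sup_gt (ex_intro _ _ Jx0) xs.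
    by apply: (iJ x0 y) => //; rewrite x0x ltW.
  pose b n := Num.max x0 (sup J - n.+1%:R^-1).
  have b_lt n : b n < sup J by rewrite gt_max lts//= ltrBlDr ltrDl invr_gt0.
  have b_ge n : x0 <= b n by rewrite le_max lexx.
  exists b; split.
  - by move=> n; split => //; exact: inJ.
  - move=> n k nk; rewrite /b ge_max !le_max lexx/=; apply/orP; right.
    by rewrite lerB// lef_pV2 ?posrE// ler_nat ltnS.
  - move=> x Jx; have xs : 0 < sup J - x by rewrite subr_gt0 lts.
    exists (Num.bound (sup J - x)^-1); rewrite /b le_max; apply/orP; right.
    rewrite lerBrDl addrC -lerBrDl invf_ple ?posrE//.
    apply: (@le_trans _ _ (Num.bound (sup J - x)^-1)%:R); last by rewrite ler_nat.
    by apply/ltW/archi_boundP; rewrite invr_ge0 ltW.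
exists (fun n => x0 + n%:R); split.
- move=> n; rewrite lerDl ler0n; split=> //.
  have [y Jy xy] : exists2 y, J y & x0 + n%:R <= y.
    apply: contrapT => h; apply: nubJ; exists (x0 + n%:R) => y Jy.
    by rewrite leNgt; apply/negP => yn; apply: h; exists y => //; exact: ltW.
  by apply: (iJ x0 y) => //; rewrite lerDl ler0n.
- by move=> n k nk; rewrite lerD2l ler_nat.
- move=> x Jx; have [n /andP[_ xn]] := nat_itvP (x - x0).
  by exists n; rewrite addrC -lerBlDr ltW.
Qed.

(** An interval is an increasing union of compact intervals, constant at an endpoint that
    belongs to it. *)
Lemma interval_exhaustion J x0 : is_interval J -> J x0 ->
  exists a b : nat -> R,
  [/\ forall n, [/\ J (a n), J (b n), a n <= x0 & x0 <= b n],
      nondecreasing_seq (fun n => `[a n, b n]%classic : set M) &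
      J = \bigcup_n `[a n, b n]%classic].
Proof.
move=> iJ Jx0; have [b [b1 b2 b3]] := interval_exhaustion_up iJ Jx0.
have iNJ : is_interval (J \o -%R).
  move=> x y /= Jx Jy z /andP[xz zy]; apply: (iJ (- y) (- x)) => //.
  by rewrite !lerN2 xz zy.
have NJx0 : (J \o -%R) (- x0) by rewrite /= opprK.
have [c [c1 c2 c3]] := interval_exhaustion_up iNJ NJx0.
exists (fun n => - c n), b; split.
- by move=> n; have [? ?] := b1 n; have [? ?] := c1 n; split => //; rewrite lerNl.
- move=> n k nk; apply/subsetPset; apply: subset_itv; rewrite bnd_simp.
    by rewrite lerN2 c2.
  exact: b2.
- apply/seteqP; split=> [x Jx|x [n _]].
    have [n xn] := b3 _ Jx; have [k xk] := c3 (- x) (eq_ind_r J Jx (opprK x)).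
    exists (maxn n k) => //=; rewrite in_itv/= lerNl (le_trans xk)/= ?c2 ?leq_maxr//.
    by rewrite (le_trans xn)// b2// leq_maxl.
  rewrite /= in_itv/= => h; have [? _] := b1 n; have [? _] := c1 n.
  exact: (iJ (- c n) (b n)).
Qed.

Lemma ae_exhaustion (mu : {measure set M -> \bar R}) J (P : R -> Prop) :
  is_interval J ->
  (forall x y, J x -> J y -> x <= y -> {ae mu, forall z, `[x, y]%classic z -> P z}) ->
  {ae mu, forall z, J z -> P z}.
Proof.
move=> iJ H; have [[x0 Jx0]|J0] := pselect (J !=set0); last first.
  by apply: aeW => z Jz; exfalso; apply: J0; exists z.
have [a [b [ab _ JE]]] := interval_exhaustion iJ Jx0.
have /ae_foralln : forall n, {ae mu, forall z, `[a n, b n]%classic z -> P z}.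
  by move=> n; have [? ? h1 h2] := ab n; apply: H => //; exact: le_trans h2.
apply: filterS => z Hz; rewrite {1}JE => -[n _]; exact: Hz.
Qed.

End intervals.

Section scale_change.
Context {R : realType}.
Local Notation M := (measurableTypeR R).
Local Notation leb := (@lebesgue_measure R).
Variables (J : set R) (s : R -> R) (lam : {measure set M -> \bar R}).
Hypotheses (iJ : is_interval J) (J0 : (lower J < upper J)%E).
Hypothesis sJ : scale_function J s.
Hypothesis lamJ : forall x y, J x -> J y -> x <= y ->
  lam `[x, y]%classic = (s y - s x)%:E.

Lemma scale_lt x y : J x -> J y -> (s x < s y) = (x < y).
Proof.
have [sm _ _] := sJ.
move=> Jx Jy; apply/idP/idP => [|xy]; last by apply: sm; rewrite ?inE.
case: (ltgtP x y) => // [yx|->]; last by rewrite ltxx.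
by rewrite ltNge ltW// sm// inE.
Qed.

Lemma scale_le x y : J x -> J y -> (s x <= s y) = (x <= y).
Proof. by move=> Jx Jy; rewrite !leNgt scale_lt. Qed.

Lemma scale_image_interval : is_interval (s @` J).
Proof.
by have [_ cs _] := sJ; apply/connected_intervalP/connected_continuous_connected => //; apply/connected_intervalP.
Qed.

Lemma measurable_scale : measurable_fun (J : set M) (s : M -> M).
Proof.
by apply: nondecreasing_in_measurable => // x y /set_mem Jx /set_mem Jy xy; rewrite scale_le.
Qed.

(** The inverse of the scale is nondecreasing, hence measurable. *)
Lemma scale_inverse : exists h : R -> R,
  [/\ forall x, J x -> h (s x) = x, forall t, (s @` J) t -> J (h t) /\ s (h t) = t &
      measurable_fun (s @` J : set M) (h : M -> M)].
Proof.
have /choice[h hP] t : exists x, (s @` J) t -> J x /\ s x = t.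
  have [[x Jx <-]|nD] := pselect ((s @` J) t); first by exists x.
  by exists 0 => /nD.
exists h; split => //.
- move=> x Jx; have [|Jh sh] := hP (s x); first by exists x.
  by apply/eqP; rewrite eq_le; apply/andP; split; rewrite -scale_le// sh.
- apply: nondecreasing_in_measurable; first exact: scale_image_interval.
  move=> t t' /set_mem/hP[Jt st] /set_mem/hP[Jt' st'].
  by rewrite -(scale_le Jt Jt') st st'.
Qed.

Section change_of_variables.
Variable h : R -> R.
Hypotheses (hs : forall x, J x -> h (s x) = x)
  (hP : forall t, (s @` J) t -> J (h t) /\ s (h t) = t)
  (mh : measurable_fun (s @` J : set M) (h : M -> M)).

Lemma scale_image_cc x y : J x -> J y -> `[s x, s y]%classic `<=` s @` J.
Proof.
move=> Jx Jy t; rewrite /= in_itv/= => ht.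
by apply: (@scale_image_interval (s x) (s y)) => //.
Qed.

(** The measure of s is the image of the Lebesgue measure under the inverse h of s, because
    both give s y - s x to [x, y]. *)
Lemma integral_scale_change x y (k : R -> \bar R) : J x -> J y -> x <= y ->
  measurable_fun (`[x, y]%classic : set M) (k : M -> \bar R) ->
  (\int[lam]_(z in `[x, y]) k z = \int[leb]_(t in `[s x, s y]) k (h t))%E.
Proof.
move=> Jx Jy xy mk.
have Dxy := scale_image_cc Jx Jy.
have mxy : measurable (`[s x, s y]%classic : set M) by exact: measurable_itv.
have mxy' : measurable (`[x, y]%classic : set M) by exact: measurable_itv.
pose hh (t : M) : M := if t \in (`[s x, s y] : interval R) then h t else y + 1.
have mhh : measurable_fun setT hh.
  apply: measurable_fun_if => //.
  - apply: (measurable_fun_bool true); rewrite setTI (_ : _ @^-1` _ = `[s x, s y]%classic)//.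
  - apply: measurable_funS mh; first exact: is_interval_measurable scale_image_interval.
    by move=> t [_ /= tI]; exact: Dxy.
have hh_pre : hh @^-1` `[x, y]%classic = `[s x, s y]%classic.
  apply/seteqP; split => t; rewrite /= /hh.
    by case: ifP => // _; rewrite in_itv/= => /andP[_]; rewrite leNgt ltrDl ltr01.
  move=> tI; rewrite tI in_itv/=; have [Jh sh] := hP (Dxy _ tI).
  by move: tI; rewrite in_itv/= -{1 2}sh !scale_le.
pose nu := measure_function_pushforward__canonical__measure_function_Measure leb mhh.
have nuE (A : set M) : nu A = leb (hh @^-1` A) by [].
have lamnu (A : set M) : measurable A -> A `<=` `[x, y]%classic -> lam A = nu A.
  apply: cc_measure_unique; first by rewrite lamJ// ltry.
  move=> z /andP[xz zy]; have Jz : J z by apply: (iJ Jx Jy); rewrite xz.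
  rewrite lamJ// nuE.
  have -> : hh @^-1` `[z, y]%classic = `[s z, s y]%classic.
    apply/seteqP; split => t; rewrite /= /hh.
      case: ifPn => [tI|_]; last by rewrite in_itv/= => /andP[_]; rewrite leNgt ltrDl ltr01.
      have [Jh sh] := hP (Dxy _ tI).
      by rewrite !in_itv/= -{3 4}sh !scale_le.
    rewrite in_itv/= => /andP[zt ty].
    have tI : t \in `[s x, s y] by rewrite in_itv/= ty (le_trans _ zt)// scale_le.
    rewrite tI; have [Jh sh] := hP (Dxy _ tI).
    by rewrite in_itv/= -(scale_le Jz Jh) -(scale_le Jh Jy) sh zt.
  rewrite lebesgue_measure_itv/= lte_fin scale_lt//.
  by move: zy; rewrite le_eqVlt => /predU1P[->|->]; rewrite ?ltxx ?subrr.
rewrite (eq_measure_integral nu); last by move=> A mA Axy; exact: lamnu.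
rewrite (integral_image_measure leb mhh mxy' mk) hh_pre.
by apply: eq_integral => t /set_mem tI; rewrite /= /hh tI.
Qed.

Lemma integrable_scale_change x y (k : R -> \bar R) : J x -> J y -> x <= y ->
  measurable_fun (`[x, y]%classic : set M) (k : M -> \bar R) ->
  lam.-integrable `[x, y] k <-> leb.-integrable `[s x, s y] (k \o h).
Proof.
move=> Jx Jy xy mk.
have Dxy := scale_image_cc Jx Jy.
have mkh : measurable_fun (`[s x, s y]%classic : set M) (k \o h : M -> \bar R).
  apply: (measurable_comp (F := `[x, y]%classic : set M)) => //.
  - move=> _ [t tI <-]; have [Jh sh] := hP (Dxy _ tI).
    by move: tI; rewrite /= !in_itv/= -{1 2}sh !scale_le.
  - by apply: measurable_funS mh => //; exact: is_interval_measurable scale_image_interval.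
have mak : measurable_fun (`[x, y]%classic : set M) (fun t => `|k t|%E : \bar R).
  exact: measurableT_comp.
have E := integral_scale_change Jx Jy xy mak.
by split=> /integrableP[_ H]; apply/integrableP; split => //; move: H; rewrite E.
Qed.

End change_of_variables.
End scale_change.


(** * The derivative with respect to a scale function *)

Section local_absolute_continuity.
Context {R : realType}.
Local Notation M := (measurableTypeR R).
Implicit Types (g : R -> R) (D : set R).

Lemma abs_continuous_dist (c d : R) g : abs_continuous c d g ->
  forall eps, 0 < eps -> exists2 delta : R, 0 < delta &
    forall x y, c <= x <= d -> c <= y <= d -> `|x - y| < delta ->
      `|g x - g y| < eps.
Proof.
move=> /abs_continuous_family H eps /H[delta d0 {}H]; exists delta => // x y.
wlog xy : x y / x <= y.
  move=> W xcd ycd xy; have [/W|/ltW/W] := leP x y; first exact.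
  by move=> H'; rewrite distrC; apply: H' => //; rewrite distrC.
move=> /andP[cx xd] /andP[cy yd]; rewrite distrC ger0_norm ?subr_ge0// => yx.
have := H [:: (x, y)]; rewrite !big_seq1 /= distrC; apply => //=.
  by rewrite /family/= /proper_pair/= xy.
by rewrite /pair_within/= cx yd.
Qed.

Lemma loc_abs_continuous_interior D g t : loc_abs_continuous D g ->
  D^° t -> {for t, continuous g}.
Proof.
move=> lg /nbhs_ballP[r /= r0 H].
have sub : `[t - r / 2, t + r / 2]%classic `<=` D.
  move=> y; rewrite /= in_itv/= => /andP[y1 y2]; apply: H.
  by rewrite /ball/= ltr_norml; apply/andP; split; lra.
have acg := lg _ _ (_ : t - r / 2 <= t + r / 2) sub.
have {}acg := acg ltac:(lra).
apply/cvgrPdist_lt => e /(abs_continuous_dist acg)[delta d0 {}H].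
near=> y; apply: H.
- by apply/andP; split; lra.
- have : `|t - y| < r / 2 by near: y; apply: cvgr_dist_lt => //; rewrite divr_gt0.
  by rewrite ltr_norml => /andP[? ?]; apply/andP; split; lra.
- by near: y; exact: cvgr_dist_lt.
Unshelve. all: by end_near. Qed.

Lemma measurable_subsingleton D (k : R -> R) :
  (forall x y, D x -> D y -> x = y) ->
  measurable (D : set M) /\ measurable_fun (D : set M) (k : M -> M).
Proof.
move=> D1; have [[x Dx]|D0] := pselect (D !=set0).
  have -> : D = [set x].
    by apply/seteqP; split=> [y Dy|_ ->//]; exact: D1.
  by split; [exact: measurable_set1|exact: measurable_fun_set1].
have -> : D = set0 by apply/seteqP; split=> // y Dy; apply: D0; exists y.
by split; [exact: measurable0|exact: measurable_fun_set0].
Qed.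

(** The endpoints of D form two sets with at most one element, on which every function is
    measurable; the interior is covered by [measurable_derive1]. *)
Lemma measurable_derive1_interval D g : is_interval D ->
  loc_abs_continuous D g -> measurable_fun (D : set M) (derive1 g : M -> M).
Proof.
move=> iD lg.
pose P1 := [set t | D t /\ forall x, D x -> t <= x].
pose P2 := [set t | D t /\ forall x, D x -> x <= t].
have [mP1 fP1] : measurable (P1 : set M) /\ measurable_fun (P1 : set M) (derive1 g : M -> M).
  apply: measurable_subsingleton => x y [Dx h1] [Dy h2].
  by apply/eqP; rewrite eq_le h1// h2.
have [mP2 fP2] : measurable (P2 : set M) /\ measurable_fun (P2 : set M) (derive1 g : M -> M).
  apply: measurable_subsingleton => x y [Dx h1] [Dy h2].
  by apply/eqP; rewrite eq_le h1// h2.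
have fU : measurable_fun (D^° : set M) (derive1 g : M -> M).
  apply: measurable_derive1; first exact: open_interior.
  by move=> x; exact: loc_abs_continuous_interior.
have mU : measurable (D^° : set M) by apply: open_measurable; exact: open_interior.
have -> : D = D^° `|` (P1 `|` P2).
  apply/seteqP; split=> [t Dt|t [/interior_subset//|[[]|[]]]//].
  have [|n1] := pselect (P1 t); first by right; left.
  have [|n2] := pselect (P2 t); first by right; right.
  have [x1 Dx1 x1t] : exists2 x, D x & x < t.
    apply: contrapT => h; apply: n1; split => // x Dx.
    by rewrite leNgt; apply/negP => xt; apply: h; exists x.
  have [x2 Dx2 tx2] : exists2 x, D x & t < x.
    apply: contrapT => h; apply: n2; split => // x Dx.
    by rewrite leNgt; apply/negP => xt; apply: h; exists x.
  left; rewrite /interior.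
  have : t \in `]x1, x2[ by rewrite in_itv/= x1t.
  move/near_in_itvoo; apply: filterS => y; rewrite in_itv/= => /andP[y1 y2].
  by apply: (iD x1 x2) => //; rewrite !ltW.
have mP : measurable (P1 `|` P2 : set M) by exact: measurableU.
by apply/(measurable_funU _ mU mP); split => //; apply/(measurable_funU _ mP1 mP2).
Qed.

End local_absolute_continuity.

Section scale_derivatives.
Context {R : realType}.
Local Notation M := (measurableTypeR R).
Local Notation leb := (@lebesgue_measure R).
Variables (J : set R) (s : R -> R) (lam : {measure set M -> \bar R}).
Hypotheses (nJ : nondegenerate_interval J) (sJ : scale_function J s).
Hypothesis lamJ : forall x y, J x -> J y -> x <= y ->
  lam `[x, y]%classic = (s y - s x)%:E.

Let iJ : is_interval J := nJ.1.
Let mJ : measurable (J : set M). Proof. exact: is_interval_measurable. Qed.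

Definition increments (mu : {measure set M -> \bar R}) (J : set R) (u D : R -> R) :=
  forall x y, J x -> J y -> x <= y ->
    u y - u x = \int[mu]_(z in `[x, y]) D z.

Lemma lam_cc_lty x y : J x -> J y -> (lam `[x, y]%classic < +oo)%E.
Proof.
move=> Jx Jy; have [xy|yx] := leP x y; first by rewrite lamJ// ltry.
by rewrite set_itv_ge ?measure0// bnd_simp -ltNge.
Qed.

(** The factor g of u is the integral of its derivative on compact intervals, and the change
    of variables turns this into an integral of g' o s for the measure of s. *)
Lemma scale_derive_increments u : scale_abs_continuous J s u ->
  [/\ measurable_fun setT (scale_derive J s u \_ J : M -> M),
      forall x y, J x -> J y -> x <= y ->
        lam.-integrable `[x, y] (EFin \o (scale_derive J s u \_ J)) &
      increments lam J u (scale_derive J s u \_ J)].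
Proof.
move=> su; rewrite /scale_derive.
have [] := xgetPex (cst 0) su.
set g := xget _ _ => lg ug; set d := _ \_ J.
have [h [hs hP mh]] := scale_inverse iJ sJ.
have iD := scale_image_interval iJ sJ.
have mg' := measurable_derive1_interval iD lg.
have ms := measurable_scale iJ sJ.
have mD : measurable (s @` J : set M) by exact: is_interval_measurable.
have md : measurable_fun setT (d : M -> M).
  apply/(measurable_restrictT _ mJ).
  apply: (measurable_comp (F := s @` J : set M) (g := (s : M -> M))) => //.
have main x y : J x -> J y -> x <= y ->
    lam.-integrable `[x, y] (EFin \o d) /\ u y - u x = \int[lam]_(z in `[x, y]) d z.
  move=> Jx Jy xy.
  have Dxy := scale_image_cc iJ sJ Jx Jy.
  have sxy : s x <= s y by rewrite (scale_le sJ).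
  have [D1 [mD1 iD1 gD1]] := abs_continuous_density sxy (lg _ _ sxy Dxy).
  have ae1 := ae_derive1_primitive iD1 gD1.
  have mxy : measurable (`[s x, s y]%classic : set M) by exact: measurable_itv.
  have E t : `[s x, s y]%classic t -> d (h t) = derive1 g t.
    by move=> /Dxy/hP[Jh sh]; rewrite /d patchE mem_set// sh.
  have mdh : measurable_fun (`[s x, s y]%classic : set M) (d \o h : M -> M).
    by apply: measurableT_comp => //; exact: measurable_funS mh.
  have aeq : ae_eq leb (`[s x, s y]%classic : set M) (EFin \o D1) (EFin \o (d \o h)).
    have n1 : leb.-negligible [set s x] by apply/negligibleP => //; exact: lebesgue_measure_set1.
    have n2 : leb.-negligible [set s y] by apply/negligibleP => //; exact: lebesgue_measure_set1.
    apply: negligibleS (negligibleU (negligibleU n1 n2) ae1) => t /=.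
    move=> /not_implyP[tI ne].
    have [->|tx] := eqVneq t (s x); first by left; left.
    have [->|ty] := eqVneq t (s y); first by left; right.
    right => /= H; apply: ne; rewrite /= E//.
    move: (tI); rewrite in_itv/= => /andP[t1 t2].
    by have [|_ ->] := H; first by rewrite !lt_neqAle eq_sym tx t1 ty.
  have iD1' : leb.-integrable (`[s x, s y]%classic : set M) (EFin \o D1) by exact: integrableS iD1.
  have idh : leb.-integrable (`[s x, s y]%classic : set M) (EFin \o (d \o h)).
    by apply: (ae_eq_integrable mxy _ aeq iD1'); apply/measurable_EFinP.
  have mkd : measurable_fun (`[x, y]%classic : set M) (EFin \o d : M -> \bar R).
    by apply/measurable_EFinP; exact: measurable_funTS.
  split; first by apply/(integrable_scale_change iJ sJ lamJ hP mh Jx Jy xy mkd).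
  rewrite !ug// gD1//; congr fine.
  rewrite (integral_scale_change iJ sJ lamJ hP mh Jx Jy xy mkd).
  apply: ae_eq_integral => //; first by case/integrableP: iD1'.
  by case/integrableP: idh.
by split => // x y Jx Jy xy; have [] := main _ _ Jx Jy xy.
Qed.

Lemma increments_unique u D1 D2 : 
  (forall x y, J x -> J y -> x <= y -> lam.-integrable `[x, y] (EFin \o D1)) ->
  (forall x y, J x -> J y -> x <= y -> lam.-integrable `[x, y] (EFin \o D2)) ->
  increments lam J u D1 -> increments lam J u D2 ->
  {ae lam, forall x, J x -> D1 x = D2 x}.
Proof.
move=> i1 i2 d1 d2; apply: ae_exhaustion => // x y Jx Jy xy.
have := @cc_ae_eq _ lam (EFin \o D1) (EFin \o D2) x y (i1 _ _ Jx Jy xy) (i2 _ _ Jx Jy xy).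
have h z : x <= z <= y ->
    (\int[lam]_(t in `[z, y]) (EFin \o D1) t = \int[lam]_(t in `[z, y]) (EFin \o D2) t)%E.
  move=> /andP[xz zy]; have Jz : J z by apply: (iJ Jx Jy); rewrite xz.
  rewrite !RintegralE; [|exact: measurable_itv|exact: i2|exact: measurable_itv|exact: i1].
  by rewrite -d1// -d2.
by move=> /(_ h); apply: ae_imply => z /[apply] /= -[].
Qed.

Lemma Lfun2_integrable_cc D x y : D \in Lfun lam 2%:E -> J x -> J y ->
  lam.-integrable `[x, y] (EFin \o D).
Proof.
by move=> D2 Jx Jy; apply: Lfun2_integrable => //; exact: lam_cc_lty.
Qed.

(** The factor is u o h with h the inverse of the scale: by the change of variables it is the
    integral of D o h, which is square-integrable on compact intervals. *)
Lemma increments_scale_abs_continuous u D : D \in Lfun lam 2%:E ->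
  increments lam J u D -> scale_abs_continuous J s u.
Proof.
move=> D2 uD.
have [h [hs hP mh]] := scale_inverse iJ sJ.
have iD := scale_image_interval iJ sJ.
have mD : measurable (s @` J : set M) by exact: is_interval_measurable.
have mD2 := Lfun2_measurable D2.
exists (u \o h); split; last by move=> x Jx /=; rewrite hs.
move=> c d cd sub.
have inD t : c <= t -> t <= d -> J (h t) /\ s (h t) = t.
  by move=> ct td; apply/hP/sub; rewrite /= in_itv/= ct.
have [Jc sc] := inD c (lexx _) cd.
have [Jd sd] := inD d cd (lexx _).
have hle t t' : c <= t -> t <= t' -> t' <= d -> [/\ J (h t), J (h t'), s (h t) = t, s (h t') = t' & h t <= h t'].
  move=> ct tt' td.
  have [Jt st] := inD t ct (le_trans tt' td).
  have [Jt' st'] := inD t' (le_trans ct tt') td.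
  by split => //; rewrite -(scale_le sJ)// st st'.
have [_ _ _ _ hcd] := hle c d (lexx _) cd (lexx _).
have mcd : measurable (`[c, d]%classic : set M) by exact: measurable_itv.
have mDh : measurable_fun (`[c, d]%classic : set M) (D \o h : M -> M).
  by apply: measurableT_comp => //; exact: measurable_funS mh.
have mDx (A : set M) : measurable_fun A (EFin \o D : M -> \bar R).
  by apply/measurable_EFinP; exact: measurable_funTS.
have mDxx (A : set M) : measurable_fun A (fun z => (D z ^+ 2)%:E : \bar R).
  by apply/measurable_EFinP; apply: measurable_funX; exact: measurable_funTS.
apply: (@Lfun2_abs_continuous _ c d (u \o h) ((D \o h) \_ `[c, d])).
  apply/Lfun2P; split; first by apply/(measurable_restrictT _ mcd).
  rewrite (_ : (fun x => _) = (fun t => (((D \o h) t) ^+ 2)%:E) \_ `[c, d]); last first.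
    by apply/funext => t; rewrite !patchE; case: ifP => //; rewrite expr0n.
  rewrite -integral_mkcond.
  have := @integral_scale_change _ J s lam iJ sJ lamJ h hP mh (h c) (h d) (fun z => (D z ^+ 2)%:E) Jc Jd hcd (mDxx _).
  rewrite sc sd => <-.
  have [_ fin] := (Lfun2P lam D).1 D2; apply: le_lt_trans fin.
  apply: ge0_subset_integral => //.
  by move=> z _; rewrite lee_fin sqr_ge0.
move=> t t' ct tt' td; have [Jt Jt' st st' htt'] := hle t t' ct tt' td.
rewrite /= uD// /Rintegral (integral_scale_change iJ sJ lamJ hP mh Jt Jt' htt' (mDx _)) st st'.
congr fine; apply: eq_integral => z /set_mem; rewrite /= in_itv/= => /andP[tz zt'].
by rewrite patchE mem_set//= in_itv/= (le_trans ct)// (le_trans zt').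
Qed.

Lemma scale_derive_ae u D : D \in Lfun lam 2%:E -> increments lam J u D ->
  {ae lam, forall x, J x -> scale_derive J s u x = D x}.
Proof.
move=> D2 uD.
have [md id ud] := scale_derive_increments (increments_scale_abs_continuous D2 uD).
have := increments_unique id (fun x y Jx Jy _ => Lfun2_integrable_cc D2 Jx Jy) ud uD.
by apply: ae_imply => x H Jx; have := H Jx; rewrite patchE mem_set.
Qed.

Lemma scale_measure_restr (A : set M) : measurable A -> A `<=` J ->
  scale_measure J s A = lam A.
Proof.
move=> mA AJ; have [_ dsE] := scale_measureP nJ sJ.
have [[x0 Jx0]|J0] := pselect (J !=set0); last first.
  have -> : A = set0 by apply/seteqP; split => // x /AJ Jx; apply: J0; exists x.
  by rewrite !measure0.
have [a [b [ab nd JE]]] := interval_exhaustion iJ Jx0.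
have mAn n : measurable (A `&` `[a n, b n]%classic : set M) by apply: measurableI => //; exact: measurable_itv.
have AE : A = \bigcup_n (A `&` `[a n, b n]%classic).
  by rewrite -setI_bigcupr -JE setIidl.
have ndA : nondecreasing_seq (fun n => A `&` `[a n, b n]%classic : set M).
  by move=> n k nk; apply/subsetPset; apply: setIS; exact/subsetPset/nd.
have mU : measurable (\bigcup_n (A `&` `[a n, b n]%classic) : set M) by rewrite -AE.
have c1 := nondecreasing_cvg_mu mAn mU ndA (mu := scale_measure J s).
have c2 := nondecreasing_cvg_mu mAn mU ndA (mu := lam).
rewrite -AE in c1 c2; rewrite -(cvg_lim _ c1)// -(cvg_lim _ c2)//.
suff -> : scale_measure J s \o (fun n => A `&` `[a n, b n]%classic) =
    lam \o (fun n => A `&` `[a n, b n]%classic) by [].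
apply/funext => n /=.
have [Ja Jb an bn] := ab n.
apply: (@cc_measure_unique _ _ _ (a n) (b n)) => //.
  by rewrite dsE ?(le_trans an)// ltry.
move=> x /andP[ax xb]; have Jx : J x by apply: (iJ Ja Jb); rewrite ax.
by rewrite dsE// lamJ.
Qed.

Lemma integral_scale_measure (k : R -> \bar R) :
  (\int[scale_measure J s]_(x in J) k x = \int[lam]_(x in J) k x)%E.
Proof.
by apply: eq_measure_integral => A mA AJ; exact: scale_measure_restr.
Qed.

Lemma L2_on_scale_measure d : L2_on (scale_measure J s) J d <->
  d \_ J \in Lfun lam 2%:E.
Proof.
rewrite /L2_on /=; suff E : (\int[scale_measure J s]_x ((d \_ J) x ^+ 2)%:E =
    \int[lam]_x ((d \_ J) x ^+ 2)%:E)%E.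
  by split=> /Lfun2P[? ?]; apply/Lfun2P; split=> //; [rewrite -E|rewrite E].
have -> : (fun x => ((d \_ J) x ^+ 2)%:E) = (fun x => (d x ^+ 2)%:E) \_ J.
  by apply/funext => t; rewrite !patchE; case: ifP => //; rewrite expr0n.
by rewrite -!integral_mkcond; exact: integral_scale_measure.
Qed.

End scale_derivatives.


(** * Represented forms through densities *)

Section continuous_versions.
Context {R : realType}.
Local Notation M := (measurableTypeR R).

(** Every nonempty relatively open subset of J contains an open interval, which m
    charges. *)
Lemma continuous_ae_eq (m : {measure set M -> \bar R}) (J : set R) (v w : R -> R) :
  nondegenerate_interval J -> fully_supported m ->
  (forall x, J x -> v y @[y --> within J (nbhs x)] --> v x) ->
  (forall x, J x -> w y @[y --> within J (nbhs x)] --> w x) ->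
  {ae m, forall x, v x = w x} -> forall x, J x -> v x = w x.
Proof.
move=> nJ ms cv cw vw x Jx; apply: contrapT => /eqP; rewrite -subr_eq0 => nz.
have cvw : (v y - w y) @[y --> within J (nbhs x)] --> v x - w x.
  by apply: cvgB; [exact: cv|exact: cw].
have : \forall y \near within J (nbhs x), v y - w y != 0.
  by apply: cvgr_neq0 cvw _.
move=> /nbhs_ballP[r /= r0 rP].
have [y Jy yx] : exists2 y, J y & y != x.
  apply: contrapT => nex; have [iJ] := nJ.
  have JE : J = [set x].
    apply/seteqP; split => z /=; last by move=> ->.
    by move=> Jz; apply: contrapT => /eqP zx; apply: nex; exists z.
  by rewrite /lower /upper JE image_set1 ereal_inf1 ereal_sup1 ltxx.
pose a := Num.max (Num.min x y) (x - r / 2); pose b := Num.min (Num.max x y) (x + r / 2).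
have ab : a < b.
  rewrite /a /b; case: (ltgtP x y) yx => // xy _;
  by rewrite lt_max !gt_min || (rewrite gt_max !lt_min; lra).
have sub z : a < z < b -> J z /\ `|x - z| < r.
  rewrite /a /b gt_max lt_min => /andP[/andP[z1 z2] /andP[z3 z4]]; split.
    case: (ltgtP x y) yx z1 z3 => // xy _ z1 z3.
      by apply: (nJ.1 x y) => //; rewrite !ltW.
    by apply: (nJ.1 y x) => //; rewrite !ltW.
  by rewrite ltr_norml; lra.
have [N [mN N0 subN]] := vw.
have : (0 < m `]a, b[%classic)%E.
  apply: ms; first exact: itv_open.
  by exists ((a + b) / 2); rewrite /= in_itv/= !(midf_lt ab).
apply/negP; rewrite -leNgt.
rewrite -N0; apply: le_measure; rewrite ?inE//=.
move=> z; rewrite /= in_itv/= => /sub[Jz xz]; apply: subN => /= vwz.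
by have := rP z xz Jz; rewrite vwz subrr eqxx.
Qed.

End continuous_versions.

Section single_interval.
Context {R : realType}.
Local Notation M := (measurableTypeR R).
Variables (J : set R) (s : R -> R) (lam : {measure set M -> \bar R}).
Hypotheses (nJ : nondegenerate_interval J) (sJ : scale_function J s).
Hypothesis lamJ : forall x y, J x -> J y -> x <= y ->
  lam `[x, y]%classic = (s y - s x)%:E.

(** Cauchy-Schwarz; this gives the continuity of v with respect to the scale. *)
Lemma increments_holder v D x y : D \in Lfun lam 2%:E -> increments lam J v D ->
  J x -> J y -> (v y - v x) ^+ 2 <= `|s y - s x| * \int[lam]_z (D z ^+ 2).
Proof.
move=> D2 vD; wlog xy : x y / x <= y => [hw|] Jx Jy.
  have [|/ltW yx] := leP x y; first by move=> xy; exact: hw.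
  by rewrite distrC (_ : (v y - v x) ^+ 2 = (v x - v y) ^+ 2) ?hw//; ring.
have ss : 0 <= s y - s x by rewrite subr_ge0 (scale_le sJ).
have I2 : lam.-integrable setT (EFin \o (fun z => D z ^+ 2)).
  exact: (Lfun2M D2 D2).
rewrite vD// (le_trans (Rintegral_sqr_le _ _ D2))//.
  by rewrite lamJ// ltry.
rewrite lamJ//= ger0_norm// ler_wpM2l//.
rewrite /Rintegral fine_le//.
- apply: integrable_fin_num => //; apply: integrableS I2 => //.
- exact: integrable_fin_num I2.
apply: ge0_subset_integral => //.
  by case/integrableP: I2.
by move=> z _; rewrite lee_fin sqr_ge0.
Qed.

Lemma increments_continuous v D : D \in Lfun lam 2%:E -> increments lam J v D ->
  forall x, J x -> v y @[y --> within J (nbhs x)] --> v x.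
Proof.
move=> D2 vD x Jx; apply/cvgrPdist_lt => e e0.
set K := \int[lam]_z (D z ^+ 2).
have K0 : 0 <= K by apply: Rintegral_ge0 => z _; exact: sqr_ge0.
have [_ cs _] := sJ.
have /cvgrPdist_lt/(_ (e ^+ 2 / (K + 1))) : s y @[y --> within J (nbhs x)] --> s x.
  by move/subspace_continuousP: cs; exact.
rewrite divr_gt0 ?exprn_gt0//; last by lra.
move=> /(_ isT); apply: filter_app; near=> y => sxy.
have Jy : J y by near: y; exact: withinT.
rewrite -(ltr_pXn2r (_ : 0 < 2)%N) ?nnegrE ?normr_ge0 ?(ltW e0)//.
rewrite real_normK ?num_real// (_ : (v x - v y) ^+ 2 = (v y - v x) ^+ 2); last by ring.
rewrite (le_lt_trans (increments_holder D2 vD Jx Jy))// distrC.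
move: sxy; rewrite ltr_pdivlMr; last by lra.
by apply: le_lt_trans; rewrite ler_wpM2l//; rewrite -/K; lra.
Unshelve. all: by end_near. Qed.

Lemma increments_measurable v D : D \in Lfun lam 2%:E -> increments lam J v D ->
  measurable_fun (J : set M) (v : M -> M).
Proof.
move=> D2 vD; apply: subspace_continuous_measurable_fun.
  exact: is_interval_measurable nJ.1.
by apply/subspace_continuousP => x Jx; exact: (increments_continuous D2 vD).
Qed.

Lemma increments_ae_eq (m : {measure set M -> \bar R}) v w D E :
  fully_supported m ->
  D \in Lfun lam 2%:E -> E \in Lfun lam 2%:E ->
  increments lam J v D -> increments lam J w E ->
  {ae m, forall x, v x = w x} -> forall x, J x -> v x = w x.
Proof.
move=> ms D2 E2 vD wE; apply: continuous_ae_eq => //.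
  exact: increments_continuous vD.
exact: increments_continuous wE.
Qed.

End single_interval.

Section representation.
Context {R : realType}.
Local Notation M := (measurableTypeR R).

Definition boundary_condition (m : {measure set M -> \bar R}) (J : set R) (s v : R -> R) :=
  (lower J = -oo%E -> (-oo < lower_value (lower J) s)%E ->
    (m `]-oo, 0%R]%classic < +oo)%E -> v x @[x --> -oo] --> (0 : R)) /\
  (upper J = +oo%E -> (upper_value (upper J) s < +oo)%E ->
    (m `[0%R, +oo[%classic < +oo)%E -> v x @[x --> +oo] --> (0 : R)).

(** Only the values of lam on the intervals matter, so that the same notion serves for the
    original intervals with their scale measure and for the merged ones with lbar. *)
Record carries (C : @itv_family R) (lam : {measure set M -> \bar R}) : Prop := {
  carries_trivIset : trivIset (indices C) (itv C) ;
  carries_itv : forall n, indices C n -> nondegenerate_interval (itv C n) ;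
  carries_scale : forall n, indices C n -> scale_function (itv C n) (scale C n) ;
  carries_cc : forall n, indices C n -> forall x y, itv C n x -> itv C n y -> x <= y ->
    lam `[x, y]%classic = (scale C n y - scale C n x)%:E }.

(** The function v is the version of u that is continuous on the intervals, and D stands
    for its derivative with respect to the scales, on all the intervals at once. Unlike
    [scale_derive], it depends linearly on u and can be changed on null sets. *)
Record represents (m : {measure set M -> \bar R}) (C : @itv_family R)
    (lam : {measure set M -> \bar R}) (u v D : R -> R) : Prop := {
  represents_L2 : u \in Lfun m 2%:E ;
  represents_ae : {ae m, forall x, v x = u x} ;
  represents_density_L2 : D \in Lfun lam 2%:E ;
  represents_density0 : forall x, ~ covered C x -> D x = 0 ;
  represents_increments : forall n, indices C n -> increments lam (itv C n) v D ;
  represents_boundary : forall n, indices C n ->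
    boundary_condition m (itv C n) (scale C n) v }.

Variables (m : {measure set M -> \bar R}) (C : @itv_family R)
  (lam : {measure set M -> \bar R}).
Hypotheses (ms : fully_supported m) (hC : carries C lam).

Let mI n : indices C n -> measurable (itv C n : set M).
Proof. by move=> Cn; apply: is_interval_measurable; case: (carries_itv hC Cn). Qed.

Let I n : set M := if n \in indices C then itv C n else set0.

Let mI' n : measurable (I n).
Proof. by rewrite /I; case: ifPn => // /set_mem; exact: mI. Qed.

Let cI : covered C = \bigcup_n I n.
Proof. by rewrite /covered bigcup_mkcond. Qed.

Lemma measurable_carries : measurable (covered C).
Proof. by rewrite cI; exact: bigcup_measurable. Qed.

Lemma ae_covered (P : R -> Prop) :
  (forall n, indices C n -> {ae lam, forall x, itv C n x -> P x}) ->
  {ae lam, forall x, covered C x -> P x}.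
Proof.
move=> h; have : {ae lam, forall x, forall n, indices C n -> itv C n x -> P x}.
  apply: ae_foralln => n; have [Cn|nC] := pselect (indices C n).
    by apply: ae_imply (h n Cn) => x Px _.
  by apply: aeW => x /nC.
by apply: ae_imply => x hx [n Cn nx]; exact: hx nx.
Qed.

(** Two versions are continuous on each interval and agree almost everywhere; m has full
    support. *)
Lemma represents_unique u v w D E : represents m C lam u v D ->
  represents m C lam u w E ->
  (forall x, covered C x -> v x = w x) /\ {ae lam, forall x, D x = E x}.
Proof.
move=> hv hw.
have vw : {ae m, forall x, v x = w x}.
  by apply: ae_imply2 (represents_ae hv) (represents_ae hw) => x -> ->.
have eqI n : indices C n -> forall x, itv C n x -> v x = w x.
  move=> Cn; apply: (increments_ae_eq (carries_itv hC Cn) (carries_scale hC Cn)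
    (carries_cc hC Cn) ms (represents_density_L2 hv) (represents_density_L2 hw)
    (represents_increments hv Cn) (represents_increments hw Cn) vw).
split; first by move=> x [n Cn nx]; exact: (eqI n Cn).
have : {ae lam, forall x, covered C x -> D x = E x}.
  apply: ae_covered => n Cn.
  have cc F x y : F \in Lfun lam 2%:E -> itv C n x -> itv C n y -> x <= y ->
      lam.-integrable `[x, y] (EFin \o F).
    by move=> F2 nx ny _; exact: (Lfun2_integrable_cc (carries_cc hC Cn)).
  apply: (increments_unique (carries_itv hC Cn) (u := v)).
  - by move=> x y; exact: (cc _ _ _ (represents_density_L2 hv)).
  - by move=> x y; exact: (cc _ _ _ (represents_density_L2 hw)).
  - exact: represents_increments hv _ Cn.
  - move=> x y nx ny xy; rewrite (eqI n Cn _ nx) (eqI n Cn _ ny).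
    exact: (represents_increments hw Cn).
apply: ae_imply => x; have [cx /(_ cx)//|ncx _] := pselect (covered C x).
by rewrite (represents_density0 hv)// (represents_density0 hw).
Qed.

Lemma represents_linear (c : R) u v D u' v' D' : represents m C lam u v D ->
  represents m C lam u' v' D' ->
  represents m C lam (fun x => c * u x + u' x) (fun x => c * v x + v' x)
    (fun x => c * D x + D' x).
Proof.
move=> h h'; split.
- exact: Lfun2_linear (represents_L2 h) (represents_L2 h').
- by apply: ae_imply2 (represents_ae h) (represents_ae h') => x -> ->.
- exact: Lfun2_linear (represents_density_L2 h) (represents_density_L2 h').
- by move=> x nx; rewrite (represents_density0 h)// (represents_density0 h')// mulr0 addr0.
- move=> n Cn x y nx ny xy.
  have i1 := Lfun2_integrable_cc (carries_cc hC Cn) (represents_density_L2 h) nx ny.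
  have i2 := Lfun2_integrable_cc (carries_cc hC Cn) (represents_density_L2 h') nx ny.
  rewrite RintegralD//; last exact: integrable_realZ.
  rewrite RintegralZl// -(represents_increments h Cn)// -(represents_increments h' Cn)//.
  by ring.
- move=> n Cn; have [l1 u1] := represents_boundary h Cn.
  have [l2 u2] := represents_boundary h' Cn.
  split=> e1 e2 e3; rewrite -(addr0 0) -[X in X + _](mulr0 c).
    by apply: cvgD; [apply: cvgMr; exact: l1|exact: l2].
  by apply: cvgD; [apply: cvgMr; exact: u1|exact: u2].
Qed.

End representation.

Section representation_of_forms.
Context {R : realType}.
Local Notation M := (measurableTypeR R).
Variables (m : {measure set M -> \bar R}) (C : @itv_family R)
  (lam : {measure set M -> \bar R}).
Hypotheses (ms : fully_supported m) (hC : carries C lam).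

Let I n : set M := if n \in indices C then itv C n else set0.

Let mI n : measurable (I n).
Proof.
rewrite /I; case: ifPn => // /set_mem Cn.
by apply: is_interval_measurable; case: (carries_itv hC Cn).
Qed.

Let tI : trivIset setT I.
Proof. exact: (trivIset_mkcond _ _).1 (carries_trivIset hC). Qed.

Let cI : covered C = \bigcup_n I n.
Proof. by rewrite /covered bigcup_mkcond. Qed.

Let IE n : indices C n -> I n = itv C n.
Proof. by move=> /mem_set; rewrite /I => ->. Qed.

Let I0 n : ~ indices C n -> I n = set0.
Proof. by move=> nC; rewrite /I memNset. Qed.

(** The derivatives on the disjoint intervals are glued together and extended by zero. *)
Lemma eff_function_represents u v : u \in Lfun m 2%:E ->
  {ae m, forall x, v x = u x} -> eff_function m C v ->
  exists D, represents m C lam u v D.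
Proof.
move=> u2 vu [vd vE].
have /choice[idx idxP] x : exists n, covered C x -> indices C n /\ itv C n x.
  by have [[n Cn nx]|nc] := pselect (covered C x); [exists n|exists 0%N => /nc].
pose D x : R := if x \in covered C
  then scale_derive (itv C (idx x)) (scale C (idx x)) v x else 0.
have DE n x : indices C n -> itv C n x -> D x = scale_derive (itv C n) (scale C n) v x.
  move=> Cn nx; have cx : covered C x by exists n.
  rewrite /D mem_set//; have [Ci ix] := idxP x cx.
  suff -> : idx x = n by [].
  by apply: (carries_trivIset hC) => //; exists x.
have sac n : indices C n -> scale_abs_continuous (itv C n) (scale C n) v.
  by move=> /vd[].
have hn n (Cn : indices C n) := scale_derive_increments (carries_itv hC Cn)
  (carries_scale hC Cn) (carries_cc hC Cn) (sac n Cn).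
have DrE n : indices C n -> D \_ (I n) = scale_derive (itv C n) (scale C n) v \_ (itv C n).
  move=> Cn; apply/funext => x; rewrite IE// !patchE; case: ifPn => // /set_mem nx.
  exact: DE.
have mDn n : measurable_fun (I n) (D : M -> M).
  have [Cn|/I0 ->] := pselect (indices C n); last exact: measurable_fun_set0.
  apply/(measurable_restrictT _ (mI n)); rewrite DrE//.
  by have [] := hn _ Cn.
have mD : measurable_fun setT (D : M -> M).
  have -> : D = D \_ (covered C).
    by apply/funext => x; rewrite patchE /D; case: ifPn.
  apply/(measurable_restrictT (D : M -> M)).
    exact: measurable_carries hC.
  by rewrite cI; apply/measurable_fun_bigcup.
have D0 x : ~ covered C x -> D x = 0 by move=> nx; rewrite /D memNset.
exists D; split => //.
- apply/Lfun2P; split => //.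
  have -> : (\int[lam]_x (D x ^+ 2)%:E = \int[lam]_(x in \bigcup_n I n) (D x ^+ 2)%:E)%E.
    rewrite [RHS]integral_mkcond; apply: eq_integral => x _; rewrite patchE.
    case: ifPn => // /negP nx; rewrite D0 ?expr0n//.
    by rewrite cI => cx; apply: nx; rewrite inE.
  have mD2 : measurable_fun setT (fun x : M => (D x ^+ 2)%:E).
    by apply/measurable_EFinP; exact: measurable_funX.
  rewrite ge0_integral_bigcup//; last 2 first.
    exact: measurable_funTS.
    by move=> x _; rewrite lee_fin sqr_ge0.
  have -> : (\sum_(0 <= n <oo) \int[lam]_(x in I n) (D x ^+ 2)%:E =
      2%:E * \sum_(0 <= n <oo | n \in indices C) scale_energy (itv C n) (scale C n) v v)%E.
    rewrite -nneseriesZl; last first.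
      move=> n _; apply: mule_ge0; first by rewrite lee_fin.
      by apply: integral_ge0 => x _; rewrite lee_fin -expr2 sqr_ge0.
    rewrite [RHS]eseries_mkcond; apply: eq_eseriesr => n _.
    case: ifPn => [/set_mem Cn|/negP nC]; last first.
      by rewrite I0 ?integral_set0// => ?; apply: nC; rewrite inE.
    rewrite /scale_energy muleA -EFinM divff// mul1e.
    rewrite (integral_scale_measure (carries_itv hC Cn) (carries_scale hC Cn) (carries_cc hC Cn)).
    rewrite IE//; apply: eq_integral => x /set_mem nx.
    by rewrite (DE n)// expr2.
  by rewrite lte_mul_pinfty.
- move=> n Cn x y nx ny xy; have [_ _ /(_ x y nx ny xy) ->] := hn _ Cn.
  apply: eq_Rintegral => z /set_mem; rewrite /= in_itv/= => xzy.
  have nz : itv C n z by exact: (carries_itv hC Cn).1 nx ny _ xzy.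
  by rewrite patchE mem_set// (DE n).
- by move=> n /vd[].
Qed.

Let scale_derive_ae_eq u v D n : represents m C lam u v D -> indices C n ->
  {ae lam, forall x, itv C n x -> scale_derive (itv C n) (scale C n) v x = D x}.
Proof.
move=> h Cn; exact: (scale_derive_ae (carries_itv hC Cn) (carries_scale hC Cn)
  (carries_cc hC Cn) (represents_density_L2 h) (represents_increments h Cn)).
Qed.

Let scale_abs u v D n : represents m C lam u v D -> indices C n ->
  scale_abs_continuous (itv C n) (scale C n) v.
Proof.
move=> h Cn; exact: (increments_scale_abs_continuous (carries_itv hC Cn)
  (carries_scale hC Cn) (carries_cc hC Cn) (represents_density_L2 h)
  (represents_increments h Cn)).
Qed.

Let mscale_derive u v D n : represents m C lam u v D -> indices C n ->
  measurable_fun (itv C n : set M) (scale_derive (itv C n) (scale C n) v : M -> M).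
Proof.
move=> h Cn; have := scale_derive_increments (carries_itv hC Cn)
  (carries_scale hC Cn) (carries_cc hC Cn) (scale_abs h Cn).
case=> mr _ _; apply/(measurable_restrictT _ _) => //.
by rewrite -IE.
Qed.

Lemma represents_scale_energy u v D u' v' D' n : represents m C lam u v D ->
  represents m C lam u' v' D' -> indices C n ->
  (scale_energy (itv C n) (scale C n) v v' =
    \int[lam]_(x in itv C n) (2^-1 * (D x * D' x))%:E)%E.
Proof.
move=> h h' Cn.
have mn : measurable (itv C n : set M) by rewrite -IE.
have mD := Lfun2_measurable (represents_density_L2 h).
have mD' := Lfun2_measurable (represents_density_L2 h').
rewrite /scale_energy.
rewrite (integral_scale_measure (carries_itv hC Cn) (carries_scale hC Cn) (carries_cc hC Cn)).
under [RHS]eq_integral do rewrite EFinM.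
rewrite integralZl//; last first.
  apply: (@integrableS _ _ _ _ setT) => //.
  exact: Lfun2M (represents_density_L2 h) (represents_density_L2 h').
congr (_ * _)%E; apply: ae_eq_integral => //.
- apply/measurable_EFinP; apply: measurable_funM.
    exact: mscale_derive h Cn.
  exact: mscale_derive h' Cn.
- by apply/measurable_EFinP; apply: measurable_funM; exact: measurable_funTS.
- apply: ae_imply2 (scale_derive_ae_eq h Cn) (scale_derive_ae_eq h' Cn) => x e1 e2 nx.
  by rewrite /= e1// e2.
Qed.

Lemma represents_energy_sum u v D u' v' D' : represents m C lam u v D ->
  represents m C lam u' v' D' ->
  (\sum_(0 <= n <oo | n \in indices C) scale_energy (itv C n) (scale C n) v v' =
   \int[lam]_x (2^-1 * (D x * D' x))%:E)%E.
Proof.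
move=> h h'.
have -> : (\int[lam]_x (2^-1 * (D x * D' x))%:E =
    \int[lam]_(x in \bigcup_n I n) (2^-1 * (D x * D' x))%:E)%E.
  rewrite [RHS]integral_mkcond; apply: eq_integral => x _; rewrite patchE.
  case: ifPn => // /negP nx; rewrite (represents_density0 h) ?mul0r ?mulr0//.
  by rewrite cI => cx; apply: nx; rewrite inE.
rewrite integral_bigcup//; last first.
  apply: (@integrableS _ _ _ _ setT) => //; first exact: bigcup_measurable.
  apply: (integrable_realZ measurableT (2^-1)).
  exact: Lfun2M (represents_density_L2 h) (represents_density_L2 h').
rewrite eseries_mkcond; apply: eq_eseriesr => n _.
case: ifPn => [/set_mem Cn|/negP nC]; last first.
  by rewrite I0 ?integral_set0// => ?; apply: nC; rewrite inE.
by rewrite IE// (represents_scale_energy h h').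
Qed.

Lemma represents_eff_function u v D : represents m C lam u v D -> eff_function m C v.
Proof.
move=> h; split; last first.
  rewrite (represents_energy_sum h h).
  have : lam.-integrable setT (fun x => (2^-1 * (D x * D x))%:E).
    apply: (integrable_realZ measurableT (2^-1)).
    exact: Lfun2M (represents_density_L2 h) (represents_density_L2 h).
  by move=> /(integrable_fin_num measurableT); rewrite fin_numE -ltey => /andP[].
move=> n Cn; have mn : measurable (itv C n : set M) by rewrite -IE.
have mv := increments_measurable (carries_itv hC Cn) (carries_scale hC Cn)
  (carries_cc hC Cn) (represents_density_L2 h) (represents_increments h Cn).
have [bl bu] := represents_boundary h Cn.
have msd := mscale_derive h Cn.
split => //.
- rewrite /L2_on/=.
  have /Lfun2P[mu u2] := Lfun2_restrict mn (represents_L2 h).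
  have mvr : measurable_fun setT ((v : M -> M) \_ (itv C n)).
    exact/(measurable_restrictT _ mn).
  apply/Lfun2P; split => //.
  apply: le_lt_trans u2; rewrite le_eqVlt; apply/orP; left; apply/eqP.
  apply: ae_eq_integral => //.
  - by apply/measurable_EFinP; exact: measurable_funX.
  - by apply/measurable_EFinP; exact: measurable_funX.
  - by apply: ae_imply (represents_ae h) => x vx _; rewrite !patchE vx.
- exact: scale_abs h Cn.
- apply/(L2_on_scale_measure (carries_itv hC Cn) (carries_scale hC Cn) (carries_cc hC Cn)).
  have /Lfun2P[mD D2] := Lfun2_restrict mn (represents_density_L2 h).
  have mr : measurable_fun setT ((scale_derive (itv C n) (scale C n) v : M -> M) \_ (itv C n)).
    exact/(measurable_restrictT _ mn).
  apply/Lfun2P; split => //.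
  apply: le_lt_trans D2; rewrite le_eqVlt; apply/orP; left; apply/eqP.
  apply: ae_eq_integral => //.
  - by apply/measurable_EFinP; exact: measurable_funX.
  - by apply/measurable_EFinP; exact: measurable_funX.
  - apply: ae_imply (scale_derive_ae_eq h Cn) => x e1 _; rewrite !patchE.
    by case: ifPn => // /set_mem nx; rewrite e1.
Qed.

Lemma represented_domainP u : domain (represented_form m C) u <->
  exists v D, represents m C lam u v D.
Proof.
split=> [[u2 [v [vu /(eff_function_represents u2 vu)[D h]]]]|[v [D h]]].
  by exists v, D.
split; first exact: represents_L2 h.
by exists v; split; [exact: represents_ae h|exact: represents_eff_function h].
Qed.

(** The version chosen in the definition of the energy has a density that agrees with D almost
    everywhere, by uniqueness. *)
Lemma represented_energyE u v D u' v' D' : represents m C lam u v D ->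
  represents m C lam u' v' D' ->
  energy (represented_form m C) u u' = 2^-1 * \int[lam]_x (D x * D' x).
Proof.
move=> h h'.
have version w z F : represents m C lam w z F -> exists F',
    represents m C lam w (eff_version m C w) F' /\ {ae lam, forall x, F' x = F x}.
  move=> hw; have [ev1 ev2] : {ae m, forall x, eff_version m C w x = w x} /\
      eff_function m C (eff_version m C w).
    apply: (@xgetI _ w [set v | {ae m, forall x, v x = w x} /\ eff_function m C v] z).
    split; [exact: represents_ae hw|exact: represents_eff_function hw].
  have [F' hF'] := eff_function_represents (represents_L2 hw) ev1 ev2.
  by exists F'; split => //; case: (represents_unique ms hC hF' hw).
have [F [hF FD]] := version _ _ _ h; have [F' [hF' FD']] := version _ _ _ h'.
rewrite /= (represents_energy_sum hF hF').
have iD := Lfun2M (represents_density_L2 h) (represents_density_L2 h').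
have iF := Lfun2M (represents_density_L2 hF) (represents_density_L2 hF').
rewrite -RintegralZl// /Rintegral; congr fine; apply: ae_eq_integral => //.
- by apply: measurable_int; exact: (integrable_realZ measurableT (2^-1) iF).
- by apply: measurable_int; exact: (integrable_realZ measurableT (2^-1) iD).
- by apply: ae_imply2 FD FD' => x -> ->.
Qed.

End representation_of_forms.

Section total_scale_measure.
Context {R : realType}.

Lemma carries_total_scale_measure (C : @itv_family R) : effective_intervals C ->
  carries C (total_scale_measure C).
Proof.
move=> hC; split.
- exact: eff_trivIset hC.
- exact: eff_itv hC.
- exact: eff_scale hC.
move=> n Cn x y nx ny xy.
have sm k (Ck : indices C k) := scale_measureP (eff_itv hC Ck) (eff_scale hC Ck).
rewrite /total_scale_measure /= /mseries (@nneseriesD1 _ _ n)//.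
rewrite (mem_set Cn) (sm n Cn).2// eseries0 ?adde0// => k _ kn.
case: ifPn => // /set_mem Ck; apply/eqP; rewrite eq_le measure_ge0 andbT.
rewrite -(sm k Ck).1; apply: le_measure; rewrite ?inE//.
  by apply: measurableC; apply: is_interval_measurable; case: (eff_itv hC Ck).
move=> z; rewrite /= in_itv/= => xzy kz; move/eqP: kn; apply.
have nz : itv C n z by exact: (eff_itv hC Cn).1 nx ny _ xzy.
by apply: (eff_trivIset hC) => //; exists z.
Qed.

End total_scale_measure.


(** * Smooth bump functions *)

Section smooth_bumps.
Context {R : realType}.
Local Notation M := (measurableTypeR R).
Local Notation leb := (@lebesgue_measure R).
Implicit Types (f g : R -> R) (t : R).

(** Each derivative of exp (- 1 / t), extended by zero, is a combination of these functions. *)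
Definition flat (k : nat) (t : R) : R :=
  if 0 < t then t^-1 ^+ k * expR (- t^-1) else 0.

(** The exponential dominates the term of order k + 2 of its series; the bound by t^2 gives
    the derivative 0 at the origin. *)
Lemma flat_small k t : `|flat k t| <= (k.+2)`!%:R * `|t| ^+ 2.
Proof.
rewrite /flat; case: ifPn => [t0|_]; last first.
  by rewrite normr0 mulr_ge0// exprn_ge0.
have t'0 : 0 < t^-1 by rewrite invr_gt0.
rewrite ger0_norm; last by rewrite mulr_ge0 ?expR_ge0 ?exprn_ge0 ?ltW.
rewrite expRN -ler_pdivlMr ?invr_gt0 ?expR_gt0// invrK.
have h := expR_ge1Dxn k.+1 (ltW t'0).
have f0 : 0 < (k.+2)`!%:R :> R by rewrite ltr0n fact_gt0.
apply: (@le_trans _ _ ((k.+2)`!%:R * `|t| ^+ 2 * (1 + t^-1 ^+ k.+2 / (k.+2)`!%:R))).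
  rewrite gtr0_norm//.
  have -> : (k.+2)`!%:R * t ^+ 2 * (1 + t^-1 ^+ k.+2 / (k.+2)`!%:R) =
      t^-1 ^+ k + (k.+2)`!%:R * t ^+ 2 :> R.
    rewrite -addn2 exprD; field.
    by rewrite !gt_eqF//= addn2.
  by rewrite lerDl mulr_ge0 ?ltW// exprn_gt0.
by rewrite ler_wpM2l// mulr_ge0 ?exprn_ge0.
Qed.

Lemma is_derive_flat k t :
  is_derive t 1 (flat k) (flat k.+2 t - k%:R * flat k.+1 t).
Proof.
have [t0|t0|->] := ltgtP t 0.
- have -> : flat k.+2 t - k%:R * flat k.+1 t = 0.
    by rewrite /flat ltNge (ltW t0)/= mulr0 subr0.
  apply: (@near_eq_is_derive R R R (cst (0 : R))).
  near=> z; rewrite /flat ltNge (_ : z <= 0)//.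
  by apply: ltW; near: z; exact: lt_nbhsl.
- have -> : flat k.+2 t - k%:R * flat k.+1 t =
     (t^-1 ^+ k) *: (expR (- t^-1) * (- (- t ^- 2 *: 1))) +
       expR (- t^-1) *: ((k%:R * t^-1 ^+ k.-1) *: (- t ^- 2 *: 1)) :> R.
    rewrite /flat t0 /GRing.scale/=; case: k => [|k].
      by rewrite !mul0r mulr0 addr0 subr0 expr0 mul1r exprVn; ring.
    by rewrite -!exprVn !exprS /=; ring.
  have dV : is_derive t 1 (fun y : R => y^-1) (- t ^- 2 *: 1).
    by apply: (@is_deriveV _ id); rewrite gt_eqF.
  have dN : is_derive t 1 (fun y : R => - y^-1) (- (- t ^- 2 *: 1)) := is_deriveN dV.
  have dE : is_derive t 1 (expR \o (fun y : R => - y^-1)) (expR (- t^-1) * - (- t ^- 2 *: 1)).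
    by apply: is_derive1_comp.
  apply: (@near_eq_is_derive R R R (fun y => y^-1 ^+ k * expR (- y^-1))).
    near=> z; have z0 : 0 < z by near: z; exact: lt_nbhsr.
    by rewrite /flat z0.
  have dF := is_deriveM (is_deriveX k dV) dE.
  rewrite exprfctE /= in dF.
  by apply: (is_derive_eq dF).
- have -> : flat k.+2 0 - k%:R * flat k.+1 0 = 0 by rewrite /flat ltxx mulr0 subr0.
  have cv : h^-1 *: (flat k (h *: 1 + 0) - flat k 0) @[h --> (0:R)^'] --> (0 : R).
    apply/cvgrPdist_le => e e0.
    set K : R := (k.+2)`!%:R.
    have K0 : 0 < K by rewrite ltr0n fact_gt0.
    near=> h; rewrite sub0r normrN addr0 /GRing.scale/= mulr1.
    have h0 : h != 0 by near: h; exact: nbhs_dnbhs_neq.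
    rewrite {2}/flat ltxx subr0 normrM normrV ?unitfE// ler_pdivrMl ?normr_gt0//.
    rewrite (le_trans (flat_small _ _))// -/K expr2 mulrCA ler_wpM2l//.
    have : `|h| < e / K.
      near: h; apply: dnbhs0_lt; exact: divr_gt0.
    by rewrite ltr_pdivlMr// mulrC => /ltW.
  apply: DeriveDef; last exact: cvg_lim cv.
  by apply/cvg_ex; exists 0.
Unshelve. all: by end_near. Qed.

(** A class of functions that contains the bumps and is closed under differentiation, so
    that its members are smooth. *)
Inductive bump_class : (R -> R) -> Prop :=
| bump_flat k : bump_class (flat k)
| bump_cst c : bump_class (cst c)
| bump_add f g : bump_class f -> bump_class g -> bump_class (f \+ g)
| bump_mul f g : bump_class f -> bump_class g -> bump_class (f \* g)
| bump_affine f a b : bump_class f -> bump_class (fun t => f (a * t + b)).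

Lemma bump_class_derive f : bump_class f ->
  exists2 f', bump_class f' & forall t, is_derive t 1 f (f' t).
Proof.
elim=> {f} [k|c|f g _ [f' bf' df] _ [g' bg' dg]|f g bf [f' bf' df] bg [g' bg' dg]|f a b _ [f' bf' df]].
- exists (flat k.+2 \+ (cst (- k%:R) \* flat k.+1)).
    by do ?constructor.
  by move=> t; have := is_derive_flat k t; rewrite /= mulNr.
- by exists (cst 0); [constructor|move=> t; exact: is_derive_cst].
- by exists (f' \+ g') => [|t]; [constructor|exact: is_deriveD].
- exists ((f \* g') \+ (g \* f')); first by do ?constructor.
  by move=> t; exact: is_deriveM.
- exists (cst a \* (fun t => f' (a * t + b))); first by do ?constructor.
  move=> t; rewrite /= mulrC; apply: (@is_derive1_comp _ f (fun t => a * t + b)).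
  have := is_deriveD (is_deriveZ a (is_derive_id t 1)) (is_derive_cst b t 1).
  by rewrite /GRing.scale/= mulr1 addr0.
Qed.

Lemma bump_class_smooth f : bump_class f -> smooth f.
Proof.
move=> bf n; have : bump_class (derive1n n f).
  elim: n => [|n /bump_class_derive[g bg dg]]; first by rewrite derive1n0.
  rewrite derive1nS (_ : derive1 _ = g)//; apply/funext => t.
  by rewrite derive1E; exact: derive_val.
by move=> /bump_class_derive[g _ dg] x; exact: ex_derive.
Qed.

Lemma smooth_continuous f : smooth f -> continuous f.
Proof.
move=> sf x; apply: differentiable_continuous; apply/derivable1_diffP.
by have := sf 0%N x; rewrite derive1n0.
Qed.

Lemma smooth_primitive f g : (forall t, is_derive t 1 f (g t)) -> smooth g -> smooth f.
Proof.
move=> dfg sg [|n] x; first by rewrite derive1n0; exact: ex_derive.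
rewrite derive1Sn (_ : derive1 f = g); first exact: sg.
by apply/funext => t; rewrite derive1E; exact: derive_val.
Qed.

(** As n grows, these functions increase to the indicator of ]a, b[. *)
Definition bump (n : nat) (a b t : R) : R :=
  flat 0 (n%:R * (t - a)) * flat 0 (n%:R * (b - t)).

Lemma bump_class_bump n a b : bump_class (bump n a b).
Proof.
have -> : bump n a b = (fun t => flat 0 (n%:R * t + - (n%:R * a))) \*
    (fun t => flat 0 (- n%:R * t + n%:R * b)).
  by apply/funext => t; rewrite /bump/= mulrBr; congr (_ * flat 0 _); ring.
by do ?constructor.
Qed.

Lemma flat0_itv t : 0 <= flat 0 t <= 1.
Proof.
rewrite /flat; case: ifPn => t0; last by rewrite lexx ler01.
by rewrite expr0 mul1r expR_ge0/= -expR0 ler_expR oppr_le0 invr_ge0 ltW.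
Qed.

Lemma bump_itv n a b t : 0 <= bump n a b t <= 1.
Proof.
have /andP[x0 x1] := flat0_itv (n%:R * (t - a)).
have /andP[y0 y1] := flat0_itv (n%:R * (b - t)).
by rewrite /bump mulr_ge0//= mulr_ile1.
Qed.

Lemma bump_out n a b t : ~ (a < t < b) -> bump n a b t = 0.
Proof.
move=> /negP; rewrite negb_and -!leNgt => /orP[h|h]; rewrite /bump /flat.
  by rewrite ltNge mulr_ge0_le0 ?subr_le0// mul0r.
by rewrite [X in _ * X](_ : _ = 0) ?mulr0// ltNge mulr_ge0_le0 ?subr_le0.
Qed.

Lemma bump_gt0 n a b t : a < t < b -> 0 < bump n.+1 a b t.
Proof.
move=> /andP[h1 h2]; rewrite /bump.
have flat_gt0 x : 0 < x -> 0 < flat 0 x.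
  by move=> x0; rewrite /flat x0 expr0 mul1r expR_gt0.
by apply: mulr_gt0; apply: flat_gt0; rewrite mulr_gt0 ?subr_gt0.
Qed.

Lemma flat0_cvg1 t : 0 < t -> flat 0 (n%:R * t) @[n --> \oo] --> (1 : R).
Proof.
move=> t0; have : expR (- (n.+1%:R^-1 * t^-1)) @[n --> \oo] --> expR (- (0 * t^-1)).
  apply: (continuous_cvg _ (@continuous_expR _ _)).
  apply: cvgN; apply: cvgMl; exact: cvg_harmonic.
rewrite mul0r oppr0 expR0 => h.
rewrite -(cvg_shiftS (fun n => flat 0 (n%:R * t)))/=.
apply: cvg_trans h; apply: near_eq_cvg; near=> n.
by rewrite /flat mulr_gt0// expr0 mul1r invfM.
Unshelve. all: by end_near. Qed.

Lemma bump_cvg a b t : a < t < b -> bump n a b t @[n --> \oo] --> (1 : R).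
Proof.
move=> /andP[h1 h2]; rewrite -(mulr1 1).
by apply: cvgM; apply: flat0_cvg1; rewrite subr_gt0.
Qed.

(** The primitive that vanishes before a vanishes again after b, since the integral is zero. *)
Lemma compact_primitive (psi : R -> R) (a b : R) : a <= b -> continuous psi ->
  (forall t, ~ (a < t < b) -> psi t = 0) ->
  \int[leb]_(t in `[a, b]) psi t = 0 ->
  exists phi : R -> R, (forall t, is_derive t 1 phi (psi t)) /\
    forall t, ~ (a < t < b) -> phi t = 0.
Proof.
move=> ab cpsi psi0 I0.
have mpsi : measurable_fun setT (psi : M -> M) by exact: continuous_measurable_fun.
have psiE : psi = psi \_ `[a, b]%classic.
  apply/funext => t; rewrite patchE; case: ifPn => // /negP nt; apply: psi0 => h.
  by apply: nt; rewrite inE/= in_itv/=; case/andP: h => /ltW -> /ltW ->.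
have icc : leb.-integrable `[a, b] (EFin \o psi).
  apply: continuous_compact_integrable; first exact: segment_compact.
  exact: continuous_subspaceT.
have iT : leb.-integrable setT (EFin \o psi).
  have : leb.-integrable setT (EFin \o psi \_ `[a, b]%classic).
    by rewrite -restrict_EFin; apply/(integrable_mkcond _ (measurable_cc a b)).
  by rewrite -psiE.
pose phi t := \int[leb]_(z in `]-oo, t]) psi z.
have IT : \int[leb]_z psi z = 0.
  by rewrite psiE -Rintegral_mkcond.
exists phi; split => // t.
  have t1 : t < t + 1 by rewrite ltrDl.
  have it1 : leb.-integrable `]-oo, (t + 1)] (EFin \o psi).
    by apply: integrableS iT.
  apply: DeriveDef; first exact: (continuous_FTC1 t1 it1 (ltNyr _) (cpsi t)).1.
  rewrite -derive1E; exact: (continuous_FTC1 t1 it1 (ltNyr _) (cpsi t)).2.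
move=> /negP; rewrite negb_and -!leNgt => /orP[ta|bt]; rewrite /phi.
  rewrite /Rintegral integral0_eq// => z; rewrite /= in_itv/= => zt.
  by rewrite psi0//; apply/negP; rewrite negb_and -leNgt (le_trans zt ta).
rewrite -[RHS]IT Rintegral_mkcond; congr (Rintegral _ _ _); apply/funext => z.
rewrite patchE; case: ifPn => // /negP nz; rewrite psi0// => /andP[_ zb].
by apply: nz; rewrite inE/= in_itv/= ltW// (lt_le_trans zb).
Qed.

End smooth_bumps.


(** * Integrals for measures with a density and for the measure of f *)

Section signed_density.
Local Open Scope ereal_scope.
Context d (T : measurableType d) (R : realType).
Variables (nu mu : {measure set T -> \bar R}) (g : T -> \bar R).
Hypotheses (mg : measurable_fun setT g) (g0 : forall x, 0 <= g x).
Hypothesis nuE : forall A, measurable A -> nu A = \int[mu]_(x in A) g x.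

Lemma integral_density f E : measurable E -> measurable_fun E f ->
  \int[nu]_(x in E) f x = \int[mu]_(x in E) (f x * g x).
Proof.
move=> mE mf; rewrite [LHS]integralE [RHS]integralE.
rewrite !(ge0_integral_density mg g0 nuE)//; last 2 first.
  exact: measurable_funeneg.
  exact: measurable_funepos.
congr (_ - _); apply: eq_integral => x _; rewrite ?funeposE ?funenegE.
  have [fx|/ltW fx] := leP 0 (f x).
    by rewrite !max_l ?mule_ge0.
  by rewrite !max_r ?mul0e ?mule_le0_ge0.
have [fx|/ltW fx] := leP 0 (f x).
  by rewrite !max_r ?mul0e ?oppe_le0 ?mule_ge0.
by rewrite !max_l ?oppe_ge0 ?mule_le0_ge0// mulNe.
Qed.

Lemma integrable_density f E : measurable E -> measurable_fun E f ->
  nu.-integrable E f <-> mu.-integrable E (fun x => f x * g x).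
Proof.
move=> mE mf.
have mfg : measurable_fun E (fun x => f x * g x).
  by apply: emeasurable_funM => //; exact: measurable_funTS.
have e : \int[nu]_(x in E) `|f x| = \int[mu]_(x in E) `|f x * g x|.
  rewrite integral_density//; last exact: measurableT_comp.
  by apply: eq_integral => x _; rewrite abseM [`|g x|]gee0_abs.
by split=> /integrableP[_ h]; apply/integrableP; split => //; rewrite -?e// e.
Qed.

Lemma ae_density P : {ae mu, forall x, P x} -> {ae nu, forall x, P x}.
Proof.
move=> [A [mA A0 PA]]; exists A; split => //.
rewrite nuE//; apply: null_set_integral => //; exact: measurable_funTS.
Qed.

End signed_density.

Section restricted_measure.
Context d (T : measurableType d) (R : realType).
Variables (nu mu : {measure set T -> \bar R}) (B : set T).
Hypotheses (mB : measurable B)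
  (nuE : forall A, measurable A -> nu A = mu (A `&` B)).

Let indicator_density A : measurable A -> nu A = (\int[mu]_(x in A) (\1_B x)%:E)%E.
Proof. by move=> mA; rewrite nuE// integral_indic// setIC. Qed.

Let mind : measurable_fun setT (fun x => (\1_B x : R)%:E).
Proof. by apply/measurable_EFinP; apply: measurable_indic. Qed.

Let ind0 x : (0 <= (\1_B x : R)%:E)%E.
Proof. by rewrite lee_fin indicE; case: (_ \in _). Qed.

Let patch_indicator (k : T -> R) x : (k \_ B) x = k x * \1_B x.
Proof. by rewrite patchE indicE; case: ifPn; rewrite ?mulr1 ?mulr0. Qed.

Lemma integral_restricted (k : T -> R) A : measurable A -> measurable_fun A k ->
  (\int[nu]_(x in A) (k x)%:E = \int[mu]_(x in A) ((k \_ B) x)%:E)%E.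
Proof.
move=> mA mk; rewrite (integral_density mind ind0 indicator_density)//; last exact/measurable_EFinP.
by apply: eq_integral => x _; rewrite patch_indicator EFinM.
Qed.

Lemma integrable_restricted (k : T -> R) A : measurable A -> measurable_fun A k ->
  nu.-integrable A (EFin \o k) <-> mu.-integrable A (EFin \o (k \_ B)).
Proof.
move=> mA mk; rewrite (integrable_density mind ind0 indicator_density)//; last exact/measurable_EFinP.
by split; apply: eq_integrable => // x _; rewrite /= patch_indicator EFinM.
Qed.

Lemma Lfun2_restricted (k : T -> R) : k \in Lfun mu 2%:E -> k \in Lfun nu 2%:E.
Proof.
move=> /Lfun2P[mk k2]; apply/Lfun2P; split => //; apply: le_lt_trans k2.
have mk2 : measurable_fun setT (fun x => (k x ^+ 2)%:E).
  by apply/measurable_EFinP; exact: measurable_funX.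
rewrite (integral_density mind ind0 indicator_density)//; apply: ge0_le_integral => //.
- by move=> x _; rewrite mule_ge0 ?ind0// lee_fin sqr_ge0.
- exact: emeasurable_funM.
- by move=> x _; rewrite -EFinM lee_fin ler_piMr ?sqr_ge0// indicE.
Qed.

Lemma Lfun2_patch (k : T -> R) : k \in Lfun nu 2%:E -> k \_ B \in Lfun mu 2%:E.
Proof.
move=> /Lfun2P[mk k2]; apply/Lfun2P; split.
  by apply/(measurable_restrictT _ mB); exact: measurable_funTS.
apply: le_lt_trans k2; rewrite integral_restricted//; last exact: measurable_funX.
rewrite le_eqVlt; apply/orP; left; apply/eqP; apply: eq_integral => x _.
by rewrite !patchE; case: ifPn; rewrite ?expr0n.
Qed.

Lemma ae_restricted (P : T -> Prop) : {ae mu, forall x, B x -> P x} -> {ae nu, forall x, P x}.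
Proof.
move=> [A [mA A0 PA]]; exists (A `|` ~` B); split.
- by apply: measurableU => //; exact: measurableC.
- rewrite nuE; last by apply: measurableU => //; exact: measurableC.
  rewrite setIUl setICl setU0; apply/eqP; rewrite eq_le measure_ge0 andbT -A0.
  by apply: le_measure; rewrite ?inE//; exact: measurableI.
- move=> x /= nP; have [Bx|] := pselect (B x); [left|by right].
  by apply: PA => /= /(_ Bx).
Qed.

Lemma restricted_ae (P : T -> Prop) : {ae nu, forall x, P x} -> {ae mu, forall x, B x -> P x}.
Proof.
move=> [A [mA A0 PA]]; exists (A `&` B); split; first exact: measurableI.
  by rewrite -nuE.
move=> x /= nP; have Bx : B x by apply: contrapT => nB; apply: nP => Bx.
by split => //; apply: PA => /= Px; apply: nP.
Qed.

End restricted_measure.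

Lemma ae_eq_rintegral d (T : measurableType d) (R : realType)
    (mu : {measure set T -> \bar R}) (D : set T) (f h : T -> \bar R) :
  measurable D -> measurable_fun D f -> measurable_fun D h ->
  {ae mu, forall x, f x = h x} ->
  (\int[mu]_(x in D) f x = \int[mu]_(x in D) h x)%E.
Proof.
move=> mD mf mh fh; apply: ae_eq_integral => //.
by apply: ae_imply fh => x ->.
Qed.

Section composition_with_test_functions.
Context {R : realType}.
Local Notation M := (measurableTypeR R).
Local Notation leb := (@lebesgue_measure R).

Lemma lower_setT : lower [set: R] = -oo%E.
Proof.
case E : (lower setT) => [r| |] //.
- have : (lower setT <= (r - 1)%:E)%E by apply: ereal_inf_lbound; exists (r - 1).
  rewrite E lee_fin; clear E => ?; exfalso; lra.
- have : (lower setT <= (0 : R)%:E)%E by apply: ereal_inf_lbound; exists 0.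
  by rewrite E.
Qed.

Lemma upper_setT : upper [set: R] = +oo%E.
Proof.
case E : (upper setT) => [r| |] //.
- have : ((r + 1)%:E <= upper setT)%E by apply: ereal_sup_ubound; exists (r + 1).
  rewrite E lee_fin; clear E => ?; exfalso; lra.
- have : ((0 : R)%:E <= upper setT)%E by apply: ereal_sup_ubound; exists 0.
  by rewrite E.
Qed.

Variable f : cumulative R R.
Hypotheses (f_incr : {homo f : x y / x < y}) (f_cont : continuous f) (f0 : f 0 = 0).
Local Notation lf := (lebesgue_stieltjes_measure f : {measure set M -> \bar R}).

Lemma whole_line_nondegenerate : nondegenerate_interval [set: R].
Proof. by split; [move=> //|rewrite lower_setT upper_setT]. Qed.

Lemma whole_line_scale : scale_function [set: R] f.
Proof.
split; first by move=> x y _ _; exact: f_incr.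
  by apply: continuous_subspaceT.
by rewrite /itv_point lower_setT upper_setT.
Qed.

Lemma whole_line_cc x y : [set: R] x -> [set: R] y -> x <= y ->
  lf `[x, y]%classic = (f y - f x)%:E.
Proof. by move=> _ _; exact: stieltjes_cc. Qed.

Lemma lf_cc_lty x y : (lf `[x, y]%classic < +oo)%E.
Proof.
have [xy|yx] := leP x y; first by rewrite whole_line_cc// ltry.
by rewrite set_itv_ge ?measure0// bnd_simp -ltNge.
Qed.

Lemma f_lt x y : (f x < f y) = (x < y).
Proof. exact: (scale_lt whole_line_scale). Qed.

Lemma f_le x y : (f x <= f y) = (x <= y).
Proof. exact: (scale_le whole_line_scale). Qed.

Lemma comp_integrable (psi : R -> R) (x y : R) : continuous psi ->
  lf.-integrable `[x, y] (EFin \o (psi \o f)).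
Proof.
move=> cpsi.
have cpf : continuous (psi \o f) by move=> t; apply: continuous_comp; [exact: f_cont|exact: cpsi].
have mpf : measurable_fun setT (psi \o f : M -> M) by exact: continuous_measurable_fun.
have [x0 _ /(_ _)bnd] : exists2 K : R, 0 <= K & forall z, x <= z <= y -> `|psi (f z)| <= K.
  have /compact_bounded[K [_ Kb]] : compact ((psi \o f) @` `[x, y]%classic).
    by apply: continuous_compact; [exact: continuous_subspaceT|exact: segment_compact].
  exists (`|K| + 1) => [|z zxy]; first by rewrite addr_ge0.
  by apply: Kb; [rewrite (le_lt_trans (ler_norm _))// ltrDl|exists z].
apply: (le_integrable _ _ _ (integrable_cst_lty (mu := lf) x0 _ (lf_cc_lty x y))) => //.
  by apply/measurable_EFinP; exact: measurable_funTS.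
move=> z; rewrite /= in_itv/= => /bnd; rewrite lee_fin => /le_trans; apply.
exact: ler_norm.
Qed.

(** The map f carries its own measure to the Lebesgue measure. *)
Lemma comp_integral (psi : R -> R) (x y : R) : x <= y -> continuous psi ->
  \int[lf]_(z in `[x, y]) psi (f z) = \int[leb]_(t in `[f x, f y]) psi t.
Proof.
move=> xy cpsi; have ipf := comp_integrable x y cpsi.
have [h [hs hP mh]] := scale_inverse whole_line_nondegenerate.1 whole_line_scale.
have := integral_scale_change whole_line_nondegenerate.1 whole_line_scale
  whole_line_cc hP mh (k := EFin \o (psi \o f)) I I xy (measurable_int _ ipf).
rewrite /Rintegral => ->.
congr fine; apply: eq_integral => t /set_mem ft /=.
have [//|_ -> //] := hP t _; apply: (scale_image_cc whole_line_nondegenerate.1 whole_line_scale) ft => //.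
Qed.

(** The fundamental theorem of calculus for phi, transported by f. *)
Lemma comp_increment (phi psi : R -> R) (x y : R) : x <= y ->
  (forall t : R, is_derive t 1 phi (psi t)) -> continuous psi ->
  phi (f y) - phi (f x) = \int[lf]_(z in `[x, y]) psi (f z).
Proof.
move=> + dphi cpsi; have cphi : continuous phi.
  by move=> t; apply: differentiable_continuous; apply/derivable1_diffP; exact: ex_derive.
move=> xy; rewrite comp_integral//; move: xy; rewrite le_eqVlt => /orP[/eqP <-|xy].
  by rewrite subrr /Rintegral set_itv1 integral_set1.
have fxy : f x < f y by exact: f_incr.
have FTC : (\int[leb]_(t in `[f x, f y]) (psi t)%:E = (phi (f y))%:E - (phi (f x))%:E)%E.
  apply: continuous_FTC2 => //.
  - exact: continuous_subspaceT.
  - split; first by move=> t _; exact: ex_derive.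
      by apply: cvg_at_right_filter; exact: cphi.
    by apply: cvg_at_left_filter; exact: cphi.
  - by move=> t _; rewrite derive1E; exact: derive_val.
by rewrite /Rintegral FTC.
Qed.

End composition_with_test_functions.


(** * The Lebesgue decomposition and the densities of the test functions *)

Section unbounded_intervals.
Context {R : realType}.
Variable J : set R.
Hypothesis nJ : nondegenerate_interval J.

Lemma lowerNy_near : lower J = -oo%E -> \forall x \near -oo, J x.
Proof.
move=> lJ.
have lt z : exists2 x, J x & x < z.
  have [_ [x Jx <-]] : exists2 y, (EFin @` J) y & (y < z%:E)%E.
    by apply: ereal_inf_lt; rewrite -/(lower J) lJ ltNyr.
  by rewrite lte_fin => xz; exists x.
have [z Jz _] := lt 0; exists z; split; first exact: num_real.
move=> y yz; have [x Jx xy] := lt y.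
by apply: (nJ.1 x z) => //; rewrite (ltW xy) (ltW yz).
Qed.

Lemma uppery_near : upper J = +oo%E -> \forall x \near +oo, J x.
Proof.
move=> uJ.
have gt z : exists2 x, J x & z < x.
  have [_ [x Jx <-]] : exists2 y, (EFin @` J) y & (z%:E < y)%E.
    by apply: ereal_sup_gt; rewrite -/(upper J) uJ ltry.
  by rewrite lte_fin => xz; exists x.
have [z Jz _] := gt 0; exists z; split; first exact: num_real.
move=> y zy; have [x Jx yx] := gt y.
by apply: (nJ.1 z x) => //; rewrite (ltW zy) (ltW yx).
Qed.

End unbounded_intervals.

Section decomposed_scale.
Context {R : realType}.
Local Notation M := (measurableTypeR R).

(** The Lebesgue decomposition in terms of a set N that carries lbar and the measure of f on
    the intervals, together with the standing assumptions on m and f. *)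
Record decomposed (m : {measure set M -> \bar R}) (C : @itv_family R)
    (C_eff : effective_intervals C) (f : cumulative R R)
    (lbar : {measure set M -> \bar R}) (N : set M) (g : M -> \bar R) : Prop := {
  m_is_radon : radon m ;
  m_is_supported : fully_supported m ;
  f_increasing : {homo f : x y / x < y} ;
  f_continuous : continuous f ;
  f_zero : f 0 = 0 ;
  f_test : composed_test_functions f `<=` domain (represented_form m C) ;
  measurable_N : measurable N ;
  N_total : mrestr (lebesgue_stieltjes_measure f) (measurable_covered C_eff) (~` N) = 0%E ;
  lbar_N : forall A, measurable A -> lbar A = total_scale_measure C (A `&` N) ;
  measurable_g : measurable_fun setT g ;
  g_ge0 : forall x, (0 <= g x)%E ;
  lbar_g : forall A, measurable A -> lbar A =
    (\int[mrestr (lebesgue_stieltjes_measure f) (measurable_covered C_eff)]_(x in A) g x)%E }.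

(** Mutual singularity gives a set N that is null for kappa and whose complement is null for
    the measure of f on the intervals, hence for lbar. *)
Lemma lebesgue_decomposed (m : {measure set M -> \bar R}) (C : @itv_family R)
    (C_eff : effective_intervals C) (f : cumulative R R)
    (lbar kappa : {measure set M -> \bar R}) :
  radon m -> fully_supported m -> {homo f : x y / x < y} -> continuous f -> f 0 = 0 ->
  composed_test_functions f `<=` domain (represented_form m C) ->
  lebesgue_decomposition (total_scale_measure C)
    (mrestr (lebesgue_stieltjes_measure f) (measurable_covered C_eff)) lbar kappa ->
  exists N g, decomposed m C_eff f lbar N g.
Proof.
move=> mr ms fi fc f0 ft [lsE [g [mg g0 gE]] [N [mN kN lN]]].
exists N, g; split => // A mA.
rewrite lsE; last exact: measurableI.
have -> : kappa (A `&` N) = 0%E.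
  apply/eqP; rewrite eq_le measure_ge0 andbT -kN; apply: le_measure; rewrite ?inE//.
  exact: measurableI.
rewrite adde0 (measureDI lbar mA mN) setDE.
suff z0 : lbar (A `&` ~` N) = 0%E by rewrite [X in (X + _)%E]z0 add0e.
rewrite gE; last by apply: measurableI => //; exact: measurableC.
apply: null_set_integral; [by apply: measurableI => //; exact: measurableC|exact: measurable_funTS|].
apply/eqP; rewrite eq_le measure_ge0 andbT -lN; apply: le_measure; rewrite ?inE//.
- by apply: measurableI => //; exact: measurableC.
- exact: measurableC.
Qed.

Variables (m : {measure set M -> \bar R}) (C : @itv_family R)
  (C_eff : effective_intervals C) (f : cumulative R R)
  (lbar : {measure set M -> \bar R}) (N : set M) (g : M -> \bar R).
Hypothesis H : decomposed m C_eff f lbar N g.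

Local Notation lf := (lebesgue_stieltjes_measure f : {measure set M -> \bar R}).
Local Notation lfe := (mrestr lf (measurable_covered C_eff)
  : {measure set M -> \bar R}).
Local Notation lam := (total_scale_measure C).

Let hC : carries C lam := carries_total_scale_measure C_eff.
Let mN := measurable_N H.

Lemma ae_lbar_lfe (P : R -> Prop) : {ae lfe, forall x, P x} -> {ae lbar, forall x, P x}.
Proof. exact: (ae_density (measurable_g H) (lbar_g H)). Qed.

Lemma Lfun2_lbar D : D \in Lfun lam 2%:E -> D \in Lfun lbar 2%:E.
Proof. exact: (Lfun2_restricted mN (lbar_N H)). Qed.

Lemma Lfun2_lam_patch D : D \in Lfun lbar 2%:E -> D \_ N \in Lfun lam 2%:E.
Proof. exact: (Lfun2_patch mN (lbar_N H)). Qed.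

Lemma integral_lbar (k : M -> R) (A : set M) : measurable A -> measurable_fun A k ->
  (\int[lbar]_(x in A) (k x)%:E = \int[lam]_(x in A) ((k \_ N) x)%:E)%E.
Proof. exact: (integral_restricted mN (lbar_N H)). Qed.

Lemma integrable_lbar (k : M -> R) (A : set M) : measurable A -> measurable_fun A k ->
  lbar.-integrable A (EFin \o k) <-> lam.-integrable A (EFin \o (k \_ N)).
Proof. exact: (integrable_restricted mN (lbar_N H)). Qed.

Lemma lfe_covered (A : set M) : A `<=` covered C -> lfe A = lf A.
Proof. by move=> Ac; rewrite /= /mrestr setIidl. Qed.

Lemma lfe_uncovered : lfe (~` covered C) = 0%E.
Proof. by rewrite /= /mrestr setICl measure0. Qed.

Lemma ae_lfe_covered (P : R -> Prop) :
  {ae lfe, forall x, covered C x -> P x} -> {ae lfe, forall x, P x}.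
Proof.
move=> aeP; have : {ae lfe, forall x, covered C x}.
  exists (~` covered C); split => //; [exact: measurable_uncovered|exact: lfe_uncovered].
by apply: ae_imply2 aeP => x Px /Px.
Qed.

(** A continuous function is its own version, because m has full support. *)
Lemma represents_continuous u v D : continuous u -> represents m C lam u v D ->
  represents m C lam u u D.
Proof.
move=> cu h.
have uv n : indices C n -> forall x, itv C n x -> u x = v x.
  move=> Cn; apply: (continuous_ae_eq (m := m) (carries_itv hC Cn) (m_is_supported H)).
  - by move=> x nx; apply: cvg_within_filter; exact: cu.
  - exact: (increments_continuous (carries_scale hC Cn)
      (carries_cc hC Cn) (represents_density_L2 h) (represents_increments h Cn)).
  - by apply: ae_imply (represents_ae h) => x ->.
split.
- exact: represents_L2 h.
- by apply: aeW.
- exact: represents_density_L2 h.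
- exact: represents_density0 h.
- by move=> n Cn x y nx ny xy; 
  rewrite (uv n Cn x nx) (uv n Cn y ny); exact: (represents_increments h Cn).
- move=> n Cn; have [bl bu] := represents_boundary h Cn.
  split => e1 e2 e3.
    apply: cvg_trans (bl e1 e2 e3); apply: near_eq_cvg.
    by apply: filterS (lowerNy_near (carries_itv hC Cn) e1) => x /(uv n Cn) ->.
  apply: cvg_trans (bu e1 e2 e3); apply: near_eq_cvg.
  by apply: filterS (uppery_near (carries_itv hC Cn) e1) => x /(uv n Cn) ->.
Qed.

Record test_function (phi psi : R -> R) : Prop := {
  test_smooth : smooth phi ;
  test_compact : compact (closure [set y | phi y != 0]) ;
  test_range : closure [set y | phi y != 0] `<=` range f ;
  test_derive : forall t : R, is_derive t 1 phi (psi t) ;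
  test_derive_continuous : continuous psi }.

Lemma composed_test_functionP u : composed_test_functions f u ->
  exists phi psi, test_function phi psi /\ u = phi \o f.
Proof.
move=> [phi [sphi cphi rphi] <-]; exists phi, (derive1 phi); split => //; split => //.
  by move=> t; rewrite derive1E; apply: derivableP; have := sphi 0%N t; rewrite derive1n0.
move=> t; apply: differentiable_continuous; apply/derivable1_diffP.
by have := sphi 1%N t; rewrite derive1n1.
Qed.

(** The density of phi o f: by comparison of the increments on the intervals,
    D lam = phi'(f) lf there, and the right-hand side lives on N, where lbar = g lfe. *)
Record test_density (phi psi D : R -> R) : Prop := {
  test_represents : represents m C lam (phi \o f) (phi \o f) D ;
  test_density_off : {ae lam, forall x, ~ N x -> D x = 0} ;
  test_density_on : {ae lfe, forall x, ((D x)%:E * g x = (psi (f x))%:E)%E} }.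

(** On compact subintervals D lam and psi(f) lf have the same integrals over all Borel sets.
    Outside of N the second measure vanishes; on N it is compared with D lbar = D g lfe. *)
Lemma test_density_exists phi psi : test_function phi psi -> exists D, test_density phi psi D.
Proof.
move=> tp; have [v [D hv]] : exists v D, represents m C lam (phi \o f) v D.
  apply/(represented_domainP m hC); apply: (f_test H).
  by exists phi => //; split; [exact: test_smooth tp|exact: test_compact tp|exact: test_range tp].
have cphi : continuous (phi \o f).
  move=> x; apply: continuous_comp; first exact: (f_continuous H).
  exact: (smooth_continuous (test_smooth tp)).
have h := represents_continuous cphi hv; exists D.
have D2 := represents_density_L2 h.
have mD := Lfun2_measurable D2.
have cpsi : continuous (psi \o f).
  move=> x; apply: continuous_comp; first exact: (f_continuous H).
  exact: (test_derive_continuous tp).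
have mpsi : measurable_fun setT (EFin \o (psi \o f) : M -> _).
  by apply/measurable_EFinP; exact: continuous_measurable_fun.
have inc x y : x <= y -> lf.-integrable `[x, y] (EFin \o (psi \o f)) /\
    phi (f y) - phi (f x) = \int[lf]_(z in `[x, y]) psi (f z).
  move=> xy; split; first exact: (comp_integrable (f_continuous H) x y (test_derive_continuous tp)).
  exact: (comp_increment (f_increasing H) (f_continuous H) (f_zero H) xy
    (test_derive tp) (test_derive_continuous tp)).
have iD n x y : indices C n -> itv C n x -> itv C n y -> x <= y ->
    lam.-integrable `[x, y] (EFin \o D).
  by move=> Cn nx ny xy; exact: (Lfun2_integrable_cc (carries_cc hC Cn)).
have eqA n x y : indices C n -> itv C n x -> itv C n y -> x <= y ->
    forall A : set M, measurable A -> A `<=` `[x, y]%classic ->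
    (\int[lam]_(z in A) (D z)%:E = \int[lf]_(z in A) (psi (f z))%:E)%E.
  move=> Cn nx ny xy A mA; apply: (cc_integral_unique (iD _ _ _ Cn nx ny xy) (inc x y xy).1) => //.
  move=> z /andP[xz zy]; have nz : itv C n z by apply: (carries_itv hC Cn).1 nx ny _ _; rewrite xz.
  rewrite RintegralE//; last exact: iD Cn nz ny zy.
  rewrite RintegralE//; last exact: (inc z y zy).1.
  by rewrite -(inc z y zy).2 -(represents_increments h Cn nz ny zy).
have offN : {ae lam, forall x, ~ N x -> D x = 0}.
  have : {ae lam, forall x, covered C x -> ~ N x -> D x = 0}.
    apply: ae_covered => n Cn; apply: ae_exhaustion; first exact: (carries_itv hC Cn).1.
    move=> x y nx ny xy; pose K : set M := `[x, y]%classic `&` ~` N.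
    have mK : measurable K by apply: measurableI; [exact: measurable_itv|exact: measurableC].
    have iK : lam.-integrable K (EFin \o D).
      by apply: integrableS (iD _ _ _ Cn nx ny xy) => //; exact: subIsetl.
    have : ae_eq lam K (EFin \o D) (cst 0%E).
      apply: integral_ae_eq => // E EK mE; rewrite integral0.
      rewrite (eqA _ _ _ Cn nx ny xy)//; last by move=> z /EK[].
      apply: null_set_integral => //; first exact: measurable_funTS.
      apply/eqP; rewrite eq_le measure_ge0 andbT -lfe_covered.
        rewrite -(N_total H); apply: le_measure; rewrite ?inE//; first exact: measurableC.
        by move=> z /EK[].
      move=> z /EK[/=]; rewrite in_itv/= => xzy _; exists n => //.
      exact: (carries_itv hC Cn).1 nx ny _ xzy.
    by apply: ae_imply => z Kz zxy nN; have [] := Kz (conj zxy nN).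
  apply: ae_imply => x; have [cx /(_ cx)//|ncx _ _] := pselect (covered C x).
  exact: (represents_density0 h).
split => //; apply: ae_lfe_covered; apply: ae_covered => n Cn.
apply: ae_exhaustion; first exact: (carries_itv hC Cn).1.
move=> x y nx ny xy.
have mcc : measurable (`[x, y]%classic : set M) by exact: measurable_itv.
have ccov : `[x, y]%classic `<=` covered C.
  move=> z; rewrite /= in_itv/= => xzy; exists n => //.
  exact: (carries_itv hC Cn).1 nx ny _ xzy.
have mcD (E : set M) : measurable_fun E (EFin \o D).
  by apply/measurable_EFinP; exact: measurable_funTS.
have ibar : lbar.-integrable `[x, y] (EFin \o D).
  apply/integrable_lbar => //; first exact: measurable_funTS.
  apply: (le_integrable _ _ _ (iD _ _ _ Cn nx ny xy)) => //.
    apply/measurable_EFinP; apply: measurable_funTS.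
    by apply/(measurable_restrictT _ mN); exact: measurable_funTS.
  move=> z _; rewrite /= lee_fin patchE; case: ifPn => // _.
  by rewrite normr0.
apply: (integral_ae_eq (g := EFin \o (psi \o f)) mcc).
- by apply/(integrable_density (measurable_g H) (g_ge0 H) (lbar_g H)).
- exact: measurable_funTS.
move=> E Exy mE.
rewrite -(integral_density (measurable_g H) (g_ge0 H) (lbar_g H))//.
rewrite integral_lbar//; last exact: measurable_funTS.
transitivity (\int[lf]_(z in E) (psi (f z))%:E)%E.
  rewrite -(eqA _ _ _ Cn nx ny xy)//; apply: ae_eq_rintegral => //.
    apply/measurable_EFinP; apply: measurable_funTS.
    by apply/(measurable_restrictT _ mN); exact: measurable_funTS.
  apply: ae_imply offN => z; rewrite patchE; case: ifPn => // /negP nz ->//.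
  by move=> Nz; apply: nz; rewrite inE.
apply: eq_measure_integral => A mA AE; rewrite lfe_covered//.
exact: subset_trans AE (subset_trans Exy ccov).
Qed.

End decomposed_scale.


(** * Construction of test functions *)

Lemma Rintegral_gt0 d (T : measurableType d) (R : realType)
    (mu : {measure set T -> \bar R}) (A B : set T) (F : T -> R) :
  measurable A -> measurable B -> B `<=` A -> (0 < mu B)%E ->
  mu.-integrable A (EFin \o F) ->
  (forall x, A x -> 0 <= F x) -> (forall x, B x -> 0 < F x) ->
  0 < \int[mu]_(x in A) F x.
Proof.
move=> mA mB BA B0 iF F0 FB; rewrite lt_neqAle Rintegral_ge0// andbT.
apply/eqP => I0; move: B0; apply/negP; rewrite -leNgt.
have mF := measurable_int _ iF.
have : (\int[mu]_(x in A) `|(EFin \o F) x| = 0)%E.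
  rewrite (_ : (\int[mu]_(x in A) `|(EFin \o F) x| = \int[mu]_(x in A) (F x)%:E)%E).
    by rewrite RintegralE// -I0.
  by apply: eq_integral => x /set_mem Ax; rewrite /= ger0_norm ?F0.
move/(ae_eq_integral_abs mu mA mF) => [Z [mZ Z0 ZP]].
rewrite -Z0; apply: le_measure; rewrite ?inE// => x Bx; apply: ZP => /= /(_ (BA x Bx)).
by move=> -[] /eqP; rewrite gt_eqF// FB.
Qed.

Section test_function_supply.
Context {R : realType}.
Local Notation M := (measurableTypeR R).
Local Notation leb := (@lebesgue_measure R).
Variables (m : {measure set M -> \bar R}) (C : @itv_family R)
  (C_eff : effective_intervals C) (f : cumulative R R)
  (lbar : {measure set M -> \bar R}) (N : set M) (g : M -> \bar R).
Hypothesis H : decomposed m C_eff f lbar N g.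

Local Notation lf := (lebesgue_stieltjes_measure f : {measure set M -> \bar R}).
Local Notation lfe := (mrestr lf (measurable_covered C_eff)
  : {measure set M -> \bar R}).

Let flt := f_lt (f_increasing H) (f_continuous H) (f_zero H).
Let fle := f_le (f_increasing H) (f_continuous H) (f_zero H).

Lemma f_cc_range (c d : R) : `[f c, f d]%classic `<=` range f.
Proof.
exact: (scale_image_cc whole_line_nondegenerate.1
  (whole_line_scale (f_increasing H) (f_continuous H) (f_zero H))).
Qed.

(** Compactness of the support, and its inclusion in the range of f, come from the fact that
    the primitive vanishes off [f c, f d]. *)
Lemma primitive_test_function (psi : R -> R) (c d : R) : c <= d -> smooth psi ->
  (forall t, ~ (f c < t < f d) -> psi t = 0) ->
  \int[leb]_(t in `[f c, f d]) psi t = 0 ->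
  exists2 phi, test_function f phi psi & forall t, ~ (f c < t < f d) -> phi t = 0.
Proof.
move=> cd spsi psi0 I0.
have [|phi [dphi phi0]] := compact_primitive _ (smooth_continuous spsi) psi0 I0.
  by rewrite fle.
have sub : closure [set y | phi y != 0] `<=` `[f c, f d]%classic.
  rewrite (closure_id `[f c, f d]%classic).1; last exact: itv_closed.
  apply: closure_subset => t /= t0; rewrite in_itv/=; apply: contrapT => nt.
  move/eqP: t0; apply; apply: phi0 => /andP[h1 h2]; apply: nt.
  by rewrite (ltW h1) (ltW h2).
exists phi => //; split => //.
- exact: smooth_primitive dphi spsi.
- apply: (subclosed_compact _ (@segment_compact _ (f c) (f d))) => //.
  exact: closed_closure.
- exact: subset_trans sub (@f_cc_range _ _).
- exact: smooth_continuous spsi.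
Qed.

Lemma continuous_integrable_cc (psi : R -> R) (a b : R) : continuous psi ->
  leb.-integrable `[a, b] (EFin \o psi).
Proof.
move=> cpsi; apply: continuous_compact_integrable; first exact: segment_compact.
exact: continuous_subspaceT.
Qed.

Lemma bump_continuous n a b : continuous (@bump R n a b).
Proof. exact/smooth_continuous/bump_class_smooth/bump_class_bump. Qed.

Lemma integral_bump_gt0 (a b c d : R) : c <= a -> a < b -> b <= d ->
  0 < \int[leb]_(t in `[c, d]) bump 1 a b t.
Proof.
move=> ca ab bd; apply: (@Rintegral_gt0 _ M R leb _ (`]a, b[%classic : set M)) => //.
- move=> t; rewrite /= !in_itv/= => /andP[h1 h2].
  by rewrite (le_trans ca (ltW h1)) (le_trans (ltW h2) bd).
- have := lebesgue_measure_itv `]a, b[; rewrite /= lte_fin ab => e.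
  by rewrite [X in (_ < X)%E]e -EFinB lte_fin subr_gt0.
- exact/continuous_integrable_cc/bump_continuous.
- by move=> t _; have /andP[] := bump_itv 1 a b t.
- by move=> t; rewrite /= in_itv/= => /bump_gt0; apply.
Qed.

(** A bump on ]f x, f y[, minus a multiple of a bump on ]f y, f (y + 1)[ that makes the
    integral zero, is the derivative of a test function. *)
Lemma increasing_test_function (x y : R) : x < y ->
  exists phi psi, test_function f phi psi /\ forall t, f x < t < f y -> 0 < psi t.
Proof.
move=> xy; pose z := y + 1; have yz : y < z by rewrite ltrDl.
have fxy : f x < f y by rewrite flt.
have fyz : f y < f z by rewrite flt.
pose b1 := bump 1 (f x) (f y); pose b2 := bump 1 (f y) (f z).
have c1 : continuous b1 by exact: bump_continuous.
have c2 : continuous b2 by exact: bump_continuous.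
pose I1 := \int[leb]_(t in `[f x, f z]) b1 t.
pose I2 := \int[leb]_(t in `[f x, f z]) b2 t.
have I20 : 0 < I2 by apply: integral_bump_gt0 => //; exact: ltW.
pose psi := (cst I2 \* b1) \+ (cst (- I1) \* b2).
have spsi : smooth psi.
  apply: bump_class_smooth; apply: bump_add; apply: bump_mul; try exact: bump_cst.
    exact: bump_class_bump.
  exact: bump_class_bump.
have [|||phi tp _] := @primitive_test_function psi x z _ spsi.
- by rewrite ltW// (lt_trans xy).
- move=> t nt; rewrite /psi /b1 /b2 /= !bump_out ?mulr0 ?addr0// => /andP[h1 h2]; apply: nt.
    by rewrite h2 andbT (lt_trans fxy).
  by rewrite h1/= (lt_trans h2).
- have i1 := @continuous_integrable_cc b1 (f x) (f z) c1.
  have i2 := @continuous_integrable_cc b2 (f x) (f z) c2.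
  rewrite /psi /= RintegralD//; try by apply: integrable_realZ.
  by rewrite !RintegralZl// -/I1 -/I2; ring.
exists phi, psi; split => // t txy; rewrite /psi /= /b2 bump_out; last first.
  by move/andP: txy => [_ h] /andP[h' _]; have := lt_trans h h'; rewrite ltxx.
by rewrite mulr0 addr0 mulr_gt0// bump_gt0.
Qed.

(** On a null set of lbar the density g vanishes lfe-almost everywhere; but for a test
    function with positive derivative, D g = psi(f) shows that g does not vanish. *)
Lemma lbar_lfe_null (A : set M) : measurable A -> lbar A = 0%E -> lfe A = 0%E.
Proof.
move=> mA A0.
have aeg : {ae lfe, forall x, A x -> g x = 0%E}.
  have : (\int[lfe]_(x in A) `|g x| = 0)%E.
    by rewrite -[RHS]A0 (lbar_g H mA); apply: eq_integral => x _; rewrite gee0_abs// (g_ge0 H).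
  by move/(ae_eq_integral_abs lfe mA (measurable_funTS (measurable_g H))).
have : {ae lfe, forall x, forall n : nat, - n%:R < x < n%:R -> ~ A x}.
  apply: ae_foralln => -[|n]; first by apply: aeW => x; rewrite oppr0 => /andP[/lt_trans h /h]; rewrite ltxx.
  have [|phi [psi [tp psi0]]] := @increasing_test_function (- n.+1%:R) n.+1%:R.
    by rewrite gtrN// ltr0n.
  have [D hD] := test_density_exists H tp.
  apply: ae_imply2 aeg (test_density_on hD) => x gx /[swap] xn /[swap] /gx ->.
  rewrite mule0 => -[] /eqP; apply/negP; rewrite lt_eqF//; apply: psi0.
  by rewrite !flt.
have : {ae lfe, forall x, ~ A x} -> lfe A = 0%E.
  case=> B [mB B0 AB]; apply/eqP; rewrite eq_le measure_ge0 andbT -B0.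
  apply: le_measure; rewrite ?inE// => x Ax; apply: AB => /=; apply.
  exact: Ax.
move=> fin aeA; apply: fin; apply: ae_imply aeA => x h Ax.
by have [n xn] := nat_itvP x; exact: h xn Ax.
Qed.

Lemma ae_lfe (P : R -> Prop) : {ae lbar, forall x, P x} -> {ae lfe, forall x, P x}.
Proof. by move=> [A [mA A0 PA]]; exists A; split => //; exact: lbar_lfe_null. Qed.

Lemma test_pairing phi psi D E (A : set M) : test_density m C_eff f N g phi psi D ->
  test_function f phi psi -> measurable A ->
  E \in Lfun lbar 2%:E ->
  lfe.-integrable A (fun x => (E x * psi (f x))%:E) /\
  (\int[lbar]_(x in A) (E x * D x)%:E = \int[lfe]_(x in A) (E x * psi (f x))%:E)%E.
Proof.
move=> hD tp mA E2.
have D2 := Lfun2_lbar H (represents_density_L2 (test_represents hD)).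
have mE := Lfun2_measurable E2; have mD := Lfun2_measurable D2.
have mED : measurable_fun A (fun x : M => (E x * D x)%:E).
  by apply/measurable_EFinP; apply: measurable_funTS; exact: measurable_funM.
have cpsi : continuous (psi \o f).
  move=> x; apply: continuous_comp; first exact: (f_continuous H).
  exact: (test_derive_continuous tp).
have mpsi : measurable_fun setT (psi \o f : M -> M) by exact: continuous_measurable_fun.
have mEp : measurable_fun A (fun x : M => (E x * psi (f x))%:E).
  by apply/measurable_EFinP; apply: measurable_funTS; exact: measurable_funM.
have aeq : {ae lfe, forall x, ((E x * D x)%:E * g x = (E x * psi (f x))%:E)%E}.
  by apply: ae_imply (test_density_on hD) => x e; rewrite EFinM -muleA e.
have mEDg : measurable_fun A (fun x : M => ((E x * D x)%:E * g x)%E).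
  by apply: emeasurable_funM => //; apply: measurable_funTS; exact: measurable_g H.
split; last first.
  rewrite (integral_density (measurable_g H) (g_ge0 H) (lbar_g H))//.
  exact: ae_eq_rintegral.
have : lfe.-integrable A (fun x => ((E x * D x)%:E * g x)%E).
  apply/(integrable_density (measurable_g H) (g_ge0 H) (lbar_g H)) => //.
  by apply: (@integrableS _ _ _ _ setT) => //; exact: Lfun2M.
apply: ae_eq_integrable => //; by apply: ae_imply aeq => x ->.
Qed.

(** There is a test function with derivative bounded below on [x, y]. The product of E with
    its density D is lbar-integrable, and D lbar dominates a multiple of the measure of f on
    the intervals. *)
Lemma Lfun2_lbar_integrable E x y : E \in Lfun lbar 2%:E ->
  lfe.-integrable `[x, y] (EFin \o E).
Proof.
move=> E2; have [xy|yx] := leP x y; last first.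
  rewrite set_itv_ge; last by rewrite bnd_simp -ltNge.
  by apply/integrableP; split; [exact: measurable_fun_set0|rewrite integral_set0].
have [|phi [psi [tp psi0]]] := @increasing_test_function (x - 1) (y + 1); first by lra.
have [D hD] := test_density_exists H tp.
have mcc : measurable (`[x, y]%classic : set M) by exact: measurable_itv.
have [iE _] := test_pairing hD tp mcc E2.
have cpsi : continuous (psi \o f).
  move=> z; apply: continuous_comp; first exact: (f_continuous H).
  exact: (test_derive_continuous tp).
have [z zxy zmin] := EVT_min xy (continuous_subspaceT cpsi).
have K0 : 0 < psi (f z).
  apply: psi0; rewrite !flt; move: zxy; rewrite in_itv/= => /andP[h1 h2].
  by apply/andP; split; lra.
set K := psi (f z) in K0.
have mE := Lfun2_measurable E2.
apply: (le_integrable mcc _ _ (integrable_realZ mcc K^-1 iE)) => //.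
  by apply/measurable_EFinP; exact: measurable_funTS.
move=> t txy; rewrite /= lee_fin mulrCA normrM ler_peMr// ger0_norm.
  by rewrite -(mulVf (lt0r_neq0 K0)) ler_wpM2l ?invr_ge0 ?(ltW K0)//; apply: zmin.
rewrite mulr_ge0 ?invr_ge0 ?(ltW K0)// (le_trans (ltW K0))//; exact: zmin.
Qed.

End test_function_supply.


(** * Boundary values of scale functions *)

Section interval_points.
Context {R : realType}.
Local Notation M := (measurableTypeR R).

Lemma between_interval (J : set R) (x : R) : is_interval J ->
  (lower J < x%:E < upper J)%E -> J x.
Proof.
move=> iJ /andP[/ereal_inf_lt[_ [y Jy <-]] + /ereal_sup_gt[_ [z Jz <-]]].
by rewrite !lte_fin => yx xz; apply: (iJ y z) => //; rewrite !ltW.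
Qed.

Lemma interval_between (J : set R) (x : R) : J x -> (lower J <= x%:E <= upper J)%E.
Proof.
by move=> Jx; rewrite ereal_inf_lbound ?ereal_sup_ubound//; exists x.
Qed.

Lemma fixed_point_between (a b : \bar R) : (a < b)%E -> (a < (fixed_point a b)%:E < b)%E.
Proof.
case: a b => [a| |] [b| |] //=; rewrite ?lte_fin ?ltry ?ltNyr//.
- by move=> ab; rewrite !(midf_lt ab).
- by move=> _; rewrite andbT ltrDl.
- by move=> _; rewrite ltrBlDr ltrDl ltr01.
Qed.

Lemma itv_point_in (J : set R) : nondegenerate_interval J -> J (itv_point J).
Proof. by move=> [iJ J0]; apply: between_interval => //; exact: fixed_point_between. Qed.

Lemma measure_interval_le (mu : {measure set M -> \bar R}) (J : set R) (K : \bar R) :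
  is_interval J -> (0 <= K)%E ->
  (forall x y, J x -> J y -> x <= y -> (mu `[x, y]%classic <= K)%E) -> (mu J <= K)%E.
Proof.
move=> iJ K0 muK; have [[x0 Jx0]|J0] := pselect (J !=set0); last first.
  have -> : J = set0 by apply/seteqP; split => // x Jx; apply: J0; exists x.
  by rewrite measure0.
have [a [b [ab nd JE]]] := interval_exhaustion iJ Jx0.
have c := nondecreasing_cvg_mu (mu := mu) (fun n => measurable_cc (a n) (b n)) _ nd.
rewrite JE -(cvg_lim _ (c _))//; last first.
  by rewrite -JE; exact: is_interval_measurable.
apply: lime_le; first by apply/cvg_ex; eexists; apply: c; rewrite -JE; exact: is_interval_measurable.
by apply: nearW => n /=; have [Ja Jb an bn] := ab n; exact: muK Ja Jb (le_trans an bn).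
Qed.

Lemma small_step (w t : R) : 0 < w -> 0 < t -> exists n : nat, w / n.+1%:R < t.
Proof.
move=> w0 t0; have wt : 0 < t / w by exact: divr_gt0.
have [n _ Pn] := near_infty_natSinv_lt (PosNum wt).
exists n; have := Pn n (leqnn n); rewrite /= => h.
by move: h; rewrite ltr_pdivlMr// mulrC.
Qed.

Lemma nonincreasing_null (mu : {measure set M -> \bar R}) (F : nat -> set M) (A : set M) :
  (forall n, measurable (F n)) -> nonincreasing_seq F -> (mu (F 0%N) < +oo)%E ->
  \bigcap_n F n = A -> mu A = 0%E ->
  forall e : R, 0 < e -> exists n, (mu (F n) < e%:E)%E.
Proof.
move=> mF ni fin FI A0 e e0; have mA : measurable A by rewrite -FI; exact: bigcap_measurable.
 apply: contrapT => nF.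
have cv := nonincreasing_cvg_mu (mu := mu) fin mF _ ni.
rewrite FI A0 in cv; have {}cv := cv mA.
have : (e%:E <= 0%R)%E; last by rewrite lee_fin leNgt e0.
rewrite -(cvg_lim _ cv)//; apply: lime_ge; first by apply/cvg_ex; exists 0%E.
by apply: nearW => n /=; rewrite leNgt; apply/negP => h; apply: nF; exists n.
Qed.

(** Continuity from above at a point that is not an atom. *)
Lemma atomless_right (mu : {measure set M -> \bar R}) (x z : R) : x < z ->
  (mu `[x, z]%classic < +oo)%E -> mu [set x] = 0%E ->
  forall e : R, 0 < e -> exists2 d : R, 0 < d & (mu `[x, (x + d)%R]%classic < e%:E)%E.
Proof.
move=> xz fin x0 e e0; have d0 n : 0 < (z - x) / n.+1%:R by rewrite divr_gt0 ?subr_gt0 ?ltr0n.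
pose F n : set M := `[x, x + (z - x) / n.+1%:R]%classic.
have [||||n Fn] := @nonincreasing_null mu F [set x] _ _ _ _ x0 e e0.
- by move=> n; exact: measurable_itv.
- move=> i j ij; apply/subsetPset => t; rewrite /F /= !in_itv/= => /andP[-> h].
  apply: le_trans h _; rewrite lerD2l ler_wpM2l ?subr_ge0 ?(ltW xz)//.
  by rewrite lef_pV2 ?posrE ?ltr0n// ler_nat.
- by rewrite /F divr1 addrC subrK.
- apply/seteqP; split => [t Ft|t -> n _]; last first.
    by rewrite /F /= in_itv/= lexx lerDl ltW.
  have := Ft 0%N I; rewrite /F /= in_itv/= => /andP[xt _].
  apply/eqP; rewrite eq_le xt andbT leNgt; apply/negP => tx.
  have [||n hn] := @small_step (z - x) (t - x); rewrite ?subr_gt0//.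
  have := Ft n I; rewrite /F /= in_itv/= => /andP[_].
  by move: hn; set w := _ / _ => *; lra.
by exists ((z - x) / n.+1%:R).
Qed.

Lemma atomless_left (mu : {measure set M -> \bar R}) (x z : R) : z < x ->
  (mu `[z, x]%classic < +oo)%E -> mu [set x] = 0%E ->
  forall e : R, 0 < e -> exists2 d : R, 0 < d & (mu `[(x - d)%R, x]%classic < e%:E)%E.
Proof.
move=> zx fin x0 e e0; have d0 n : 0 < (x - z) / n.+1%:R by rewrite divr_gt0 ?subr_gt0 ?ltr0n.
pose F n : set M := `[x - (x - z) / n.+1%:R, x]%classic.
have [||||n Fn] := @nonincreasing_null mu F [set x] _ _ _ _ x0 e e0.
- by move=> n; exact: measurable_itv.
- move=> i j ij; apply/subsetPset => t; rewrite /F /= !in_itv/= => /andP[h ->].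
  rewrite andbT; apply: le_trans h; rewrite lerD2l lerN2 ler_wpM2l ?subr_ge0 ?(ltW zx)//.
  by rewrite lef_pV2 ?posrE ?ltr0n// ler_nat.
- by rewrite /F divr1 subKr.
- apply/seteqP; split => [t Ft|t -> n _]; last first.
    by rewrite /F /= in_itv/= lexx andbT gerBl ltW.
  have := Ft 0%N I; rewrite /F /= in_itv/= => /andP[_ tx].
  apply/eqP; rewrite eq_le tx/= leNgt; apply/negP => xt.
  have [||n hn] := @small_step (x - z) (x - t); rewrite ?subr_gt0//.
  have := Ft n I; rewrite /F /= in_itv/= => /andP[+ _].
  by move: hn; set w := _ / _ => *; lra.
by exists ((x - z) / n.+1%:R).
Qed.

Section monotone_limits.
Variables (F : set_system R) (D : set R) (s : R -> R).
Context {FF : ProperFilter F}.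
Hypothesis FD : F D.

Lemma lim_ereal_sup : (forall x, D x -> \forall y \near F, s x <= s y) ->
  lim ((s x)%:E @[x --> F]) = ereal_sup [set (s x)%:E | x in D].
Proof.
move=> ms; apply: cvg_lim => //; set S := ereal_sup _.
have ub x : D x -> ((s x)%:E <= S)%E by move=> Dx; apply: ereal_sup_ubound; exists x.
have lb z : (z%:E < S)%E -> \forall y \near F, z < s y.
  move=> /ereal_sup_gt[_ [x Dx <-]]; rewrite lte_fin => zx.
  by apply: filterS (ms x Dx) => y; exact: lt_le_trans.
case E : S ub lb => [l| |] ub lb.
- apply/fine_cvgP; split; first exact: nearW.
  apply/cvgrPdist_lt => e e0; near=> x; rewrite /= ltr_norml.
  have : s x <= l by rewrite -lee_fin; apply: ub; near: x.
  have : l - e < s x by near: x; apply: lb; rewrite lte_fin ltrBlDr ltrDl.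
  by move=> *; lra.
- apply/cvgeyPgt => A; near=> x; rewrite lte_fin; near: x; apply: lb; exact: ltry.
- have [x Dx] : D !=set0 := filter_ex FD.
  by have := ub x Dx; rewrite leeNy_eq.
Unshelve. all: by end_near. Qed.

Lemma lim_ereal_inf : (forall x, D x -> \forall y \near F, s y <= s x) ->
  lim ((s x)%:E @[x --> F]) = ereal_inf [set (s x)%:E | x in D].
Proof.
move=> ms; apply: cvg_lim => //; set S := ereal_inf _.
have lb x : D x -> (S <= (s x)%:E)%E by move=> Dx; apply: ereal_inf_lbound; exists x.
have ub z : (S < z%:E)%E -> \forall y \near F, s y < z.
  move=> /ereal_inf_lt[_ [x Dx <-]]; rewrite lte_fin => zx.
  by apply: filterS (ms x Dx) => y yx; exact: le_lt_trans yx zx.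
case E : S ub lb => [l| |] ub lb.
- apply/fine_cvgP; split; first exact: nearW.
  apply/cvgrPdist_lt => e e0; near=> x; rewrite /= ltr_norml.
  have : l <= s x by rewrite -lee_fin; apply: lb; near: x.
  have : s x < l + e by near: x; apply: ub; rewrite lte_fin ltrDl.
  by move=> *; lra.
- have [x Dx] : D !=set0 := filter_ex FD.
  by have := lb x Dx; rewrite leye_eq.
- apply/cvgeNyPlt => A; near=> x; rewrite lte_fin; near: x; apply: ub; exact: ltNyr.
Unshelve. all: by end_near. Qed.

End monotone_limits.

Lemma up_to_proper (b : \bar R) : b != -oo%E -> ProperFilter (up_to b).
Proof. by case: b => [b| |] // _; rewrite /up_to; exact: _. Qed.

Lemma down_to_proper (a : \bar R) : a != +oo%E -> ProperFilter (down_to a).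
Proof. by case: a => [b| |] // _; rewrite /down_to; exact: _. Qed.

Lemma up_to_near (b : \bar R) (x : R) : (x%:E < b)%E ->
  up_to b [set y | x < y /\ (y%:E < b)%E].
Proof.
case: b => [b| |] //=; rewrite ?lte_fin => xb.
- near=> y; split; last by rewrite lte_fin; near: y; exact: nbhs_left_lt.
  by near: y; exact: nbhs_left_gt.
- near=> y; split; last by rewrite ltry.
  by near: y; apply: nbhs_pinfty_gt; exact: num_real.
Unshelve. all: by end_near. Qed.

Lemma down_to_near (a : \bar R) (x : R) : (a < x%:E)%E ->
  down_to a [set y | y < x /\ (a < y%:E)%E].
Proof.
case: a => [a| |] //=; rewrite ?lte_fin => xa.
- near=> y; split; last by rewrite lte_fin; near: y; exact: nbhs_right_gt.
  by near: y; exact: nbhs_right_lt.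
- near=> y; split; last by rewrite ltNyr.
  by near: y; apply: nbhs_ninfty_lt; exact: num_real.
Unshelve. all: by end_near. Qed.

Lemma lower_upper_sandwich (I : set R) (a b : \bar R) : (a < b)%E ->
  (forall x : R, (a < x%:E < b)%E -> I x) -> (forall x, I x -> (a <= x%:E <= b)%E) ->
  lower I = a /\ upper I = b.
Proof.
move=> ab aI Ia; split; apply/eqP; rewrite eq_le; apply/andP; split.
- rewrite leNgt; apply/negP => al.
  have /fixed_point_between/andP[] : (a < Order.min (lower I) b)%E by rewrite lt_min al.
  set p := fixed_point _ _; rewrite lt_min => ap /andP[pl pb].
  have /interval_between/andP[+ _] : I p by apply: aI; rewrite ap.
  by rewrite leNgt pl.
- by apply: le_ereal_inf_tmp => _ [x /Ia/andP[ax _] <-].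
- by apply: ub_ereal_sup => _ [x /Ia/andP[_ ax] <-].
- rewrite leNgt; apply/negP => ub.
  have /fixed_point_between/andP[] : (Order.max a (upper I) < b)%E by rewrite gt_max ab.
  set p := fixed_point _ _; rewrite gt_max => /andP[ap up] pb.
  have /interval_between/andP[_] : I p by apply: aI; rewrite ap.
  by rewrite leNgt up.
Qed.

(** The boundary value of a nondecreasing function is its supremum. *)
Lemma upper_value_lty (c : R) (b : \bar R) (s : R -> R) : (c%:E < b)%E ->
  (forall x y, c < x -> x <= y -> (y%:E < b)%E -> s x <= s y) ->
  (upper_value b s < +oo)%E <-> exists K, forall x, c < x -> (x%:E < b)%E -> s x <= K.
Proof.
move=> cb ms; have bN : b != -oo%E by apply: contraTneq cb => ->; rewrite -leNgt leNye.
have FF := up_to_proper bN.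
rewrite /upper_value (lim_ereal_sup (D := [set y | c < y /\ (y%:E < b)%E]))//; last 2 first.
- exact: up_to_near.
- move=> x [cx xb]; have := up_to_near xb; apply: filterS => y [xy yb].
  by apply: ms => //; exact: ltW.
split=> [Sy|[K KP]].
  have [x [cx xb]] : [set y | c < y /\ (y%:E < b)%E] !=set0 := filter_ex (up_to_near cb).
  set S := ereal_sup _ in Sy.
  have ub z : c < z -> (z%:E < b)%E -> ((s z)%:E <= S)%E.
    by move=> cz zb; apply: ereal_sup_ubound; exists z.
  exists (fine S) => z cz zb; rewrite -lee_fin fineK ?ub//.
  by rewrite fin_numElt Sy andbT (lt_le_trans _ (ub x cx xb))// ltNyr.
apply: (@le_lt_trans _ _ K%:E); last exact: ltry.
by apply: ub_ereal_sup => _ [x [cx xb] <-]; rewrite lee_fin KP.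
Qed.

Lemma lower_value_ltNy (c : R) (a : \bar R) (s : R -> R) : (a < c%:E)%E ->
  (forall x y, (a < x%:E)%E -> x <= y -> y < c -> s x <= s y) ->
  (-oo < lower_value a s)%E <-> exists K, forall x, (a < x%:E)%E -> x < c -> K <= s x.
Proof.
move=> ac ms; have aN : a != +oo%E by apply: contraTneq ac => ->; rewrite -leNgt leey.
have FF := down_to_proper aN.
rewrite /lower_value (lim_ereal_inf (D := [set y | y < c /\ (a < y%:E)%E]))//; last 2 first.
- exact: down_to_near.
- move=> x [xc ax]; have := down_to_near ax; apply: filterS => y [yx ay].
  by apply: ms => //; exact: ltW.
split=> [Sy|[K KP]].
  have [x [xc ax]] : [set y | y < c /\ (a < y%:E)%E] !=set0 := filter_ex (down_to_near ac).
  set S := ereal_inf _ in Sy.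
  have lb z : z < c -> (a < z%:E)%E -> (S <= (s z)%:E)%E.
    by move=> cz zb; apply: ereal_inf_lbound; exists z.
  exists (fine S) => z cz zb; rewrite -lee_fin fineK ?lb//.
  by rewrite fin_numElt Sy/= (le_lt_trans (lb x xc ax))// ltry.
apply: (@lt_le_trans _ _ K%:E); first exact: ltNyr.
by apply: le_ereal_inf_tmp => _ [x [cx xb] <-]; rewrite lee_fin KP.
Qed.

Section boundary_values.
Variables (a b : \bar R) (c : R) (s : R -> R) (mu : {measure set M -> \bar R}).
Hypotheses (ac : (a < c%:E)%E) (cb : (c%:E < b)%E).
Hypothesis mu_cc : forall x y : R, (a < x%:E)%E -> x <= y -> (y%:E < b)%E ->
  mu `[x, y]%classic = (s y - s x)%:E.

Let s_le x y : (a < x%:E)%E -> x <= y -> (y%:E < b)%E -> s x <= s y.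
Proof. by move=> ax xy yb; rewrite -subr_ge0 -lee_fin -mu_cc//; exact: measure_ge0. Qed.

Lemma upper_half_interval : is_interval [set x | c <= x /\ (x%:E < b)%E].
Proof.
move=> x y [cx _] [_ yu] z /andP[xz zy]; split; first exact: le_trans cx xz.
by apply: le_lt_trans yu; rewrite lee_fin.
Qed.

Lemma lower_half_interval : is_interval [set x | x <= c /\ (a < x%:E)%E].
Proof.
move=> x y [_ xl] [cy _] z /andP[xz zy]; split; first exact: le_trans zy cy.
by apply: lt_le_trans xl _; rewrite lee_fin.
Qed.

(** The boundary value is the supremum of s, and the measure of the half-interval is the
    supremum of the measures of its compact subintervals, which are increments of s. *)
Lemma upper_value_measure : (upper_value b s < +oo)%E <->
  (mu [set x : R | (c <= x)%R /\ (x%:E < b)%E] < +oo)%E.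
Proof.
rewrite (upper_value_lty cb); last first.
  move=> x y cx xy yb; apply: s_le => //; apply: lt_trans ac _.
  by rewrite lte_fin.
split=> [[K KP]|lfin].
  apply: (@le_lt_trans _ _ (Num.max (K - s c) 0)%:E); last exact: ltry.
  apply: measure_interval_le; first exact: upper_half_interval.
    by rewrite lee_fin le_max lexx orbT.
  move=> x y [cx xu] [cy yu] xy.
  rewrite mu_cc//; last by apply: (lt_le_trans ac); rewrite lee_fin.
  have : s c <= s x by exact: s_le.
  move: cy; rewrite lee_fin le_eqVlt => /orP[/eqP cy|cy].
    by rewrite le_max -cy; move=> ?; apply/orP; right; lra.
  by have := KP y cy yu; rewrite le_max => *; apply/orP; left; lra.
set L := mu _ in lfin; have L0 : (0 <= L)%E by exact: measure_ge0.
exists (fine L + s c) => x cx xu.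
rewrite -lerBlDr -lee_fin fineK ?ge0_fin_numE// -mu_cc//; last exact: ltW.
apply: le_measure; rewrite ?inE//.
  by apply: is_interval_measurable; exact: upper_half_interval.
move=> z; rewrite /= in_itv/= => /andP[cz zx]; split => //.
by apply: le_lt_trans xu; rewrite lee_fin.
Qed.

Lemma lower_value_measure : (-oo < lower_value a s)%E <->
  (mu [set x : R | (x <= c)%R /\ (a < x%:E)%E] < +oo)%E.
Proof.
rewrite (lower_value_ltNy ac); last first.
  move=> x y ax xy yc; apply: s_le => //; apply: lt_trans cb.
  by rewrite lte_fin.
split=> [[K KP]|lfin].
  apply: (@le_lt_trans _ _ (Num.max (s c - K) 0)%:E); last exact: ltry.
  apply: measure_interval_le; first exact: lower_half_interval.
    by rewrite lee_fin le_max lexx orbT.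
  move=> x y [xc ax] [yc ay] xy.
  rewrite mu_cc//; last by apply: le_lt_trans cb; rewrite lee_fin.
  have : s y <= s c by exact: s_le.
  move: xc; rewrite lee_fin le_eqVlt => /orP[/eqP xc|xc].
    by rewrite le_max xc; move=> ?; apply/orP; right; lra.
  by have := KP x ax xc; rewrite le_max => *; apply/orP; left; lra.
set L := mu _ in lfin; have L0 : (0 <= L)%E by exact: measure_ge0.
exists (s c - fine L) => x ax xc.
rewrite lerBlDr -lerBlDl -lee_fin fineK ?ge0_fin_numE// -mu_cc//; last exact: ltW.
apply: le_measure; rewrite ?inE//.
  by apply: is_interval_measurable; exact: lower_half_interval.
move=> z; rewrite /= in_itv/= => /andP[xz zc]; split => //.
by apply: lt_le_trans ax _; rewrite lee_fin.
Qed.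

End boundary_values.

End interval_points.

(** * Merged intervals *)

Section merged_intervals.
Context {R : realType}.
Local Notation M := (measurableTypeR R).
Variables (m : {measure set M -> \bar R}) (C : @itv_family R)
  (C_eff : effective_intervals C) (f : cumulative R R)
  (lbar : {measure set M -> \bar R}) (N : set M) (g : M -> \bar R).
Hypothesis H : decomposed m C_eff f lbar N g.

Local Notation lf := (lebesgue_stieltjes_measure f : {measure set M -> \bar R}).
Local Notation lfe := (mrestr lf (measurable_covered C_eff)
  : {measure set M -> \bar R}).
Local Notation lft := (mrestr lf (measurable_uncovered C_eff)
  : {measure set M -> \bar R}).
Local Notation lam := (total_scale_measure C).
Local Notation merge := (interval_merge lft lbar C).

Let hC : carries C lam := carries_total_scale_measure C_eff.

(** Connection of arbitrary points rather than of intervals: merged intervals are its classes. *)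
Definition connected_points (x y : R) :=
  let K := `[Num.min x y, Num.max x y]%classic in lft K = 0%E /\ (lbar K < +oo)%E.
Local Notation conn := connected_points.

Lemma lf_set1 (x : R) : lf [set x] = 0%E.
Proof. exact: (stieltjes_set1 (@f_continuous _ _ _ _ _ _ _ _ H x)). Qed.

Lemma lf_oo_gt0 (x y : R) : x < y -> (0 < lf `]x, y[%classic)%E.
Proof.
move=> xy; have xz : x < (x + y) / 2 by lra.
have zy : (x + y) / 2 < y by lra.
apply: (@lt_le_trans _ _ (lf `](x + y)/2 - (y - x) / 4, (x + y)/2]%classic)).
  have le : (x + y)/2 - (y - x) / 4 <= (x + y)/2 by lra.
  have e : lf `](x + y)/2 - (y - x) / 4, (x + y)/2]%classic = _ := stieltjes_oc f le.
  rewrite [X in (_ < X)%E]e.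
  by rewrite lte_fin subr_gt0; apply: (f_increasing H); lra.
apply: le_measure; rewrite ?inE//=.
by move=> z; rewrite /= !in_itv/= => /andP[h1 h2]; apply/andP; split; lra.
Qed.

Lemma lbar_set1 (x : R) : lbar [set x] = 0%E.
Proof.
rewrite (lbar_g H)//; apply: null_set_integral => //.
  exact: measurable_funTS (measurable_g H).
apply/eqP; rewrite eq_le measure_ge0 andbT -(lf_set1 x).
by apply: le_measure; rewrite ?inE//; apply: measurableI => //; exact: measurable_covered.
Qed.

Lemma connP x y : x <= y -> conn x y <-> lft `[x, y]%classic = 0%E /\ (lbar `[x, y]%classic < +oo)%E.
Proof. by move=> xy; rewrite /conn min_l// max_r. Qed.

Lemma conn_refl x : conn x x.
Proof.
apply/connP => //; rewrite set_itv1 lbar_set1; split => //.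
apply/eqP; rewrite eq_le measure_ge0 andbT -(lf_set1 x).
by apply: le_measure; rewrite ?inE//; apply: measurableI => //; exact: measurable_uncovered.
Qed.

Lemma conn_sym x y : conn x y -> conn y x.
Proof. by rewrite /conn minC maxC. Qed.

Lemma conn_subset x y (A : set R) : conn x y -> measurable (A : set M) ->
  A `<=` `[Num.min x y, Num.max x y]%classic -> lft A = 0%E /\ (lbar A < +oo)%E.
Proof.
move=> [h1 h2] mA sA; split.
  by apply/eqP; rewrite eq_le measure_ge0 andbT -h1; apply: le_measure; rewrite ?inE.
by apply: le_lt_trans h2; apply: le_measure; rewrite ?inE.
Qed.

Lemma conn_trans y x z : conn x y -> conn y z -> conn x z.
Proof.
move=> [h1 h2] [h3 h4].
have sub : `[Num.min x z, Num.max x z]%classic `<=`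
   `[Num.min x y, Num.max x y]%classic `|` `[Num.min y z, Num.max y z]%classic.
  move=> t; rewrite /= !in_itv/= !ge_min !le_max => /andP[a b].
  case: (leP t y) => [ty|/ltW yt].
    by case/orP: a => a; [left|right]; rewrite a ?ty ?orbT.
  by case/orP: b => b; [left|right]; rewrite b ?yt ?orbT.
have mc (a b : R) : measurable (`[a, b]%classic : set M) by exact: measurable_itv.
have le (mu : {measure set M -> \bar R}) : (mu `[Num.min x z, Num.max x z]%classic <=
   mu `[Num.min x y, Num.max x y]%classic + mu `[Num.min y z, Num.max y z]%classic)%E.
  apply: le_trans (measureU2 _ _ _) => //.
  by apply: le_measure; rewrite ?inE//; exact: measurableU.
split.
  by apply/eqP; rewrite eq_le measure_ge0 andbT (le_trans (le lft))// h1 h3 adde0.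
by apply: le_lt_trans (le lbar) _; rewrite lte_add_pinfty.
Qed.

Lemma conn_between x y z : conn x y -> x <= z <= y -> conn x z.
Proof.
move=> xy /andP[xz zy]; apply/connP => //; apply: (conn_subset xy); first exact: measurable_itv.
rewrite min_l ?max_r ?(le_trans xz)// => t; rewrite /= !in_itv/= => /andP[-> tz].
exact: le_trans tz zy.
Qed.

Lemma conn_convex e : is_interval [set x | conn e x].
Proof.
move=> x y /= ex ey z xzy; have xy := conn_trans (conn_sym ex) ey.
exact: conn_trans ex (conn_between xy xzy).
Qed.

Lemma lbar_le_lam (A : set M) : measurable A -> (lbar A <= lam A)%E.
Proof.
move=> mA; rewrite (lbar_N H mA); apply: le_measure; rewrite ?inE//.
by apply: measurableI => //; exact: measurable_N H.
Qed.

Lemma itv_conn n x y : indices C n -> itv C n x -> itv C n y -> conn x y.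
Proof.
move=> Cn; wlog xy : x y / x <= y => [hw nx ny|nx ny].
  have [xy|/ltW yx] := leP x y; first exact: hw.
  by apply: conn_sym; exact: hw.
apply/connP => //; split; last first.
  apply: (le_lt_trans (lbar_le_lam _)); first exact: measurable_itv.
  by rewrite (carries_cc hC Cn)// ltry.
rewrite /= /mrestr (_ : _ `&` _ = set0) ?measure0//.
apply/seteqP; split => // z [/=]; rewrite in_itv/= => xzy; apply.
by exists n => //; exact: (carries_itv hC Cn).1 nx ny _ xzy.
Qed.

Let pt n := itv_point (itv C n).

Lemma itv_pt n : indices C n -> itv C n (pt n).
Proof. by move=> Cn; apply: itv_point_in; exact: carries_itv hC _ Cn. Qed.

Let union n := \bigcup_(j in connected_class lft lbar C n) itv C j.

Let union_conn n x : indices C n -> union n x -> conn (pt n) x.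
Proof.
move=> Cn [j [Cj nj] jx]; apply: (conn_trans nj).
by apply: (itv_conn Cj) => //; exact: itv_pt.
Qed.

Let itv_union n : indices C n -> itv C n `<=` union n.
Proof. by move=> Cn x nx; exists n => //; split => //; exact: conn_refl. Qed.

Let lt_union n : indices C n -> (lower (union n) < upper (union n))%E.
Proof.
move=> Cn; have [_ h] := carries_itv hC Cn.
apply: (le_lt_trans _ (lt_le_trans h _)).
  by apply: ereal_inf_le_tmp; apply: image_subset; exact: itv_union.
by apply: ereal_sup_le; apply: image_subset; exact: itv_union.
Qed.

Let low n := lower (union n).
Let upp n := upper (union n).

Let open_conn n x : indices C n -> (low n < x%:E < upp n)%E -> conn (pt n) x.
Proof.
move=> Cn /andP[/ereal_inf_lt[_ [y uy <-]] + /ereal_sup_gt[_ [z uz <-]]].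
rewrite !lte_fin => yx xz.
apply: (@conn_convex (pt n) y z) => /=; [exact: union_conn|exact: union_conn|].
by rewrite !ltW.
Qed.

(** Otherwise ]x, y[ would be a gap, on which the measure of f vanishes. *)
Let conn_covered x y : x < y -> conn x y -> exists2 z, x < z < y & covered C z.
Proof.
move=> xy cxy; apply: contrapT => nz.
have : (0 < lft `]x, y[%classic)%E.
  rewrite /= /mrestr setIidl ?lf_oo_gt0// => z; rewrite /= in_itv/= => xzy cz.
  by apply: nz; exists z.
suff [-> _] : lft `]x, y[%classic = 0%E /\ (lbar `]x, y[%classic < +oo)%E by rewrite ltxx.
apply: (conn_subset cxy) => //.
rewrite min_l ?max_r ?(ltW xy)// => z; rewrite /= !in_itv/= => /andP[h1 h2].
by rewrite !ltW.
Qed.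

Let covered_conn_union n z : indices C n -> covered C z -> conn (pt n) z -> union n z.
Proof.
move=> Cn [j Cj jz] nz; exists j => //; split => //.
by apply: (conn_trans nz); apply: (itv_conn Cj) => //; exact: itv_pt.
Qed.

(** Between the union and a connected point beyond it there would be a covered point; its
    interval is connected as well, hence part of the union. *)
Let conn_closed n x : indices C n -> conn (pt n) x -> (low n <= x%:E <= upp n)%E.
Proof.
move=> Cn nx; have /andP[lp pu] : (low n <= (pt n)%:E <= upp n)%E.
  exact: interval_between (itv_union Cn (itv_pt Cn)).
apply/andP; split; rewrite leNgt; apply/negP => h.
  have xp : x < pt n by rewrite -lte_fin; exact: lt_le_trans h lp.
  have [y [xy yl]] : exists y, x < y /\ (y <= pt n) /\ (y%:E <= low n)%E.
    move: h lp; case: (low n) => [l| |]//; rewrite ?lte_fin ?lee_fin => h1 h2.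
    by exists l; rewrite h1 h2 lee_fin.
  have xcy : conn x y.
    apply: conn_between (conn_sym nx) _; rewrite (ltW xy); exact: yl.1.
  have [z /andP[xz zy] cz] := conn_covered xy xcy.
  have uz : union n z.
    apply: covered_conn_union => //; apply: (conn_trans nx).
    by apply: conn_between xcy _; rewrite !ltW.
  have [+ _] := andP (interval_between uz); rewrite -/(low n); apply/negP; rewrite -ltNge.
  by apply: lt_le_trans yl.2; rewrite lte_fin.
have xp : pt n < x by rewrite -lte_fin; exact: le_lt_trans pu h.
have [y [yx yl]] : exists y, y < x /\ (pt n <= y) /\ (upp n <= y%:E)%E.
  move: h pu; case: (upp n) => [l| |]//; rewrite ?lte_fin ?lee_fin => h1 h2.
  by exists l; rewrite h1 h2 lee_fin.
have xcy : conn y x.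
  apply: conn_sym; apply: conn_trans (conn_sym nx) _; apply: conn_between nx _.
  by rewrite yl.1 ltW.
have [z /andP[yz zx] cz] := conn_covered yx xcy.
have uz : union n z.
  apply: covered_conn_union => //; apply: conn_between nx _.
  by rewrite (le_trans yl.1 (ltW yz)) ltW.
have [_] := andP (interval_between uz); rewrite -/(upp n); apply/negP; rewrite -ltNge.
by apply: le_lt_trans yl.2 _; rewrite lte_fin.
Qed.

Let cen n := fixed_point (low n) (upp n).
Let sbar n := distribution_function lbar (cen n).

Let cen_between n : indices C n -> (low n < (cen n)%:E < upp n)%E.
Proof. by move=> Cn; apply: fixed_point_between; exact: lt_union. Qed.

Let cen_conn n : indices C n -> conn (pt n) (cen n).
Proof. by move=> Cn; apply: open_conn => //; exact: cen_between. Qed.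

Let lbar_oc (x y : R) : lbar `]x, y]%classic = lbar `[x, y]%classic.
Proof.
have [xy|yx] := leP x y; last first.
  by rewrite !set_itv_ge// bnd_simp -?ltNge -?leNgt// ltW.
rewrite -[in RHS](@setU1itv _ _ (BRight y) x false) ?bnd_simp// measureU//=; first by rewrite lbar_set1 add0e.
by apply/seteqP; split => // z [/= ->]; rewrite in_itv/= ltxx.
Qed.

(** Outside of the merged interval the measure in the definition of the distribution function
    may be infinite, hence the restriction to connected points. *)
Lemma distribution_increments n x y : indices C n -> conn (pt n) x -> conn (pt n) y ->
  x <= y -> lbar `[x, y]%classic = (sbar n y - sbar n x)%:E.
Proof.
move=> Cn nx ny xy.
have fin u v : conn (pt n) u -> conn (pt n) v -> lbar `]u, v]%classic \is a fin_num.
  move=> nu nv; rewrite lbar_oc ge0_fin_numE//; have [uv|vu] := leP u v.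
    exact: ((connP uv).1 (conn_trans (conn_sym nu) nv)).2.
  by rewrite set_itv_ge ?measure0// bnd_simp -ltNge.
have nc := cen_conn Cn.
have add u v w : u <= v -> v <= w -> lbar `]u, w]%classic = (lbar `]u, v]%classic + lbar `]v, w]%classic)%E.
  move=> uv vw; rewrite -measureU//=; first by congr (lbar _); rewrite -itv_bndbnd_setU// bnd_simp.
  by apply/seteqP; split => // z [/=]; rewrite !in_itv/= => /andP[_ zv] /andP[]; rewrite ltNge zv.
rewrite -lbar_oc -(fineK (fin _ _ nx ny)); congr (_%:E).
rewrite /sbar /distribution_function; case: (leP (cen n) x) => cx.
  rewrite (le_trans cx xy) (add _ _ _ cx xy) fineD ?fin//; ring.
case: (leP (cen n) y) => cy.
  rewrite (add _ _ _ (ltW cx) cy) fineD ?fin//; ring.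
by rewrite (add x y (cen n) xy (ltW cy)) fineD ?fin//; ring.
Qed.

(** The measure of f on the intervals charges [x, y], and it is absolutely continuous with
    respect to lbar. *)
Lemma lbar_cc_gt0 x y : x < y -> conn x y -> (0 < lbar `[x, y]%classic)%E.
Proof.
move=> xy /(connP (ltW xy))[t0 _]; rewrite lt_neqAle measure_ge0 andbT eq_sym.
apply/negP => /eqP l0.
have := lbar_lfe_null H (measurable_cc x y) l0 => e0.
have : (0 < lf `[x, y]%classic)%E.
  by rewrite (whole_line_cc (f_continuous H))// ?lte_fin ?subr_gt0; [exact: f_increasing H _ _ xy|exact: ltW].
suff -> : (lf `[x, y]%classic = lfe `[x, y]%classic + lft `[x, y]%classic)%E.
  by rewrite e0 t0 adde0 ltxx.
rewrite /= /mrestr -setDE addeC -measureDI//; exact: measurable_covered.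
Qed.


Let sbar_le n x y : indices C n -> conn (pt n) x -> conn (pt n) y -> x <= y ->
  sbar n x <= sbar n y.
Proof.
move=> Cn nx ny xy; rewrite -subr_ge0 -lee_fin -(distribution_increments Cn nx ny xy).
exact: measure_ge0.
Qed.

Let sbar_cen n : sbar n (cen n) = 0.
Proof. by rewrite /sbar /distribution_function lexx set_itv_ge ?measure0// bnd_simp ltxx. Qed.

Let half_conn n x : indices C n -> cen n <= x -> (x%:E < upp n)%E -> conn (pt n) x.
Proof.
move=> Cn cx xu; apply: open_conn => //; rewrite xu andbT.
by have /andP[h _] := cen_between Cn; apply: lt_le_trans h _; rewrite lee_fin.
Qed.

Let half_conn' n x : indices C n -> x <= cen n -> (low n < x%:E)%E -> conn (pt n) x.
Proof.
move=> Cn cx xu; apply: open_conn => //; rewrite xu/=.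
by have /andP[_ h] := cen_between Cn; apply: le_lt_trans h; rewrite lee_fin.
Qed.

Let sbar_cc n x y : indices C n -> (low n < x%:E)%E -> x <= y -> (y%:E < upp n)%E ->
  lbar `[x, y]%classic = (sbar n y - sbar n x)%:E.
Proof.
move=> Cn lx xy yu; apply: distribution_increments => //; apply: open_conn => //.
  by rewrite lx/=; apply: le_lt_trans yu; rewrite lee_fin.
by rewrite yu andbT; apply: lt_le_trans lx _; rewrite lee_fin.
Qed.

Lemma upper_value_merge n : indices C n -> (upper_value (upp n) (sbar n) < +oo)%E <->
  (lbar [set x : R | (cen n <= x)%R /\ (x%:E < upp n)%E] < +oo)%E.
Proof.
move=> Cn; have /andP[lc cu] := cen_between Cn.
exact: (upper_value_measure lc cu (fun x y => @sbar_cc n x y Cn)).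
Qed.

Lemma lower_value_merge n : indices C n -> (-oo < lower_value (low n) (sbar n))%E <->
  (lbar [set x : R | (x <= cen n)%R /\ (low n < x%:E)%E] < +oo)%E.
Proof.
move=> Cn; have /andP[lc cu] := cen_between Cn.
exact: (lower_value_measure lc cu (fun x y => @sbar_cc n x y Cn)).
Qed.

Let lft_half n (J : set R) : indices C n -> is_interval J -> (forall x, J x -> conn (pt n) x) ->
  lft J = 0%E.
Proof.
move=> Cn iJ Jc; apply/eqP; rewrite eq_le measure_ge0 andbT; apply: measure_interval_le => //.
move=> x y Jx Jy xy.
by have [-> _] := (connP xy).1 (conn_trans (conn_sym (Jc x Jx)) (Jc y Jy)).
Qed.

Let conn_endpoint c x (J : set R) : measurable (J : set M) ->
  `[Num.min c x, Num.max c x]%classic `<=` J `|` [set x] -> lft J = 0%E -> (lbar J < +oo)%E ->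
  conn c x.
Proof.
move=> mJ sub t0 lJ.
have le (mu : {measure set M -> \bar R}) : mu [set x] = 0%E ->
    (mu `[Num.min c x, Num.max c x]%classic <= mu J)%E.
  move=> mx; rewrite -[leRHS]adde0 -mx; apply: le_trans (measureU2 _ _ _) => //.
  by apply: le_measure; rewrite ?inE//; exact: measurableU.
have tx : lft [set x] = 0%E by have [] := (connP (lexx x)).1 (conn_refl x); rewrite set_itv1.
split; last exact: le_lt_trans (le lbar (lbar_set1 x)) lJ.
by apply/eqP; rewrite eq_le measure_ge0 andbT -t0 le.
Qed.

(** The endpoints that are added to the merged interval are the ones that are still
    connected to its points, because a bounded scale means finite measure. *)
Lemma merge_itvE n : indices C n -> itv merge n = [set x | conn (pt n) x].
Proof.
move=> Cn; have [/andP[lc cu] nc] := (cen_between Cn, cen_conn Cn).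
apply/seteqP; split => x /=.
  case=> [/(open_conn Cn)//|[xl h]|[xu h]].
  - have {}xl : x%:E = low n := xl.
    have {h} : (-oo < low n + lower_value (low n) (sbar n))%E := h.
    have drop : (-oo < low n + lower_value (low n) (sbar n))%E ->
        (-oo < lower_value (low n) (sbar n))%E.
      by case: (lower_value _ _) => [r| |]; rewrite ?ltNyr ?addeNy.
    move=> /drop/(lower_value_merge Cn).
    set J := [set _ | _] => lJ; apply: (conn_trans nc).
    have xc : x < cen n by rewrite -lte_fin xl.
    have mJ : measurable (J : set M) := is_interval_measurable (@lower_half_interval _ _ _).
    apply: (@conn_endpoint _ _ J mJ) => //.
      rewrite min_r ?max_l ?ltW// => z; rewrite /= in_itv/= => /andP[xz zc].
      move: xz; rewrite le_eqVlt => /orP[/eqP ->|xz]; [by right|left].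
      by rewrite /J/= -xl lte_fin.
    apply: (@lft_half n J Cn (@lower_half_interval _ _ _)) => z [zc lz]; exact: half_conn'.
  - have {}xu : x%:E = upp n := xu.
    have {h} : (upp n + upper_value (upp n) (sbar n) < +oo)%E := h.
    have drop : (upp n + upper_value (upp n) (sbar n) < +oo)%E ->
        (upper_value (upp n) (sbar n) < +oo)%E.
      by case: (upper_value _ _) => [r| |]; rewrite ?ltry// -xu.
    move=> /drop/(upper_value_merge Cn).
    set J := [set _ | _] => lJ; apply: (conn_trans nc).
    have xc : cen n < x by rewrite -lte_fin xu.
    have mJ : measurable (J : set M) := is_interval_measurable (@upper_half_interval _ _ _).
    apply: (@conn_endpoint _ _ J mJ) => //.
      rewrite min_l ?max_r ?ltW// => z; rewrite /= in_itv/= => /andP[cz zx].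
      move: zx; rewrite le_eqVlt => /orP[/eqP ->|zx]; [by right|left].
      by rewrite /J/= -xu lte_fin.
    by apply: (@lft_half n J Cn (@upper_half_interval _ _ _)) => z [zc lz]; exact: half_conn.
move=> nx; have /andP[lx xu] := conn_closed Cn nx.
rewrite -/(low n) -/(upp n) -/(sbar n).
move: lx; rewrite le_eqVlt => /orP[/eqP lx|lx].
  constructor 2; split => //.
  have : (-oo < lower_value (low n) (sbar n))%E.
    apply/(lower_value_merge Cn); apply: le_lt_trans ((conn_trans (conn_sym nc) nx).2).
    apply: le_measure; rewrite ?inE//.
      by apply: is_interval_measurable; exact: lower_half_interval.
    move=> z [zc]; rewrite lx lte_fin => xz /=; rewrite in_itv/= min_r ?max_l ?zc ?(ltW xz)//.
      by rewrite (le_trans (ltW xz)).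
    by rewrite (le_trans (ltW xz)).
  change ((-oo < lower_value (low n) (sbar n))%E ->
    (-oo < low n + lower_value (low n) (sbar n))%E).
  by rewrite lx; case: (lower_value _ _) => [r| |]; rewrite ?ltxx// -EFinD !ltNyr.
move: xu; rewrite le_eqVlt => /orP[/eqP xu|xu]; last by constructor 1; rewrite lx.
constructor 3; split => //.
have : (upper_value (upp n) (sbar n) < +oo)%E.
  apply/(upper_value_merge Cn); apply: le_lt_trans ((conn_trans (conn_sym nc) nx).2).
  apply: le_measure; rewrite ?inE//.
    by apply: is_interval_measurable; exact: upper_half_interval.
  move=> z [cz]; rewrite -xu lte_fin => zx /=; rewrite in_itv/= min_l ?max_r ?cz ?(ltW zx)//.
    by rewrite (le_trans cz) ?ltW.
  by rewrite (le_trans cz) ?ltW.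
change ((upper_value (upp n) (sbar n) < +oo)%E ->
  (upp n + upper_value (upp n) (sbar n) < +oo)%E).
by rewrite -xu; case: (upper_value _ _) => [r| |]; rewrite ?ltxx// -EFinD !ltry.
Qed.

Lemma merge_indices n : indices merge n -> indices C n.
Proof. by case. Qed.

Lemma merge_bounds n : indices C n -> lower (itv merge n) = low n /\ upper (itv merge n) = upp n.
Proof.
move=> Cn; apply: lower_upper_sandwich; first exact: lt_union.
  by move=> x lxu; rewrite merge_itvE//; exact: open_conn.
by move=> x; rewrite merge_itvE// => nx; exact: conn_closed.
Qed.

(** The distribution function of lbar is strictly increasing and continuous on the merged
    interval, because lbar charges all its subintervals and has no atoms. *)
Lemma carries_merge : carries merge lbar.
Proof.
have hn n (mn : indices merge n) := merge_indices mn.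
split.
- move=> i j [Ci mi] [Cj mj] [x]; rewrite !merge_itvE// => -[/= ix jx].
  have cij := conn_trans ix (conn_sym jx).
  by apply/eqP; rewrite eqn_leq mi//; apply: mj; split => //; exact: conn_sym.
- move=> n /hn Cn; split; first by rewrite merge_itvE//; exact: conn_convex.
  by have [-> ->] := merge_bounds Cn; exact: lt_union.
- move=> n /hn Cn; have [l u] := merge_bounds Cn; split.
  + move=> x y; rewrite !inE merge_itvE// => /= nx ny xy.
    rewrite -subr_gt0 -lte_fin -(distribution_increments Cn nx ny (ltW xy)).
    by apply: lbar_cc_gt0 => //; exact: conn_trans (conn_sym nx) ny.
  + suff cs x : conn (pt n) x ->
        sbar n y @[y --> within [set z | conn (pt n) z] (nbhs x)] --> sbar n x.
      by rewrite merge_itvE//; apply/subspace_continuousP.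
    move=> nx.
    have ec : conn x (cen n) := conn_trans (conn_sym nx) (cen_conn Cn).
    have scont e : 0 < e -> exists2 d : R, 0 < d & forall y, x <= y -> conn (pt n) y ->
        y < x + d -> sbar n y - sbar n x < e.
      move=> e0; have [[z [xz nz]]|nz] := pselect (exists z, x < z /\ conn (pt n) z); last first.
        exists 1 => // y; rewrite le_eqVlt => /orP[/eqP <-|xy]; first by rewrite subrr.
        by move=> ny; case: nz; exists y.
      have xz' : conn x z := conn_trans (conn_sym nx) nz.
      have [d d0 hd] := atomless_right xz ((connP (ltW xz)).1 xz').2 (lbar_set1 x) e0.
      exists d => // y xy ny yd; rewrite -lte_fin -(distribution_increments Cn nx ny xy).
      apply: le_lt_trans hd; apply: le_measure; rewrite ?inE//.
      by move=> t; rewrite /= !in_itv/= => /andP[-> /le_trans -> //]; exact: ltW.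
    have scont' e : 0 < e -> exists2 d : R, 0 < d & forall y, y <= x -> conn (pt n) y ->
        x - d < y -> sbar n x - sbar n y < e.
      move=> e0; have [[z [xz nz]]|nz] := pselect (exists z, z < x /\ conn (pt n) z); last first.
        exists 1 => // y; rewrite le_eqVlt => /orP[/eqP ->|xy]; first by rewrite subrr.
        by move=> ny; case: nz; exists y.
      have xz' : conn z x := conn_trans (conn_sym nz) nx.
      have [d d0 hd] := atomless_left xz ((connP (ltW xz)).1 xz').2 (lbar_set1 x) e0.
      exists d => // y xy ny yd; rewrite -lte_fin -(distribution_increments Cn ny nx xy).
      apply: le_lt_trans hd; apply: le_measure; rewrite ?inE//.
      by move=> t; rewrite /= !in_itv/= => /andP[/(lt_le_trans yd)/ltW -> ->].
    apply/cvgrPdist_lt => e e0.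
    have [d d0 hd] := scont e e0; have [d' d'0 hd'] := scont' e e0.
    near=> y; have ny : conn (pt n) y by near: y; exact: withinT.
    have xyd : `|x - y| < Num.min d d' 
      by near: y; apply: cvg_within; apply: (nbhsx_ballx x); rewrite lt_min d0.
    move: xyd; rewrite lt_min => /andP[k1 k2].
    have /andP[h1 h2] : - d < x - y < d by rewrite -ltr_norml.
    have /andP[h3 h4] : - d' < x - y < d' by rewrite -ltr_norml.
    have [xy|/ltW yx] := leP x y.
      rewrite distrC ger0_norm ?subr_ge0 ?(sbar_le Cn)//.
      by apply: hd => //; lra.
    by rewrite ger0_norm ?subr_ge0 ?(sbar_le Cn)//; apply: hd' => //; lra.
  + by rewrite /itv_point l u; exact: sbar_cen.
- move=> n /hn Cn x y; rewrite merge_itvE// => nx ny xy.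
  exact: (distribution_increments Cn nx ny xy).
Unshelve. all: by end_near. Qed.

Lemma merge_covers n : indices C n -> exists2 k, indices merge k & itv C n `<=` itv merge k.
Proof.
move=> Cn; have ex : exists j, `[< connected_class lft lbar C n j >].
  by exists n; apply/asboolP; split => //; exact: conn_refl.
case: (ex_minnP ex) => k /asboolP[Ck nk] kmin.
have mk : indices merge k.
  split => // j [Cj kj]; apply: kmin; apply/asboolP; split => //.
  exact: conn_trans nk kj.
exists k => // x nx; rewrite merge_itvE//=; apply: (conn_trans (conn_sym nk)).
by apply: (itv_conn Cn) => //; exact: itv_pt.
Qed.

Lemma merge_conn k x y : indices merge k -> itv merge k x -> itv merge k y -> conn x y.
Proof.
move=> /merge_indices Ck; rewrite merge_itvE// => kx ky.
exact: conn_trans (conn_sym kx) ky.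
Qed.

Lemma conn_merge k x y : indices merge k -> itv merge k x -> conn x y -> itv merge k y.
Proof.
by move=> /merge_indices Ck; rewrite merge_itvE// => kx; exact: conn_trans.
Qed.

Lemma covered_merge : covered C `<=` covered merge.
Proof. by move=> x [n Cn nx]; have [k mk sub] := merge_covers Cn; exists k => //; exact: sub. Qed.

End merged_intervals.


(** * The closure of the test functions *)

Lemma Lfun2B d (T : measurableType d) (R : realType) (mu : {measure set T -> \bar R})
    (f h : T -> R) : f \in Lfun mu 2%:E -> h \in Lfun mu 2%:E ->
  (fun x => f x - h x) \in Lfun mu 2%:E.
Proof.
move=> f2 h2; have := Lfun2_linear (-1) h2 f2.
by rewrite (_ : (fun x => -1 * h x + f x) = (fun x => f x - h x))//; apply/funext => x; ring.
Qed.

Lemma Lfun2_sqrE d (T : measurableType d) (R : realType) (mu : {measure set T -> \bar R})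
    (f : T -> R) : f \in Lfun mu 2%:E ->
  (\int[mu]_x (f x ^+ 2)%:E = (\int[mu]_x (f x ^+ 2))%:E)%E.
Proof. by move=> f2; apply: RintegralE => //; exact: (Lfun2M f2 f2). Qed.

(** The convexity inequality for the square, integrated. *)
Lemma Lfun2_sqr_le d (T : measurableType d) (R : realType) (mu : {measure set T -> \bar R})
    (f h : T -> R) : f \in Lfun mu 2%:E -> h \in Lfun mu 2%:E ->
  \int[mu]_x (h x ^+ 2) <= 2 * \int[mu]_x ((f x - h x) ^+ 2) + 2 * \int[mu]_x (f x ^+ 2).
Proof.
move=> f2 h2; have d2 := Lfun2B f2 h2.
have i1 := Lfun2M h2 h2; have i2 := Lfun2M f2 f2; have i3 := Lfun2M d2 d2.
have j2 := integrable_realZ measurableT 2 i2; have j3 := integrable_realZ measurableT 2 i3.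
rewrite -RintegralZl// -[X in _ + X]RintegralZl// -RintegralD//.
apply: le_Rintegral => //; first exact: integrable_realD.
by move=> x _; have := sqr_ge0 (2 * f x - h x); rewrite !expr2 => ?; lra.
Qed.

Section fast_convergence.
Context d (T : measurableType d) (R : realType).
Variables (mu : {measure set T -> \bar R}) (h : nat -> T -> R).
Hypothesis mh : forall j, measurable_fun setT (h j).
Hypothesis small : forall j,
  (\int[mu]_x (h j x ^+ 2)%:E <= (1 / (2 ^ j.+1)%:R)%:E)%E.

(** The integrals of the squares are summable, so that the squares are summable almost
    everywhere. *)
Lemma fast_ae_cvg : {ae mu, forall x, h j x @[j --> \oo] --> 0}.
Proof.
pose F j x := ((h j x ^+ 2)%:E : \bar R).
have F0 j x : (0 <= F j x)%E by rewrite lee_fin sqr_ge0.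
have mF j : measurable_fun setT (F j).
  by apply/measurable_EFinP; exact: measurable_funX.
have sum_fin : (\int[mu]_x (\sum_(0 <= j <oo) F j x) < +oo)%E.
  rewrite integral_nneseries//; apply: (@le_lt_trans _ _ 1%:E); last exact: ltry.
  apply: le_trans (epsilon_trick0 xpredT ler01).
  apply: lee_nneseries => [j _ _|j _]; last exact: small.
  by apply: integral_ge0 => x _; exact: F0.
have : mu.-integrable setT (fun x => \sum_(0 <= j <oo) F j x)%E.
  apply/integrableP; split; first exact: ge0_emeasurable_sum.
  rewrite (eq_integral (fun x => \sum_(0 <= j <oo) F j x)%E)// => x _.
  by rewrite gee0_abs// nneseries_ge0.
move/(integrable_ae measurableT); apply: ae_imply => x /(_ I) fin.
have {}fin : (\sum_(0 <= j <oo) F j x < +oo)%E.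
  by move: fin; rewrite ge0_fin_numE// nneseries_ge0.
have tail := nneseries_tail_cvg fin (fun j _ => F0 j x).
have F0cv : F j x @[j --> \oo] --> 0%E.
  apply: (squeeze_cvge _ _ tail); last exact: cvg_cst.
  apply: nearW => j; rewrite F0/=.
  apply: le_trans (nneseries_lim_ge j.+1 _); last by move=> *; exact: F0.
  by rewrite big_nat1.
have : Num.sqrt (h j x ^+ 2) @[j --> \oo] --> Num.sqrt (0 : R).
  apply: continuous_cvg; first exact: sqrt_continuous.
  by move/fine_cvg: F0cv.
rewrite sqrtr0 => c; apply/norm_cvg0P; apply: cvg_trans c.
by apply: near_eq_cvg; apply: nearW => j; rewrite /= sqrtr_sqr.
Qed.

End fast_convergence.

Section unbounded_scale.
Context {R : realType}.
Local Notation M := (measurableTypeR R).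
Variables (J : set R) (s : R -> R) (lam : {measure set M -> \bar R}).
Hypothesis nJ : nondegenerate_interval J.
Hypothesis lamJ : forall x y, J x -> J y -> x <= y ->
  lam `[x, y]%classic = (s y - s x)%:E.

Let lam_lty x y : J x -> J y -> (lam `[x, y]%classic < +oo)%E.
Proof.
move=> Jx Jy; have [xy|yx] := leP x y; first by rewrite lamJ// ltry.
by rewrite set_itv_ge ?measure0// bnd_simp -ltNge.
Qed.

Let cen := itv_point J.
Let cenJ : (lower J < cen%:E < upper J)%E.
Proof. by apply: fixed_point_between; exact: nJ.2. Qed.

(** Half-lines ending at two points of J differ by a compact interval, of finite measure. *)
Lemma lower_unbounded_measure c : J c -> lower J = -oo%E ->
  (-oo < lower_value (lower J) s)%E <-> (lam `]-oo, c]%classic < +oo)%E.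
Proof.
move=> Jc lJ; have /andP[l u] := cenJ.
rewrite (lower_value_measure (mu := lam) l u); last first.
  move=> x y lx xy yu; apply: lamJ => //; apply: between_interval nJ.1 _.
    by rewrite lx/=; apply: le_lt_trans yu; rewrite lee_fin.
  by rewrite yu andbT; apply: lt_le_trans lx _; rewrite lee_fin.
have -> : [set x : R | (x <= cen)%R /\ (lower J < x%:E)%E] = `]-oo, cen]%classic.
  apply/seteqP; split => x /=; rewrite in_itv/=; first by case.
  by move=> xc; split => //; rewrite lJ ltNyr.
have Jcen : J cen by exact: itv_point_in.
have step x y : J x -> J y -> (lam `]-oo, x]%classic < +oo)%E -> (lam `]-oo, y]%classic < +oo)%E.
  move=> Jx Jy lx; apply: (@le_lt_trans _ _ (lam `]-oo, x]%classic + lam `[x, y]%classic)%E).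
    apply: le_trans (measureU2 _ _ _) => //; apply: le_measure; rewrite ?inE//.
      exact: measurableU.
    move=> z; rewrite /= !in_itv/= => zy; have [zx|xz] := leP z x; [by left|right].
    by rewrite ltW.
  by rewrite lte_add_pinfty// lam_lty.
by split; exact: step.
Qed.

Lemma upper_unbounded_measure c : J c -> upper J = +oo%E ->
  (upper_value (upper J) s < +oo)%E <-> (lam `[c, +oo[%classic < +oo)%E.
Proof.
move=> Jc lJ; have /andP[l u] := cenJ.
rewrite (upper_value_measure (mu := lam) l u); last first.
  move=> x y lx xy yu; apply: lamJ => //; apply: between_interval nJ.1 _.
    by rewrite lx/=; apply: le_lt_trans yu; rewrite lee_fin.
  by rewrite yu andbT; apply: lt_le_trans lx _; rewrite lee_fin.
have -> : [set x : R | (cen <= x)%R /\ (x%:E < upper J)%E] = `[cen, +oo[%classic.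
  apply/seteqP; split => x /=; rewrite in_itv/= andbT; first by case.
  by move=> xc; split => //; rewrite lJ ltry.
have Jcen : J cen by exact: itv_point_in.
have step x y : J x -> J y -> (lam `[x, +oo[%classic < +oo)%E -> (lam `[y, +oo[%classic < +oo)%E.
  move=> Jx Jy lx; apply: (@le_lt_trans _ _ (lam `[y, x]%classic + lam `[x, +oo[%classic)%E).
    apply: le_trans (measureU2 _ _ _) => //; apply: le_measure; rewrite ?inE//.
      exact: measurableU.
    move=> z; rewrite /= !in_itv/= !andbT => zy; have [zx|xz] := leP x z; [by right|left].
    by rewrite zy ltW.
  by rewrite lte_add_pinfty// lam_lty.
by split; exact: step.
Qed.

End unbounded_scale.

Section boundary_limits.
Context {R : realType}.
Local Notation M := (measurableTypeR R).
Variables (J : set R) (s : R -> R) (lam : {measure set M -> \bar R}).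
Hypotheses (nJ : nondegenerate_interval J) (sJ : scale_function J s).
Hypothesis lamJ : forall x y, J x -> J y -> x <= y ->
  lam `[x, y]%classic = (s y - s x)%:E.
Variables (v : R -> R) (vs Ds : nat -> R -> R) (K : R).
Hypotheses (Ds2 : forall j, Ds j \in Lfun lam 2%:E)
  (vsD : forall j, increments lam J (vs j) (Ds j))
  (DsK : forall j, \int[lam]_x (Ds j x ^+ 2) <= K)
  (vsv : forall y, J y -> vs j y @[j --> \oo] --> v y).

Let K0 : 0 <= K.
Proof. by apply: le_trans (DsK 0%N); apply: Rintegral_ge0 => x _; exact: sqr_ge0. Qed.

Let K1 : 0 < K + 1.
Proof. by apply: ltr_wpDl => //; exact: K0. Qed.

Let sqr_limit_le y L : J y -> 0 <= L -> (forall j, exists2 z, J z &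
  vs j z = 0 /\ `|s y - s z| <= L) -> v y ^+ 2 <= L * K.
Proof.
move=> Jy L0 h; have c : vs j y ^+ 2 @[j --> \oo] --> v y ^+ 2.
  by rewrite !expr2; apply: cvgM; exact: vsv.
rewrite -(cvg_lim _ c)//; apply: limr_le; first by apply/cvg_ex; exists (v y ^+ 2).
apply: nearW => j; have [z Jz [vz sL]] := h j.
rewrite -(subr0 (vs j y)) -vz (le_trans (increments_holder sJ lamJ (Ds2 j) (vsD j) Jz Jy))//.
by rewrite ler_pM// ?Rintegral_ge0// => x _; exact: sqr_ge0.
Qed.

Let small_sqr (e x : R) : 0 < e -> x ^+ 2 <= e ^+ 2 / (K + 1) * K -> `|x| < e.
Proof.
move=> e0 h; rewrite -(ltr_pXn2r (_ : 0 < 2)%N) ?nnegrE ?normr_ge0 ?(ltW e0)//.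
rewrite real_normK ?num_real//; apply: le_lt_trans h _.
by rewrite -mulrA gtr_pMr ?exprn_gt0// mulrC ltr_pdivrMr// mul1r ltrDl.
Qed.

(** By the Hoelder bound from a far point where [vs j] vanishes, the square of [v y] is at
    most the measure of the half-line at [y], up to a constant. *)
Lemma boundary_limit_left c : J c -> lower J = -oo%E -> (lam `]-oo, c]%classic < +oo)%E ->
  (forall j, exists z0, forall z, z <= z0 -> vs j z = 0) -> v x @[x --> -oo] --> (0 : R).
Proof.
move=> Jc lJ lfin vs0.
have near_J := lowerNy_near nJ lJ.
apply/cvgrPdist_lt => e e0.
have d0 : 0 < e ^+ 2 / (K + 1) by rewrite divr_gt0 ?exprn_gt0.
have [n hn] : exists n : nat, (lam `]-oo, (c - n%:R)%R]%classic < (e ^+ 2 / (K + 1))%:E)%E.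
  apply: (@nonincreasing_null _ lam (fun n => `]-oo, (c - n%:R)%R]%classic) set0) => //.
  - move=> i j ij; apply/subsetPset => z; rewrite /= !in_itv/= => /le_trans; apply.
    by rewrite lerD2l lerN2 ler_nat.
  - by rewrite subr0.
  - apply/seteqP; split => // z hz; have [k /andP[zk _]] := nat_itvP (z - c).
    by have := hz k I; rewrite /= in_itv/= leNgt => /negP; apply; lra.
near=> y; rewrite sub0r normrN; apply: small_sqr => //.
have Jy : J y by near: y.
have yn : y <= c - n%:R by near: y; apply: nbhs_ninfty_le; exact: num_real.
apply: sqr_limit_le => //; first exact: ltW.
move=> j; have [z0 hz0] := vs0 j.
have [z [Jz [zz0 zy]]] : exists z, J z /\ (z <= z0 /\ z <= y).
  have : \forall z \near -oo, J z /\ (z <= z0 /\ z <= y).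
    near=> z; split; first by near: z.
    by split; near: z; apply: nbhs_ninfty_le; exact: num_real.
  by move=> /filter_ex[z]; exists z.
exists z => //; split; first exact: hz0.
rewrite ger0_norm ?subr_ge0 ?(scale_le sJ)// -lee_fin -lamJ// ltW//.
apply: le_lt_trans hn; apply: le_measure; rewrite ?inE//.
by move=> t; rewrite /= !in_itv/= => /andP[_ /le_trans]; apply.
Unshelve. all: by end_near. Qed.

Lemma boundary_limit_right c : J c -> upper J = +oo%E -> (lam `[c, +oo[%classic < +oo)%E ->
  (forall j, exists z0, forall z, z0 <= z -> vs j z = 0) -> v x @[x --> +oo] --> (0 : R).
Proof.
move=> Jc lJ lfin vs0.
have near_J := uppery_near nJ lJ.
apply/cvgrPdist_lt => e e0.
have d0 : 0 < e ^+ 2 / (K + 1) by rewrite divr_gt0 ?exprn_gt0.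
have [n hn] : exists n : nat, (lam `[(c + n%:R)%R, +oo[%classic < (e ^+ 2 / (K + 1))%:E)%E.
  apply: (@nonincreasing_null _ lam (fun n => `[(c + n%:R)%R, +oo[%classic) set0) => //.
  - move=> i j ij; apply/subsetPset => z; rewrite /= !in_itv/= !andbT; apply: le_trans.
    by rewrite lerD2l ler_nat.
  - by rewrite addr0.
  - apply/seteqP; split => // z hz; have [k /andP[_ zk]] := nat_itvP (z - c).
    by have := hz k I; rewrite /= in_itv/= andbT leNgt => /negP; apply; lra.
near=> y; rewrite sub0r normrN; apply: small_sqr => //.
have Jy : J y by near: y.
have yn : c + n%:R <= y by near: y; apply: nbhs_pinfty_ge; exact: num_real.
apply: sqr_limit_le => //; first exact: ltW.
move=> j; have [z0 hz0] := vs0 j.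
have [z [Jz [zz0 zy]]] : exists z, J z /\ (z0 <= z /\ y <= z).
  have : \forall z \near +oo, J z /\ (z0 <= z /\ y <= z).
    near=> z; split; first by near: z.
    by split; near: z; apply: nbhs_pinfty_ge; exact: num_real.
  by move=> /filter_ex[z]; exists z.
exists z => //; split; first exact: hz0.
rewrite distrC ger0_norm ?subr_ge0 ?(scale_le sJ)// -lee_fin -lamJ// ltW//.
apply: le_lt_trans hn; apply: le_measure; rewrite ?inE//.
by move=> t; rewrite /= !in_itv/= andbT => /andP[/(le_trans yn)].
Unshelve. all: by end_near. Qed.

End boundary_limits.

Section closure_of_test_functions.
Context {R : realType}.
Local Notation M := (measurableTypeR R).
Variables (m : {measure set M -> \bar R}) (C : @itv_family R)
  (C_eff : effective_intervals C) (f : cumulative R R)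
  (lbar : {measure set M -> \bar R}) (N : set M) (g : M -> \bar R).
Hypothesis H : decomposed m C_eff f lbar N g.

Local Notation lf := (lebesgue_stieltjes_measure f : {measure set M -> \bar R}).
Local Notation lfe := (mrestr lf (measurable_covered C_eff)
  : {measure set M -> \bar R}).
Local Notation lft := (mrestr lf (measurable_uncovered C_eff)
  : {measure set M -> \bar R}).
Local Notation lam := (total_scale_measure C).
Local Notation merge := (interval_merge lft lbar C).
Local Notation conn := (connected_points C_eff f lbar).

Let hM : carries merge lbar := carries_merge H.

Lemma lf_lfe_conn x y (A : set M) : conn x y -> x <= y -> measurable A ->
  A `<=` `[x, y]%classic -> lf A = lfe A.
Proof.
move=> cxy xy mA Axy; rewrite (measureDI lf mA (measurable_covered C_eff)) setDE.
have [|t0 _] := conn_subset cxy mA; first by rewrite min_l// max_r.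
by rewrite [X in (X + _)%E]t0 add0e.
Qed.

(** Between connected points the gaps are null for the measure of f, so that the formula for
    the increments of phi o f holds across them. *)
Lemma test_increments phi psi D x y : test_function f phi psi ->
  test_density m C_eff f N g phi psi D -> conn x y -> x <= y ->
  phi (f y) - phi (f x) = \int[lbar]_(z in `[x, y]) D z.
Proof.
move=> tp hD cxy xy.
have ipsi := comp_integrable (f_continuous H) x y (test_derive_continuous tp).
rewrite (comp_increment (f_increasing H) (f_continuous H) (f_zero H) xy
  (test_derive tp) (test_derive_continuous tp)).
have mD := Lfun2_measurable (represents_density_L2 (test_represents hD)).
have mg := measurable_g H.
rewrite /Rintegral; congr fine.
rewrite (integral_density mg (g_ge0 H) (lbar_g H))//; last first.
  by apply/measurable_EFinP; exact: measurable_funTS.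
transitivity (\int[lfe]_(z in `[x, y]) (psi (f z))%:E)%E.
  by apply: eq_measure_integral => A mA Axy; exact: lf_lfe_conn cxy xy mA Axy.
apply/esym; apply: ae_eq_rintegral => //.
- apply: emeasurable_funM; last exact: measurable_funTS.
  by apply/measurable_EFinP; exact: measurable_funTS.
- exact: measurable_int ipsi.
- by apply: ae_imply (test_density_on hD) => z ->.
Qed.

Lemma test_vanish phi psi : test_function f phi psi ->
  (exists z0, forall z, z <= z0 -> phi (f z) = 0) /\
  (exists z0, forall z, z0 <= z -> phi (f z) = 0).
Proof.
move=> tp; set K := closure [set y | phi y != 0].
have phiK y : ~ K y -> phi y = 0.
  by move=> nK; apply: contrapT => /eqP y0; apply: nK; exact: subset_closure.
have [K0|K0] := pselect (K !=set0); last first.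
  have z y : phi y = 0 by apply: phiK => Ky; apply: K0; exists y.
  by split; exists 0 => t _; exact: z.
have cK : {within K, continuous (@id R)} by apply: continuous_subspaceT => ?; exact: cvg_id.
split.
- have [k /set_mem Kk kmin] := compact_EVT_min K0 (test_compact tp) cK.
  have [z0 _ fz0] := test_range tp Kk; exists (z0 - 1) => z zz0; apply: phiK => /mem_set/kmin.
  apply/negP; rewrite -ltNge -fz0; apply: (f_increasing H); lra.
- have [k /set_mem Kk kmax] := compact_EVT_max K0 (test_compact tp) cK.
  have [z0 _ fz0] := test_range tp Kk; exists (z0 + 1) => z zz0; apply: phiK => /mem_set/kmax.
  apply/negP; rewrite -ltNge -fz0; apply: (f_increasing H); lra.
Qed.

Lemma ae_nonempty (J : set R) (P : R -> Prop) : nondegenerate_interval J ->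
  {ae m, forall x, P x} -> exists2 x, J x & P x.
Proof.
move=> nJ aeP; apply: contrapT => nP.
pose w x : R := if `[< P x >] then 0 else 1.
have w1 x : J x -> w x = 1.
  move=> Jx; rewrite /w; case: ifPn => // /asboolP Px.
  by exfalso; apply: nP; exists x.
have : cst (0 : R) (itv_point J) = w (itv_point J).
  apply: (continuous_ae_eq (m := m) nJ (m_is_supported H)) (itv_point_in nJ).
  - by move=> x Jx; exact: cvg_cst.
  - move=> x Jx; rewrite w1//; apply: cvg_near_cst.
    by near=> y; apply: w1; near: y; exact: withinT.
  - by apply: ae_imply aeP => x Px; rewrite /w asboolT.
rewrite w1; last exact: itv_point_in.
by move=> /esym/eqP; rewrite oner_eq0.
Unshelve. all: by end_near. Qed.

Lemma sqr_lbar_le F : F \in Lfun lam 2%:E ->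
  (\int[lbar]_x (F x ^+ 2)%:E <= \int[lam]_x (F x ^+ 2)%:E)%E.
Proof.
move=> F2; have mF : measurable_fun setT (fun x : M => F x ^+ 2).
  by apply: measurable_funX; exact: Lfun2_measurable F2.
rewrite (integral_lbar H)//; apply: ge0_le_integral => //.
- by move=> x _; rewrite lee_fin patchE; case: ifPn => // _; exact: sqr_ge0.
- apply/measurable_EFinP; apply/(measurable_restrictT _ (measurable_N H)).
  exact: measurable_funTS.
- exact/measurable_EFinP.
- move=> x _; rewrite lee_fin patchE; case: ifPn => // _; exact: sqr_ge0.
Qed.

Lemma dyadic_cvg0 : 1 / (2 ^ j.+1)%:R @[j --> \oo] --> (0 : R).
Proof.
apply: (squeeze_cvgr _ _ (@cvg_harmonic R)); last exact: (@cvg_cst _ (0 : R)).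
apply: nearW => j; rewrite divr_ge0//= div1r lef_pV2 ?posrE ?ltr0n ?expn_gt0// ler_nat.
by rewrite ltnW// ltn_expl.
Qed.

(** The L^2 convergence of the densities is locally uniform convergence of the
    increments, so that one point of convergence in each merged interval suffices. *)
Lemma closure_represents u v D : represents m C lam u v D ->
  (forall eps : R, 0 < eps -> exists p : (R -> R) * (R -> R) * (R -> R),
    [/\ test_function f p.1.1 p.1.2, test_density m C_eff f N g p.1.1 p.1.2 p.2,
      \int[lam]_x ((D x - p.2 x) ^+ 2) < eps &
      \int[m]_x ((p.1.1 (f x) - u x) ^+ 2) < eps]) ->
  {ae lam, forall x, ~ N x -> D x = 0} /\ exists w, represents m merge lbar u w D.
Proof.
move=> hu approx.
(* errors with a finite sum, for almost everywhere convergence *)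
pose e j : R := 1 / (2 ^ j.+1)%:R.
have e0 j : 0 < e j by rewrite divr_gt0// ltr0n expn_gt0.
have /choice[p hp] j := approx (e j) (e0 j).
pose phi j := (p j).1.1; pose Dp j := (p j).2.
have tp j : test_function f (phi j) (p j).1.2 by case: (hp j).
have hD j : test_density m C_eff f N g (phi j) (p j).1.2 (Dp j) by case: (hp j).
have De j : \int[lam]_x ((D x - Dp j x) ^+ 2) < e j by case: (hp j).
have ue j : \int[m]_x ((phi j (f x) - u x) ^+ 2) < e j by case: (hp j).
have D2 := represents_density_L2 hu.
have Dp2 j : Dp j \in Lfun lam 2%:E := represents_density_L2 (test_represents (hD j)).
have DB2 j := Lfun2B D2 (Dp2 j).
have mN := measurable_N H.
have offN : {ae lam, forall x, ~ N x -> D x = 0}.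
  have mNc : measurable (~` N) by exact: measurableC.
  have mD2 : measurable_fun (~` N) (fun x : M => (D x ^+ 2)%:E).
    by apply/measurable_EFinP; apply: measurable_funTS; apply: measurable_funX; exact: Lfun2_measurable D2.
  have I0 : (\int[lam]_(x in ~` N) `|(D x ^+ 2)%:E| = 0)%E.
    rewrite (eq_integral (fun x : M => (D x ^+ 2)%:E)); last first.
      by move=> x _; rewrite gee0_abs// lee_fin sqr_ge0.
    apply/eqP; rewrite eq_le integral_ge0 ?andbT; last by move=> x _; rewrite lee_fin sqr_ge0.
    apply/lee_addgt0Pr => eps eps0; rewrite add0e; have [q [_ hq qe _]] := approx eps eps0.
    have q2 := Lfun2B D2 (represents_density_L2 (test_represents hq)).
    have mq2 (A : set M) : measurable_fun A (fun x : M => ((D x - q.2 x) ^+ 2)%:E).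
      by apply/measurable_EFinP; apply: measurable_funTS; apply: measurable_funX; exact: Lfun2_measurable q2.
    apply: (@le_trans _ _ (\int[lam]_x ((D x - q.2 x) ^+ 2)%:E)%E); last first.
      by rewrite (Lfun2_sqrE q2) lee_fin ltW.
    rewrite (@ae_eq_integral _ _ _ lam _ (fun x => ((D x - q.2 x) ^+ 2)%:E))//.
      by apply: ge0_subset_integral => // x _; rewrite lee_fin sqr_ge0.
    by apply: ae_imply (test_density_off hq) => x h Nx; rewrite h// subr0.
  move/(ae_eq_integral_abs lam mNc mD2): I0; apply: ae_imply => x h Nx.
  by have := h Nx => -[] /eqP; rewrite sqrf_eq0 => /eqP.
split => //.
have cvD x y : conn x y -> x <= y ->
    phi j (f y) - phi j (f x) @[j --> \oo] --> \int[lbar]_(z in `[x, y]) D z.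
  move=> cxy xy; have [_ lxy] := (connP _ _ _ xy).1 cxy.
  have iD F : F \in Lfun lbar 2%:E -> lbar.-integrable `[x, y] (EFin \o F).
    by apply: Lfun2_integrable.
  apply/cvgrPdist_lt => eps eps0.
  set L := fine (lbar `[x, y]%classic); have L0 : 0 <= L by exact: fine_ge0.
  have small : \forall j \near \oo, e j < eps ^+ 2 / (L + 1).
    apply: (cvgr_lt 0 dyadic_cvg0); rewrite divr_gt0 ?exprn_gt0//; lra.
  near=> j.
  rewrite (test_increments (tp j) (hD j) cxy xy) -RintegralB//; last 2 first.
  - exact/iD/(Lfun2_lbar H).
  - exact/iD/(Lfun2_lbar H).
  rewrite -(ltr_pXn2r (_ : 0 < 2)%N) ?nnegrE ?normr_ge0 ?(ltW eps0)// real_normK ?num_real//.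
  have db := Lfun2_lbar H (DB2 j).
  apply: le_lt_trans (Rintegral_sqr_le (measurable_cc x y) lxy db) _.
  apply: (@le_lt_trans _ _ (L * e j)).
    rewrite -/L ler_wpM2l//; apply: le_trans (ltW (De j)).
    rewrite fine_le//.
    - by apply: integrable_fin_num => //; apply: integrableS (Lfun2M db db).
    - by rewrite (Lfun2_sqrE (DB2 j)).
    - apply: (@le_trans _ _ (\int[lbar]_x ((D x - Dp j x) ^+ 2)%:E)%E).
        apply: ge0_subset_integral => //; last by move=> z _; rewrite lee_fin sqr_ge0.
        by apply/measurable_EFinP; apply: measurable_funX; exact: Lfun2_measurable db.
      exact: sqr_lbar_le (DB2 j).
  have : e j < eps ^+ 2 / (L + 1) by near: j.
  rewrite ltr_pdivlMr; last by lra.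
  by apply: le_lt_trans; rewrite mulrC ler_wpM2l ?(ltW (e0 j))//; lra.
have aecv : {ae m, forall x, phi j (f x) @[j --> \oo] --> u x}.
  have pu2 j := Lfun2B (represents_L2 (test_represents (hD j))) (represents_L2 hu).
  have small j : (\int[m]_x ((phi j (f x) - u x) ^+ 2)%:E <= (1 / (2 ^ j.+1)%:R)%:E)%E.
    by rewrite (Lfun2_sqrE (pu2 j)) lee_fin; exact: ltW (ue j).
  apply: ae_imply (fast_ae_cvg (fun j => Lfun2_measurable (pu2 j)) small) => x.
  by move/subr_cvg0.
pose w x := lim (phi j (f x) @[j --> \oo]).
have wE x l : phi j (f x) @[j --> \oo] --> l -> w x = l by exact: cvg_lim.
have cvk k x : indices merge k -> itv merge k x -> phi j (f x) @[j --> \oo] --> w x.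
  move=> mk kx; have [x0 kx0 cx0] := ae_nonempty (carries_itv hM mk) aecv.
  suff [l hl] : exists l : R, phi j (f x) @[j --> \oo] --> l by have -> := wE x l hl.
  have [xx0|/ltW x0x] := leP x x0.
    have c := cvD x x0 (merge_conn H mk kx kx0) xx0.
    exists (u x0 - \int[lbar]_(z in `[x, x0]) D z).
    rewrite (_ : (fun j => phi j (f x)) =
        fun j => phi j (f x0) - (phi j (f x0) - phi j (f x))).
      exact: cvgB cx0 c.
    by apply/funext => j; rewrite subKr.
  have c := cvD x0 x (merge_conn H mk kx0 kx) x0x.
  exists (\int[lbar]_(z in `[x0, x]) D z + u x0).
  rewrite (_ : (fun j => phi j (f x)) =
      fun j => phi j (f x) - phi j (f x0) + phi j (f x0)).
    exact: cvgD c cx0.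
  by apply/funext => j; rewrite subrK.
exists w; split.
- exact: represents_L2 hu.
- by apply: ae_imply aecv => x; exact: wE.
- exact: Lfun2_lbar H _ D2.
- move=> x nx; apply: (represents_density0 hu) => cx; apply: nx; exact: covered_merge H _ cx.
- move=> k mk x y kx ky xy.
  have c1 : phi j (f y) - phi j (f x) @[j --> \oo] --> w y - w x.
    by apply: cvgB; [exact: cvk mk ky|exact: cvk mk kx].
  have c2 := cvD x y (merge_conn H mk kx ky) xy.
  by rewrite -(cvg_lim _ c1)// (cvg_lim _ c2).
- move=> k mk; have nk := carries_itv hM mk; have sk := carries_scale hM mk.
  have ck := carries_cc hM mk; have pk := itv_point_in nk.
  have incs j : increments lbar (itv merge k) (phi j \o f) (Dp j).
    move=> x y kx ky xy.
    exact: (test_increments (tp j) (hD j) (merge_conn H mk kx ky) xy).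
  have Dl2 := Lfun2_lbar H D2; have Dpl2 j := Lfun2_lbar H (Dp2 j).
  (* a bound for the energies, needed for a boundary condition uniform in j *)
  pose K := 2 * 1 + 2 * \int[lbar]_x (D x ^+ 2).
  have DK j : \int[lbar]_x (Dp j x ^+ 2) <= K.
    apply: le_trans (Lfun2_sqr_le Dl2 (Dpl2 j)) _; rewrite lerD2r ler_wpM2l//.
    rewrite -lee_fin -(Lfun2_sqrE (Lfun2B Dl2 (Dpl2 j))).
    apply: le_trans (sqr_lbar_le (DB2 j)) _; rewrite (Lfun2_sqrE (DB2 j)) lee_fin.
    apply: le_trans (ltW (De j)) _; rewrite /e ler_pdivrMr ?ltr0n ?expn_gt0// mul1r.
    by rewrite ler1n expn_gt0.
  split => [lk lv _|uk uv _].
  + have lf := (lower_unbounded_measure nk ck pk lk).1 lv.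
    apply: (boundary_limit_left nk sk ck Dpl2 incs DK (cvk k ^~ mk) pk lk lf) => j.
    by have [[z0 hz0] _] := test_vanish (tp j); exists z0.
  + have uf := (upper_unbounded_measure nk ck pk uk).1 uv.
    apply: (boundary_limit_right nk sk ck Dpl2 incs DK (cvk k ^~ mk) pk uk uf) => j.
    by have [_ [z0 hz0]] := test_vanish (tp j); exists z0.
Unshelve. all: by end_near. Qed.

End closure_of_test_functions.


(** * Orthogonal projection *)

Section projection.
Context {R : realType}.
Variables (F S : set (R -> R)) (Q : (R -> R) -> (R -> R) -> R).
Hypotheses
  (F_linear : forall (c : R) u v, F u -> F v -> F (fun x => c * u x + v x))
  (Q_sym : forall u v, F u -> F v -> Q u v = Q v u)
  (Q_bilinear : forall (c : R) u v w, F u -> F v -> F w ->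
    Q (fun x => c * u x + v x) w = c * Q u w + Q v w)
  (Q_ge0 : forall u, F u -> 0 <= Q u u)
  (Q_complete : forall u_ : nat -> R -> R, (forall n, F (u_ n)) ->
    (forall eps : R, 0 < eps -> exists N, forall p q, (N <= p)%N -> (N <= q)%N ->
      Q (u_ p \- u_ q) (u_ p \- u_ q) < eps) ->
    exists2 u, F u & Q (u_ n \- u) (u_ n \- u) @[n --> \oo] --> (0 : R))
  (SF : S `<=` F)
  (S_linear : forall (c : R) u v, S u -> S v -> S (fun x => c * u x + v x))
  (S0 : S (cst 0)).

Let subE (u v : R -> R) : u \- v = (fun x => -1 * v x + u x).
Proof. by apply/funext => x /=; ring. Qed.

Lemma form_sub u v : F u -> F v -> F (u \- v).
Proof. by move=> Fu Fv; rewrite subE; exact: F_linear. Qed.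

Lemma form_square (c : R) u v : F u -> F v ->
  Q (fun x => c * u x + v x) (fun x => c * u x + v x) =
  c ^+ 2 * Q u u + 2 * c * Q u v + Q v v.
Proof.
move=> Fu Fv; have Fw := F_linear c Fu Fv.
rewrite Q_bilinear// (Q_sym Fu Fw) (Q_sym Fv Fw) !Q_bilinear// (Q_sym Fv Fu); ring.
Qed.

Lemma discriminant_le (a b c : R) : 0 <= c -> (forall t, 0 <= a + 2 * t * b + t ^+ 2 * c) ->
  b ^+ 2 <= a * c.
Proof.
move=> c0 h.
have [c00|cn0] := eqVneq c 0.
  rewrite c00 mulr0; have [->|b0] := eqVneq b 0; first by rewrite expr0n.
  have := h (- (a + 1) / (2 * b)); rewrite c00 mulr0 addr0.
  have -> : 2 * (- (a + 1) / (2 * b)) * b = - (a + 1) by field; rewrite b0.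
  by lra.
have {}c0 : 0 < c by rewrite lt_neqAle eq_sym cn0.
have := h (- b / c).
have -> : a + 2 * (- b / c) * b + (- b / c) ^+ 2 * c = (a * c - b ^+ 2) / c by field.
by rewrite pmulr_lge0 ?invr_gt0// subr_ge0.
Qed.

Lemma form_Cauchy_Schwarz u v : F u -> F v -> Q u v ^+ 2 <= Q u u * Q v v.
Proof.
move=> Fu Fv; rewrite mulrC; apply: discriminant_le => [|t]; first exact: Q_ge0.
rewrite (_ : Q v v + _ + _ = t ^+ 2 * Q u u + 2 * t * Q u v + Q v v); last by ring.
by rewrite -form_square//; apply: Q_ge0; exact: F_linear.
Qed.

Let small_arith (p q a b e y : R) : p ^+ 2 <= a -> q ^+ 2 <= b -> a <= e * y -> b <= e * y ->
  (p + q) ^+ 2 <= 2 * y * (e + e).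
Proof.
move=> h1 h2 h3 h4.
have -> : (p + q) ^+ 2 = 2 * p ^+ 2 + 2 * q ^+ 2 - (p - q) ^+ 2 by ring.
have -> : 2 * y * (e + e) = 4 * (e * y) by ring.
by have := sqr_ge0 (p - q); move: (p ^+ 2) (q ^+ 2) (e * y) ((p - q) ^+ 2) h1 h2 h3 h4 => *; lra.
Qed.

Let midpoint_arith (d x y z a b : R) : y < d + b -> x < d + a ->
  d <= 2^-1 * 2^-1 * x + 2 * 2^-1 * (2^-1 * z) + 4^-1 * y ->
  - 1 * - 1 * x + 2 * - 1 * z + y <= 2 * a + 2 * b.
Proof. by move=> *; lra. Qed.

(** A minimizing sequence for the distance to [S] is a Cauchy sequence by the parallelogram
    identity; at its limit the first variation vanishes. *)
Lemma form_projection u : F u -> exists p, [/\ F p,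
  forall eps, 0 < eps -> exists2 v, S v & Q (p \- v) (p \- v) < eps &
  forall v, S v -> Q (u \- p) v = 0].
Proof.
move=> Fu; pose dist := [set Q (u \- v) (u \- v) | v in S].
have dist_inf : has_inf dist.
  split; first by exists (Q (u \- cst 0) (u \- cst 0)), (cst 0).
  by exists 0 => _ [v Sv <-]; apply: Q_ge0; apply: form_sub => //; exact: SF.
pose d := inf dist.
have dle v : S v -> d <= Q (u \- v) (u \- v).
  by move=> Sv; apply: ge_inf; [exact: dist_inf.2|exists v].
have /choice[v_ hv] n : exists v, S v /\ Q (u \- v) (u \- v) < d + n.+1%:R^-1.
  have n0 : 0 < n.+1%:R^-1 :> R by rewrite invr_gt0 ltr0n.
  have [_ [v Sv <-] hv] := inf_adherent n0 dist_inf.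
  by exists v.
have Sv n : S (v_ n) by have [] := hv n.
have vd n : Q (u \- v_ n) (u \- v_ n) < d + n.+1%:R^-1 by have [] := hv n.
have Fd n : F (u \- v_ n) by apply: form_sub => //; exact: SF.
clearbody d.
have parallelogram i j : Q (v_ i \- v_ j) (v_ i \- v_ j) <= 2 * i.+1%:R^-1 + 2 * j.+1%:R^-1.
  (* the midpoint of v_ i and v_ j, at squared distance at least d from u *)
  pose mid := fun x => 2^-1 * (v_ i x - v_ j x) + v_ j x.
  have Smid : S mid.
    rewrite (_ : mid = fun x => 2^-1 * v_ i x + (2^-1 * v_ j x + cst 0 x)).
      by apply: S_linear => //; exact: S_linear.
    by apply/funext => x; rewrite /mid /=; field.
  have e1 : v_ i \- v_ j = (fun x => -1 * (u \- v_ i) x + (u \- v_ j) x).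
    by apply/funext => x /=; ring.
  pose w := fun x => - 2^-1 * (u \- v_ j) x + (u \- v_ j) x.
  have Fw : F w by exact: F_linear.
  have e2 : u \- mid = (fun x => 2^-1 * (u \- v_ i) x + w x).
    by apply/funext => x; rewrite /mid /w /=; field.
  have qw : Q w w = 4^-1 * Q (u \- v_ j) (u \- v_ j) by rewrite /w form_square//; field.
  have qaw : Q (u \- v_ i) w = 2^-1 * Q (u \- v_ i) (u \- v_ j).
    by rewrite Q_sym// /w Q_bilinear// (Q_sym (Fd j) (Fd i)); field.
  clearbody w mid; have := dle _ Smid; rewrite e1 e2 !form_square// qw qaw !expr2.
  have := vd i; have := vd j.
  exact: midpoint_arith.
have [eps eps0|p Fp pv] := Q_complete (fun n => SF (Sv n)).
  have e4 : 0 < eps / 4 by lra.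
  have [n _ hn] := near_infty_natSinv_lt (PosNum e4).
  exists n => i j ni nj; apply: le_lt_trans (parallelogram i j) _.
  have h1 : i.+1%:R^-1 < eps / 4 := hn i ni; have h2 : j.+1%:R^-1 < eps / 4 := hn j nj.
  by move: h1 h2; move: (i.+1%:R^-1) (j.+1%:R^-1) => a b *; lra.
have Fup := form_sub Fu Fp.
exists p; split => // [eps eps0|v Sv'].
  have [n _ hn] := cvgr_lt 0 pv eps eps0.
  exists (v_ n) => //; have := hn n (leqnn n).
  have -> : p \- v_ n = (fun x => -1 * (v_ n \- p) x + cst 0 x).
    by apply/funext => x /=; ring.
  have F0 : F (cst 0) by exact: SF.
  have Fvp : F (v_ n \- p) by apply: form_sub => //; exact: SF.
  have Q0 w : F w -> Q (cst 0) w = 0.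
    move=> Fw; have := Q_bilinear 1 F0 F0 Fw.
    have -> : (fun x => 1 * cst 0 x + cst 0 x) = cst 0 :> (R -> R).
      by apply/funext => x; rewrite /= mulr0 addr0.
    by lra.
  by rewrite form_square// (Q_sym Fvp F0) !Q0// mulr0 !addr0 sqrrN expr1n mul1r.
have Fv := SF Sv'.
have ortho n : Q (u \- v_ n) v ^+ 2 <= n.+1%:R^-1 * Q v v.
  apply: discriminant_le => [|t]; first exact: Q_ge0.
  have St : S (fun x => - t * v x + v_ n x) by exact: S_linear.
  have := dle _ St.
  have -> : u \- (fun x => - t * v x + v_ n x) = (fun x => t * v x + (u \- v_ n) x).
    by apply/funext => x /=; ring.
  rewrite form_square// (Q_sym Fv (Fd n)); have := vd n.
  move: (Q (u \- v_ n) v) (Q (u \- v_ n) (u \- v_ n)) (Q v v) (n.+1%:R^-1) => q x y a.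
  by move: (t ^+ 2 * y) => z *; lra.
have small eps : 0 < eps -> Q (u \- p) v ^+ 2 <= 2 * Q v v * (eps + eps).
  move=> eps0; have [n1 _ hn1] := near_infty_natSinv_lt (PosNum eps0).
  have [n2 _ hn2] := cvgr_lt 0 pv eps eps0.
  pose n := maxn n1 n2; have h1 := hn1 n (leq_maxl _ _); have h2 := hn2 n (leq_maxr _ _).
  rewrite /= in h1 h2.
  have Fvp : F (v_ n \- p) by apply: form_sub => //; exact: SF.
  have -> : u \- p = (fun x => 1 * (u \- v_ n) x + (v_ n \- p) x).
    by apply/funext => x /=; ring.
  rewrite Q_bilinear// mul1r.
  have k1 := ortho n; have k2 := form_Cauchy_Schwarz Fvp Fv.
  have v0 := Q_ge0 Fv; have p0 := Q_ge0 Fvp.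
  set q1 := Q (u \- v_ n) v in k1 *; set q2 := Q (v_ n \- p) v in k2 *.
  have l1 : n.+1%:R^-1 * Q v v <= eps * Q v v by rewrite ler_wpM2r// ltW.
  have l2 : Q (v_ n \- p) (v_ n \- p) * Q v v <= eps * Q v v by rewrite ler_wpM2r// ltW.
  exact: small_arith k1 k2 l1 l2.
apply/eqP; rewrite -sqrf_eq0 eq_le sqr_ge0 andbT leNgt; apply/negP => q0.
have v0 := Q_ge0 Fv.
(* small enough for the bound 4 eps Q v v to be below Q (u \- p) v ^+ 2 *)
pose eps := Q (u \- p) v ^+ 2 / (8 * (Q v v + 1)).
have eps0 : 0 < eps by rewrite divr_gt0// mulr_gt0//; lra.
have := small eps eps0; apply/negP; rewrite -ltNge.
have : eps * (8 * (Q v v + 1)) = Q (u \- p) v ^+ 2.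
  by rewrite /eps divfK// gt_eqF// mulr_gt0//; lra.
by move=> <-; nra.
Qed.

End projection.

Section test_function_space.
Context {R : realType}.
Variable f : R -> R.

Lemma smooth_linear (c : R) (p q : R -> R) : smooth p -> smooth q ->
  smooth (fun x => c * p x + q x).
Proof.
move=> sp sq; have D (n : nat) (x : R) : is_derive x 1 (fun x => c * derive1n n p x + derive1n n q x)
    (c * derive1 (derive1n n p) x + derive1 (derive1n n q) x).
  have dp := derivableP (sp n x); have dq := derivableP (sq n x).
  by rewrite !derive1E; exact: is_deriveD (is_deriveZ c dp) dq.
have E n : derive1n n (fun x => c * p x + q x) =
    (fun x => c * derive1n n p x + derive1n n q x).
  elim: n => [|n IH]; first by rewrite !derive1n0.
  by apply/funext => x; rewrite !derive1nS IH derive1E; exact: derive_val.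
by move=> n x; rewrite E; exact: ex_derive.
Qed.

Lemma composed_test_functions0 : composed_test_functions f (cst 0).
Proof.
exists (cst 0) => //; split.
- move=> n x; have -> : derive1n n (cst (0 : R)) = cst 0.
    elim: n => [|n IH]; first by rewrite derive1n0.
    by rewrite derive1nS IH; apply/funext => y; rewrite derive1_cst.
  exact: derivable_cst.
- rewrite (_ : [set y | _] = set0) ?closure0//; first exact: compact0.
  by apply/seteqP; split => // y /=; rewrite eqxx.
- rewrite (_ : [set y | _] = set0) ?closure0//.
  by apply/seteqP; split => // y /=; rewrite eqxx.
Qed.

Lemma composed_test_functions_linear (c : R) u v : composed_test_functions f u ->
  composed_test_functions f v -> composed_test_functions f (fun x => c * u x + v x).
Proof.
move=> [p [sp cp rp] <-] [q [sq cq rq] <-].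
exists (fun x => c * p x + q x); last by [].
have sub : closure [set y | c * p y + q y != 0] `<=`
    closure [set y | p y != 0] `|` closure [set y | q y != 0].
  rewrite -closureU; apply: closure_subset => y /= h.
  have [py|] := eqVneq (p y) 0; [right|by left].
  by move: h; rewrite py mulr0 add0r.
split; first exact: smooth_linear.
- apply: (subclosed_compact _ _ sub); first exact: closed_closure.
  exact: compactU.
- by apply: subset_trans sub _; rewrite subUset.
Qed.

End test_function_space.

(** * Merged functions in the original domain *)

Section merged_functions.
Context {R : realType}.
Local Notation M := (measurableTypeR R).
Variables (m : {measure set M -> \bar R}) (C : @itv_family R)
  (C_eff : effective_intervals C) (f : cumulative R R)
  (lbar : {measure set M -> \bar R}) (N : set M) (g : M -> \bar R).
Hypothesis H : decomposed m C_eff f lbar N g.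

Local Notation lf := (lebesgue_stieltjes_measure f : {measure set M -> \bar R}).
Local Notation lft := (mrestr lf (measurable_uncovered C_eff)
  : {measure set M -> \bar R}).
Local Notation lam := (total_scale_measure C).
Local Notation merge := (interval_merge lft lbar C).

Let hC : carries C lam := carries_total_scale_measure C_eff.
Let hM : carries merge lbar := carries_merge H.

(** An interval of C lies in a merged interval, where the increments are integrals for lbar,
    that is, for lam over N. The boundary condition is inherited since lbar <= lam. *)
Lemma merge_represents u w D : represents m merge lbar u w D ->
  represents m C lam u w ((D \_ N) \_ (covered C)).
Proof.
move=> h; have D2 := represents_density_L2 h.
have mD := Lfun2_measurable D2; have mC := measurable_covered C_eff.
split.
- exact: represents_L2 h.
- exact: represents_ae h.
- by apply: Lfun2_restrict => //; exact: (Lfun2_lam_patch H).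
- by move=> x nx; rewrite patchE memNset.
- move=> n Cn x y nx ny xy; have [k mk sub] := merge_covers H Cn.
  rewrite (represents_increments h mk (sub _ nx) (sub _ ny) xy) /Rintegral; congr fine.
  rewrite (integral_lbar H)//; last exact: measurable_funTS.
  apply: eq_integral => z /set_mem; rewrite /= in_itv/= => xzy.
  rewrite [in RHS]patchE mem_set//; exists n => //.
  exact: (carries_itv hC Cn).1 nx ny _ xzy.
- move=> n Cn; have [k mk sub] := merge_covers H Cn.
  have [bl bu] := represents_boundary h mk.
  have nC := carries_itv hC Cn; have cC := carries_cc hC Cn; have pC := itv_point_in nC.
  have nM := carries_itv hM mk; have cM := carries_cc hM mk; have pM := sub _ pC.
  split => [ln lv mfin|un uv mfin].
    have lM : lower (itv merge k) = -oo%E.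
      by apply/eqP; rewrite -leeNy_eq -ln; apply: ereal_inf_le_tmp; exact: image_subset.
    apply: bl => //; apply/(lower_unbounded_measure nM cM pM lM).
    apply: le_lt_trans ((lower_unbounded_measure nC cC pC ln).1 lv).
    exact: (lbar_le_lam H).
  have uM : upper (itv merge k) = +oo%E.
    by apply/eqP; rewrite -leye_eq -un; apply: ereal_sup_le; exact: image_subset.
  apply: bu => //; apply/(upper_unbounded_measure nM cM pM uM).
  apply: le_lt_trans ((upper_unbounded_measure nC cC pC un).1 uv).
  exact: (lbar_le_lam H).
Qed.

(** Both sides integrate over N, as lbar is the restriction of lam to N, and off the
    intervals E vanishes. *)
Lemma patch_pairing D E : D \in Lfun lbar 2%:E -> E \in Lfun lam 2%:E ->
  (forall x, ~ covered C x -> E x = 0) ->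
  \int[lam]_x (((D \_ N) \_ (covered C)) x * E x) = \int[lbar]_x (D x * E x).
Proof.
move=> D2 E2 E0; rewrite /Rintegral; congr fine.
rewrite (integral_lbar H)//; last first.
  by apply: measurable_funM; [exact: Lfun2_measurable D2|exact: Lfun2_measurable E2].
apply: eq_integral => x _; congr (_%:E); rewrite !patchE.
case: ifPn => [_|nc]; first by case: ifPn => //; rewrite mul0r.
have Ex : E x = 0 by apply: E0 => cx; move/negP: nc; apply; rewrite inE.
by rewrite Ex !mulr0; case: ifPn.
Qed.

End merged_functions.


(** * The weak equation for the density *)

Section triangle.
Context {R : realType}.
Local Notation M := (measurableTypeR R).

Lemma integral_mfrestr (mu : {measure set M -> \bar R}) (D A : set M) (mD : measurable D)
    (fD : (mu D < +oo)%E) (h : M -> \bar R) : measurable A -> A `<=` D ->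
  (\int[mfrestr mD fD]_x (h \_ A) x = \int[mu]_(x in A) h x)%E.
Proof.
move=> mA AD; rewrite -integral_mkcond; apply: eq_measure_integral => B mB BA.
by rewrite /= /mfrestr /mrestr setIidl//; exact: subset_trans BA AD.
Qed.

Variables (mu nu : {measure set M -> \bar R}) (c d : R).
Hypotheses (mufin : (mu `[c, d]%classic < +oo)%E) (nufin : (nu `[c, d]%classic < +oo)%E).
Variables (r k : R -> R) (K : R).
Hypotheses (ir : mu.-integrable `[c, d] (EFin \o r))
  (mk : measurable_fun setT (k : M -> M)) (kK : forall z, `|k z| <= K).

Let mcc := measurable_cc c d.
Let mu' : {finite_measure set M -> \bar R} := mfrestr mcc mufin.
Let nu' : {finite_measure set M -> \bar R} := mfrestr mcc nufin.
Let T : set (M * M) := [set p | c <= p.2 /\ p.2 <= p.1 /\ p.1 <= d].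
Let F (p : M * M) : \bar R := ((r \_ `[c, d]%classic) p.1 * k p.2 * \1_T p)%:E.

Let mT : measurable T.
Proof.
have m1 : measurable_fun setT (fun p : M * M => p.2 : M) by exact: measurable_snd.
have m2 : measurable_fun setT (fun p : M * M => (p.1 - p.2) : M).
  by apply: measurable_funB; [exact: measurable_fst|exact: measurable_snd].
have m3 : measurable_fun setT (fun p : M * M => p.1 : M) by exact: measurable_fst.
have -> : T = ((fun p => p.2) @^-1` `[c, +oo[%classic) `&`
    (((fun p => p.1 - p.2) @^-1` `[0, +oo[%classic) `&` ((fun p => p.1) @^-1` `]-oo, d]%classic)).
  by apply/seteqP; split => p /=; rewrite !in_itv/= !andbT subr_ge0.
apply: measurableI.
  by rewrite -[X in measurable X]setTI; apply: m1 => //; exact: measurable_itv.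
apply: measurableI; rewrite -[X in measurable X]setTI.
  by apply: m2 => //; exact: measurable_itv.
by apply: m3 => //; exact: measurable_itv.
Qed.

Let mr : measurable_fun setT ((r : M -> M) \_ `[c, d]%classic).
Proof.
apply/(measurable_restrictT _ mcc); apply/measurable_EFinP; exact: measurable_int ir.
Qed.

Let mF : measurable_fun setT F.
Proof.
apply/measurable_EFinP; apply: measurable_funM; last exact: measurable_indic.
apply: measurable_funM; first exact: measurableT_comp mr measurable_fst.
exact: measurableT_comp mk measurable_snd.
Qed.

Let K0 : 0 <= K. Proof. exact: le_trans (normr_ge0 _) (kK 0). Qed.

Let iF : (mu' \x nu')%E.-integrable setT F.
Proof.
apply/(integrable12ltyP mu' nu' mF).
have rfin : (\int[mu']_x (K%:E * `|((r \_ `[c, d]%classic) x)%:E|) < +oo)%E.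
  rewrite ge0_integralZl//; last first.
    by apply: measurableT_comp => //; exact/measurable_EFinP.
  rewrite (_ : (\int[mu']_x `|((r \_ `[c, d]%classic) x)%:E| =
     \int[mu]_(x in `[c, d]) `|(r x)%:E|)%E).
    by rewrite lte_mul_pinfty ?lee_fin//; case/integrableP: ir.
  rewrite -(integral_mfrestr mcc mufin)//; apply: eq_integral => x _.
  by rewrite !patchE; case: ifPn => // _; rewrite abse0.
apply: (@le_lt_trans _ _ (\int[mu']_x ((K%:E * `|((r \_ `[c, d]%classic) x)%:E|) * nu' setT))%E).
  apply: ge0_le_integral => //.
  - by move=> x _; exact: integral_ge0.
  - have mFa : measurable_fun setT (fun p => `|F p|%E) by exact: measurableT_comp.
    exact: (measurable_fun_fubini_tonelli_F (m2 := nu') _ mFa (fun p => abse_ge0 (F p))).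
  - apply: emeasurable_funM => //; apply: emeasurable_funM => //.
    by apply: measurableT_comp => //; exact/measurable_EFinP.
  - move=> x _; rewrite -integral_cst//; apply: ge0_le_integral => //.
    + apply: measurableT_comp => //; exact: measurableT_comp mF (pair1_measurable x).
    + move=> z _; rewrite /F /= -EFinM lee_fin normrM normrM.
      rewrite [`|\1_T _|]ger0_norm; last by rewrite indicE; case: (_ \in _).
      apply: (@le_trans _ _ (`|(r \_ `[c, d]%classic) x| * `|k z|)).
        by rewrite ler_piMr ?mulr_ge0// indicE; case: (_ \in _).
      by rewrite mulrC ler_wpM2r.
rewrite ge0_integralZr//; last 2 first.
- apply: emeasurable_funM => //; apply: measurableT_comp => //; exact/measurable_EFinP.
- by move=> x _; rewrite mule_ge0 ?lee_fin.
rewrite lte_mul_pinfty//.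
- by apply: integral_ge0 => x _; rewrite mule_ge0 ?lee_fin.
- by rewrite ge0_fin_numE// integral_ge0// => x _; rewrite mule_ge0 ?lee_fin.
- by rewrite /nu' /= /mfrestr /mrestr setTI.
Qed.

(** Fubini on the triangle of the points (x, z) with c <= z <= x <= d. *)
Lemma triangle_Fubini :
  \int[mu]_(x in `[c, d]) (r x * \int[nu]_(z in `[c, x]) k z) =
  \int[nu]_(z in `[c, d]) (k z * \int[mu]_(x in `[z, d]) r x).
Proof.
have ik : nu.-integrable `[c, d] (EFin \o k).
  apply: (le_integrable mcc _ _ (integrable_cst_lty (mu := nu) K mcc nufin)) => //.
    by apply/measurable_EFinP; exact: measurable_funTS.
  by move=> z _; rewrite /= lee_fin (le_trans (kK z))// ler_norm.
have E1 x : (\int[nu']_z F (x, z) =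
    ((EFin \o (fun x => r x * \int[nu]_(z in `[c, x]) k z)%R) \_ `[c, d]%classic) x)%E.
  rewrite [RHS]patchE; case: ifPn => [/set_mem xcd|/negP nx]; last first.
    rewrite integral0_eq// => z _; rewrite /F /= patchE.
    by case: ifPn => [/nx []|_]; rewrite !mul0r.
  move: (xcd); rewrite /= in_itv/= => /andP[cx xd].
  have sub : `[c, x]%classic `<=` `[c, d]%classic.
    by move=> z; rewrite /= !in_itv/= => /andP[-> /le_trans]; apply.
  have ikx : nu.-integrable `[c, x] (EFin \o k).
    by apply: integrableS ik.
  rewrite /= -RintegralZl// -RintegralE//; last exact: integrable_realZ.
  rewrite -(integral_mfrestr mcc nufin _ (measurable_cc c x) sub).
  apply: eq_integral => z _; rewrite /F /= !patchE mem_set// indicE.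
  have -> : ((x, z) \in T) = (z \in `[c, x]%classic).
    apply/idP/idP; rewrite !inE/= in_itv/=; first by move=> [-> [-> _]].
    by move=> /andP[h1 h2]; split.
  by case: ifPn; rewrite ?mulr1 ?mulr0.
have E2 z : (\int[mu']_x F (x, z) =
    ((EFin \o (fun z => k z * \int[mu]_(x in `[z, d]) r x)%R) \_ `[c, d]%classic) z)%E.
  rewrite [RHS]patchE; case: ifPn => [/set_mem zcd|/negP nz]; last first.
    rewrite integral0_eq// => x _; rewrite /F /= indicE.
    case: (boolP ((x, z) \in T)) => [/set_mem[/= h1 [h2 h3]]|_]; last by rewrite mulr0.
    by exfalso; apply: nz; rewrite inE/= in_itv/= h1 (le_trans h2).
  move: (zcd); rewrite /= in_itv/= => /andP[cz zd].
  have sub : `[z, d]%classic `<=` `[c, d]%classic.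
    by move=> x; rewrite /= !in_itv/= => /andP[/(le_trans cz) -> ->].
  have irz : mu.-integrable `[z, d] (EFin \o r) by apply: integrableS ir.
  rewrite /= -RintegralZl// -RintegralE//; last exact: integrable_realZ.
  rewrite -(integral_mfrestr mcc mufin _ (measurable_cc z d) sub).
  apply: eq_integral => x _; rewrite /F /= !patchE indicE.
  case: (boolP (x \in `[z, d]%classic)) => [/set_mem zx|/negP nzx].
    have xcd := sub _ zx; rewrite [x \in `[c, d]%classic]mem_set//.
    rewrite mem_set; last by move: zx; rewrite /= in_itv/= => /andP[? ?].
    by rewrite mulr1 mulrC.
  rewrite [(x, z) \in T]memNset ?mulr0// => -[/= h1 [h2 h3]]; apply: nzx.
  by rewrite inE/= in_itv/= h2.
rewrite /Rintegral; congr fine.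
have := Fubini iF; rewrite (eq_integral _ _ (fun x _ => E1 x)).
rewrite [X in _ = X](eq_integral _ _ (fun x _ => E2 x)).
by rewrite (integral_mfrestr mcc mufin)// (integral_mfrestr mcc nufin).
Qed.

End triangle.

Lemma integrable_bounded_mul d (T : measurableType d) (R : realType)
    (mu : {measure set T -> \bar R}) (A : set T) (k h : T -> R) (K : R) :
  measurable A -> measurable_fun A k -> (forall x, A x -> `|k x| <= K) ->
  mu.-integrable A (EFin \o h) -> mu.-integrable A (EFin \o (fun x => k x * h x)).
Proof.
move=> mA mk kK ih; apply: (le_integrable mA _ _ (integrable_realZ mA K ih)).
  apply/measurable_EFinP; apply: measurable_funM => //.
  by apply/measurable_EFinP; exact: measurable_int ih.
move=> x Ax; rewrite /= lee_fin !normrM ler_wpM2r//.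
by rewrite (le_trans (kK x Ax))// ler_norm.
Qed.

Lemma Rintegral_patch d (T : measurableType d) (R : realType)
    (mu : {measure set T -> \bar R}) (A B : set T) (h : T -> R) : B `<=` A ->
  \int[mu]_(x in B) h x = \int[mu]_(x in A) (h \_ B) x.
Proof.
move=> BA; rewrite [LHS]Rintegral_mkcond [RHS]Rintegral_mkcond.
congr (Rintegral _ _ _); apply/funext => x; rewrite !patchE.
case: ifPn => [/set_mem/BA Ax|]; first by rewrite mem_set.
by case: ifPn.
Qed.

Section du_Bois_Reymond.
Context {R : realType}.
Local Notation M := (measurableTypeR R).
Local Notation leb := (@lebesgue_measure R).
Variables (m : {measure set M -> \bar R}) (C : @itv_family R)
  (C_eff : effective_intervals C) (f : cumulative R R)
  (lbar : {measure set M -> \bar R}) (N : set M) (g : M -> \bar R).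
Hypothesis H : decomposed m C_eff f lbar N g.

Local Notation lf := (lebesgue_stieltjes_measure f : {measure set M -> \bar R}).

Variables (E r : R -> R).
Hypotheses (iE : forall x y, lf.-integrable `[x, y] (EFin \o E)) (r2 : r \in Lfun m 2%:E).
Hypothesis orthogonal : forall c d phi psi, c <= d -> test_function f phi psi ->
  (forall t, ~ (f c < t < f d) -> psi t = 0) ->
  (forall t, ~ (f c < t < f d) -> phi t = 0) ->
  \int[lf]_(z in `[c, d]) (E z * psi (f z)) +
  2 * \int[m]_(x in `[c, d]) (r x * phi (f x)) = 0.

Let fc := f_continuous H.
Let fi := f_increasing H.
Let f0 := f_zero H.
Let flt := f_lt fi fc f0.
Let fle := f_le fi fc f0.

Lemma radon_cc x y : (m `[x, y]%classic < +oo)%E.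
Proof. by apply: (m_is_radon H); exact: segment_compact. Qed.

Let ir x y : m.-integrable `[x, y] (EFin \o r).
Proof. by apply: Lfun2_integrable => //; exact: radon_cc. Qed.

Let lf_fin x y : (lf `[x, y]%classic < +oo)%E := lf_cc_lty fc x y.

Let mass d z := \int[m]_(x in `[z, d]) r x.

Section window.
Variables c d : R.
Hypothesis cd : c < d.

Let E_mass z := E z + 2 * mass d z.

Let P z := \int[m]_(x in `[z, d]) `|r x|.
Let Q z := \int[m]_(x in `[z, d]) (`|r x| - r x).

Let iabs x y : m.-integrable `[x, y] (EFin \o (fun z => `|r z|)).
Proof. exact: integrable_abse (ir x y). Qed.

Let mcc := measurable_cc c d.

Let monotone_mass (h : R -> R) : (forall x y, m.-integrable `[x, y] (EFin \o h)) ->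
  (forall x, 0 <= h x) -> measurable_fun setT (fun z => \int[m]_(x in `[z, d]) h x : M).
Proof.
move=> ih h0.
have : measurable_fun setT (fun z => - \int[m]_(x in `[z, d]) h x : M).
  apply: nondecreasing_in_measurable => // x y _ _ xy.
  rewrite lerN2 /Rintegral fine_le//; try exact: integrable_fin_num.
  apply: ge0_subset_integral => //; last 2 first.
  - by move=> z _; rewrite lee_fin.
  - by move=> z; rewrite /= !in_itv/= => /andP[/(le_trans xy) -> ->].
  exact: measurable_int (ih _ _).
move=> /measurable_funN; apply: eq_measurable_fun => z _.
by rewrite /= opprK.
Qed.

Let mmass : measurable_fun setT (mass d : M -> M).
Proof.
have -> : mass d = (fun z => P z - Q z).
  apply/funext => z; rewrite /P /Q /mass RintegralB//; first by ring.
apply: measurable_funB; apply: monotone_mass => //.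
- by move=> x y; exact: integrable_realB.
- by move=> x; rewrite subr_ge0 ler_norm.
Qed.

Let mass_le z : c <= z -> `|mass d z| <= P c.
Proof.
move=> cz; apply: le_trans (le_normr_Rintegral _ (ir z d)) _ => //.
rewrite /Rintegral fine_le//; try exact: integrable_fin_num (iabs _ _).
apply: ge0_subset_integral => //.
- exact: measurable_int (iabs _ _).
- by move=> x; rewrite /= !in_itv/= => /andP[/(le_trans cz) -> ->].
Qed.

Let imass : lf.-integrable `[c, d] (EFin \o mass d).
Proof.
apply: (le_integrable mcc _ _ (integrable_cst_lty (P c) mcc (lf_fin c d))).
  by apply/measurable_EFinP; exact: measurable_funTS.
move=> z; rewrite /= in_itv/= => /andP[cz _]; rewrite lee_fin.
by apply: le_trans (mass_le cz) _; exact: ler_norm.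
Qed.

Let iE_mass : lf.-integrable `[c, d] (EFin \o E_mass).
Proof. by apply: integrable_realD => //; exact: integrable_realZ. Qed.

(** By Fubini, the test function phi enters only through its density psi. *)
Let orthogonal_density (psi : R -> R) : bump_class psi ->
  (forall t, ~ (f c < t < f d) -> psi t = 0) ->
  \int[leb]_(t in `[f c, f d]) psi t = 0 ->
  \int[lf]_(z in `[c, d]) (psi (f z) * E_mass z) = 0.
Proof.
move=> bpsi psi0 I0; have spsi := bump_class_smooth bpsi.
have cpsi := smooth_continuous spsi.
have [phi tp phi0] := primitive_test_function H (ltW cd) spsi psi0 I0.
have phiE x : c <= x -> phi (f x) = \int[lf]_(z in `[c, x]) psi (f z).
  move=> cx; rewrite -(comp_increment fi fc f0 cx (test_derive tp) cpsi).
  by rewrite (phi0 (f c)) ?subr0// ltxx.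
have [K Kpsi] : exists K, forall z, `|psi (f z)| <= K.
  have [K0 [_ K0b]] : bounded_set (psi @` `[f c, f d]%classic).
    apply: compact_bounded; apply: continuous_compact; first exact: continuous_subspaceT.
    exact: segment_compact.
  exists (`|K0| + 1) => z; have [fz|nfz] := pselect (f c < f z < f d).
    apply: K0b; first by rewrite (le_lt_trans (ler_norm _))// ltrDl.
    by exists (f z) => //; move: fz; rewrite /= in_itv/= => /andP[/ltW -> /ltW ->].
  by rewrite psi0// normr0 addr_ge0.
have mpsi : measurable_fun setT (psi \o f : M -> M).
  by apply: continuous_measurable_fun => z; apply: continuous_comp; [exact: fc|exact: cpsi].
have := orthogonal (ltW cd) tp psi0 phi0.
have -> : \int[m]_(x in `[c, d]) (r x * phi (f x)) =
    \int[lf]_(z in `[c, d]) (psi (f z) * mass d z).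
  rewrite -(triangle_Fubini (radon_cc c d) (lf_fin c d) (ir c d) mpsi Kpsi).
  apply: eq_Rintegral => x /set_mem; rewrite /= in_itv/= => /andP[cx _].
  by rewrite phiE.
have iEpsi : lf.-integrable `[c, d] (EFin \o (fun z => psi (f z) * E z)).
  exact: (integrable_bounded_mul mcc (measurable_funTS mpsi) (fun z _ => Kpsi z) (iE c d)).
have impsi : lf.-integrable `[c, d] (EFin \o (fun z => psi (f z) * mass d z)).
  exact: (integrable_bounded_mul mcc (measurable_funTS mpsi) (fun z _ => Kpsi z) imass).
move=> <-; rewrite -RintegralZl// -RintegralD//; last 2 first.
- by apply: eq_integrable iEpsi => // z _; rewrite /= mulrC.
- exact: integrable_realZ.
by apply: eq_Rintegral => z _; rewrite /E_mass; ring.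
Qed.

Let b n x y z := bump n (f x) (f y) (f z).

Let mb n x y : measurable_fun (`[c, d]%classic : set M) (b n x y : M -> M).
Proof.
apply: measurable_funTS; apply: continuous_measurable_fun => z.
by apply: (@continuous_comp _ _ _ f (bump n (f x) (f y))); [exact: fc|exact: bump_continuous].
Qed.

Let b1 n x y z : `|b n x y z| <= 1.
Proof. by have /andP[h1 h2] := bump_itv n (f x) (f y) (f z); rewrite ger0_norm. Qed.

Let mpatch (F : R -> R) (A : set M) : lf.-integrable `[c, d] (EFin \o F) -> measurable A ->
  A `<=` `[c, d]%classic -> measurable_fun setT ((F : M -> M) \_ A).
Proof.
move=> iF mA sub; apply/(measurable_restrictT _ mA); apply: measurable_funS sub _ => //.
by apply/measurable_EFinP; exact: measurable_int iF.
Qed.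

Let oo_sub x y : c <= x -> y <= d -> `]x, y[%classic `<=` `[c, d]%classic.
Proof.
move=> cx yd z; rewrite /= !in_itv/= => /andP[/ltW/(le_trans cx) -> /ltW h].
exact: le_trans h yd.
Qed.

Let ipatch (F : R -> R) x y : lf.-integrable `[c, d] (EFin \o F) -> c <= x -> y <= d ->
  lf.-integrable `[c, d] (EFin \o (F \_ `]x, y[%classic)).
Proof.
move=> iF cx yd; apply: (le_integrable mcc _ _ iF).
  apply/measurable_EFinP; apply: measurable_funTS; apply: mpatch => //; exact: oo_sub.
by move=> z _; rewrite /= lee_fin patchE; case: ifPn => // _; rewrite normr0.
Qed.

Let bump_limit (F : R -> R) x y : lf.-integrable `[c, d] (EFin \o F) -> c <= x -> y <= d ->
  \int[lf]_(z in `[c, d]) (b n x y z * F z) @[n --> \oo] -->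
  \int[lf]_(z in `[c, d]) (F \_ `]x, y[%classic) z.
Proof.
move=> iF cx yd; have mF : measurable_fun (`[c, d]%classic : set M) (F : M -> M).
  by apply/measurable_EFinP; exact: measurable_int iF.
have iFxy := ipatch iF cx yd.
have ibF n : lf.-integrable `[c, d] (EFin \o (fun z => b n x y z * F z)).
  exact: (integrable_bounded_mul mcc (mb n x y) (fun z _ => b1 n x y z) iF).
have cv : (\int[lf]_(z in `[c, d]) (b n x y z * F z)%:E)%E @[n --> \oo] -->
    (\int[lf]_(z in `[c, d]) ((F \_ `]x, y[%classic) z)%:E)%E.
  apply: (dominated_cvg mcc (g := fun z => `|F z|%:E)) => //.
  - by move=> n; exact: measurable_int (ibF n).
  - move=> z _; apply: cvg_EFin; first exact: nearW.
    rewrite /= patchE; case: ifPn => [/set_mem|/negP nz].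
      rewrite /= in_itv/= => /andP[xz zy]; rewrite -[X in _ --> X]mul1r.
      by apply: cvgMl; apply: bump_cvg; rewrite !flt xz.
    apply: cvg_near_cst; apply: nearW => n /=; rewrite /b bump_out ?mul0r// !flt => xzy.
    by apply: nz; rewrite inE.
  - exact: integrable_abse iF.
  - move=> n z _; rewrite lee_fin normrM -[leRHS]mul1r.
    by rewrite ler_wpM2r// b1.
rewrite [X in (_ --> X)%classic]RintegralE// in cv.
exact: (fine_cvg cv).
Qed.

Let L x y := \int[lf]_(z in `[c, d]) ((cst 1 : R -> R) \_ `]x, y[%classic) z.
Let I x y := \int[lf]_(z in `[c, d]) (E_mass \_ `]x, y[%classic) z.

Let i1 : lf.-integrable `[c, d] (EFin \o (cst 1 : R -> R)).
Proof. exact: integrable_cst_lty. Qed.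

(** Two bumps, weighted so that their difference has integral zero, are the derivative of a
    test function. *)
Let proportional x y : c <= x -> y <= d -> L c d * I x y = L x y * I c d.
Proof.
move=> cx yd; pose bf n x y : R -> R := bump n (f x) (f y).
have bf0 n x' y' t : c <= x' -> y' <= d -> ~ (f c < t < f d) -> bf n x' y' t = 0.
  move=> cx' yd' nt; apply: bump_out => /andP[h1 h2]; apply: nt.
  by rewrite (le_lt_trans _ h1) ?fle//= (lt_le_trans h2)// fle.
pose A n x y := \int[leb]_(t in `[f c, f d]) bf n x y t.
have AL x' y' : c <= x' -> y' <= d -> A n x' y' @[n --> \oo] --> L x' y'.
  move=> cx' yd'.
  rewrite (_ : (fun n => A n x' y') = fun n => \int[lf]_(z in `[c, d]) (b n x' y' z * cst 1 z)).
    exact: bump_limit.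
  apply/funext => n; rewrite /A -(comp_integral fi fc f0 (ltW cd)); last exact: bump_continuous.
  by apply: eq_Rintegral => z _; rewrite mulr1.
have key n : A n c d * \int[lf]_(z in `[c, d]) (b n x y z * E_mass z) =
    A n x y * \int[lf]_(z in `[c, d]) (b n c d z * E_mass z).
  pose psi := (cst (A n c d) \* bf n x y) \+ (cst (- A n x y) \* bf n c d).
  have bpsi : bump_class psi.
    by apply: bump_add; apply: bump_mul; try exact: bump_cst; exact: bump_class_bump.
  have psi0 t : ~ (f c < t < f d) -> psi t = 0.
    by move=> nt; rewrite /psi /= !bf0// !mulr0 addr0.
  have ib x' y' : leb.-integrable `[f c, f d] (EFin \o bf n x' y').
    by apply: continuous_integrable_cc; exact: bump_continuous.
  have I0 : \int[leb]_(t in `[f c, f d]) psi t = 0.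
    rewrite /psi /= RintegralD//; try exact: integrable_realZ.
    by rewrite !RintegralZl// -/(A n x y) -/(A n c d); ring.
  have ibH x' y' : lf.-integrable `[c, d] (EFin \o (fun z => b n x' y' z * E_mass z)).
    exact: (integrable_bounded_mul mcc (mb n x' y') (fun z _ => b1 n x' y' z) iE_mass).
  have := orthogonal_density bpsi psi0 I0.
  have -> : \int[lf]_(z in `[c, d]) (psi (f z) * E_mass z) =
     A n c d * \int[lf]_(z in `[c, d]) (b n x y z * E_mass z) +
     - A n x y * \int[lf]_(z in `[c, d]) (b n c d z * E_mass z).
    rewrite -!RintegralZl// -RintegralD//; try exact: integrable_realZ.
    by apply: eq_Rintegral => z _; rewrite /psi /= /bf /b; ring.
  by rewrite mulNr => /eqP; rewrite subr_eq0 => /eqP.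
have c1 : A n c d * \int[lf]_(z in `[c, d]) (b n x y z * E_mass z) @[n --> \oo] --> L c d * I x y.
  by apply: cvgM; [exact: AL|exact: bump_limit].
have c2 : A n x y * \int[lf]_(z in `[c, d]) (b n c d z * E_mass z) @[n --> \oo] --> L x y * I c d.
  by apply: cvgM; [exact: AL|exact: bump_limit].
rewrite (_ : (fun n => A n c d * _) = fun n => A n x y * \int[lf]_(z in `[c, d]) (b n c d z * E_mass z)) in c1.
  exact: (cvg_unique (@Rhausdorff R) c1 c2).
by apply/funext => n; exact: key.
Qed.

Let patch_ends (F : R -> R) x : lf.-integrable `[c, d] (EFin \o F) -> c <= x ->
  \int[lf]_(z in `[x, d]) F z = \int[lf]_(z in `[c, d]) (F \_ `]x, d[%classic) z.
Proof.
move=> iF cx; rewrite -Rintegral_patch; last first.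
  by move=> z; rewrite /= !in_itv/= => /andP[/ltW/(le_trans cx) -> /ltW ->].
rewrite /Rintegral; congr fine; rewrite [LHS]integral_mkcond [RHS]integral_mkcond.
have cc_sub : `[x, d]%classic `<=` `[c, d]%classic.
  by move=> z; rewrite /= !in_itv/= => /andP[/(le_trans cx) -> ->].
have oosub := oo_sub cx (lexx d).
apply: ae_eq_rintegral => //.
- rewrite restrict_EFin; apply/measurable_EFinP; exact: mpatch.
- rewrite restrict_EFin; apply/measurable_EFinP; exact: mpatch.
exists ([set x] `|` [set d]); split.
- exact: measurableU.
- apply/eqP; rewrite eq_le measure_ge0 andbT; apply: le_trans (measureU2 _ _ _) _ => //.
  by rewrite [X in (X + _)%E](lf_set1 H) [X in (_ + X)%E](lf_set1 H) adde0.
- move=> z /= nz; apply: contrapT => nxd; apply: nz; rewrite !patchE.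
  have -> : (z \in `[x, d]%classic) = (z \in `]x, d[%classic).
    apply/idP/idP; rewrite !inE/= !in_itv/= => /andP[h1 h2].
      rewrite !lt_neqAle h1 h2 !andbT; apply/andP; split; apply/eqP => e; apply: nxd.
        by left.
      by right.
    by rewrite !ltW.
  by [].
Qed.

(** The integral of E + 2 mass over ]x, y[ is proportional to the measure of f there. *)
Lemma window_constant : exists kappa : R,
  {ae lf, forall z, `[c, d]%classic z -> E z + 2 * mass d z = kappa}.
Proof.
have L0 : 0 < L c d.
  apply: (@Rintegral_gt0 _ M R lf _ (`]c, d[%classic : set M)) => //.
  - by move=> z; rewrite /= !in_itv/= => /andP[/ltW -> /ltW ->].
  - exact: (lf_oo_gt0 H).
  - exact: ipatch.
  - by move=> z _; rewrite patchE; case: ifPn.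
  - by move=> z zcd; rewrite patchE mem_set.
exists (I c d / L c d).
have : ae_eq lf `[c, d]%classic (EFin \o E_mass) (EFin \o cst (I c d / L c d)).
  apply: cc_ae_eq => //; first exact: integrable_cst_lty.
  move=> x /andP[cx xd].
  have sub : `[x, d]%classic `<=` `[c, d]%classic.
    by move=> z; rewrite /= !in_itv/= => /andP[/(le_trans cx) -> ->].
  have iHx : lf.-integrable `[x, d] (EFin \o E_mass) by apply: integrableS iE_mass.
  rewrite !RintegralE//; last exact: integrable_cst_lty.
  congr (_%:E); rewrite patch_ends// -/(I x d).
  have -> : \int[lf]_(z in `[x, d]) cst (I c d / L c d) z = I c d / L c d * L x d.
    have i1x : lf.-integrable `[x, d] (EFin \o (cst 1 : R -> R)) by apply: integrableS i1.
    have -> : L x d = \int[lf]_(z in `[x, d]) cst 1 z := esym (patch_ends i1 cx).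
    rewrite -RintegralZl//.
    by apply: eq_Rintegral => z _; rewrite mulr1.
  rewrite mulrAC [I c d * _]mulrC -(proportional cx (lexx d)) mulrAC divff ?mul1r//.
  by rewrite gt_eqF.
by apply: ae_imply => z h zcd; have := h zcd => -[].
Qed.

End window.

Definition signed_mass (z : R) : R :=
  if 0 <= z then \int[m]_(x in `[0, z[) r x else - \int[m]_(x in `[z, 0[) r x.

Let co x y := \int[m]_(z in `[x, y[) r z.

Let ico x y (A : set M) : measurable A -> A `<=` `[x, y]%classic -> m.-integrable A (EFin \o r).
Proof. by move=> mA sub; apply: integrableS (ir x y). Qed.

Let co_add x y z : x <= y -> y <= z -> co x z = co x y + co y z.
Proof.
move=> xy yz; have sub a b : `[a, b[%classic `<=` `[a, b]%classic :> Prop.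
  by move=> t; rewrite /= !in_itv/= => /andP[-> /ltW].
rewrite /co -Rintegral_setU//.
- by congr (Rintegral _ _ _); rewrite -itv_bndbnd_setU// bnd_simp.
- apply: (@ico x z); first exact: measurableU.
  move=> t [] /=; rewrite !in_itv/= => /andP[h1 h2]; apply/andP; split => //.
  + exact: le_trans (ltW h2) yz.
  + exact: le_trans xy h1.
  + exact: ltW.
- apply/disj_setPS => t [] /=; rewrite !in_itv/= => /andP[_ h1] /andP[h2 _].
  by move: h1; rewrite ltNge h2.
Qed.

Let signed_mass_inc z z' : z <= z' -> signed_mass z' - signed_mass z = co z z'.
Proof.
move=> zz; rewrite /signed_mass; case: (leP 0 z) => z0.
  by rewrite (le_trans z0 zz) -/(co 0 z) -/(co 0 z') (co_add z0 zz); ring.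
case: (leP 0 z') => z'0.
  by rewrite -/(co 0 z') -/(co z 0) (co_add (ltW z0) z'0); ring.
by rewrite -/(co z' 0) -/(co z 0) (co_add zz (ltW z'0)); ring.
Qed.

Let mass_co d z : z <= d -> mass d z = co z d + \int[m]_(x in [set d]) r x.
Proof.
move=> zd; rewrite /mass /co -Rintegral_setU//.
- congr (Rintegral _ _ _); apply/seteqP; split => t /=; rewrite !in_itv/=.
    move=> /andP[h1]; rewrite le_eqVlt => /orP[/eqP ->|h2]; [by right|by left; rewrite h1].
  by move=> [/andP[-> /ltW]|->]//; rewrite zd lexx.
- apply: (@ico z d); first exact: measurableU.
  move=> t [|->] /=; rewrite !in_itv/= ?zd ?lexx//.
  by move=> /andP[-> /ltW].
- apply/disj_setPS => t [] /=; rewrite !in_itv/= => /andP[_ h] e.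
  by move: h; rewrite e ltxx.
Qed.

(** The constants for two windows agree once the mass is counted from 0 instead of the end of
    the window. This is the weak form of the equation dE = 2 r dm. *)
Lemma density_equation : exists G : R -> R,
  (forall x y, x <= y -> G y - G x = 2 * \int[m]_(z in `[x, y[) r z) /\
  {ae lf, forall z, E z = G z}.
Proof.
have win n : exists k, {ae lf, forall z, `[- n.+1%:R, n.+1%:R]%classic z ->
    E z - 2 * signed_mass z = k}.
  have [|k hk] := @window_constant (- n.+1%:R) n.+1%:R; first by rewrite gtrN// ltr0n.
  exists (k - 2 * (signed_mass n.+1%:R + \int[m]_(x in [set n.+1%:R]) r x)).
  apply: ae_imply hk => z h zn; rewrite -(h zn) mass_co; last first.
    by move: zn; rewrite /= in_itv/= => /andP[].
  by rewrite -signed_mass_inc; [ring|move: zn; rewrite /= in_itv/= => /andP[]].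
have /choice[k hk] := win.
have kE n : k n = k 0%N.
  apply: contrapT => kn.
  have [A [mA A0 hA]] : {ae lf, forall z, ~ `[(- 1)%R, 1%R]%classic z}.
    move: (hk n) (hk 0%N); apply: ae_imply2 => z h1 h2 z1; apply: kn.
    rewrite -(h1 _) -?(h2 _)//; move: z1; rewrite /= !in_itv/= => /andP[z1 z2].
    have n1 : 1 <= n.+1%:R :> R by rewrite ler1n.
    by apply/andP; split; lra.
  have := whole_line_cc fc I I (_ : - 1 <= 1 :> R).
  move=> /(_ _) e; have {e} e : lf `[(- 1)%R, 1%R]%classic = (f 1 - f (- 1))%:E by apply: e; lra.
  have : (lf `[(- 1)%R, 1%R]%classic <= 0)%E.
    rewrite -A0; apply: le_measure; rewrite ?inE//.
  by move=> z z1; apply: hA => /= /(_ z1).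
  by rewrite [X in (X <= _)%E]e lee_fin leNgt subr_gt0 fi//; lra.
exists (fun z => k 0%N + 2 * signed_mass z); split.
  by move=> x y xy; rewrite -/(co x y) -signed_mass_inc//; ring.
have : {ae lf, forall z n, `[- n.+1%:R, n.+1%:R]%classic z -> E z - 2 * signed_mass z = k n}.
  by apply: ae_foralln => n; exact: hk.
apply: ae_imply => z hz; have [n /andP[n1 n2]] := nat_itvP z.
have := hz n; rewrite kE => <-; first by ring.
rewrite /= in_itv/= -natr1; apply/andP; split; lra.
Qed.

End du_Bois_Reymond.


(** * Vanishing of the orthogonal part *)

Section pointwise_bounds.
Context d (T : measurableType d) (R : realType).
Variable mu : {measure set T -> \bar R}.

(** Chebyshev. *)
Lemma Lfun2_level (h : T -> R) A (c : R) : measurable A -> 0 < c -> h \in Lfun mu 2%:E ->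
  {ae mu, forall x, A x -> c <= `|h x|} -> (mu A < +oo)%E.
Proof.
move=> mA c0 h2 hA; have mh := Lfun2_measurable h2.
have m2 B : measurable_fun B (fun x => (h x ^+ 2)%:E).
  by apply/measurable_EFinP; apply: measurable_funTS; exact: measurable_funX.
have : (\int[mu]_(x in A) (c ^+ 2)%:E <= \int[mu]_x (h x ^+ 2)%:E)%E.
  apply: (@le_trans _ _ (\int[mu]_(x in A) (h x ^+ 2)%:E)%E); last first.
    by apply: ge0_subset_integral => // x _; rewrite lee_fin sqr_ge0.
  apply: ae_ge0_le_integral => //.
  - by move=> x _; rewrite lee_fin sqr_ge0.
  - by move=> x _; rewrite lee_fin sqr_ge0.
  - apply: ae_imply hA => x hx Ax; rewrite lee_fin -[leRHS]real_normK ?num_real//.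
    by rewrite lerXn2r ?nnegrE ?normr_ge0 ?(ltW c0)//; exact: hx.
rewrite integral_cst// (Lfun2_sqrE h2); apply: contraTT; rewrite -leNgt leye_eq => /eqP ->.
by rewrite gt0_muley ?lte_fin ?exprn_gt0// leye_eq.
Qed.

Lemma Rintegral_ge_cst (h : T -> R) A (c : R) : measurable A -> (mu A < +oo)%E ->
  mu.-integrable A (EFin \o h) -> {ae mu, forall x, A x -> c <= h x} ->
  c * fine (mu A) <= \int[mu]_(x in A) h x.
Proof.
move=> mA Afin ih hA; rewrite -(Rintegral_cst mu mA c).
have ic : mu.-integrable A (EFin \o cst c) by exact: integrable_cst_lty.
rewrite -subr_ge0 -RintegralB//.
have mhc : measurable_fun A (fun x => h x - c).
  by apply: measurable_funB => //; apply/measurable_EFinP; exact: measurable_int ih.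
rewrite /Rintegral fine_ge0// (ae_eq_integral (fun x => (`|h x - c|)%:E))//.
- by apply: integral_ge0 => x _; rewrite lee_fin.
- exact/measurable_EFinP.
- by apply/measurable_EFinP; exact: measurableT_comp.
- by apply: ae_imply hA => x hx Ax; rewrite ger0_norm// subr_ge0; exact: hx.
Qed.

End pointwise_bounds.

Lemma ae_neq (R : realType) (mu : {measure set (measurableTypeR R) -> \bar R}) (x : R) :
  mu [set x] = 0%E -> {ae mu, forall t, t <> x}.
Proof. by move=> x0; exists [set x]; split => // t /=; exact: contrapT. Qed.

(** The integral of a square-integrable function over small sets is small, because a
    decreasing sequence of sets of finite measure with empty intersection has measures
    tending to zero. *)
Lemma Rintegral_small (R : realType) (mu : {measure set (measurableTypeR R) -> \bar R})
    (h : R -> R) (F : nat -> set (measurableTypeR R)) (e : R) : h \in Lfun mu 2%:E ->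
  (forall n, measurable (F n)) -> nonincreasing_seq F -> (mu (F 0%N) < +oo)%E ->
  \bigcap_n F n = set0 -> 0 < e -> exists n, forall A, measurable A -> A `<=` F n ->
  `|\int[mu]_(x in A) h x| <= e.
Proof.
move=> h2 mF dF F0 capF e0; pose K := \int[mu]_x (h x ^+ 2).
have K0 : 0 <= K by apply: Rintegral_ge0 => x _; exact: sqr_ge0.
have eK : 0 < e ^+ 2 / (K + 1) by rewrite divr_gt0 ?exprn_gt0//; lra.
have [n Fn] := nonincreasing_null mF dF F0 capF (measure0 mu) eK.
exists n => A mA AF.
have Ale : (mu A <= mu (F n))%E by apply: le_measure; rewrite ?inE.
have Afin : (mu A < +oo)%E by apply: le_lt_trans Ale (lt_trans Fn (ltry _)).
rewrite -(ler_pXn2r (_ : 0 < 2)%N) ?nnegrE ?normr_ge0 ?(ltW e0)// real_normK ?num_real//.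
apply: le_trans (Rintegral_sqr_le mA Afin h2) _.
have i2 : mu.-integrable setT (fun x => (h x ^+ 2)%:E) by exact: (Lfun2M h2 h2).
have le1 : \int[mu]_(x in A) (h x ^+ 2) <= K.
  rewrite /K /Rintegral fine_le//.
  - by apply: integrable_fin_num => //; exact: integrableS i2.
  - exact: integrable_fin_num.
  - apply: ge0_subset_integral => //; first exact: measurable_int i2.
    by move=> x _; rewrite lee_fin sqr_ge0.
have le2 : fine (mu A) <= e ^+ 2 / (K + 1).
  rewrite -lee_fin fineK ?ge0_fin_numE//; exact: le_trans Ale (ltW Fn).
apply: (@le_trans _ _ (e ^+ 2 / (K + 1) * (K + 1))); last by rewrite divfK// gt_eqF//; lra.
apply: ler_pM => //.
- by apply: Rintegral_ge0 => x _; exact: sqr_ge0.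
- by lra.
Qed.


Section small_windows.
Context {R : realType}.
Local Notation M := (measurableTypeR R).
Variables (m : {measure set M -> \bar R}) (h : R -> R).
Hypotheses (h2 : h \in Lfun m 2%:E) (m_cc : forall x y, (m `[x, y]%classic < +oo)%E).

Let shrink (i j : nat) : (i <= j)%N -> j.+1%:R^-1 <= i.+1%:R^-1 :> R.
Proof. by move=> ij; rewrite lef_pV2 ?posrE ?ltr0n// ler_nat. Qed.

Lemma Rintegral_small_right b (e : R) : 0 < e -> exists2 d : R, 0 < d &
  forall z, b <= z <= b + d -> `|\int[m]_(x in `]b, z[) h x| <= e.
Proof.
move=> e0; pose F n : set M := `]b, b + n.+1%:R^-1]%classic.
have mF n : measurable (F n) by exact: measurable_itv.
have [|||n hn] := Rintegral_small (F := F) h2 mF _ _ _ e0.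
- move=> i j ij; apply/subsetPset => z; rewrite /F /= !in_itv/= => /andP[-> /le_trans]; apply.
  by rewrite lerD2l shrink.
- apply: le_lt_trans (m_cc b (b + 1)); apply: le_measure; rewrite ?inE//.
  by move=> z; rewrite /F /= !in_itv/= invr1 => /andP[/ltW -> ->].
- apply/seteqP; split => // z hz; have := hz 0%N I; rewrite /F /= in_itv/= => /andP[bz _].
  have z0 : 0 < z - b by lra.
  have [n _ hn] := near_infty_natSinv_lt (PosNum z0).
  have := hn n (leqnn n); have := hz n I; rewrite /F /= in_itv/= => /andP[_].
  by move: (n.+1%:R^-1) => a *; lra.
exists n.+1%:R^-1; first by rewrite invr_gt0 ltr0n.
move=> z /andP[bz zd]; apply: hn => //.
by move=> t; rewrite /F /= !in_itv/= => /andP[-> tz]; exact: le_trans (ltW tz) zd.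
Qed.

Lemma Rintegral_small_left a (e : R) : 0 < e -> exists2 d : R, 0 < d &
  forall z, a - d <= z <= a -> `|\int[m]_(x in `[z, a[) h x| <= e.
Proof.
move=> e0; pose F n : set M := `[a - n.+1%:R^-1, a[%classic.
have mF n : measurable (F n) by exact: measurable_itv.
have [|||n hn] := Rintegral_small (F := F) h2 mF _ _ _ e0.
- move=> i j ij; apply/subsetPset => z; rewrite /F /= !in_itv/= => /andP[+ ->]; rewrite andbT.
  by apply: le_trans; rewrite lerD2l lerN2 shrink.
- apply: le_lt_trans (m_cc (a - 1) a); apply: le_measure; rewrite ?inE//.
  by move=> z; rewrite /F /= !in_itv/= invr1 => /andP[-> /ltW ->].
- apply/seteqP; split => // z hz; have := hz 0%N I; rewrite /F /= in_itv/= => /andP[_ za].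
  have z0 : 0 < a - z by lra.
  have [n _ hn] := near_infty_natSinv_lt (PosNum z0).
  have := hn n (leqnn n); have := hz n I; rewrite /F /= in_itv/= => /andP[+ _].
  by move: (n.+1%:R^-1) => b *; lra.
exists n.+1%:R^-1; first by rewrite invr_gt0 ltr0n.
move=> z /andP[bz zd]; apply: hn => //.
by move=> t; rewrite /F /= !in_itv/= => /andP[zt ->]; rewrite andbT; exact: le_trans zt.
Qed.

End small_windows.

Section remainder.
Context {R : realType}.
Local Notation M := (measurableTypeR R).
Variables (m : {measure set M -> \bar R}) (C : @itv_family R)
  (C_eff : effective_intervals C) (f : cumulative R R)
  (lbar : {measure set M -> \bar R}) (N : set M) (g : M -> \bar R).
Hypothesis H : decomposed m C_eff f lbar N g.

Local Notation lf := (lebesgue_stieltjes_measure f : {measure set M -> \bar R}).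
Local Notation lfe := (mrestr lf (measurable_covered C_eff)
  : {measure set M -> \bar R}).
Local Notation lft := (mrestr lf (measurable_uncovered C_eff)
  : {measure set M -> \bar R}).
Local Notation merge := (interval_merge lft lbar C).
Local Notation conn := (connected_points C_eff f lbar).

Let hM : carries merge lbar := carries_merge H.
Let mC : measurable (covered C) := measurable_covered C_eff.

(** The difference r between a merged function and its projection, with the equation obeyed
    by its density on the whole line, gaps included. *)
Record remainder (r w D G : R -> R) : Prop := {
  remainder_represents : represents m merge lbar r w D ;
  remainder_increments : forall x y, x <= y -> G y - G x = 2 * \int[m]_(z in `[x, y[) r z ;
  remainder_density : {ae lf, forall z, (D \_ (covered C)) z = G z} }.

Lemma remainder_opp r w D G : remainder r w D G ->
  remainder (fun x => - r x) (fun x => - w x) (fun x => - D x) (fun x => - G x).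
Proof.
move=> [h hG hD]; have E (k : R -> R) : (fun x => -2 * k x + k x) = (fun x => - k x).
  by apply/funext => x; ring.
have r2 := represents_L2 h; split.
- by have := represents_linear hM (-2) h h; rewrite !E.
- move=> x y xy; rewrite -opprD hG// -mulrN; congr (_ * _).
  rewrite -mulN1r -RintegralZl//.
    by apply: eq_Rintegral => z _; rewrite mulN1r.
  apply: (Lfun2_integrable _ _ r2) => //; apply: le_lt_trans (radon_cc H x y).
  apply: le_measure; rewrite ?inE//.
  by move=> z; rewrite /= !in_itv/= => /andP[-> /ltW].
- by apply: ae_imply hD => z; rewrite !patchE; case: ifPn => _ <-; rewrite ?oppr0.
Qed.

Section endpoints.
Variables (r w D G : R -> R).
Hypothesis hr : remainder r w D G.

Let r2 := represents_L2 (remainder_represents hr).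
Let D2 := represents_density_L2 (remainder_represents hr).

Lemma remainder_density_lbar : {ae lbar, forall x, D x = G x}.
Proof.
have : {ae lfe, forall x, (D \_ (covered C)) x = G x /\ covered C x}.
  apply: (ae_restricted mC (mu := lf)) => //.
  by apply: ae_imply (remainder_density hr) => x e Cx.
move/(ae_lbar_lfe H); apply: ae_imply => x [+ Cx].
by rewrite patchE mem_set.
Qed.

Let open_interval (mu : {measure set M -> \bar R}) x y : mu [set x] = 0%E -> mu [set y] = 0%E ->
  (mu `[x, y]%classic <= mu `]x, y[%classic)%E.
Proof.
move=> x0 y0; apply: (@le_trans _ _ (mu ([set x] `|` ([set y] `|` `]x, y[%classic)))).
  apply: le_measure; rewrite ?inE//; first by do 2 apply: measurableU => //.
  move=> z; rewrite /= !in_itv/= !le_eqVlt => /andP[/orP[/eqP ->|xz]]; first by left.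
  by move=> /orP[/eqP ->|zy]; right; [left|right; rewrite xz].
apply: le_trans (measureU2 _ _ _) _ => //; first by apply: measurableU.
rewrite [X in (X + _)%E]x0 add0e; apply: le_trans (measureU2 _ _ _) _ => //.
by rewrite [X in (X + _)%E]y0 add0e.
Qed.

(** Where the density stays away from zero there is no gap for lf, as it vanishes off the
    intervals, and lbar is finite, as it is square-integrable. *)
Lemma density_conn x y (c : R) : x <= y -> 0 < c -> (forall z, x < z < y -> c <= `|G z|) ->
  conn x y.
Proof.
move=> xy c0 hG; have moo : measurable (`]x, y[%classic : set M) by exact: measurable_itv.
apply/connP => //; split.
  have t0 z : lft [set z] = 0%E.
    apply/eqP; rewrite eq_le measure_ge0 andbT -(lf_set1 H z).
    by apply: le_measure; rewrite ?inE//; apply: measurableI => //; exact: measurable_uncovered.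
  apply/eqP; rewrite eq_le measure_ge0 andbT.
  apply: le_trans (open_interval (t0 x) (t0 y)) _.
  have [A [mA A0 sub]] := remainder_density hr.
  rewrite -A0; apply: le_measure; rewrite ?inE//; first by apply: measurableI => //; exact: measurable_uncovered.
  move=> z /= [zxy nC]; apply: sub => /=; rewrite patchE memNset// => e.
  move: zxy; rewrite in_itv/= => /hG; rewrite -e normr0; lra.
apply: le_lt_trans (open_interval (lbar_set1 H x) (lbar_set1 H y)) _.
apply: (Lfun2_level moo c0 D2); apply: ae_imply remainder_density_lbar => z ->.
by rewrite /= in_itv/=; exact: hG.
Qed.

Variable k : nat.
Hypothesis mk : indices merge k.
Let I := itv merge k.
Let nI : nondegenerate_interval I := carries_itv hM mk.
Let iI : is_interval I := nI.1.

Let w_cvg x : I x -> forall e : R, 0 < e -> exists2 d : R, 0 < d &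
  forall t, I t -> `|t - x| < d -> `|w x - w t| < e.
Proof.
move=> Ix e e0.
have /cvgrPdist_lt/(_ e e0)[d d0 hd] := increments_continuous (carries_scale hM mk)
  (carries_cc hM mk) D2 (represents_increments (remainder_represents hr) mk) Ix.
by exists d => // t It td; apply: (hd t) => //; rewrite /= distrC.
Qed.

Let ir (A : set M) x y : measurable A -> A `<=` `[x, y]%classic -> m.-integrable A (EFin \o r).
Proof.
move=> mA sub; apply: (Lfun2_integrable mA _ r2); apply: le_lt_trans (radon_cc H x y).
by apply: le_measure; rewrite ?inE//.
Qed.

Let G_le (c x y : R) : x <= y -> (forall t, x <= t < y -> I t /\ c <= w t) ->
  G x + 2 * (c * fine (m `[x, y[%classic)) <= G y.
Proof.
move=> xy hw; have sub : `[x, y[%classic `<=` `[x, y]%classic :> Prop.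
  by move=> z; rewrite /= !in_itv/= => /andP[-> /ltW].
rewrite -lerBrDl (remainder_increments hr xy) ler_wpM2l//.
apply: Rintegral_ge_cst => //; last 2 first.
- exact: ir sub.
- apply: ae_imply (represents_ae (remainder_represents hr)) => z <-.
  by rewrite /= in_itv/= => /hw[].
apply: le_lt_trans (radon_cc H x y); apply: le_measure; rewrite ?inE//.
Qed.

Let G_mono x y : x <= y -> (forall t, x <= t < y -> I t /\ 0 <= w t) -> G x <= G y.
Proof. by move=> xy /(G_le xy); rewrite mul0r mulr0 addr0. Qed.

Let w_mono (e x y : R) : I x -> I y -> x <= y -> (forall t, x < t < y -> 0 <= e * G t) ->
  0 <= e * (w y - w x).
Proof.
move=> Ix Iy xy hG; have ck := carries_cc hM mk.
have iD := Lfun2_integrable_cc ck D2 Ix Iy.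
rewrite (represents_increments (remainder_represents hr) mk Ix Iy xy).
have lfin : (lbar `[x, y]%classic < +oo)%E by rewrite ck// ltry.
rewrite -RintegralZl//.
have -> : 0 = 0 * fine (lbar `[x, y]%classic) by rewrite mul0r.
apply: Rintegral_ge_cst => //; first exact: integrable_realZ.
have nx := ae_neq (lbar_set1 H x).
have ny := ae_neq (lbar_set1 H y).
apply: ae_imply2 remainder_density_lbar (ae_imply2 (fun t => @conj _ _) nx ny).
move=> t -> [/eqP tx /eqP ty]; rewrite /= in_itv/= => /andP[xt ty']; apply: hG.
by rewrite !lt_neqAle xt ty' ty eq_sym tx.
Qed.

Let between x y t : I x -> I y -> x <= t <= y -> I t.
Proof. by move=> Ix Iy /(iI Ix Iy). Qed.

(** At the first point where w would fall to half its value, w has only increased. *)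
Let level_right x0 y : I x0 -> 0 < w x0 -> 0 <= G x0 -> I y -> x0 <= y -> w x0 / 2 <= w y.
Proof.
move=> Ix0 w0 G0 Iy xy; rewrite leNgt; apply/negP => wy.
pose K := [set t | x0 <= t <= y /\ w t <= w x0 / 2].
have Ky : K y by split; [rewrite xy lexx|exact: ltW].
have K0 : has_inf K by split; [exists y|exists x0 => t [/andP[]]].
have le0 : x0 <= inf K by apply: lb_le_inf; [exists y|move=> t [/andP[]]].
have ley : inf K <= y by apply: ge_inf => //; exact: K0.2.
have I0 : I (inf K) by apply: (between Ix0 Iy); rewrite le0.
have above t : x0 <= t < inf K -> w x0 / 2 < w t.
  move=> /andP[xt tK]; rewrite ltNge; apply/negP => wt.
  have : inf K <= t by apply: ge_inf; [exact: K0.2|split => //; rewrite xt (le_trans (ltW tK))].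
  by rewrite leNgt tK.
have wK : w (inf K) <= w x0 / 2.
  rewrite leNgt; apply/negP => hw.
  have [d d0 hd] := w_cvg I0 (e := w (inf K) - w x0 / 2) (ltac:(lra)).
  have [t Kt td] := inf_adherent d0 K0.
  have Kle : inf K <= t by apply: ge_inf => //; exact: K0.2.
  have [/andP[xt ty] wt] := Kt.
  have /ltr_normlW : `|w (inf K) - w t| < w (inf K) - w x0 / 2.
    apply: hd; first by apply: (between Ix0 Iy); rewrite xt.
    by rewrite ger0_norm; lra.
  by lra.
have : 0 <= 1 * (w (inf K) - w x0).
  apply: w_mono => // t /andP[xt tK]; rewrite mul1r; apply: le_trans G0 _.
  apply: G_mono => [|z /andP[xz zt]]; first exact: ltW.
  have zK := lt_trans zt tK; split; first by apply: (between Ix0 I0); rewrite xz ltW.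
  by have := above z; rewrite xz zK => /(_ isT); lra.
by lra.
Qed.

Let level_left x0 y : I x0 -> 0 < w x0 -> G x0 <= 0 -> I y -> y <= x0 -> w x0 / 2 <= w y.
Proof.
move=> Ix0 w0 G0 Iy yx; rewrite leNgt; apply/negP => wy.
pose K := [set t | y <= t <= x0 /\ w t <= w x0 / 2].
have Ky : K y by split; [rewrite yx lexx|exact: ltW].
have K0 : has_sup K by split; [exists y|exists x0 => t [/andP[]]].
have le0 : sup K <= x0 by apply: ge_sup; [exists y|move=> t [/andP[]]].
have ley : y <= sup K by apply: ub_le_sup => //; exact: K0.2.
have I0 : I (sup K) by apply: (between Iy Ix0); rewrite ley.
have above t : sup K < t <= x0 -> w x0 / 2 < w t.
  move=> /andP[tK tx]; rewrite ltNge; apply/negP => wt.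
  have : t <= sup K.
    by apply: ub_le_sup; [exact: K0.2|split => //; rewrite tx (le_trans ley (ltW tK))].
  by rewrite leNgt tK.
have wK : w (sup K) <= w x0 / 2.
  rewrite leNgt; apply/negP => hw.
  have [d d0 hd] := w_cvg I0 (e := w (sup K) - w x0 / 2) (ltac:(lra)).
  have [t Kt td] := sup_adherent d0 K0.
  have Kle : t <= sup K by apply: ub_le_sup => //; exact: K0.2.
  have [/andP[yt tx] wt] := Kt.
  have /ltr_normlW : `|w (sup K) - w t| < w (sup K) - w x0 / 2.
    apply: hd; first by apply: (between Iy Ix0); rewrite yt.
    by rewrite ler0_norm; lra.
  by lra.
have : 0 <= -1 * (w x0 - w (sup K)).
  apply: w_mono => // t /andP[Kt tx]; rewrite mulN1r oppr_ge0; apply: le_trans G0.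
  apply: G_mono => [|z /andP[tz zx]]; first exact: ltW.
  have zK := lt_le_trans Kt tz; split; first by apply: (between I0 Ix0); rewrite (ltW zK) ltW.
  by have := above z; rewrite zK (ltW zx) => /(_ isT); lra.
by lra.
Qed.

Let m_co_gt0 x y : x < y -> 0 < fine (m `[x, y[%classic).
Proof.
move=> xy; apply: fine_gt0; apply/andP; split.
  apply: (@lt_le_trans _ _ (m `]x, y[%classic)).
    apply: (m_is_supported H); first exact: itv_open.
    by exists ((x + y) / 2); rewrite /= in_itv/=; apply/andP; split; lra.
  by apply: le_measure; rewrite ?inE// => z; rewrite /= !in_itv/= => /andP[/ltW -> ->].
apply: le_lt_trans (radon_cc H x y); apply: le_measure; rewrite ?inE//.
by move=> z; rewrite /= !in_itv/= => /andP[-> /ltW].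
Qed.

(** Starting from a point with w > 0 and G >= 0, both functions stay bounded away from
    zero up to the right endpoint b of the interval. If b is finite, G stays away from
    zero also beyond b, so that points beyond b would be merged; otherwise lbar and m are
    finite near +oo and the boundary condition fails. *)
Lemma no_positive_right x0 x1 : I x0 -> I x1 -> x0 < x1 -> 0 < w x0 -> 0 <= G x0 -> False.
Proof.
move=> Ix0 Ix1 x01 w0 G0.
have lev := level_right Ix0 w0 G0.
have c0 : 0 < G x1.
  apply: le_lt_trans G0 (lt_le_trans _ (G_le (c := w x0 / 2) (ltW x01) _)).
    by rewrite ltrDl; apply: mulr_gt0 => //; apply: mulr_gt0; [lra|exact: m_co_gt0].
  move=> t /andP[xt tx]; have It : I t by apply: (between Ix0 Ix1); rewrite xt ltW.
  by split => //; exact: lev.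
set c := G x1 in c0.
have Gx1 y : x1 <= y -> (forall t, x1 <= t < y -> I t) -> c <= G y.
  move=> xy It; apply: G_mono => // t xt; split; first exact: It.
  apply: le_trans (lev _ (It _ xt) _); first by lra.
  by move: xt => /andP[? _]; lra.
have beyond t : x1 <= t -> (t%:E < upper I)%E -> I t.
  move=> xt tu; apply: (between_interval iI); rewrite tu andbT.
  apply: (@lt_le_trans _ _ x1%:E); last by rewrite lee_fin.
  apply: (@le_lt_trans _ _ x0%:E); last by rewrite lte_fin.
  by have /andP[] := interval_between Ix0.
have := (interval_between Ix1); case eu : (upper I) => [b| |]; last by rewrite andbC.
- move=> /andP[_]; rewrite lee_fin => x1b.
  have Ib t : x1 <= t < b -> I t by move=> /andP[xt tb]; apply: beyond => //; rewrite eu lte_fin.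
  have Gb : c <= G b by exact: Gx1.
  have cb : conn x1 b.
    apply: (density_conn x1b c0) => z /andP[xz zb]; apply: le_trans (ler_norm _).
    apply: Gx1 => [|t /andP[xt tz]]; first exact: ltW.
    by apply: Ib; rewrite xt (lt_trans tz).
  have Ibb : I b := conn_merge H mk Ix1 cb.
  have wb : 0 <= w b by apply: le_trans (lev _ Ibb _); lra.
  have [d d0 hd] := Rintegral_small_right r2 (radon_cc H) b (e := c / 4) (ltac:(lra)).
  have big z : b < z <= b + d -> c / 2 <= G z.
    move=> /andP[bz zd]; have := remainder_increments hr (ltW bz).
    have -> : `[b, z[%classic = [set b] `|` `]b, z[%classic.
      apply/seteqP; split => t; rewrite /= !in_itv/=.
        by rewrite le_eqVlt => /andP[/orP[/eqP ->|->] ->]; [left|right].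
      by move=> [->|/andP[/ltW -> ->]//]; rewrite lexx.
    rewrite Rintegral_setU//; last 2 first.
    - apply: (@ir _ b z); first by apply: measurableU.
      move=> t [->|]; rewrite /= !in_itv/=; first by rewrite lexx ltW.
      by move=> /andP[/ltW -> /ltW].
    - apply/disj_setPS => t [->]; by rewrite /= in_itv/= ltxx.
    (* an atom of m at b contributes with the sign of w b *)
    have r0 : 0 <= \int[m]_(x in [set b]) r x.
      have -> : 0 = 0 * fine (m [set b]) by rewrite mul0r.
      apply: Rintegral_ge_cst => //.
      - by rewrite -set_itv1; exact: radon_cc H _ _.
      - by apply: (@ir _ b b) => // t ->; rewrite /= in_itv/= lexx.
      - by apply: ae_imply (represents_ae (remainder_represents hr)) => t <- ->.
    have := hd z; rewrite (ltW bz) zd => /(_ isT); rewrite ler_norml => /andP[].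
    move: r0; set p := Rintegral _ _ _; set q := Rintegral _ _ _; move: p q (G z) (G b) Gb.
    by move=> p q p' q'; clearbody c; lra.
  (* the points up to b + d would be merged, although b is the supremum *)
  have cd : conn x1 (b + d).
    apply: (density_conn (c := c / 2)); [by lra|by lra|].
    move=> z /andP[xz zb]; apply: le_trans (ler_norm _).
    have [zb'|bz] := leP z b; last by apply: big; rewrite bz ltW.
    apply: (@le_trans _ _ c); first by lra.
    apply: Gx1 => [|t /andP[xt tz]]; first exact: ltW.
    by apply: Ib; rewrite xt (lt_le_trans tz).
  have := interval_between (conn_merge H mk Ix1 cd).
  rewrite -/I eu => /andP[_]; rewrite lee_fin; lra.
- move=> _; have Ib t : x1 <= t -> I t by move=> xt; apply: beyond => //; rewrite eu ltry.
  have mx1 : measurable (`[x1, +oo[%classic : set M) by exact: measurable_itv.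
  have lfin : (lbar `[x1, +oo[%classic < +oo)%E.
    apply: (Lfun2_level mx1 c0 D2); apply: ae_imply remainder_density_lbar => z ->.
    rewrite /= in_itv/= andbT => xz; apply: le_trans (ler_norm _); apply: Gx1 => // t /andP[+ _].
    exact: Ib.
  have mfin : (m `[x1, +oo[%classic < +oo)%E.
    apply: (Lfun2_level mx1 (c := w x0 / 2) _ r2); first by lra.
    apply: ae_imply (represents_ae (remainder_represents hr)) => z <-.
    rewrite /= in_itv/= andbT => xz; apply: le_trans (ler_norm _); apply: lev; first exact: Ib.
    exact: le_trans (ltW x01) xz.
  have mfin0 : (m `[0%R, +oo[%classic < +oo)%E.
    apply: (@le_lt_trans _ _ (m (`[0%R, x1]%classic `|` `[x1, +oo[%classic))).
      apply: le_measure; rewrite ?inE//; first exact: measurableU.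
      move=> z; rewrite /= !in_itv/= !andbT => z0; have [zx|xz] := leP z x1.
        by left; rewrite z0.
      by right; rewrite ltW.
    apply: le_lt_trans (measureU2 _ _ _) _ => //.
    by rewrite lte_add_pinfty//; exact: radon_cc H _ _.
  have [_ bc] := represents_boundary (remainder_represents hr) mk.
  have up := (upper_unbounded_measure nI (carries_cc hM mk) Ix1 eu).2 lfin.
  have w20 : 0 < w x0 / 2 by lra.
  have [M' [_ hM']] := cvgr_lt 0 (bc eu up mfin0) _ w20.
  have t1 : M' < Num.max x1 M' + 1 by rewrite ltr_pwDr// le_max lexx orbT.
  have t2 : x1 <= Num.max x1 M' + 1.
    by apply: (@le_trans _ _ (Num.max x1 M')); [rewrite le_max lexx|lra].
  have := hM' _ t1; apply/negP; rewrite -leNgt; apply: lev; first exact: Ib.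
  exact: le_trans (ltW x01) t2.
Qed.


(** The mirror image of the previous argument; as G is left-continuous, there is no atom to
    discuss. *)
Lemma no_positive_left x0 x1 : I x0 -> I x1 -> x1 < x0 -> 0 < w x0 -> G x0 <= 0 -> False.
Proof.
move=> Ix0 Ix1 x10 w0 G0.
have lev := level_left Ix0 w0 G0.
have c0 : 0 < - G x1.
  rewrite oppr_gt0; apply: lt_le_trans G0; apply: lt_le_trans (G_le (c := w x0 / 2) (ltW x10) _).
    by rewrite ltrDl; apply: mulr_gt0 => //; apply: mulr_gt0; [lra|exact: m_co_gt0].
  move=> t /andP[xt tx]; have It : I t by apply: (between Ix1 Ix0); rewrite xt ltW.
  by split => //; apply: lev => //; exact: ltW.
set c := - G x1 in c0.
have Gx1 y : y <= x1 -> (forall t, y <= t < x1 -> I t) -> G y <= - c.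
  move=> xy It; rewrite /c opprK; apply: G_mono => // t xt; split; first exact: It.
  apply: le_trans (lev _ (It _ xt) _); first by lra.
  by move: xt => /andP[_ ?]; lra.
have beyond t : t <= x1 -> (lower I < t%:E)%E -> I t.
  move=> xt tu; apply: (between_interval iI); rewrite tu andTb.
  apply: (@le_lt_trans _ _ x1%:E); first by rewrite lee_fin.
  apply: (@lt_le_trans _ _ x0%:E); first by rewrite lte_fin.
  by have /andP[] := interval_between Ix0.
have := (interval_between Ix1); case eu : (lower I) => [a| |] //.
- move=> /andP[+ _]; rewrite lee_fin => ax1.
  have Ia t : a < t <= x1 -> I t by move=> /andP[at' tx]; apply: beyond => //; rewrite eu lte_fin.
  have ca : conn a x1.
    apply: (density_conn ax1 c0) => z /andP[az zx]; rewrite -normrN; apply: le_trans (ler_norm _).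
    rewrite lerNr; apply: Gx1 => [|t /andP[zt tx]]; first exact: ltW.
    by apply: Ia; rewrite (lt_le_trans az zt) ltW.
  have Iaa : I a := conn_merge H mk Ix1 (conn_sym ca).
  have Ga : G a <= - c.
    apply: Gx1 => // t /andP[]; rewrite le_eqVlt => /orP[/eqP <- //|at' tx].
    by apply: Ia; rewrite at' ltW.
  have [d d0 hd] := Rintegral_small_left r2 (radon_cc H) a (e := c / 4) (ltac:(lra)).
  have big z : a - d <= z <= a -> G z <= - (c / 2).
    move=> zd; have := hd z zd; move: zd => /andP[_ za].
    have := remainder_increments hr za; rewrite ler_norml.
    set q := Rintegral _ _ _; move: q (G z) (G a) Ga => q p' q' ? ? /andP[].
    by clearbody c; lra.
  have cd : conn (a - d) x1.
    apply: (density_conn (c := c / 2)); [by lra|by lra|].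
    move=> z /andP[dz zx]; rewrite -normrN; apply: le_trans (ler_norm _); rewrite lerNr.
    have [za|az] := leP z a; first by apply: big; rewrite za ltW.
    apply: (@le_trans _ _ (- c)); last by lra.
    apply: Gx1 => [|t /andP[zt tx]]; first exact: ltW.
    by apply: Ia; rewrite (lt_le_trans az zt) ltW.
  have := interval_between (conn_merge H mk Ix1 (conn_sym cd)).
  rewrite -/I eu => /andP[+ _]; rewrite lee_fin; lra.
- move=> _; have Ia t : t <= x1 -> I t by move=> xt; apply: beyond => //; rewrite eu ltNyr.
  have mx1 : measurable (`]-oo, x1]%classic : set M) by exact: measurable_itv.
  have lfin : (lbar `]-oo, x1]%classic < +oo)%E.
    apply: (Lfun2_level mx1 c0 D2); apply: ae_imply remainder_density_lbar => z ->.
    rewrite /= in_itv/= => zx; rewrite -normrN; apply: le_trans (ler_norm _).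
    by rewrite lerNr; apply: Gx1 => // t /andP[_ /ltW]; exact: Ia.
  have mfin : (m `]-oo, x1]%classic < +oo)%E.
    apply: (Lfun2_level mx1 (c := w x0 / 2) _ r2); first by lra.
    apply: ae_imply (represents_ae (remainder_represents hr)) => z <-.
    rewrite /= in_itv/= => zx; apply: le_trans (ler_norm _); apply: lev; first exact: Ia.
    exact: le_trans zx (ltW x10).
  have mfin0 : (m `]-oo, 0%R]%classic < +oo)%E.
    apply: (@le_lt_trans _ _ (m (`[x1, 0%R]%classic `|` `]-oo, x1]%classic))).
      apply: le_measure; rewrite ?inE//; first exact: measurableU.
      move=> z; rewrite /= !in_itv/= => z0; have [zx|xz] := leP z x1.
        by right.
      by left; rewrite z0 ltW.
    apply: le_lt_trans (measureU2 _ _ _) _ => //.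
    by rewrite lte_add_pinfty//; exact: radon_cc H _ _.
  have [bc _] := represents_boundary (remainder_represents hr) mk.
  have low := (lower_unbounded_measure nI (carries_cc hM mk) Ix1 eu).2 lfin.
  have w20 : 0 < w x0 / 2 by lra.
  have [M' [_ hM']] := cvgr_lt 0 (bc eu low mfin0) _ w20.
  have t1 : Num.min x1 M' - 1 < M'.
    by apply: (@lt_le_trans _ _ (Num.min x1 M')); [lra|rewrite ge_min lexx orbT].
  have t2 : Num.min x1 M' - 1 <= x1.
    by apply: (@le_trans _ _ (Num.min x1 M')); [lra|rewrite ge_min lexx].
  have := hM' _ t1; apply/negP; rewrite -leNgt; apply: lev; first exact: Ia.
  exact: le_trans t2 (ltW x10).
Qed.

(** By continuity w would be positive at an interior point, where G >= 0 or G <= 0. *)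
Lemma remainder_le0 x : I x -> w x <= 0.
Proof.
move=> Ix; rewrite leNgt; apply/negP => w0.
have inner a y b : I a -> I y -> I b -> a < y -> y < b -> 0 < w y -> False.
  move=> Ia Iy Ib ay yb wy; have [G0|/ltW G0] := leP 0 (G y).
    exact: (no_positive_right Iy Ib).
  exact: (no_positive_left Iy Ia).
have [d d0 hd] := w_cvg Ix w0.
have near_pos t : I t -> `|t - x| < d -> 0 < w t.
  by move=> It /(hd t It); rewrite ltr_norml => /andP[]; lra.
pose c := itv_point I; have Ic : I c := itv_point_in nI.
have [xc|cx|xc] := ltgtP x c.
- pose y := Num.min (x + d / 2) ((x + c) / 2).
  have xy : x < y by rewrite lt_min; apply/andP; split; lra.
  have yc : y <= (x + c) / 2 by rewrite ge_min lexx orbT.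
  have yd : y <= x + d / 2 by rewrite ge_min lexx.
  have {}yc : y < c by lra.
  have Iy : I y by apply: (between Ix Ic); rewrite !ltW.
  apply: (inner x y c) => //; apply: near_pos => //.
  by rewrite gtr0_norm; lra.
- pose y := Num.max (x - d / 2) ((x + c) / 2).
  have xy : y < x by rewrite gt_max; apply/andP; split; lra.
  have yc : (x + c) / 2 <= y by rewrite le_max lexx orbT.
  have yd : x - d / 2 <= y by rewrite le_max lexx.
  have {}yc : c < y by lra.
  have Iy : I y by apply: (between Ic Ix); rewrite !ltW.
  apply: (inner c y x) => //; apply: near_pos => //.
  by rewrite ltr0_norm; lra.
- have /andP[/ereal_inf_lt[_ [a Ia <-] ac] /ereal_sup_gt[_ [b Ib <-] cb]] := fixed_point_between nI.2.
  rewrite !lte_fin in ac cb.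
  by apply: (inner a x b Ia Ix Ib _ _ w0); rewrite xc.
Qed.

End endpoints.

Lemma remainder_eq0 r w D G k x : remainder r w D G -> indices merge k -> itv merge k x -> w x = 0.
Proof.
move=> hr mk kx; apply/eqP; rewrite eq_le (remainder_le0 hr mk kx)/=.
by have := remainder_le0 (remainder_opp hr) mk kx; rewrite oppr_le0.
Qed.

(** Once w vanishes on the merged intervals, so does D, hence G vanishes almost everywhere for
    the measure of f and, being left-continuous, everywhere; then r m has no mass. *)
Lemma remainder_null r w D G : remainder r w D G -> {ae m, forall x, r x = 0}.
Proof.
move=> hr; have h := remainder_represents hr.
have r2 := represents_L2 h; have D2 := represents_density_L2 h.
have D0 : {ae lbar, forall x, D x = 0}.
  have : {ae lbar, forall x, covered merge x -> D x = 0}.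
    apply: ae_covered => k mk; have ck := carries_cc hM mk.
    apply: (increments_unique (u := w) (carries_itv hM mk) (D2 := cst 0)).
    - by move=> x y kx ky _; exact: (Lfun2_integrable_cc ck).
    - by move=> x y _ _ _; exact: integrable0.
    - exact: (represents_increments h).
    - move=> x y kx ky _; rewrite (remainder_eq0 hr mk kx) (remainder_eq0 hr mk ky) subr0.
      by rewrite Rintegral_cst// mul0r.
  apply: ae_imply => x; have [cx /(_ cx)//|nx _] := pselect (covered merge x).
  exact: represents_density0 h _ nx.
have G0 : {ae lf, forall x, G x = 0}.
  have lfeE (A : set M) : measurable A -> lfe A = lf (A `&` covered C) by [].
  have := restricted_ae mC lfeE (ae_lfe H D0).
  apply: ae_imply2 (remainder_density hr) => x <-; rewrite patchE.
  by case: ifPn => [/set_mem cx /(_ cx)|].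
have Gx x : G x = 0.
  apply/eqP; rewrite -normr_le0; apply/ler_addgt0Pr => e e0; rewrite add0r.
  have e20 : 0 < e / 2 by lra.
  have [d d0 hd] := Rintegral_small_left r2 (radon_cc H) x e20.
  have [z /andP[zd zx] Gz] : exists2 z, x - d < z < x & G z = 0.
    apply: contrapT => nz; have [A [mA A0 sub]] := G0.
    have := lf_oo_gt0 H (x := x - d) (y := x) (ltac:(lra)).
    rewrite ltNge; apply/negP/negPn; rewrite -A0; apply: le_measure; rewrite ?inE//.
    by move=> z; rewrite /= in_itv/= => xz; apply: sub => /= Gz; apply: nz; exists z.
  have := remainder_increments hr (ltW zx); rewrite Gz subr0 => ->.
  rewrite normrM ger0_norm//.
  by have := hd z; rewrite (ltW zd) (ltW zx) => /(_ isT); lra.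
have R0 x y : x <= y -> \int[m]_(z in `[x, y[) r z = 0.
  by move=> /(remainder_increments hr); rewrite !Gx; lra.
have : {ae m, forall x (n : nat), - n%:R < x < n%:R -> r x = 0}.
  apply: ae_foralln => n.
  have mco : measurable (`[(- n%:R)%R, n%:R%R[%classic : set M) by exact: measurable_itv.
  have rco2 := Lfun2_restrict mco r2.
  have i1 := Lfun2_integrable (measurable_cc _ _) (radon_cc H (- n%:R) n%:R) rco2.
  have i0 : m.-integrable `[- n%:R, n%:R] (EFin \o (cst 0 : R -> R)).
    exact: integrable0.
  have := cc_ae_eq i1 i0.
  have R1 x : - n%:R <= x <= n%:R ->
      (\int[m]_(z in `[x, n%:R]) ((r \_ `[(- n%:R)%R, n%:R[%classic) z)%:E =
       \int[m]_(z in `[x, n%:R]) (cst 0 z)%:E)%E.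
    move=> /andP[nx xn]; have sub : `[x, n%:R]%classic `<=` `[- n%:R, n%:R]%classic :> Prop.
      by move=> z; rewrite /= !in_itv/= => /andP[xz ->]; rewrite (le_trans nx xz).
    rewrite !RintegralE//; last 2 first.
    - exact: integrableS i0.
    - exact: integrableS i1.
    congr (_%:E); rewrite Rintegral_cst// mul0r -(R0 _ _ xn).
    have sub1 : (`[x, n%:R[%classic : set M) `<=` `[x, n%:R]%classic.
      by move=> z; rewrite /= !in_itv/= => /andP[-> /ltW].
    rewrite (Rintegral_patch _ _ sub1).
    apply: eq_Rintegral => z /set_mem; rewrite /= in_itv/= => /andP[xz zn].
    have zE : (z \in `[(- n%:R)%R, n%:R%R[%classic) = (z \in `[x, n%:R[%classic).
      by apply/idP/idP => /set_mem; rewrite /= in_itv/= => /andP[_ zn']; apply/mem_set;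
        rewrite /= in_itv/= zn' ?xz ?(le_trans nx xz).
    by rewrite !patchE zE.
  move=> /(_ R1); apply: ae_imply => z + /andP[nz zn].
  rewrite /= patchE mem_set/=; last by rewrite in_itv/= (ltW nz).
  by rewrite in_itv/= !ltW// => /(_ isT)[].
apply: ae_imply => x hx; have [n xn] := nat_itvP x.
exact: hx xn.
Qed.

(** The orthogonality relation involves D on the intervals only, so that [density_equation]
    applies to D extended by zero. *)
Lemma orthogonal_remainder r w D : represents m merge lbar r w D ->
  (forall phi psi, test_function f phi psi ->
    \int[lfe]_z (D z * psi (f z)) + 2 * \int[m]_x (r x * phi (f x)) = 0) ->
  exists G, remainder r w D G.
Proof.
move=> h orth; have D2 := represents_density_L2 h; have r2 := represents_L2 h.
have mD := Lfun2_measurable D2.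
have [x y||G [hG EG]] := @density_equation _ _ _ _ _ _ _ _ H (D \_ (covered C)) r _ r2.
- apply/(integrable_restricted (nu := lfe) mC) => //.
  + exact: measurable_funTS.
  + exact: (Lfun2_lbar_integrable H).
- move=> c d phi psi cd tp psi0 phi0; rewrite -[RHS](orth _ _ tp).
  have out z : ~ `[c, d]%classic z -> ~ (f c < f z < f d).
    move=> nz /andP[cz zd]; apply: nz; rewrite /= in_itv/=; apply/andP; split; rewrite leNgt.
      by apply/negP => /(f_increasing H)/ltW; rewrite leNgt cz.
    by apply/negP => /(f_increasing H)/ltW; rewrite leNgt zd.
  have patch0 (k : R -> R) : (forall z, ~ `[c, d]%classic z -> k z = 0) -> k \_ `[c, d]%classic = k.
    by move=> k0; apply/funext => z; rewrite patchE; case: ifPn => // /negP nz; rewrite k0// => /mem_set.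
  have cpsi : continuous (psi \o f).
    by move=> x; apply: continuous_comp; [exact: (f_continuous H)|exact: (test_derive_continuous tp)].
  have mpsi : measurable_fun setT (psi \o f : M -> M) by exact: continuous_measurable_fun.
  congr (_ + 2 * _); rewrite (Rintegral_patch _ _ (subsetT (`[c, d]%classic : set M))).
    rewrite patch0; last by move=> z /out/psi0 ->; rewrite mulr0.
    rewrite /Rintegral; congr fine.
    rewrite (integral_restricted (nu := lfe) (mu := lf) mC)//; last exact: measurable_funM.
    by apply: eq_integral => z _; rewrite !patchE; case: ifPn; rewrite ?mul0r.
  by rewrite patch0// => z /out/phi0 ->; rewrite mulr0.
by exists G.
Qed.

End remainder.


(** * Identification of the generated form *)

Section generated_form.
Context {R : realType}.
Local Notation M := (measurableTypeR R).
Variables (m : {measure set M -> \bar R}) (C : @itv_family R)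
  (C_eff : effective_intervals C) (f : cumulative R R)
  (lbar : {measure set M -> \bar R}) (N : set M) (g : M -> \bar R).
Hypothesis H : decomposed m C_eff f lbar N g.
Variable A : @energy_form R.
Hypotheses (A_dirichlet : dirichlet_form m A) (A_C : form_eq A (represented_form m C)).

Local Notation lf := (lebesgue_stieltjes_measure f : {measure set M -> \bar R}).
Local Notation lft := (mrestr lf (measurable_uncovered C_eff)
  : {measure set M -> \bar R}).
Local Notation lam := (total_scale_measure C).
Local Notation merge := (interval_merge lft lbar C).
Local Notation tests := (composed_test_functions f).

Let hC : carries C lam := carries_total_scale_measure C_eff.
Let hM : carries merge lbar := carries_merge H.
Let ms := m_is_supported H.

Let domain_represents u : domain A u <-> exists v D, represents m C lam u v D.
Proof. by rewrite A_C.1; exact: represented_domainP. Qed.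

Let energyE u v D u' v' D' : represents m C lam u v D -> represents m C lam u' v' D' ->
  energy A u u' = 2^-1 * \int[lam]_x (D x * D' x).
Proof.
move=> h h'; rewrite -(represented_energyE ms hC h h'); apply: A_C.2.
- by apply/domain_represents; exists v, D.
- by apply/domain_represents; exists v', D'.
Qed.

Let subE (u v : R -> R) : (fun x => -1 * v x + u x) = u \- v.
Proof. by apply/funext => x /=; ring. Qed.

Let represents_sub (K : @itv_family R) (mu : {measure set M -> \bar R}) u v D u' v' D' :
  carries K mu -> represents m K mu u v D -> represents m K mu u' v' D' ->
  represents m K mu (u \- u') (v \- v') (D \- D').
Proof. by move=> hK h h'; have := represents_linear hK (-1) h' h; rewrite !subE. Qed.

Let domain_sub u v : domain A u -> domain A v -> domain A (u \- v).
Proof. by move=> Au Av; rewrite -subE; exact: (dirichlet_linear A_dirichlet). Qed.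

Let tests_represents u : tests u -> exists phi psi D, [/\ test_function f phi psi,
  u = phi \o f, test_density m C_eff f N g phi psi D & represents m C lam u u D].
Proof.
move=> /composed_test_functionP[phi [psi [tp ->]]].
have [D hD] := test_density_exists H tp.
by exists phi, psi, D; split => //; exact: (test_represents hD).
Qed.

Let tests_domain u : tests u -> domain A u.
Proof.
by move=> /tests_represents[phi [psi [D [_ _ _ h]]]]; apply/domain_represents; exists u, D.
Qed.

Let energy1_lt u v D eps : 0 < eps -> represents m C lam u v D ->
  energy1 m A u u < eps / 2 ->
  \int[lam]_x (D x ^+ 2) < eps /\ \int[m]_x (u x ^+ 2) < eps.
Proof.
move=> eps0 h; rewrite /energy1 (energyE h h).
have D0 : 0 <= \int[lam]_x (D x ^+ 2) by apply: Rintegral_ge0 => x _; exact: sqr_ge0.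
have u0 : 0 <= \int[m]_x (u x ^+ 2) by apply: Rintegral_ge0 => x _; exact: sqr_ge0.
by split; lra.
Qed.

(** Convergence in the form norm is convergence of the densities and of the functions. *)
Lemma generated_represents u : domain (generated_form m A tests) u ->
  exists w D, [/\ represents m C lam u w D, {ae lam, forall x, ~ N x -> D x = 0} &
    exists w', represents m merge lbar u w' D].
Proof.
move=> [/domain_represents[v [D hu]] approx]; exists v, D.
have [|offN hw] := closure_represents H hu; last by [].
move=> eps eps0; have eps20 : 0 < eps / 2 by lra.
have [p /tests_represents[phi [psi [Dp [tp pE hD hp]]]] pu] := approx _ eps20.
exists (phi, psi, Dp); have [h1 h2] := energy1_lt eps0 (represents_sub hC hu hp) pu.
split => //; apply: le_lt_trans h2; rewrite le_eqVlt; apply/orP; left; apply/eqP.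
by apply: eq_Rintegral => x _; rewrite pE /=; ring.
Qed.

(** The density vanishes off N, where lbar agrees with lam. *)
Lemma generated_energyE u v : domain (generated_form m A tests) u ->
  domain (generated_form m A tests) v ->
  energy (generated_form m A tests) u v = energy (represented_form m merge) u v.
Proof.
move=> /generated_represents[wu [Du [hu offu [wu' hu']]]].
move=> /generated_represents[wv [Dv [hv _ [wv' hv']]]].
rewrite [LHS](energyE hu hv) (represented_energyE ms hM hu' hv'); congr (_ * _).
have mD : measurable_fun setT (fun x : M => Du x * Dv x).
  apply: measurable_funM.
    exact: Lfun2_measurable (represents_density_L2 hu).
  exact: Lfun2_measurable (represents_density_L2 hv).
rewrite /Rintegral; congr fine; rewrite (integral_lbar H)//; apply/esym.
apply: ae_eq_rintegral => //.
- apply/measurable_EFinP; apply/(measurable_restrictT _ (measurable_N H)).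
  exact: measurable_funTS.
- exact/measurable_EFinP.
- apply: ae_imply offu => x nN; rewrite patchE; case: ifPn => // /negP nx.
  by rewrite nN ?mul0r// => Nx; apply: nx; exact: mem_set.
Qed.

Let L2 u : domain A u -> u \in Lfun m 2%:E := @dirichlet_L2 _ _ _ A_dirichlet u.

Let Q_sym u v : domain A u -> domain A v -> energy1 m A u v = energy1 m A v u.
Proof.
move=> Au Av; rewrite /energy1 (dirichlet_sym A_dirichlet Au Av); congr (_ + _).
by apply: eq_Rintegral => x _; rewrite mulrC.
Qed.

Let Q_ge0 u : domain A u -> 0 <= energy1 m A u u.
Proof.
move=> Au; rewrite addr_ge0 ?(dirichlet_ge0 A_dirichlet Au)//.
by apply: Rintegral_ge0 => x _; exact: sqr_ge0.
Qed.

Let Q_bilinear (c : R) u v w : domain A u -> domain A v -> domain A w ->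
  energy1 m A (fun x => c * u x + v x) w = c * energy1 m A u w + energy1 m A v w.
Proof.
move=> Au Av Aw; rewrite /energy1 (dirichlet_bilinear A_dirichlet c Au Av Aw).
have i1 := Lfun2M (L2 Au) (L2 Aw); have i2 := Lfun2M (L2 Av) (L2 Aw).
have -> : (fun x => (c * u x + v x) * w x) = (fun x => c * (u x * w x) + v x * w x).
  by apply/funext => x; ring.
rewrite RintegralD//; last exact: integrable_realZ.
by rewrite RintegralZl//; ring.
Qed.

Let energy1_ae u v : domain A u -> v \in Lfun m 2%:E -> {ae m, forall x, v x = u x} ->
  energy1 m A v v = energy1 m A u u.
Proof.
move=> Au v2 vu; have [Av E] := dirichlet_ae A_dirichlet Au v2 vu.
rewrite /energy1 (E v Av) (dirichlet_sym A_dirichlet Au Av) (E u Au); congr (_ + fine _).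
have mu := Lfun2_measurable (L2 Au); have mv := Lfun2_measurable v2.
apply: ae_eq_rintegral => //.
- by apply/measurable_EFinP; exact: measurable_funM.
- by apply/measurable_EFinP; exact: measurable_funM.
- by apply: ae_imply vu => x ->.
Qed.

(** The part of a merged function orthogonal to the test functions is a remainder, hence
    zero. *)
Lemma represented_generated u : domain (represented_form m merge) u ->
  domain (generated_form m A tests) u.
Proof.
move=> /(represented_domainP _ hM)[w [D hu]].
have Au : domain A u.
  by apply/domain_represents; eexists; eexists; exact: (merge_represents H hu).
have [p [Ap pS orth]] := form_projection (dirichlet_linear A_dirichlet) Q_sym Q_bilinear
  Q_ge0 (dirichlet_closed A_dirichlet) tests_domain
  (@composed_test_functions_linear _ f) (composed_test_functions0 f) Au.
have [wp [Dp [_ _ [wp' hp]]]] : exists w D, [/\ represents m C lam p w D,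
    {ae lam, forall x, ~ N x -> D x = 0} & exists w', represents m merge lbar p w' D].
  exact: generated_represents.
have hr := represents_sub hM hu hp.
have [|G hG] := orthogonal_remainder H hr.
  move=> phi psi tp; have [E hE] := test_density_exists H tp.
  have Sphi : tests (phi \o f) by exists phi => //; case: tp.
  have := orth _ Sphi; rewrite /energy1.
  rewrite (energyE (merge_represents H hr) (test_represents hE)).
  rewrite (patch_pairing H (represents_density_L2 hr)
    (represents_density_L2 (test_represents hE))
    (represents_density0 (test_represents hE))).
  have [_] := test_pairing H hE tp measurableT (represents_density_L2 hr).
  by rewrite /Rintegral => ->; lra.
have r0 := remainder_null H hG.
split => // eps eps0; have [v Sv pv] := pS eps eps0; exists v => //.
have Av := tests_domain Sv.
rewrite (energy1_ae (domain_sub Ap Av) (L2 (domain_sub Au Av)))//.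
by apply: ae_imply r0 => x /=; lra.
Qed.

End generated_form.

Theorem theorem5p6 (R : realType)
    (m : {measure set (measurableTypeR R) -> \bar R})
    (m_radon : radon m) (m_supp : fully_supported m)
    (A : @energy_form R) (A_dirichlet : dirichlet_form m A)
    (A_regular : regular_form m A) (A_local : strongly_local m A)
    (C : @itv_family R) (C_eff : effective_intervals C)
    (A_C : form_eq A (represented_form m C))
    (f : cumulative R R) (f_incr : {homo f : x y / x < y})
    (f_cont : continuous f) (f0 : f 0 = 0)
    (f_dom : composed_test_functions f `<=` domain A)
    (lbar kappa : {measure set (measurableTypeR R) -> \bar R})
    (decomposition : lebesgue_decomposition (total_scale_measure C)
       (mrestr (lebesgue_stieltjes_measure f) (measurable_covered C_eff))
       lbar kappa) :
  form_eq
    (generated_form m A (composed_test_functions f))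
    (represented_form m (interval_merge
       (mrestr (lebesgue_stieltjes_measure f) (measurable_uncovered C_eff))
       lbar C)).
Proof.
have [|N [g H]] := lebesgue_decomposed m_radon m_supp f_incr f_cont f0 _ decomposition.
  by rewrite -A_C.1.
split; last by move=> u v Au Av; exact: (generated_energyE H).
apply/seteqP; split => u; last exact: (represented_generated H).
move=> /(generated_represents H A_C)[w [D [_ _ [w' hw]]]].
by apply/(represented_domainP m (carries_merge H)); exists w', D.
Qed.
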